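(* Let $n\ge 2$ and $k\ge n+2$. Let $\alpha:S^n\to\mathbb{H}^n$ be a Lipschitz map and $\beta:S^k\to S^n$ a Lipschitz map satisfying condition $( * )$ (this holds, for example, if $\beta$ is a suspension of a map $S^{k-1}\to S^{n-1}$). Then $\alpha\circ\beta:S^k\to\mathbb{H}^n$ extends to a Lipschitz map $r:D^{k+1}\to\mathbb{H}^n$.
   Context: $\mathbb{H}^n$ is the $n$th Heisenberg group $\mathbb{R}^n\times\mathbb{R}^n\times\mathbb{R}$ with law $(x,y,z)\odot(x',y',z')=(x+x',y+y',z+z'+\langle y,x'\rangle)$, equipped with the Carnot–Carathéodory metric associated to the left-invariant Riemannian metric making $X_j=\partial_{x_j}+y_j\partial_z$, $Y_j=\partial_{y_j}$, $Z=\partial_z$ orthonormal (infimum of lengths of horizontal $C^1$ curves, i.e. curves tangent to the span of the $X_j,Y_j$). Condition $( * )$ on $\beta$: for every $m\ge1$, letting $Y=S^n\vee\cdots\vee S^n$ be the $m$-fold wedge of $n$-spheres and $i_j:S^n\to Y$ the inclusion of the $j$th wedge summand, one has $\bigl(\sum_{j=1}^m i_j\bigr)\circ\beta=\sum_{j=1}^m (i_j\circ\beta)$ in $\pi_k(Y)$ (equivalently, all Hopf–Hilton invariants of $\beta$ vanish). $D^{k+1}$ is the closed unit ball with boundary $S^k$. *)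

(* Defs.v *)
From Stdlib Require Import Reals Lra List ZArith.
Open Scope R_scope.

(** * Euclidean space.  A point of R^d is a function [nat -> R];
    only the coordinates [i < d] are relevant. *)
Definition pt := nat -> R.

Fixpoint rsum (d : nat) (f : nat -> R) : R :=
  match d with O => 0 | S d' => rsum d' f + f d' end.

Definition norm (d : nat) (x : pt) : R := sqrt (rsum d (fun i => x i ^ 2)).
Definition dist (d : nat) (x y : pt) : R := sqrt (rsum d (fun i => (x i - y i) ^ 2)).

Definition sphere (d : nat) (x : pt) : Prop :=
  rsum (S d) (fun i => x i ^ 2) = 1 /\ forall i, (S d <= i)%nat -> x i = 0.

Definition ball (d : nat) (x : pt) : Prop :=
  rsum d (fun i => x i ^ 2) <= 1 /\ forall i, (d <= i)%nat -> x i = 0.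

Definition e0 : pt := fun i => match i with O => 1 | _ => 0 end.
Definition bp : pt := fun i => match i with O => -1 | _ => 0 end.
Definition origin : pt := fun _ => 0.

Definition maps_to (A B : pt -> Prop) (f : pt -> pt) : Prop :=
  forall x, A x -> B (f x).

Definition cont_on (d e : nat) (A : pt -> Prop) (f : pt -> pt) : Prop :=
  forall x, A x -> forall eps, eps > 0 -> exists delta, delta > 0 /\
    forall y, A y -> dist d x y < delta -> dist e (f x) (f y) < eps.

Definition lipschitz_on (d e : nat) (A : pt -> Prop) (f : pt -> pt) : Prop :=
  exists L, 0 <= L /\ forall x y, A x -> A y -> dist e (f x) (f y) <= L * dist d x y.

(** * The Heisenberg group H^n = R^n x R^n x R, law
    (x,y,z)(x',y',z') = (x+x', y+y', z+z'+<y,x'>), with the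
    Carnot--Caratheodory metric for which X_j = d/dx_j + y_j d/dz,
    Y_j = d/dy_j, Z = d/dz are orthonormal. *)
Record hpt := mkH { hx : nat -> R; hy : nat -> R; hz : R }.

Definition hmul (n : nat) (p q : hpt) : hpt :=
  mkH (fun j => hx p j + hx q j) (fun j => hy p j + hy q j)
      (hz p + hz q + rsum n (fun j => hy p j * hx q j)).

Definition hpt_eq (n : nat) (p q : hpt) : Prop :=
  (forall j, (j < n)%nat -> hx p j = hx q j /\ hy p j = hy q j) /\ hz p = hz q.

(** A C^1 curve t |-> (gx t, gy t, gz t) (defined and C^1 on all of R; its
    restriction to [0,1] is used), with derivatives dx, dy, dz, which is
    horizontal: its velocity lies in span{X_j, Y_j}, i.e.
    velocity = sum_j dx_j X_j + dy_j Y_j, i.e. dz = sum_j gy_j dx_j. *)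
Definition horizontal_C1 (n : nat) (gx gy : nat -> R -> R) (gz : R -> R)
    (dx dy : nat -> R -> R) (dz : R -> R) : Prop :=
  (forall j t, (j < n)%nat ->
      derivable_pt_lim (gx j) t (dx j t) /\ derivable_pt_lim (gy j) t (dy j t)) /\
  (forall t, derivable_pt_lim gz t (dz t)) /\
  (forall j, (j < n)%nat -> continuity (dx j) /\ continuity (dy j)) /\
  continuity dz /\
  (forall t, dz t = rsum n (fun j => gy j t * dx j t)).

(** Riemannian speed of a horizontal curve: |sum a_j X_j + b_j Y_j| = |(a,b)|. *)
Definition hspeed (n : nat) (dx dy : nat -> R -> R) (t : R) : R :=
  sqrt (rsum n (fun j => dx j t ^ 2 + dy j t ^ 2)).

(** [cc_le n p q c] : d_cc(p,q) <= c, i.e. the infimum of lengths of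
    horizontal C^1 curves from p to q is <= c (unfolded). *)
Definition cc_le (n : nat) (p q : hpt) (c : R) : Prop :=
  forall eps, eps > 0 ->
  exists gx gy gz dx dy dz,
    horizontal_C1 n gx gy gz dx dy dz /\
    (forall j, (j < n)%nat ->
        gx j 0 = hx p j /\ gy j 0 = hy p j /\ gx j 1 = hx q j /\ gy j 1 = hy q j) /\
    gz 0 = hz p /\ gz 1 = hz q /\
    exists pr : Riemann_integrable (hspeed n dx dy) 0 1, RiemannInt pr <= c + eps.

Definition hlipschitz_on (d n : nat) (A : pt -> Prop) (f : pt -> hpt) : Prop :=
  exists L, 0 <= L /\ forall x y, A x -> A y -> cc_le n (f x) (f y) (L * dist d x y).

Definition cube (k : nat) (t : pt) : Prop := forall i, (i < k)%nat -> 0 <= t i <= 1.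
Definition cube_bd (k : nat) (t : pt) : Prop :=
  exists i, (i < k)%nat /\ (t i = 0 \/ t i = 1).

Definition pcons (s : R) (t : pt) : pt :=
  fun i => match i with O => s | S i' => t i' end.
Definition ptail (p : pt) : pt := fun i => p (S i).

Fixpoint rmaxabs (k : nat) (u : pt) : R :=
  match k with O => 0 | S k' => Rmax (rmaxabs k' u) (Rabs (u k')) end.

(** The standard quotient map I^k -> I^k / boundary = S^k, sending the
    boundary to [bp]: t |-> u = 2t-1 in [-1,1]^k, m = max |u_i|,
    image = (cos(pi m), sin(pi m) u/|u|). *)
Definition qmap (k : nat) (t : pt) : pt :=
  let u := fun i => if (i <? k)%nat then 2 * t i - 1 else 0 in
  let m := rmaxabs k u in
  let r := norm k u in
  fun i => match i with
           | O => cos (PI * m)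
           | S i' => if Req_EM_T r 0 then 0 else sin (PI * m) * u i' / r
           end.

(** [rel_homotopic k e Y y0 f g] : f, g : (I^k, boundary) -> (Y, y0) (Y in R^e)
    are homotopic rel boundary, i.e. [f] = [g] in pi_k(Y, y0). *)
Definition rel_homotopic (k e : nat) (Y : pt -> Prop) (y0 : pt) (f g : pt -> pt) : Prop :=
  exists H : pt -> pt,
    cont_on (S k) e (cube (S k)) H /\ maps_to (cube (S k)) Y H /\
    (forall t, cube k t -> forall i, H (pcons 0 t) i = f t i /\ H (pcons 1 t) i = g t i) /\
    (forall s t, 0 <= s <= 1 -> cube k t -> cube_bd k t -> forall i, H (pcons s t) i = y0 i).

(** Concatenation along the first cube coordinate of m cube maps:
    represents the sum [f_1] + ... + [f_m] in pi_k. *)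
Definition floorZ (x : R) : Z := (up x - 1)%Z.
Definition concat (fs : list (pt -> pt)) (t : pt) : pt :=
  let m := length fs in
  let x := INR m * t O in
  let j := Nat.min (m - 1) (Z.to_nat (floorZ x)) in
  nth j fs (fun _ => origin) (fun i => match i with O => x - INR j | S _ => t i end).

(** Wedge Y = S^n v ... v S^n (m copies), realised in R^{n+1} as the union of
    the spheres of radius 1/j centred at e0/j (j = 1..m), which pairwise meet
    only at the origin (the wedge point). *)
Definition wedge (n m : nat) (y : pt) : Prop :=
  exists j, (1 <= j <= m)%nat /\ sphere n (fun i => INR j * y i - e0 i).

Definition incl (j : nat) (x : pt) : pt := fun i => (x i + e0 i) / INR j.

(** Condition ( * ) for a based continuous map b : S^k -> S^n:
    for every m >= 1 and every based map s : S^n -> Y representing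
    sum_j [i_j] in pi_n(Y), one has [s o b] = sum_j [i_j o b] in pi_k(Y). *)
Definition star_condition (n k : nat) (b : pt -> pt) : Prop :=
  forall m, (1 <= m)%nat ->
  forall s : pt -> pt,
    cont_on (S n) (S n) (sphere n) s ->
    maps_to (sphere n) (wedge n m) s ->
    (forall i, s bp i = origin i) ->
    rel_homotopic n (S n) (wedge n m) origin
      (fun t => s (qmap n t))
      (concat (map (fun j => fun t => incl j (qmap n t)) (seq 1 m))) ->
    rel_homotopic k (S n) (wedge n m) origin
      (fun t => s (b (qmap k t)))
      (concat (map (fun j => fun t => incl j (b (qmap k t))) (seq 1 m))).

Definition free_homotopic (k n : nat) (f g : pt -> pt) : Prop :=
  exists H : pt -> pt,
    cont_on (S (S k)) (S n) (fun p => 0 <= p O <= 1 /\ sphere k (ptail p)) H /\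
    (forall p, 0 <= p O <= 1 -> sphere k (ptail p) -> sphere n (H p)) /\
    (forall x, sphere k x -> forall i, H (pcons 0 x) i = f x i /\ H (pcons 1 x) i = g x i).

(** beta : S^k -> S^n satisfies ( * ): its class in pi_k(S^n) (S^n simply
    connected, n >= 2, so free classes = based classes) is represented by a
    based continuous map satisfying the condition. *)
Definition satisfies_star (n k : nat) (beta : pt -> pt) : Prop :=
  exists b : pt -> pt,
    cont_on (S k) (S n) (sphere k) b /\ maps_to (sphere k) (sphere n) b /\
    (forall i, b bp i = bp i) /\ free_homotopic k n beta b /\ star_condition n k b.

(* Main.v *)
From Stdlib Require Import Reals Lra Lia List ZArith Classical ClassicalEpsilon FunctionalExtensionality.
From Coquelicot Require Coquelicot.
Require Import Defs.
Open Scope R_scope.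

(** Spheres are replaced by boundaries of cubes and distances by sup norms; [B] is [beta] seen
    as a map between boundaries of cubes.

    Target side: a map [al] with Lipschitz constant [L] from the boundary of the (n+1)-cube to
    the Heisenberg group extends, up to a homotopy in a collar, to the walls of the unit grid
    in the box [0,N^2] x [0,N]^n with constant O(L/N).  The slices at integer heights carry
    dilated copies of [al]; between them, Whitney cells of n+1 colours are filled with
    n-dimensional horizontal simplices.

    Domain side: pinching the target sphere along a hyperplane and applying condition ( * )
    extends [B] to the (k+1)-cube minus two boxes, with values in the boundaries of the two
    halves of the (n+1)-cube, so that it is again [B] on the boundary of each box.  Such a
    split halves one direction of the target, and one direction of the domain up to a factor
    close to 1.  Running through all pairs of directions (twice for the long target
    direction) e times cuts the target into unit cells with N = 2^((k+1)e), while the holes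
    in the domain have size about 2^(-(n+2)e).

    Composing both gives a Lipschitz map on the complement of the holes, and each hole remains
    to be filled for a map with constant O(L/N), on a cube of size about 2^(-(n+2)e).  Since
    k >= n+2, the rescaled constant is not larger than [L] once e is large, and the
    construction can be repeated in the holes for ever without the constant growing. *)

(** * The gauge on the Heisenberg group *)

(** The obstacle is that horizontal surfaces in the group have dimension at most n: [al] can be
    spread over the walls of a grid, which are n-dimensional, but the (n+1)-dimensional cells cannot
    be filled. Each cell stays empty on the target side and is paid for by a hole on the domain
    side. The shape of the box comes from the dilations, which are not Lipschitz in their parameter:
    the dilates by s and s' of a point at distance d from the identity are about sqrt|s - s'| * d
    apart. The rescaled [al] has diameter of order N, so shrinking it to a point in steps of unit
    size takes about N^2 heights. The condition on k is then a volume count. There are N^(n+2)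
    cells; as many holes, spread evenly over k+1 directions, have size N^(-(n+2)/(k+1)). Putting a
    map of constant L/N into a hole of this size gives the constant L * N^((n+2)/(k+1) - 1), and the
    exponent is negative exactly when k >= n+2. The gauge and the sup norms lose constant factors
    against the metrics of the statement. This is harmless, since the comparison is made only at the
    two ends of the argument and never inside the recursion. *)

Lemma rsum_ext d f g : (forall i, (i < d)%nat -> f i = g i) -> rsum d f = rsum d g.
Proof. induction d; simpl; intros H; [reflexivity|]. rewrite IHd, (H d) by (intros; auto with arith). reflexivity. Qed.

Lemma rsum_plus d f g : rsum d (fun i => f i + g i) = rsum d f + rsum d g.
Proof. induction d; simpl; [lra|rewrite IHd; lra]. Qed.

Lemma rsum_scal d c f : rsum d (fun i => c * f i) = c * rsum d f.
Proof. induction d; simpl; [lra|rewrite IHd; lra]. Qed.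

Lemma rsum_minus d f g : rsum d (fun i => f i - g i) = rsum d f - rsum d g.
Proof. induction d; simpl; [lra|rewrite IHd; lra]. Qed.

Lemma rsum_le d f g : (forall i, (i < d)%nat -> f i <= g i) -> rsum d f <= rsum d g.
Proof.
  induction d; simpl; intros H; [lra|].
  apply Rplus_le_compat; [apply IHd; intros; apply H; lia|apply H; lia].
Qed.

Lemma rsum_const d c : rsum d (fun _ => c) = INR d * c.
Proof. induction d; [simpl; lra|]. rewrite S_INR; simpl rsum. rewrite IHd; lra. Qed.

Lemma rsum_zero d f : (forall i, (i < d)%nat -> f i = 0) -> rsum d f = 0.
Proof. intros H. rewrite (rsum_ext d f (fun _ => 0)) by auto. rewrite rsum_const; lra. Qed.

Lemma rsum_nonneg d f : (forall i, (i < d)%nat -> 0 <= f i) -> 0 <= rsum d f.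
Proof. intros H. rewrite <- (rsum_zero d (fun _ => 0)) by auto. now apply rsum_le. Qed.

Lemma rsum_abs d f : Rabs (rsum d f) <= rsum d (fun i => Rabs (f i)).
Proof.
  induction d; simpl; [rewrite Rabs_R0; lra|].
  eapply Rle_trans; [apply Rabs_triang|]. lra.
Qed.

Lemma rsum_abs_le d f c : (forall i, (i < d)%nat -> Rabs (f i) <= c) -> Rabs (rsum d f) <= INR d * c.
Proof.
  intros H. eapply Rle_trans; [apply rsum_abs|]. rewrite <- rsum_const. now apply rsum_le.
Qed.

Lemma rsum_term_le d f i : (forall i, (i < d)%nat -> 0 <= f i) -> (i < d)%nat -> f i <= rsum d f.
Proof.
  induction d; intros H Hi; [lia|]. simpl.
  assert (0 <= rsum d f) by (apply rsum_nonneg; intros; apply H; lia).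
  assert (0 <= f d) by (apply H; lia).
  destruct (Nat.eq_dec i d) as [->|]; [lra|].
  assert (f i <= rsum d f) by (apply IHd; [intros; apply H|]; lia). lra.
Qed.

Lemma rsum_Sl d f : rsum (S d) f = f O + rsum d (fun i => f (S i)).
Proof. induction d; simpl in *; [lra|]. rewrite IHd. lra. Qed.

Lemma rsum_exchange d e (f : nat -> nat -> R) :
  rsum d (fun i => rsum e (fun j => f i j)) = rsum e (fun j => rsum d (fun i => f i j)).
Proof.
  induction d; simpl.
  - now rewrite rsum_zero.
  - rewrite IHd. now rewrite <- rsum_plus.
Qed.

Lemma Rabs_le_iff a b : Rabs a <= b <-> - b <= a <= b.
Proof. split; intros H; [unfold Rabs in H; destruct (Rcase_abs a); lra|now apply Rabs_le]. Qed.

Lemma Rabs_mult_le a b c d : Rabs a <= c -> Rabs b <= d -> Rabs (a * b) <= c * d.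
Proof.
  intros. rewrite Rabs_mult. apply Rmult_le_compat; auto using Rabs_pos.
Qed.

Definition cl (d : nat) (x y : pt) (a : R) : Prop := forall i, (i < d)%nat -> Rabs (x i - y i) <= a.

Lemma cl_refl d x a : 0 <= a -> cl d x x a.
Proof. intros H i _. rewrite Rminus_diag, Rabs_R0; auto. Qed.

Lemma cl_sym d x y a : cl d x y a -> cl d y x a.
Proof. intros H i Hi. rewrite Rabs_minus_sym; auto. Qed.

Lemma cl_trans d x y z a b : cl d x y a -> cl d y z b -> cl d x z (a + b).
Proof.
  intros H K i Hi. replace (x i - z i) with ((x i - y i) + (y i - z i)) by lra.
  eapply Rle_trans; [apply Rabs_triang|]. specialize (H i Hi); specialize (K i Hi); lra.
Qed.

Lemma cl_mono d x y a b : cl d x y a -> a <= b -> cl d x y b.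
Proof. intros H K i Hi. specialize (H i Hi); lra. Qed.

Lemma mx_nonneg d x : 0 <= rmaxabs d x.
Proof. induction d; simpl; [lra|]. eapply Rle_trans; [apply IHd|apply Rmax_l]. Qed.

Lemma mx_ge d x i : (i < d)%nat -> Rabs (x i) <= rmaxabs d x.
Proof.
  induction d; intros H; [lia|]. simpl. destruct (Nat.eq_dec i d) as [->|]; [apply Rmax_r|].
  eapply Rle_trans; [apply IHd; lia|apply Rmax_l].
Qed.

Lemma mx_le d x a : 0 <= a -> (forall i, (i < d)%nat -> Rabs (x i) <= a) -> rmaxabs d x <= a.
Proof. induction d; intros Ha H; simpl; [lra|]. apply Rmax_lub; [apply IHd; auto|apply H; lia]. Qed.

Lemma mx_le_inv d x a : rmaxabs d x <= a -> forall i, (i < d)%nat -> - a <= x i <= a.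
Proof. intros H i Hi. apply Rabs_le_iff. pose proof (mx_ge d x i Hi); lra. Qed.

Lemma mx_attained d x : (0 < d)%nat -> exists i, (i < d)%nat /\ Rabs (x i) = rmaxabs d x.
Proof.
  induction d; intros H; [lia|]. simpl. destruct (Rle_dec (rmaxabs d x) (Rabs (x d))).
  - exists d. rewrite Rmax_right; auto.
  - destruct d; [simpl in n; pose proof (Rabs_pos (x 0%nat)); lra|].
    destruct IHd as [i [Hi E]]; [lia|]. exists i. rewrite Rmax_left by lra. auto.
Qed.

Lemma mx_cl d x y a : cl d x y a -> 0 <= a -> Rabs (rmaxabs d x - rmaxabs d y) <= a.
Proof.
  intros H Ha. apply Rabs_le_iff. split.
  - assert (rmaxabs d y <= rmaxabs d x + a); [|lra].
    apply mx_le; [pose proof (mx_nonneg d x); lra|]. intros i Hi.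
    replace (y i) with (x i + (y i - x i)) by lra. eapply Rle_trans; [apply Rabs_triang|].
    pose proof (mx_ge d x i Hi). specialize (H i Hi). rewrite Rabs_minus_sym in H. lra.
  - assert (rmaxabs d x <= rmaxabs d y + a); [|lra].
    apply mx_le; [pose proof (mx_nonneg d y); lra|]. intros i Hi.
    replace (x i) with (y i + (x i - y i)) by lra. eapply Rle_trans; [apply Rabs_triang|].
    pose proof (mx_ge d y i Hi). specialize (H i Hi). lra.
Qed.

Lemma mx_ext d x y : (forall i, (i < d)%nat -> Rabs (x i) = Rabs (y i)) -> rmaxabs d x = rmaxabs d y.
Proof. induction d; intros H; simpl; [reflexivity|]. rewrite IHd, (H d); auto; intros; apply H; lia. Qed.

Lemma mx_scal d c x : rmaxabs d (fun i => c * x i) = Rabs c * rmaxabs d x.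
Proof.
  induction d; simpl; [lra|]. rewrite IHd, Rabs_mult. apply RmaxRmult, Rabs_pos.
Qed.

Lemma mx_Sl d x : rmaxabs (S d) x = Rmax (Rabs (x O)) (rmaxabs d (fun i => x (S i))).
Proof.
  induction d.
  - simpl. rewrite Rmax_comm. reflexivity.
  - change (rmaxabs (S (S d)) x) with (Rmax (rmaxabs (S d) x) (Rabs (x (S d)))).
    rewrite IHd. simpl. now rewrite Rmax_assoc.
Qed.

Lemma dist_cl d x y a : dist d x y <= a -> cl d x y a.
Proof.
  intros H i Hi. eapply Rle_trans; [|exact H]. unfold dist.
  rewrite <- sqrt_Rsqr_abs. apply sqrt_le_1_alt.
  replace (Rsqr (x i - y i)) with ((fun i => (x i - y i) ^ 2) i) by (unfold Rsqr; simpl; ring).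
  apply (rsum_term_le d (fun i => (x i - y i) ^ 2) i); auto. intros; apply pow2_ge_0.
Qed.

Lemma cl_dist d x y a : 0 <= a -> cl d x y a -> dist d x y <= INR d * a.
Proof.
  intros Ha H. unfold dist.
  rewrite <- (sqrt_pow2 (INR d * a)) by (apply Rmult_le_pos; auto using pos_INR).
  apply sqrt_le_1_alt.
  apply Rle_trans with (INR d * a ^ 2).
  - rewrite <- rsum_const. apply rsum_le. intros i Hi. specialize (H i Hi).
    rewrite <- (pow2_abs (x i - y i)). pose proof (Rabs_pos (x i - y i)). nra.
  - destruct d; [simpl; lra|]. rewrite S_INR. pose proof (pos_INR d). nra.
Qed.

Lemma dist_nonneg d x y : 0 <= dist d x y.
Proof. apply sqrt_pos. Qed.

(* [hle n p q a] is a left-invariant gauge comparable to [cc_le n p q a]; measuring the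
   vertical displacement by the symmetric area term [zeta] makes its triangle inequality
   hold without a constant. *)
Definition zeta (n : nat) (p q : hpt) : R :=
  hz q - hz p - rsum n (fun j => (hy p j + hy q j) / 2 * (hx q j - hx p j)).

Definition hle (n : nat) (p q : hpt) (a : R) : Prop :=
  (forall j, (j < n)%nat -> Rabs (hx q j - hx p j) <= a /\ Rabs (hy q j - hy p j) <= a) /\
  Rabs (zeta n p q) <= INR n * a ^ 2.

Lemma zeta_sym n p q : zeta n q p = - zeta n p q.
Proof.
  unfold zeta.
  replace (rsum n (fun j => (hy q j + hy p j) / 2 * (hx p j - hx q j)))
    with (- 1 * rsum n (fun j => (hy p j + hy q j) / 2 * (hx q j - hx p j))); [lra|].
  rewrite <- rsum_scal. apply rsum_ext; intros; lra.
Qed.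

Lemma hle_refl n p a : 0 <= a -> hle n p p a.
Proof.
  intros Ha. split.
  - intros; rewrite !Rminus_diag, Rabs_R0; lra.
  - unfold zeta. rewrite rsum_zero by (intros; lra).
    replace (hz p - hz p - 0) with 0 by lra. rewrite Rabs_R0. apply Rmult_le_pos; [apply pos_INR|nra].
Qed.

Lemma hle_sym n p q a : hle n p q a -> hle n q p a.
Proof.
  intros [H K]. split.
  - intros j Hj. destruct (H j Hj). rewrite !(Rabs_minus_sym _ (hx q j)), !(Rabs_minus_sym _ (hy q j)); auto.
  - rewrite zeta_sym, Rabs_Ropp; auto.
Qed.

Lemma hle_mono n p q a b : 0 <= a -> hle n p q a -> a <= b -> hle n p q b.
Proof.
  intros Ha [H K] L. split.
  - intros j Hj. destruct (H j Hj). lra.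
  - eapply Rle_trans; [exact K|]. apply Rmult_le_compat_l; [apply pos_INR|nra].
Qed.

(** Composing two displacements changes [zeta] by half their symplectic pairing, here at most
    [INR n * (a * b)], while the cross term of [INR n * (a + b) ^ 2] is twice that. The factor
    [INR n] in [hle] leaves this room. *)
Lemma hle_trans n p q r a b : 0 <= a -> 0 <= b -> hle n p q a -> hle n q r b -> hle n p r (a + b).
Proof.
  intros Ha Hb [H1 H2] [K1 K2]. split.
  - intros j Hj. destruct (H1 j Hj) as [U1 U2]. destruct (K1 j Hj) as [V1 V2].
    apply Rabs_le_iff in U1, U2, V1, V2. split; apply Rabs_le_iff; lra.
  - assert (E : zeta n p r = zeta n p q + zeta n q r -
        rsum n (fun j => /2 * ((hy r j - hy q j) * (hx q j - hx p j) + (hy p j - hy q j) * (hx r j - hx q j)))).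
    { unfold zeta.
      assert (F : rsum n (fun j => (hy p j + hy r j) / 2 * (hx r j - hx p j)) =
        rsum n (fun j => (hy p j + hy q j) / 2 * (hx q j - hx p j)) +
        rsum n (fun j => (hy q j + hy r j) / 2 * (hx r j - hx q j)) +
        rsum n (fun j => /2 * ((hy r j - hy q j) * (hx q j - hx p j) + (hy p j - hy q j) * (hx r j - hx q j)))).
      { rewrite <- !rsum_plus. apply rsum_ext; intros; field. }
      rewrite F; lra. }
    rewrite E.
    assert (B : Rabs (rsum n (fun j => /2 * ((hy r j - hy q j) * (hx q j - hx p j) + (hy p j - hy q j) * (hx r j - hx q j)))) <= INR n * (a * b)).
    { apply rsum_abs_le. intros j Hj. destruct (H1 j Hj) as [U1 U2]. destruct (K1 j Hj) as [V1 V2].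
      rewrite Rabs_minus_sym in U2.
      pose proof (Rabs_mult_le _ _ _ _ V2 U1). pose proof (Rabs_mult_le _ _ _ _ U2 V1).
      rewrite Rabs_mult, (Rabs_pos_eq (/2)) by lra.
      pose proof (Rabs_triang ((hy r j - hy q j) * (hx q j - hx p j)) ((hy p j - hy q j) * (hx r j - hx q j))). lra. }
    pose proof (pos_INR n). apply Rabs_le_iff in H2, K2, B. apply Rabs_le_iff.
    assert (0 <= INR n * (a * b)) by (apply Rmult_le_pos; nra).
    replace (INR n * (a + b) ^ 2) with (INR n * a ^ 2 + INR n * b ^ 2 + INR n * (a*b) + INR n * (a*b)) by ring. lra.
Qed.

(** Vertical deviation from the horizontal plane at [p]. Curves and Taylor expansions produce this
    asymmetric quantity; it differs from [zeta] by a term of second order, so the two give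
    equivalent bounds up to a constant. *)
Definition zdev (n : nat) (p q : hpt) : R := hz q - hz p - rsum n (fun j => hy p j * (hx q j - hx p j)).

Lemma zeta_zdev n p q : zeta n p q = zdev n p q - rsum n (fun j => / 2 * ((hy q j - hy p j) * (hx q j - hx p j))).
Proof.
  unfold zeta, zdev.
  assert (F : rsum n (fun j => (hy p j + hy q j) / 2 * (hx q j - hx p j)) =
     rsum n (fun j => hy p j * (hx q j - hx p j)) + rsum n (fun j => / 2 * ((hy q j - hy p j) * (hx q j - hx p j)))).
  { rewrite <- rsum_plus. apply rsum_ext; intros; field. }
  lra.
Qed.

Lemma half_sum_bound n p q a : (forall j, (j < n)%nat -> Rabs (hx q j - hx p j) <= a /\ Rabs (hy q j - hy p j) <= a) ->
  Rabs (rsum n (fun j => / 2 * ((hy q j - hy p j) * (hx q j - hx p j)))) <= INR n * (a ^ 2 / 2).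
Proof.
  intros H. apply rsum_abs_le. intros j Hj. destruct (H j Hj) as [U V].
  pose proof (Rabs_mult_le _ _ _ _ V U). rewrite Rabs_mult, (Rabs_pos_eq (/2)) by lra. lra.
Qed.

Lemma hle_of_zdev n p q a : (forall j, (j < n)%nat -> Rabs (hx q j - hx p j) <= a /\ Rabs (hy q j - hy p j) <= a) ->
  Rabs (zdev n p q) <= INR n * (a ^ 2 / 2) -> hle n p q a.
Proof.
  intros H K. split; auto. rewrite zeta_zdev. pose proof (half_sum_bound n p q a H) as B.
  apply Rabs_le_iff in K, B. apply Rabs_le_iff. lra.
Qed.

Lemma zdev_of_hle n p q a : hle n p q a -> Rabs (zdev n p q) <= INR n * (2 * a ^ 2).
Proof.
  intros [H K]. pose proof (half_sum_bound n p q a H) as B. pose proof (zeta_zdev n p q) as E.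
  apply Rabs_le_iff in K, B. apply Rabs_le_iff.
  assert (0 <= INR n * (a^2)) by (apply Rmult_le_pos; [apply pos_INR|nra]). lra.
Qed.

(** Lets the arbitrarily small excess in [cc_le], which unfolds an infimum, be dropped. *)
Lemma hle_closed n p q a : (forall e, e > 0 -> hle n p q (a + e)) -> hle n p q a.
Proof.
  intros H. split.
  - intros j Hj. split; apply Rnot_lt_le; intros C.
    + destruct (H ((Rabs (hx q j - hx p j) - a) / 2) ltac:(lra)) as [K _]. destruct (K j Hj). lra.
    + destruct (H ((Rabs (hy q j - hy p j) - a) / 2) ltac:(lra)) as [K _]. destruct (K j Hj). lra.
  - apply Rnot_lt_le; intros C. set (D := Rabs (zeta n p q) - INR n * a ^ 2) in *.
    assert (HD : D > 0) by (unfold D; lra). pose proof (pos_INR n) as Hn. pose proof (Rabs_pos a).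
    set (e := Rmin 1 (D / (2 * (INR n + 1) * (2 * Rabs a + 1)))).
    assert (P : 0 < 2 * (INR n + 1) * (2 * Rabs a + 1)) by (apply Rmult_lt_0_compat; nra).
    assert (He : 0 < e) by (apply Rmin_glb_lt; [lra|]; apply Rdiv_lt_0_compat; lra).
    assert (He1 : e <= 1) by apply Rmin_l.
    assert (He2 : e * (2 * (INR n + 1) * (2 * Rabs a + 1)) <= D).
    { apply Rle_trans with (D / (2 * (INR n + 1) * (2 * Rabs a + 1)) * (2 * (INR n + 1) * (2 * Rabs a + 1))).
      - apply Rmult_le_compat_r; [lra|apply Rmin_r].
      - right; field. lra. }
    destruct (H e He) as [_ K].
    assert (INR n * (a + e) ^ 2 <= INR n * a ^ 2 + D / 2); [|unfold D in *; lra].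
    assert (2 * a * e + e * e <= e * (2 * Rabs a + 1)) by (pose proof (Rle_abs a); nra).
    assert (INR n * (2 * a * e + e * e) <= INR n * (e * (2 * Rabs a + 1))) by (apply Rmult_le_compat_l; lra).
    assert (0 <= e * (2 * Rabs a + 1)) by nra.
    nra.
Qed.

Definition hdil (s : R) (p : hpt) : hpt := mkH (fun j => s * hx p j) (fun j => s * hy p j) (s * s * hz p).
Definition hinv (n : nat) (p : hpt) : hpt :=
  mkH (fun j => - hx p j) (fun j => - hy p j) (- hz p + rsum n (fun j => hy p j * hx p j)).
Definition hzero : hpt := mkH (fun _ => 0) (fun _ => 0) 0.

Lemma hle_dil n s p q a : hle n p q a -> hle n (hdil s p) (hdil s q) (Rabs s * a).
Proof.
  intros [H K]. split.
  - intros j Hj. destruct (H j Hj). simpl. rewrite <- !Rmult_minus_distr_l, !Rabs_mult.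
    split; apply Rmult_le_compat_l; auto using Rabs_pos.
  - replace (zeta n (hdil s p) (hdil s q)) with (s ^ 2 * zeta n p q).
    + rewrite Rabs_mult, Rabs_pos_eq by nra. replace ((Rabs s * a) ^ 2) with (s ^ 2 * a ^ 2) by (rewrite Rpow_mult_distr, pow2_abs; ring).
      pose proof (pow2_ge_0 s). nra.
    + unfold zeta; simpl.
      replace (rsum n (fun j => (s * hy p j + s * hy q j) / 2 * (s * hx q j - s * hx p j)))
        with (s ^ 2 * rsum n (fun j => (hy p j + hy q j) / 2 * (hx q j - hx p j))); [ring|].
      rewrite <- rsum_scal. apply rsum_ext; intros; field.
Qed.

Lemma zeta_ltr n g p q : zeta n (hmul n g p) (hmul n g q) = zeta n p q.
Proof.
  unfold zeta; simpl.
  assert (F : rsum n (fun j => (hy g j + hy p j + (hy g j + hy q j)) / 2 * (hx g j + hx q j - (hx g j + hx p j)))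
    = rsum n (fun j => (hy p j + hy q j) / 2 * (hx q j - hx p j)) + (rsum n (fun j => hy g j * hx q j) - rsum n (fun j => hy g j * hx p j))).
  { rewrite <- rsum_minus, <- rsum_plus. apply rsum_ext; intros; field. }
  lra.
Qed.

Lemma hle_ltr n g p q a : hle n p q a -> hle n (hmul n g p) (hmul n g q) a.
Proof.
  intros [H K]. split; [|rewrite zeta_ltr; auto]. intros j Hj. simpl.
  replace (hx g j + hx q j - (hx g j + hx p j)) with (hx q j - hx p j) by lra.
  replace (hy g j + hy q j - (hy g j + hy p j)) with (hy q j - hy p j) by lra. auto.
Qed.

(** [hle n p q 0] serves as equality of points throughout: coordinates with index at least [n] are
    junk, so Leibniz equality would be too strong. *)
Lemma hle0_eq n p q : (forall j, (j < n)%nat -> hx p j = hx q j /\ hy p j = hy q j) -> hz p = hz q -> hle n p q 0.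
Proof.
  intros H K. split.
  - intros j Hj. destruct (H j Hj) as [-> ->]. rewrite !Rminus_diag, Rabs_R0. lra.
  - unfold zeta. rewrite rsum_zero. { rewrite K, Rminus_diag, Rminus_0_r, Rabs_R0. lra. }
    intros i Hi. destruct (H i Hi) as [-> _]. lra.
Qed.

Lemma hle0_inv n p q : hle n p q 0 -> (forall j, (j < n)%nat -> hx p j = hx q j /\ hy p j = hy q j) /\ hz p = hz q.
Proof.
  intros [H K]. assert (E : forall j, (j < n)%nat -> hx p j = hx q j /\ hy p j = hy q j).
  { intros j Hj. destruct (H j Hj) as [U V]. apply Rabs_le_iff in U, V. lra. }
  split; auto. unfold zeta in K. rewrite rsum_zero in K.
  - apply Rabs_le_iff in K. simpl in K. lra.
  - intros i Hi. destruct (E i Hi) as [-> _]. lra.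
Qed.

Lemma hle_ltr_inv n g p : hle n (hmul n g (hmul n (hinv n g) p)) p 0.
Proof.
  apply hle0_eq; simpl; [intros; lra|].
  assert (F : rsum n (fun j => hy g j * (- hx g j + hx p j)) = - rsum n (fun j => hy g j * hx g j) + rsum n (fun j => hy g j * hx p j)).
  { replace (- rsum n (fun j => hy g j * hx g j)) with (-1 * rsum n (fun j => hy g j * hx g j)) by lra.
    rewrite <- rsum_scal, <- rsum_plus. apply rsum_ext; intros; lra. }
  assert (G : rsum n (fun j => - hy g j * hx p j) = - rsum n (fun j => hy g j * hx p j)).
  { replace (- rsum n (fun j => hy g j * hx p j)) with (-1 * rsum n (fun j => hy g j * hx p j)) by lra.
    rewrite <- rsum_scal. apply rsum_ext; intros; lra. }
  lra.
Qed.

Lemma hdil_dil n s t p : s * t = 1 -> hle n (hdil s (hdil t p)) p 0.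
Proof.
  intros E. apply hle0_eq; simpl; [intros; split; rewrite <- Rmult_assoc, E; lra|].
  replace (s * s * (t * t * hz p)) with ((s*t)*(s*t)*hz p) by ring. rewrite E; lra.
Qed.

Lemma hle_l0 n p q r a : 0 <= a -> hle n p q 0 -> hle n q r a -> hle n p r a.
Proof. intros. replace a with (0 + a) by lra. eapply hle_trans; eauto; lra. Qed.
Lemma hle_r0 n p q r a : 0 <= a -> hle n p q a -> hle n q r 0 -> hle n p r a.
Proof. intros. replace a with (a + 0) by lra. eapply hle_trans; eauto; lra. Qed.

(** * Comparison with the Carnot-Caratheodory distance *)

Section CurveLengths.
Import Coquelicot.Coquelicot Defs.

Lemma derivable_rsum n (f f' : nat -> R -> R) t :
  (forall j, (j < n)%nat -> derivable_pt_lim (f j) t (f' j t)) ->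
  derivable_pt_lim (fun s => rsum n (fun j => f j s)) t (rsum n (fun j => f' j t)).
Proof.
  induction n; simpl; intros H.
  - apply derivable_pt_lim_const.
  - apply (derivable_pt_lim_plus (fun s => rsum n (fun j => f j s)) (f n)); auto.
Qed.

Lemma continuity_rsum n (f : nat -> R -> R) :
  (forall j, (j < n)%nat -> continuity (f j)) -> continuity (fun s => rsum n (fun j => f j s)).
Proof.
  induction n; simpl; intros H.
  - apply continuity_const. intros ? ?; reflexivity.
  - apply (continuity_plus (fun s => rsum n (fun j => f j s)) (f n)); auto.
Qed.

Lemma derivative_domination (f f' G g : R -> R) K :
  (forall t, derivable_pt_lim f t (f' t)) -> (forall t, derivable_pt_lim G t (g t)) ->
  (forall t, 0 <= t <= 1 -> Rabs (f' t) <= K * g t) ->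
  forall t, 0 <= t <= 1 -> Rabs (f t - f 0) <= K * (G t - G 0).
Proof.
  intros Hf HG Hb t Ht. destruct (Req_dec t 0) as [->|Hne].
  { rewrite !Rminus_diag, Rabs_R0; lra. }
  assert (P : forall s, s = 1 \/ s = -1 -> s * (f t - f 0) <= K * (G t - G 0)).
  { intros s Hs.
    destruct (MVT_cor2 (fun u => K * G u - s * f u) (fun u => K * g u - s * f' u) 0 t) as [c [E Hc]].
    - lra.
    - intros c _. apply derivable_pt_lim_minus; apply derivable_pt_lim_scal; auto.
    - assert (Hc' : 0 <= c <= 1) by lra. specialize (Hb c Hc'). apply Rabs_le_iff in Hb.
      assert (0 <= (K * g c - s * f' c) * (t - 0)) by (apply Rmult_le_pos; destruct Hs; subst; lra).
      lra. }
  apply Rabs_le_iff. pose proof (P 1 ltac:(auto)). pose proof (P (-1) ltac:(auto)). lra.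
Qed.

Lemma continuity_hspeed n dx dy :
  (forall j, (j < n)%nat -> continuity (dx j) /\ continuity (dy j)) -> continuity (hspeed n dx dy).
Proof.
  intros H t. unfold hspeed.
  apply (continuity_pt_comp (fun t => rsum n (fun j => dx j t ^ 2 + dy j t ^ 2)) sqrt).
  - apply (continuity_rsum n (fun j t => dx j t ^ 2 + dy j t ^ 2)). intros j Hj. destruct (H j Hj).
    simpl. apply continuity_plus; apply continuity_mult; auto; apply continuity_mult; auto;
      apply continuity_const; intros ? ?; reflexivity.
  - apply continuity_pt_sqrt. apply rsum_nonneg. intros; nra.
Qed.

Lemma hspeed_ge n dx dy t j : (j < n)%nat -> Rabs (dx j t) <= hspeed n dx dy t /\ Rabs (dy j t) <= hspeed n dx dy t.
Proof.
  intros Hj. unfold hspeed.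
  pose proof (rsum_term_le n (fun j => dx j t ^ 2 + dy j t ^ 2) j ltac:(intros; nra) Hj) as H. cbv beta in H.
  pose proof (pow2_ge_0 (dx j t)). pose proof (pow2_ge_0 (dy j t)).
  split; rewrite <- sqrt_Rsqr_abs; apply sqrt_le_1_alt; rewrite Rsqr_pow2; lra.
Qed.

(** Along a horizontal curve, z minus the linear form [<y(0), x>] has derivative [<y - y(0), x'>].
    Both factors are controlled by the length, so the vertical deviation is at most [n] times its
    square; the factor 2 absorbs the passage from [zdev] to [zeta]. *)
Lemma hle_of_cc_le n p q c : 0 <= c -> cc_le n p q c -> hle n p q (2 * c).
Proof.
  intros Hc H. apply hle_closed. intros e He.
  destruct (H (e / 2) ltac:(lra)) as (gx & gy & gz & dx & dy & dz & HC & Hend & Hz0 & Hz1 & pr & Hlen).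
  destruct HC as (Hd & Hdz & Hcd & Hcdz & Hhor).
  set (S := hspeed n dx dy) in *.
  assert (HcS : continuity S) by (apply continuity_hspeed; auto).
  assert (HcS' : forall t, continuous S t) by (intros t; apply continuity_pt_filterlim, HcS).
  (* Arc length. Each coordinate is compared with [G] by the mean value theorem. *)
  set (G := fun t => RInt S 0 t).
  assert (HG : forall t, derivable_pt_lim G t (S t)).
  { intros t. apply is_derive_Reals. unfold G. apply (is_derive_RInt S (fun t => RInt S 0 t) 0 t).
    - apply filter_forall. intros y. apply (RInt_correct S 0 y). apply (ex_RInt_continuous S 0 y). auto.
    - auto. }
  assert (HG0 : G 0 = 0) by (unfold G; rewrite RInt_point; reflexivity).
  set (c' := c + e / 2) in *.
  assert (HG1 : G 1 <= c') by (unfold G; rewrite (RInt_Reals S 0 1 pr); exact Hlen).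
  assert (HSnn : forall t, 0 <= S t) by (intros; apply sqrt_pos).
  assert (HGm : forall t, 0 <= t <= 1 -> G t <= c').
  { intros t Ht. destruct (Req_dec t 1) as [->|]; [auto|].
    destruct (MVT_cor2 G S t 1) as [u [E _]]; [lra|intros; auto|].
    assert (0 <= S u * (1 - t)) by (apply Rmult_le_pos; auto; lra). lra. }
  assert (Hx : forall j t, (j < n)%nat -> 0 <= t <= 1 -> Rabs (gx j t - gx j 0) <= c' /\ Rabs (gy j t - gy j 0) <= c').
  { intros j t Hj Ht. specialize (HGm t Ht).
    assert (B : Rabs (gx j t - gx j 0) <= 1 * (G t - G 0)).
    { apply (derivative_domination (gx j) (dx j) G S); auto.
      - intros s; apply Hd; auto.
      - intros s _. rewrite Rmult_1_l. apply hspeed_ge; auto. }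
    assert (B' : Rabs (gy j t - gy j 0) <= 1 * (G t - G 0)).
    { apply (derivative_domination (gy j) (dy j) G S); auto.
      - intros s; apply Hd; auto.
      - intros s _. rewrite Rmult_1_l. apply hspeed_ge; auto. }
    lra. }
  assert (Hc' : 0 <= c') by (unfold c'; lra).
  assert (Hz : Rabs (zdev n p q) <= INR n * (c' ^ 2)).
  { set (phi := fun t => gz t - rsum n (fun j => gy j 0 * gx j t)).
    assert (HB : Rabs (phi 1 - phi 0) <= (INR n * c') * (G 1 - G 0)).
    { apply (derivative_domination phi (fun t => dz t - rsum n (fun j => gy j 0 * dx j t)) G S); auto; [| |lra].
      - intros t. apply derivable_pt_lim_minus; auto.
        apply (derivable_rsum n (fun j t => gy j 0 * gx j t) (fun j t => gy j 0 * dx j t)).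
        intros j Hj. apply derivable_pt_lim_scal. apply Hd; auto.
      - intros t Ht. rewrite Hhor, <- rsum_minus.
        rewrite Rmult_assoc. apply rsum_abs_le. intros j Hj.
        replace (gy j t * dx j t - gy j 0 * dx j t) with ((gy j t - gy j 0) * dx j t) by ring.
        apply Rabs_mult_le; [apply Hx; auto|apply hspeed_ge; auto]. }
    replace (zdev n p q) with (phi 1 - phi 0).
    - eapply Rle_trans; [exact HB|]. rewrite HG0. pose proof (pos_INR n).
      replace (INR n * c' ^ 2) with (INR n * c' * c') by ring. apply Rmult_le_compat_l; [nra|lra].
    - unfold phi, zdev. rewrite <- Hz0, <- Hz1.
      assert (E : rsum n (fun j => hy p j * (hx q j - hx p j)) = rsum n (fun j => gy j 0 * gx j 1) - rsum n (fun j => gy j 0 * gx j 0)).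
      { rewrite <- rsum_minus. apply rsum_ext. intros j Hj. destruct (Hend j Hj) as (-> & -> & -> & _). ring. }
      rewrite E. ring. }
  assert (Hle : hle n p q (2 * c')).
  { apply hle_of_zdev.
    - intros j Hj. destruct (Hend j Hj) as (<- & <- & <- & <-). destruct (Hx j 1 Hj ltac:(lra)). lra.
    - eapply Rle_trans; [exact Hz|]. pose proof (pos_INR n). apply Rmult_le_compat_l; nra. }
  replace (2 * c + e) with (2 * c') by (unfold c'; lra). exact Hle.
Qed.

(* The connecting curve is the straight segment in the (x,y)-coordinates plus a
   closed loop [(A u, B v)] in the first coordinate plane.  The polynomials u, v
   vanish at 0 and 1, have mean zero, and enclose the area int v u' = 1/70. *)
Lemma cc_le_of_hle n p q a : (1 <= n)%nat -> 0 <= a -> hle n p q a -> cc_le n p q (100 * INR n * INR n * a).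
Proof.
  intros Hn Ha [Hxy Hz] eps Heps.
  set (Z := zeta n p q) in *.
  (* A loop with amplitudes [A] and [B] changes the height by [A * B / 70], so [A * B = 70 * Z]
     supplies the missing height [Z]. Splitting the product evenly keeps both amplitudes of order
     [a], since [Rabs Z <= INR n * a ^ 2]. *)
  set (A := sqrt (70 * Rabs Z)).
  set (B := (if Rle_dec 0 Z then 1 else -1) * A).
  assert (HAB : A * B = 70 * Z).
  { unfold B, A. replace (sqrt (70 * Rabs Z) * ((if Rle_dec 0 Z then 1 else -1) * sqrt (70 * Rabs Z)))
      with ((if Rle_dec 0 Z then 1 else -1) * (sqrt (70 * Rabs Z) * sqrt (70 * Rabs Z))) by ring.
    rewrite sqrt_sqrt by (pose proof (Rabs_pos Z); lra).
    destruct (Rle_dec 0 Z); [rewrite Rabs_pos_eq by auto|rewrite Rabs_left by lra]; ring. }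
  assert (HA0 : 0 <= A) by apply sqrt_pos.
  assert (Hn1 : 1 <= INR n) by (change 1 with (INR 1); apply le_INR; auto).
  assert (HA : A <= 9 * INR n * a).
  { unfold A. rewrite <- (sqrt_pow2 (9 * INR n * a)) by (repeat apply Rmult_le_pos; lra).
    apply sqrt_le_1_alt. assert (INR n * a^2 <= INR n * INR n * a ^ 2) by (apply Rmult_le_compat_r; nra).
    replace ((9 * INR n * a) ^ 2) with (81 * (INR n * INR n * a ^ 2)) by ring.
    assert (0 <= INR n * a^2) by (apply Rmult_le_pos; nra). fold Z in Hz. lra. }
  assert (HBA : Rabs B = A).
  { unfold B. rewrite Rabs_mult, (Rabs_pos_eq A) by auto.
    destruct (Rle_dec 0 Z); [rewrite Rabs_pos_eq by lra|rewrite Rabs_left by lra]; ring. }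
  set (X := fun j => hx q j - hx p j). set (Y := fun j => hy q j - hy p j).
  set (al := fun j : nat => match j with O => A | _ => 0 end).
  set (be := fun j : nat => match j with O => B | _ => 0 end).
  set (gx := fun j t => hx p j + X j * t + al j * (t - 3*t^2 + 2*t^3)).
  set (gy := fun j t => hy p j + Y j * t + be j * (t - 6*t^2 + 10*t^3 - 5*t^4)).
  set (dx := fun j t => X j + al j * (1 - 6*t + 6*t^2)).
  set (dy := fun j t => Y j + be j * (1 - 12*t + 30*t^2 - 20*t^3)).
  (* A primitive of [gy j * dx j]; the product of [al j] with the linear part of [gy j] is
     integrated by parts. At 1 the loop contributes [al j * be j / 70]. *)
  set (gj := fun j t => hy p j * X j * t + Y j * X j * (t^2/2)
     + al j * (hy p j + Y j * t) * (t - 3*t^2 + 2*t^3) - al j * Y j * (t^2/2 - t^3 + t^4/2)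
     + be j * X j * (t^2/2 - 2*t^3 + 5/2*t^4 - t^5)
     + al j * be j * (t^2/2 - 4*t^3 + 13*t^4 - 101/5 * t^5 + 15*t^6 - 30/7*t^7)).
  set (gz := fun t => hz p + rsum n (fun j => gj j t)).
  exists gx, gy, gz, dx, dy, (fun t => rsum n (fun j => gy j t * dx j t)).
  assert (Dx : forall j t, derivable_pt_lim (gx j) t (dx j t)).
  { intros j t. apply is_derive_Reals. unfold gx, dx. auto_derive; [exact I|ring]. }
  assert (Dy : forall j t, derivable_pt_lim (gy j) t (dy j t)).
  { intros j t. apply is_derive_Reals. unfold gy, dy. auto_derive; [exact I|ring]. }
  assert (Cx : forall j, continuity (gx j)).
  { intros j t. apply derivable_continuous_pt. exists (dx j t). apply Dx. }
  assert (Cy : forall j, continuity (gy j)).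
  { intros j t. apply derivable_continuous_pt. exists (dy j t). apply Dy. }
  assert (Cdx : forall j, continuity (dx j)).
  { intros j t. apply derivable_continuous_pt. exists (al j * (-6 + 12 * t)). apply is_derive_Reals. unfold dx. auto_derive; [exact I|ring]. }
  assert (Cdy : forall j, continuity (dy j)).
  { intros j t. apply derivable_continuous_pt. exists (be j * (-12 + 60*t - 60*t^2)). apply is_derive_Reals. unfold dy. auto_derive; [exact I|ring]. }
  assert (Cs : forall t, 0 <= t <= 1 -> hspeed n dx dy t <= 100 * INR n * INR n * a).
  { intros t Ht. unfold hspeed.
    assert (Hw : Rabs (1 - 6*t + 6*t^2) <= 1) by (apply Rabs_le_iff; nra).
    assert (Hv : Rabs (1 - 12*t + 30*t^2 - 20*t^3) <= 2).
    { replace (1 - 12*t + 30*t^2 - 20*t^3) with ((1 - 2*t) * (1 - 10*(t*(1-t)))) by ring.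
      apply Rle_trans with (1 * 2); [|lra].
      assert (0 <= t * (1 - t) <= /4).
      { split; [apply Rmult_le_pos; lra|]. pose proof (pow2_ge_0 (2 * t - 1)). lra. }
      apply Rabs_mult_le; apply Rabs_le_iff; lra. }
    assert (Hb : forall j, (j < n)%nat -> Rabs (dx j t) <= 30 * INR n * a /\ Rabs (dy j t) <= 30 * INR n * a).
    { intros j Hj. destruct (Hxy j Hj) as [U V].
      assert (Hal : Rabs (al j) <= A) by (destruct j; simpl; rewrite ?Rabs_R0; auto; rewrite Rabs_pos_eq; lra).
      assert (Hbe : Rabs (be j) <= A) by (destruct j; simpl; rewrite ?Rabs_R0; auto; lra).
      pose proof (Rabs_mult_le _ _ _ _ Hal Hw). pose proof (Rabs_mult_le _ _ _ _ Hbe Hv).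
      assert (a <= INR n * a) by nra.
      unfold dx, dy. split; (eapply Rle_trans; [apply Rabs_triang|]); unfold X, Y; lra. }
    set (M := 30 * INR n * a) in *. assert (0 <= M) by (unfold M; nra).
    apply Rle_trans with (sqrt ((100 * INR n * INR n * a)^2)); [|rewrite sqrt_pow2; [lra|]; repeat apply Rmult_le_pos; lra].
    apply sqrt_le_1_alt. apply Rle_trans with (INR n * (2 * M^2)).
    2:{ unfold M. replace (INR n * (2*(30 * INR n * a)^2)) with (1800 * INR n * ((INR n * a) ^ 2)) by ring.
        replace ((100 * INR n * INR n * a) ^ 2) with (10000 * (INR n * INR n) * ((INR n * a) ^ 2)) by ring.
        apply Rmult_le_compat_r; [apply pow2_ge_0|nra]. }
    rewrite <- rsum_const. apply rsum_le. intros j Hj. destruct (Hb j Hj) as [U V].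
    rewrite <- (pow2_abs (dx j t)), <- (pow2_abs (dy j t)).
    pose proof (Rabs_pos (dx j t)). pose proof (Rabs_pos (dy j t)). nra. }
  assert (Cz : continuity (fun t => rsum n (fun j => gy j t * dx j t))).
  { apply (continuity_rsum n (fun j t => gy j t * dx j t)). intros. apply continuity_mult; auto. }
  assert (Cv : continuity (hspeed n dx dy)) by (apply continuity_hspeed; auto).
  split; [|split; [|split; [|split]]].
  - split; [|split; [|split; [|split]]]; auto.
    intros t. unfold gz. rewrite <- (Rplus_0_l (rsum n _)) at 1.
    apply derivable_pt_lim_plus; [apply derivable_pt_lim_const|].
    apply (derivable_rsum n gj (fun j t => gy j t * dx j t)). intros j Hj.
    apply is_derive_Reals. unfold gj, gy, dx. auto_derive; [exact I|field].
  - intros j Hj. unfold gx, gy, X, Y. repeat split; ring.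
  - unfold gz. rewrite rsum_zero; [ring|]. intros; unfold gj; field.
  - unfold gz.
    assert (E : rsum n (fun j => gj j 1) = rsum n (fun j => (hy p j + hy q j) / 2 * (hx q j - hx p j)) + rsum n (fun j => al j * be j / 70)).
    { rewrite <- rsum_plus. apply rsum_ext. intros. unfold gj, X, Y. field. }
    assert (F : rsum n (fun j => al j * be j / 70) = Z).
    { destruct n; [lia|]. rewrite rsum_Sl, rsum_zero by (intros; simpl; field). simpl. rewrite HAB. field. }
    rewrite E, F. unfold Z, zeta. ring.
  - assert (pr : Riemann_integrable (hspeed n dx dy) 0 1) by (apply continuity_implies_RiemannInt; [lra|intros; apply Cv]).
    exists pr.
    pose proof (RiemannInt_P14 0 1 (100 * INR n * INR n * a)) as prc.
    apply Rle_trans with (RiemannInt prc).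
    + apply RiemannInt_P19; [lra|]. intros x Hx. unfold fct_cte. apply Cs. lra.
    + rewrite RiemannInt_P15. lra.
Qed.

Lemma cc_le_of_hle_le n p q c a : (1 <= n)%nat -> hle n p q a -> 0 <= a -> 100 * INR n * INR n * a <= c -> cc_le n p q c.
Proof.
  intros Hn H Ha Hc eps He. destruct (cc_le_of_hle n p q a Hn Ha H eps He) as (gx & gy & gz & dx & dy & dz & H1 & H2 & H3 & H4 & pr & H5).
  exists gx, gy, gz, dx, dy, dz. repeat (split; auto). exists pr. lra.
Qed.

End CurveLengths.

(** * Coloured horizontal simplices *)

Lemma half_pow_pos m : 0 < (/ 2) ^ m.
Proof. apply pow_lt; lra. Qed.

Lemma half_pow_small e : 0 < e -> exists m, forall p, (m <= p)%nat -> (/ 2) ^ p < e.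
Proof.
  intros He. destruct (pow_lt_1_zero (/2) ltac:(rewrite Rabs_pos_eq; lra) e He) as [N HN].
  exists N. intros p Hp. specialize (HN p Hp). rewrite Rabs_pos_eq in HN; [auto|left; apply half_pow_pos].
Qed.

Lemma le_of_half_pow x C : (forall m, x <= C * (/ 2) ^ m) -> x <= 0.
Proof.
  intros H. apply Rnot_lt_le. intros Hx.
  assert (HC : 0 < C) by (specialize (H O); simpl in H; lra).
  destruct (half_pow_small (x / C)) as [m Hm]; [apply Rdiv_lt_0_compat; auto|].
  specialize (Hm m (le_n m)). specialize (H m).
  apply (Rmult_lt_compat_l C) in Hm; auto. replace (C * (x / C)) with x in Hm by (field; lra). lra.
Qed.

Lemma geometric_cauchy (u : nat -> R) A :
  (forall m, Rabs (u (S m) - u m) <= A * (/ 2) ^ m) -> exists l, forall m, Rabs (u m - l) <= 2 * A * (/ 2) ^ m.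
Proof.
  intros H.
  assert (HA : 0 <= A). { specialize (H O). simpl in H. pose proof (Rabs_pos (u 1%nat - u O)). lra. }
  assert (D : forall m p, Rabs (u (m + p)%nat - u m) <= 2 * A * (/2) ^ m - 2 * A * (/2) ^ (m + p)).
  { intros m p. induction p.
    - rewrite Nat.add_0_r, !Rminus_diag, Rabs_R0. lra.
    - rewrite Nat.add_succ_r. specialize (H (m + p)%nat).
      replace (u (S (m + p)) - u m) with ((u (S (m + p)) - u (m + p)%nat) + (u (m + p)%nat - u m)) by ring.
      eapply Rle_trans; [apply Rabs_triang|]. simpl. lra. }
  assert (D' : forall m p, Rabs (u (m + p)%nat - u m) <= 2 * A * (/2) ^ m).
  { intros m p. specialize (D m p). assert (0 <= 2 * A * (/2)^(m+p)) by (pose proof (half_pow_pos (m + p)); nra). lra. }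
  assert (Hc : Cauchy_crit u).
  { intros e He. destruct (half_pow_small (e / (4 * A + 1))) as [N HN]; [apply Rdiv_lt_0_compat; lra|].
    exists N. intros p q Hp Hq.
    pose proof (D' N (p - N)%nat) as Ep. pose proof (D' N (q - N)%nat) as Eq.
    replace (N + (p - N))%nat with p in Ep by lia. replace (N + (q - N))%nat with q in Eq by lia.
    specialize (HN N (le_n N)). pose proof (half_pow_pos N).
    assert ((4 * A + 1) * (/2)^N < e).
    { apply (Rmult_lt_compat_l (4 * A + 1)) in HN; [|lra]. replace ((4 * A + 1) * (e / (4 * A + 1))) with e in HN by (field; lra). auto. }
    unfold Rdist. replace (u p - u q) with ((u p - u N) - (u q - u N)) by ring.
    eapply Rle_lt_trans; [apply Rabs_triang|]. rewrite Rabs_Ropp. lra. }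
  destruct (R_complete u Hc) as [l Hl]. exists l. intros m.
  apply Rnot_lt_le. intros C.
  destruct (Hl (Rabs (u m - l) - 2 * A * (/2)^m)) as [N HN]; [lra|].
  specialize (HN (m + N)%nat ltac:(lia)). specialize (D' m N). unfold Rdist in HN.
  replace (u m - l) with (- (u (m + N)%nat - u m) + (u (m+N)%nat - l)) in C at 1 by ring.
  pose proof (Rabs_triang (- (u (m + N)%nat - u m)) (u (m+N)%nat - l)) as T. rewrite Rabs_Ropp in T. 
  replace (- (u (m + N)%nat - u m) + (u (m+N)%nat - l)) with (u m - l) in * by ring. lra.
Qed.

Section DominantSystem.
Variables (n : nat) (K e : R) (E : nat -> nat -> R).
Hypothesis HK : 0 < K.
Hypothesis HE : forall i j, (i < n)%nat -> (j < n)%nat -> Rabs (E i j) <= e.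
Hypothesis Hdom : INR n * e <= K / 2.

(** At an index where [eta] is largest in absolute value, the off-diagonal part absorbs at most half
    of the diagonal term. Besides bounding the solution, this gives its uniqueness and its Lipschitz
    dependence on the system. *)
Lemma dominant_bound (eta a : nat -> R) M : 0 <= M ->
  (forall i, (i < n)%nat -> K * eta i + rsum n (fun j => E i j * eta j) = a i) ->
  (forall i, (i < n)%nat -> Rabs (a i) <= M) -> forall i, (i < n)%nat -> Rabs (eta i) <= 2 * M / K.
Proof.
  intros HM Heq Ha i0 Hi0.
  destruct (mx_attained n eta) as [i [Hi Em]]; [lia|].
  assert (B : K * Rabs (eta i) <= M + INR n * (e * Rabs (eta i))).
  { rewrite <- (Rabs_pos_eq K) by lra. rewrite <- Rabs_mult.
    replace (K * eta i) with (a i - rsum n (fun j => E i j * eta j)) by (rewrite <- Heq by auto; ring).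
    eapply Rle_trans; [apply Rabs_triang|]. rewrite Rabs_Ropp. apply Rplus_le_compat; auto.
    apply rsum_abs_le. intros j Hj. apply Rabs_mult_le; auto. rewrite Em. now apply mx_ge. }
  pose proof (Rabs_pos (eta i)).
  assert (INR n * e * Rabs (eta i) <= K / 2 * Rabs (eta i)) by (apply Rmult_le_compat_r; auto).
  pose proof (mx_ge n eta i0 Hi0). rewrite <- Em in *.
  apply Rle_trans with (Rabs (eta i)); auto.
  apply (Rmult_le_reg_l K); auto. replace (K * (2 * M / K)) with (2 * M) by (field; lra). lra.
Qed.

(** Jacobi iteration: dominance makes each correction at most half of the previous bound. *)
Lemma dominant_solution (a : nat -> R) : exists eta : nat -> R,
  forall i, (i < n)%nat -> K * eta i + rsum n (fun j => E i j * eta j) = a i.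
Proof.
  set (M := rmaxabs n a).
  assert (Ha : forall i, (i < n)%nat -> Rabs (a i) <= M) by (intros; now apply mx_ge).
  assert (HM : 0 <= M) by apply mx_nonneg.
  set (it := fix it m : nat -> R := match m with O => fun _ => 0 | S m' => fun i => (a i - rsum n (fun j => E i j * it m' j)) / K end).
  assert (D : forall m i, (i < n)%nat -> Rabs (it (S m) i - it m i) <= M / K * (/2) ^ m).
  { induction m; intros i Hi.
    - simpl. rewrite rsum_zero by (intros; ring). replace ((a i - 0) / K - 0) with (a i / K) by (field; lra).
      unfold Rdiv. rewrite Rabs_mult, (Rabs_pos_eq (/ K)) by (left; now apply Rinv_0_lt_compat).
      rewrite Rmult_1_r. apply Rmult_le_compat_r; auto. left; now apply Rinv_0_lt_compat.
    - change (it (S (S m)) i) with ((a i - rsum n (fun j => E i j * it (S m) j)) / K).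
      change (it (S m) i) with ((a i - rsum n (fun j => E i j * it m j)) / K).
      replace ((a i - rsum n (fun j => E i j * it (S m) j)) / K - (a i - rsum n (fun j => E i j * it m j)) / K)
        with (- / K * rsum n (fun j => E i j * (it (S m) j - it m j))).
      2:{ replace (rsum n (fun j => E i j * (it (S m) j - it m j))) with (rsum n (fun j => E i j * it (S m) j) - rsum n (fun j => E i j * it m j)); [field; lra|].
          rewrite <- rsum_minus. apply rsum_ext; intros; ring. }
      rewrite Rabs_mult, Rabs_Ropp, (Rabs_pos_eq (/ K)) by (left; now apply Rinv_0_lt_compat).
      apply Rle_trans with (/ K * (INR n * (e * (M / K * (/2)^m)))).
      + apply Rmult_le_compat_l; [left; now apply Rinv_0_lt_compat|]. apply rsum_abs_le. intros j Hj.
        apply Rabs_mult_le; auto.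
      + replace (/ K * (INR n * (e * (M / K * (/ 2) ^ m)))) with ((INR n * e) * (/ K * (M / K * (/ 2) ^ m))) by ring.
        assert (0 <= / K * (M / K * (/2)^m)).
        { pose proof (half_pow_pos m). apply Rmult_le_pos; [left; now apply Rinv_0_lt_compat|].
          apply Rmult_le_pos; [|lra]. apply Rmult_le_pos; auto. left; now apply Rinv_0_lt_compat. }
        eapply Rle_trans; [apply Rmult_le_compat_r; [auto|exact Hdom]|]. right. simpl. field. lra. }
  assert (L : forall i, exists l, (i < n)%nat -> forall m, Rabs (it m i - l) <= 2 * (M / K) * (/2)^m).
  { intros i. destruct (Nat.lt_ge_cases i n) as [Hi|Hi]; [|exists 0; lia].
    destruct (geometric_cauchy (fun m => it m i) (M / K)) as [l Hl]; [intros; auto|]. exists l; auto. }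
  set (eta := fun i => proj1_sig (constructive_indefinite_description _ (L i))).
  assert (Heta : forall i, (i < n)%nat -> forall m, Rabs (it m i - eta i) <= 2 * (M / K) * (/2)^m).
  { intros i. unfold eta. destruct (constructive_indefinite_description _ (L i)); auto. }
  exists eta. intros i Hi.
  assert (Z : Rabs (K * eta i + rsum n (fun j => E i j * eta j) - a i) <= 0).
  { apply (le_of_half_pow _ (K * (2 * (M / K)) + INR n * (e * (2 * (M / K))))). intros m.
    replace (K * eta i + rsum n (fun j => E i j * eta j) - a i) with
      (K * (eta i - it (S m) i) + rsum n (fun j => E i j * (eta j - it m j))).
    2:{ change (it (S m) i) with ((a i - rsum n (fun j => E i j * it m j)) / K).
        replace (rsum n (fun j => E i j * (eta j - it m j))) with (rsum n (fun j => E i j * eta j) - rsum n (fun j => E i j * it m j)); [field; lra|].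
        rewrite <- rsum_minus. apply rsum_ext; intros; ring. }
    eapply Rle_trans; [apply Rabs_triang|].
    replace ((K * (2 * (M / K)) + INR n * (e * (2 * (M / K)))) * (/ 2) ^ m) with
      (K * (2 * (M / K) * (/2)^m) + INR n * (e * (2 * (M / K) * (/2)^m))) by ring.
    apply Rplus_le_compat.
    - rewrite Rabs_mult, (Rabs_pos_eq K) by lra. apply Rmult_le_compat_l; [lra|].
      rewrite Rabs_minus_sym. eapply Rle_trans; [apply Heta; auto|]. simpl.
      assert (0 <= M / K) by (apply Rmult_le_pos; auto; left; now apply Rinv_0_lt_compat).
      pose proof (half_pow_pos m). nra.
    - apply rsum_abs_le. intros j Hj. apply Rabs_mult_le; auto. rewrite Rabs_minus_sym. auto. }
  apply Rabs_le_iff in Z. lra.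
Qed.
End DominantSystem.

(** * Smooth interpolation between coloured values *)

Definition ps (x : R) : R := let y := Rmin x 1 in y * y * (3 - 2 * y).
Definition dps (x : R) : R := let y := Rmin x 1 in 6 * y * (1 - y).

Lemma ps_range x : 0 <= x -> 0 <= ps x <= 1.
Proof. intros. unfold ps. assert (0 <= Rmin x 1 <= 1) by (split; [apply Rmin_glb; lra|apply Rmin_r]). set (y := Rmin x 1) in *. cbv zeta.
  split; [apply Rmult_le_pos; nra|]. assert (0 <= (1 - y) ^ 2 * (1 + 2 * y)) by (apply Rmult_le_pos; [apply pow2_ge_0|lra]). lra. Qed.

Lemma dps_range x : 0 <= x -> 0 <= dps x <= 2.
Proof. intros. unfold dps. assert (0 <= Rmin x 1 <= 1) by (split; [apply Rmin_glb; lra|apply Rmin_r]). set (y := Rmin x 1) in *. simpl. split; nra. Qed.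

Lemma Rmin1_lip x y : Rabs (Rmin x 1 - Rmin y 1) <= Rabs (x - y).
Proof. unfold Rmin. destruct (Rle_dec x 1), (Rle_dec y 1); unfold Rabs; repeat destruct Rcase_abs; lra. Qed.

Lemma ps_lip x y : 0 <= x -> 0 <= y -> Rabs (ps x - ps y) <= 3 * Rabs (x - y).
Proof.
  intros. unfold ps. pose proof (Rmin1_lip x y).
  assert (0 <= Rmin x 1 <= 1) by (split; [apply Rmin_glb; lra|apply Rmin_r]).
  assert (0 <= Rmin y 1 <= 1) by (split; [apply Rmin_glb; lra|apply Rmin_r]).
  set (u := Rmin x 1) in *. set (v := Rmin y 1) in *. simpl.
  replace (u * u * (3 - 2 * u) - v * v * (3 - 2 * v)) with ((3*(u+v) - 2*(u*u+u*v+v*v)) * (u - v)) by ring.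
  apply Rabs_mult_le; auto. apply Rabs_le_iff. split; nra.
Qed.

Lemma dps_lip x y : 0 <= x -> 0 <= y -> Rabs (dps x - dps y) <= 6 * Rabs (x - y).
Proof.
  intros. unfold dps. pose proof (Rmin1_lip x y).
  assert (0 <= Rmin x 1 <= 1) by (split; [apply Rmin_glb; lra|apply Rmin_r]).
  assert (0 <= Rmin y 1 <= 1) by (split; [apply Rmin_glb; lra|apply Rmin_r]).
  set (u := Rmin x 1) in *. set (v := Rmin y 1) in *. simpl.
  replace (6 * u * (1 - u) - 6 * v * (1 - v)) with ((6 * (1 - u - v)) * (u - v)) by ring.
  apply Rabs_mult_le; auto. apply Rabs_le_iff. split; lra.
Qed.

(** On [0 <= x] the cubic step has a Lipschitz derivative, also across 1, where it becomes constant.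
    The vertical coordinate scales like the square of the horizontal ones, so it requires a
    quadratic remainder; piecewise linear weights would not do. *)
Lemma ps_taylor x y : 0 <= x -> 0 <= y -> Rabs (ps x - ps y - dps y * (x - y)) <= 3 * (x - y) ^ 2.
Proof.
  intros. assert (T : forall u v, 0 <= u <= 1 -> 0 <= v <= 1 ->
    - (3 * (u - v)^2) <= u * u * (3 - 2 * u) - v * v * (3 - 2 * v) - 6 * v * (1 - v) * (u - v) <= 3 * (u - v)^2).
  { intros u v Hu Hv.
    replace (u * u * (3 - 2 * u) - v * v * (3 - 2 * v) - 6 * v * (1 - v) * (u - v)) with ((3 - 4 * v - 2 * u) * (u - v)^2) by ring.
    pose proof (pow2_ge_0 (u - v)). split; nra. }
  apply Rabs_le_iff. unfold ps, dps, Rmin.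
  destruct (Rle_dec x 1), (Rle_dec y 1).
  - apply T; lra.
  - specialize (T x 1). pose proof (pow2_ge_0 (x - 1)). assert ((x-1)^2 <= (x-y)^2) by nra. lra.
  - assert (x > 1) by lra. specialize (T 1 y). 
    assert (0 <= 6 * y * (1 - y) * (x - 1)) by (apply Rmult_le_pos; [|lra]; nra).
    assert (E : (x - y)^2 = (1 - y)^2 + 2 * (1 - y) * (x - 1) + (x-1)^2) by ring.
    assert (F : 6 * y * (1 - y) * (x - y) = 6 * y * (1 - y) * (1 - y) + 6 * y * (1 - y) * (x - 1)) by ring.
    assert (0 <= (1 - y) * (x - 1)) by (apply Rmult_le_pos; lra).
    assert (6 * y * (1 - y) * (x - 1) <= 6 * ((1 - y) * (x - 1))) by nra.
    pose proof (pow2_ge_0 (x - 1)). lra.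
  - pose proof (pow2_ge_0 (x - y)). lra.
Qed.

(* Interpolation of the values [v] at the colours [0..m] by successive overwriting: the
   weight of colour [c] is [ps (b c)], and a colour with [b c >= 1] hides all lower ones. *)
Fixpoint itp (b v : nat -> R) (m : nat) : R :=
  match m with O => v O | S m' => (1 - ps (b m)) * itp b v m' + ps (b m) * v m end.

(** Partial derivative of [itp] in [b i]. It vanishes for [i = 0]: colour 0 is the background, whose
    weight never enters, so [m + 1] colours have [m] parameters. *)
Fixpoint dit (b v : nat -> R) (m i : nat) : R :=
  match m with
  | O => 0
  | S m' => if Nat.eqb i m then dps (b m) * (v m - itp b v m') else (1 - ps (b m)) * dit b v m' i
  end.

Definition osc (m : nat) (v : nat -> R) (w : R) : Prop :=
  forall c c', (c <= m)%nat -> (c' <= m)%nat -> Rabs (v c - v c') <= w.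

Lemma osc_S m v w : osc (S m) v w -> osc m v w.
Proof. intros H c c' ? ?. apply H; lia. Qed.

Lemma osc_nonneg m v w : osc m v w -> 0 <= w.
Proof. intros H. eapply Rle_trans; [apply Rabs_pos|apply (H O O); lia]. Qed.

Lemma itp_near b v m w c : (forall i, (i <= m)%nat -> 0 <= b i) -> (forall c', (c' <= m)%nat -> Rabs (v c' - v c) <= w) ->
  Rabs (itp b v m - v c) <= w.
Proof.
  induction m; intros Hb H; simpl.
  - apply H; lia.
  - destruct (ps_range (b (S m)) (Hb _ (le_n _))).
    replace ((1 - ps (b (S m))) * itp b v m + ps (b (S m)) * v (S m) - v c)
      with ((1 - ps (b (S m))) * (itp b v m - v c) + ps (b (S m)) * (v (S m) - v c)) by ring.
    assert (Rabs (itp b v m - v c) <= w) as I1 by (apply IHm; intros; [apply Hb|apply H]; lia).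
    assert (Rabs (v (S m) - v c) <= w) as I2 by (apply H; lia).
    apply Rabs_le_iff in I1, I2. apply Rabs_le_iff. split; nra.
Qed.

Section ItpEstimates.
Variables (b b' : nat -> R) (h : R).
Hypothesis Hb : forall i, 0 <= b i.
Hypothesis Hb' : forall i, 0 <= b' i.
Hypothesis Hh : forall i, Rabs (b i - b' i) <= h.

Lemma h_nonneg : 0 <= h.
Proof. eapply Rle_trans; [apply Rabs_pos|apply (Hh O)]. Qed.

Lemma itp_lip m v w : osc m v w -> Rabs (itp b v m - itp b' v m) <= 3 * INR m * h * w.
Proof.
  pose proof h_nonneg as Hh0.
  induction m; intros H.
  - simpl. rewrite Rminus_diag, Rabs_R0. lra.
  - pose proof (osc_nonneg _ _ _ H). specialize (IHm (osc_S _ _ _ H)). rewrite S_INR. simpl itp.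
    set (s := ps (b (S m))). set (s' := ps (b' (S m))).
    replace ((1 - s) * itp b v m + s * v (S m) - ((1 - s') * itp b' v m + s' * v (S m)))
      with ((1 - s) * (itp b v m - itp b' v m) + (s - s') * (v (S m) - itp b' v m)) by ring.
    assert (A1 : Rabs (v (S m) - itp b' v m) <= w).
    { rewrite Rabs_minus_sym. apply itp_near; auto; intros; apply H; lia. }
    assert (A2 : Rabs (s - s') <= 3 * h).
    { eapply Rle_trans; [apply ps_lip; auto|]. specialize (Hh (S m)). lra. }
    assert (A3 : Rabs (1 - s) <= 1) by (pose proof (ps_range (b (S m)) (Hb _)); fold s in H1; apply Rabs_le_iff; lra).
    eapply Rle_trans; [apply Rabs_triang|].
    pose proof (Rabs_mult_le _ _ _ _ A3 IHm). pose proof (Rabs_mult_le _ _ _ _ A2 A1). lra.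
Qed.

Lemma dit_bound m v w i : osc m v w -> Rabs (dit b v m i) <= 2 * w.
Proof.
  induction m; intros H; pose proof (osc_nonneg _ _ _ H).
  - simpl. rewrite Rabs_R0. lra.
  - cbn [dit]. destruct (Nat.eqb i (S m)).
    + assert (A1 : Rabs (v (S m) - itp b v m) <= w).
      { rewrite Rabs_minus_sym. apply itp_near; auto; intros; apply H; lia. }
      apply Rabs_mult_le; auto. pose proof (dps_range (b (S m)) (Hb _)). apply Rabs_le_iff; lra.
    + rewrite <- (Rmult_1_l (2 * w)). apply Rabs_mult_le; [|apply IHm, osc_S; auto].
      pose proof (ps_range (b (S m)) (Hb _)). apply Rabs_le_iff; lra.
Qed.
End ItpEstimates.

Section ItpEstimates2.
Variables (b b' : nat -> R) (h : R).
Hypothesis Hb : forall i, 0 <= b i.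
Hypothesis Hb' : forall i, 0 <= b' i.
Hypothesis Hh : forall i, Rabs (b i - b' i) <= h.

Lemma dit_lip m v w i : osc m v w -> Rabs (dit b v m i - dit b' v m i) <= 6 * (1 + INR m) * h * w.
Proof.
  pose proof (h_nonneg _ _ _ Hh) as Hh0.
  induction m; intros H; pose proof (osc_nonneg _ _ _ H) as Hw.
  - simpl. rewrite Rminus_diag, Rabs_R0. apply Rmult_le_pos; nra.
  - specialize (IHm (osc_S _ _ _ H)). rewrite S_INR. pose proof (pos_INR m).
    assert (0 <= h * w) by nra. assert (0 <= INR m * (h * w)) by nra. cbn [dit].
    destruct (Nat.eqb i (S m)).
    + set (s := dps (b (S m))). set (s' := dps (b' (S m))).
      replace (s * (v (S m) - itp b v m) - s' * (v (S m) - itp b' v m))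
        with ((s - s') * (v (S m) - itp b v m) + (- s') * (itp b v m - itp b' v m)) by ring.
      assert (A1 : Rabs (v (S m) - itp b v m) <= w).
      { rewrite Rabs_minus_sym. apply itp_near; auto; intros; apply H; lia. }
      assert (A2 : Rabs (s - s') <= 6 * h) by (eapply Rle_trans; [apply dps_lip; auto|]; specialize (Hh (S m)); lra).
      pose proof (itp_lip b b' h Hb Hb' Hh m v w (osc_S _ _ _ H)) as A3.
      assert (A4 : Rabs (- s') <= 2) by (pose proof (dps_range (b' (S m)) (Hb' _)) as Q; fold s' in Q; apply Rabs_le_iff; lra).
      eapply Rle_trans; [apply Rabs_triang|].
      pose proof (Rabs_mult_le _ _ _ _ A2 A1). pose proof (Rabs_mult_le _ _ _ _ A4 A3). lra.
    + set (s := ps (b (S m))). set (s' := ps (b' (S m))).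
      replace ((1 - s) * dit b v m i - (1 - s') * dit b' v m i) with
        ((1 - s) * (dit b v m i - dit b' v m i) + (s' - s) * dit b' v m i) by ring.
      assert (A2 : Rabs (s' - s) <= 3 * h).
      { rewrite Rabs_minus_sym. eapply Rle_trans; [apply ps_lip; auto|]; specialize (Hh (S m)); lra. }
      pose proof (dit_bound b' Hb' m v w i (osc_S _ _ _ H)) as A3.
      assert (A4 : Rabs (1 - s) <= 1) by (pose proof (ps_range (b (S m)) (Hb _)) as Q; fold s in Q; apply Rabs_le_iff; lra).
      eapply Rle_trans; [apply Rabs_triang|].
      pose proof (Rabs_mult_le _ _ _ _ A2 A3). pose proof (Rabs_mult_le _ _ _ _ A4 IHm). lra.
Qed.

End ItpEstimates2.

Section ItpTaylor.
Variables (b b' : nat -> R) (h : R).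
Hypothesis Hb : forall i, 0 <= b i.
Hypothesis Hb' : forall i, 0 <= b' i.
Hypothesis Hh : forall i, Rabs (b i - b' i) <= h.

Lemma itp_taylor m v w : osc m v w ->
  Rabs (itp b v m - itp b' v m - rsum m (fun i => dit b' v m (S i) * (b (S i) - b' (S i)))) <= 9 * INR m * INR m * h ^ 2 * w.
Proof.
  pose proof (h_nonneg _ _ _ Hh) as Hh0.
  induction m; intros H; pose proof (osc_nonneg _ _ _ H) as Hw.
  - simpl. rewrite Rminus_diag, Rminus_0_r, Rabs_R0. lra.
  - specialize (IHm (osc_S _ _ _ H)). rewrite S_INR. pose proof (pos_INR m).
    cbn [rsum itp]. set (s := ps (b (S m))) in *. set (s' := ps (b' (S m))) in *.
    assert (E : rsum m (fun i => dit b' v (S m) (S i) * (b (S i) - b' (S i))) = (1 - s') * rsum m (fun i => dit b' v m (S i) * (b (S i) - b' (S i)))).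
    { rewrite <- rsum_scal. apply rsum_ext. intros i Hi. cbn [dit]. rewrite (proj2 (Nat.eqb_neq (S i) (S m))) by lia. fold s'. ring. }
    rewrite E. clear E.
    assert (E : dit b' v (S m) (S m) = dps (b' (S m)) * (v (S m) - itp b' v m)) by (cbn [dit]; now rewrite Nat.eqb_refl).
    rewrite E. clear E.
    set (Rs := rsum m (fun i => dit b' v m (S i) * (b (S i) - b' (S i)))) in *. set (D := b (S m) - b' (S m)).
    replace ((1 - s) * itp b v m + s * v (S m) - ((1 - s') * itp b' v m + s' * v (S m)) - ((1 - s') * Rs + dps (b' (S m)) * (v (S m) - itp b' v m) * D))
      with ((1 - s') * (itp b v m - itp b' v m - Rs) + ((s' - s) * (itp b v m - itp b' v m) + (s - s' - dps (b' (S m)) * D) * (v (S m) - itp b' v m))) by ring.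
    assert (A1 : Rabs (v (S m) - itp b' v m) <= w).
    { rewrite Rabs_minus_sym. apply itp_near; auto; intros; apply H; lia. }
    assert (A2 : Rabs (s' - s) <= 3 * h).
    { rewrite Rabs_minus_sym. eapply Rle_trans; [apply ps_lip; auto|]; specialize (Hh (S m)); lra. }
    assert (A3 : Rabs (s - s' - dps (b' (S m)) * D) <= 3 * h^2).
    { eapply Rle_trans; [apply ps_taylor; auto|]. fold D. rewrite <- pow2_abs. specialize (Hh (S m)). fold D in Hh. pose proof (Rabs_pos D). nra. }
    pose proof (itp_lip b b' h Hb Hb' Hh m v w (osc_S _ _ _ H)) as A4.
    assert (A5 : Rabs (1 - s') <= 1) by (pose proof (ps_range (b' (S m)) (Hb' _)) as Q; fold s' in Q; apply Rabs_le_iff; lra).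
    eapply Rle_trans; [apply Rabs_triang|]. eapply Rle_trans; [apply Rplus_le_compat_l, Rabs_triang|].
    pose proof (Rabs_mult_le _ _ _ _ A5 IHm). pose proof (Rabs_mult_le _ _ _ _ A2 A4). pose proof (Rabs_mult_le _ _ _ _ A3 A1).
    assert (0 <= h^2 * w) by (apply Rmult_le_pos; nra). assert (0 <= INR m * (h^2 * w)) by nra. lra.
Qed.
End ItpTaylor.

Lemma itp_lin b u v k m : itp b (fun c => u c + k * v c) m = itp b u m + k * itp b v m.
Proof. induction m; simpl; [ring|]. rewrite IHm. ring. Qed.

Lemma dit_lin b u v k m i : dit b (fun c => u c + k * v c) m i = dit b u m i + k * dit b v m i.
Proof.
  induction m; [simpl; ring|]. cbn [dit]. destruct (Nat.eqb i (S m)); [rewrite itp_lin|rewrite IHm]; ring.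
Qed.

Lemma itp_rsum b n (y : nat -> nat -> R) (d : nat -> R) m :
  itp b (fun c => rsum n (fun j => y c j * d j)) m = rsum n (fun j => itp b (fun c => y c j) m * d j).
Proof.
  induction n.
  - simpl. induction m; simpl; [reflexivity|rewrite IHm; ring].
  - simpl. rewrite <- IHn.
    transitivity (itp b (fun c => rsum n (fun j => y c j * d j) + d n * y c n) m).
    + clear. induction m; simpl; [ring|]. rewrite IHm. ring.
    + rewrite itp_lin. ring.
Qed.

Lemma itp_ext b u v m : (forall c, (c <= m)%nat -> u c = v c) -> itp b u m = itp b v m.
Proof. induction m; simpl; intros H; [apply H; lia|]. rewrite IHm by (intros; apply H; lia). rewrite (H (S m)) by lia. reflexivity. Qed.

(** Continuity across cell boundaries: a colour whose value jumps has weight 0 on both sides, and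
    the background may jump as long as a saturated colour lies over it. The derivatives agree as
    well, because [dps] vanishes at 0 and from 1 on. *)
Lemma itp_dit_indep b b' v v' m : (1 <= m)%nat \/ v O = v' O ->
  (forall c, (1 <= c <= m)%nat -> (b c = b' c /\ v c = v' c) \/ (b c = 0 /\ b' c = 0)) ->
  (v O = v' O \/ exists c, (1 <= c <= m)%nat /\ 1 <= b c /\ b c = b' c /\ v c = v' c) ->
  itp b v m = itp b' v' m /\ forall i, dit b v m i = dit b' v' m i.
Proof.
  intros _. induction m; intros Hc H0.
  - destruct H0 as [H0|[c [Hc' _]]]; [|lia]. simpl; auto.
  - assert (P1 : forall x, 1 <= x -> ps x = 1) by (intros x Hx; unfold ps; rewrite Rmin_right by lra; simpl; ring).
    assert (P2 : forall x, 1 <= x -> dps x = 0) by (intros x Hx; unfold dps; rewrite Rmin_right by lra; simpl; ring).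
    assert (P3 : ps 0 = 0) by (unfold ps; rewrite Rmin_left by lra; simpl; ring).
    assert (P4 : dps 0 = 0) by (unfold dps; rewrite Rmin_left by lra; simpl; ring).
    destruct (classic (1 <= b (S m) /\ b (S m) = b' (S m) /\ v (S m) = v' (S m))) as [(A1 & A2 & A3)|HN].
    + cbn [itp dit]. rewrite <- A2, <- A3. rewrite P1, P2 by auto. split; [ring|]. intros i.
      destruct (Nat.eqb i (S m)); ring.
    + destruct IHm as [I1 I2].
      * intros c Hc'. apply Hc; lia.
      * destruct H0 as [H0|[c [Hc' (A1 & A2 & A3)]]]; [auto|]. right. exists c. split; [|auto].
        destruct (Nat.eq_dec c (S m)) as [->|]; [exfalso; apply HN; auto|lia].
      * cbn [itp dit]. destruct (Hc (S m)) as [[A2 A3]|[A2 A3]]; [lia| |].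
        -- rewrite <- A2, <- A3, I1. split; auto. intros i. now rewrite I2.
        -- rewrite A2, A3, P3, P4, I1. split; [ring|]. intros i. rewrite I2. destruct (Nat.eqb i (S m)); ring.
Qed.

(** * Horizontal simplices through n+1 given points *)

Definition solve (n : nat) (K : R) (E : nat -> nat -> R) (a : nat -> R) : nat -> R :=
  epsilon (inhabits (fun _ => 0)) (fun eta => forall i, (i < n)%nat -> K * eta i + rsum n (fun j => E i j * eta j) = a i).

Lemma solve_spec n K e E a : 0 < K -> (forall i j, (i < n)%nat -> (j < n)%nat -> Rabs (E i j) <= e) -> INR n * e <= K / 2 ->
  forall i, (i < n)%nat -> K * solve n K E a i + rsum n (fun j => E i j * solve n K E a j) = a i.
Proof. intros HK HE Hd. unfold solve. apply epsilon_spec. apply (dominant_solution n K e); auto. Qed.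

(* A horizontal simplex with vertices [p c]: the x-coordinates are the interpolation of
   those of the [p c] plus the spread [K * Bv (S j)], the vertical coordinate interpolates
   the affine functions [ell n p X c] (the Legendrian lifts with constant slope through
   [p c]), and the y-coordinates are corrected by [Feta] so that dz = <y, dx>. *)
Definition ell (n : nat) (p : nat -> hpt) (X : nat -> R) (c : nat) : R :=
  hz (p c) + rsum n (fun j => hy (p c) j * (X j - hx (p c) j)).

Section ColouredSimplex.
Variables (n : nat) (K : R).

Definition bb (Rr Bv : nat -> R) (c : nat) : R := Bv c / Rr c.
Definition FX (p : nat -> hpt) (Rr Bv : nat -> R) (j : nat) : R :=
  itp (bb Rr Bv) (fun c => hx (p c) j) n + K * Bv (S j).
(** The derivative of the height in [Bv (S i)] is [Frhs i], coming from the weights, plus the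
    interpolated slopes times the derivative of X, whose component [j] is [Fmat i j] plus [K] on the
    diagonal. With slopes corrected by eta, horizontality therefore reads [K * eta i + sum_j Fmat i
    j * eta j = Frhs i]. The spread was added to X for the sake of this diagonal: a large [K] makes
    the system solvable. *)
Definition Fmat (p : nat -> hpt) (Rr Bv : nat -> R) (i j : nat) : R :=
  dit (bb Rr Bv) (fun c => hx (p c) j) n (S i) / Rr (S i).
Definition Frhs (p : nat -> hpt) (Rr Bv : nat -> R) (i : nat) : R :=
  dit (bb Rr Bv) (ell n p (FX p Rr Bv)) n (S i) / Rr (S i).
Definition Feta (p : nat -> hpt) (Rr Bv : nat -> R) : nat -> R := solve n K (Fmat p Rr Bv) (Frhs p Rr Bv).
Definition Fmap (p : nat -> hpt) (Rr Bv : nat -> R) : hpt :=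
  mkH (FX p Rr Bv) (fun j => itp (bb Rr Bv) (fun c => hy (p c) j) n + Feta p Rr Bv j)
      (itp (bb Rr Bv) (ell n p (FX p Rr Bv)) n).
End ColouredSimplex.

Lemma ell_diff n p X c c' :
  ell n p X c - ell n p X c' = zdev n (p c') (p c) + rsum n (fun j => (hy (p c) j - hy (p c') j) * (X j - hx (p c) j)).
Proof.
  unfold ell, zdev.
  assert (E : rsum n (fun j => hy (p c) j * (X j - hx (p c) j)) - rsum n (fun j => hy (p c') j * (X j - hx (p c') j))
    = - rsum n (fun j => hy (p c') j * (hx (p c) j - hx (p c') j)) + rsum n (fun j => (hy (p c) j - hy (p c') j) * (X j - hx (p c) j))).
  { replace (- rsum n (fun j => hy (p c') j * (hx (p c) j - hx (p c') j))) with (-1 * rsum n (fun j => hy (p c') j * (hx (p c) j - hx (p c') j))) by ring.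
    rewrite <- rsum_minus, <- rsum_scal, <- rsum_plus. apply rsum_ext; intros; ring. }
  lra.
Qed.

Section ColouredSimplexEstimates.
Variables (n : nat) (K H b0 rho : R) (p : nat -> hpt) (Rr : nat -> R).
Hypothesis Hn : (1 <= n)%nat.
Hypothesis HH : 0 <= H.
Hypothesis Hb0 : 0 <= b0.
Hypothesis HK : 0 < K.
Hypothesis HKH : 4 * INR n * H <= K.
Hypothesis HR : 0 < rho.
Hypothesis HRr : forall c, rho <= Rr c.
Hypothesis Hp : forall c c', (c <= n)%nat -> (c' <= n)%nat -> hle n (p c) (p c') (H * rho).

Lemma Rr_inv c : 0 < / Rr c <= / rho.
Proof. specialize (HRr c). split; [apply Rinv_0_lt_compat; lra|apply Rinv_le_contravar; lra]. Qed.

Lemma osc_hx j : (j < n)%nat -> osc n (fun c => hx (p c) j) (H * rho).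
Proof. intros Hj c c' Hc Hc'. destruct (Hp c' c Hc' Hc) as [U _]. apply U; auto. Qed.

Lemma osc_hy j : (j < n)%nat -> osc n (fun c => hy (p c) j) (H * rho).
Proof. intros Hj c c' Hc Hc'. destruct (Hp c' c Hc' Hc) as [U _]. apply U; auto. Qed.

Lemma div_Rr_bound x w c : 0 <= w -> Rabs x <= w * rho -> Rabs (x / Rr c) <= w.
Proof.
  intros Hw Hx. destruct (Rr_inv c) as [I1 I2]. unfold Rdiv.
  apply Rle_trans with ((w * rho) * / rho); [|right; field; lra]. apply Rabs_mult_le; auto. rewrite Rabs_pos_eq; lra.
Qed.

Section OnePoint.
Variable Bv : nat -> R.
Hypothesis HB : forall c, 0 <= Bv c <= b0 * rho.

Lemma bb_nonneg c : 0 <= bb Rr Bv c.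
Proof. unfold bb. destruct (Rr_inv c). apply Rmult_le_pos; [apply HB|lra]. Qed.

Lemma FX_near j c : (j < n)%nat -> (c <= n)%nat -> Rabs (FX n K p Rr Bv j - hx (p c) j) <= (H + K * b0) * rho.
Proof.
  intros Hj Hc. unfold FX.
  assert (A : Rabs (itp (bb Rr Bv) (fun c => hx (p c) j) n - hx (p c) j) <= H * rho).
  { apply (itp_near _ (fun c => hx (p c) j)); [intros; apply bb_nonneg|intros; apply osc_hx; auto]. }
  assert (B : 0 <= K * Bv (S j) <= K * (b0 * rho)).
  { destruct (HB (S j)). split; [apply Rmult_le_pos; lra|apply Rmult_le_compat_l; lra]. }
  apply Rabs_le_iff in A. apply Rabs_le_iff. lra.
Qed.

(** Oscillation of the lifts in units of [rho * rho]. All constants here are free of [rho]: lengths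
    are measured in units of [rho] and heights in units of [rho * rho], in accordance with the
    dilations. *)
Definition om2 : R := INR n * (2 * H ^ 2 + H * (H + K * b0)).

Lemma om2_nonneg : 0 <= om2.
Proof. unfold om2. apply Rmult_le_pos; [apply pos_INR|]. assert (0 <= K * b0) by nra. nra. Qed.

Lemma osc_ell : osc n (ell n p (FX n K p Rr Bv)) (om2 * rho * rho).
Proof.
  intros c c' Hc Hc'. rewrite ell_diff.
  pose proof (zdev_of_hle _ _ _ _ (Hp c' c Hc' Hc)) as A.
  assert (B : Rabs (rsum n (fun j => (hy (p c) j - hy (p c') j) * (FX n K p Rr Bv j - hx (p c) j))) <= INR n * ((H * rho) * ((H + K * b0) * rho))).
  { apply rsum_abs_le. intros j Hj. apply Rabs_mult_le; [apply osc_hy; auto|apply FX_near; auto]. }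
  eapply Rle_trans; [apply Rabs_triang|]. unfold om2. 
  replace (INR n * (2 * H ^ 2 + H * (H + K * b0)) * rho * rho) with (INR n * (2 * (H * rho) ^ 2) + INR n * (H * rho * ((H + K * b0) * rho))) by ring. lra.
Qed.

Lemma Fmat_bound i j : (i < n)%nat -> (j < n)%nat -> Rabs (Fmat n p Rr Bv i j) <= 2 * H.
Proof.
  intros Hi Hj. unfold Fmat. apply div_Rr_bound; [lra|].
  eapply Rle_trans; [apply dit_bound; [apply bb_nonneg|apply osc_hx; auto]|]. lra.
Qed.

Lemma Frhs_bound i : Rabs (Frhs n K p Rr Bv i) <= 2 * om2 * rho.
Proof.
  unfold Frhs. pose proof om2_nonneg. apply div_Rr_bound; [apply Rmult_le_pos; lra|].
  eapply Rle_trans; [apply dit_bound; [apply bb_nonneg|apply osc_ell]|]. right; ring.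
Qed.

Lemma dominance : INR n * (2 * H) <= K / 2.
Proof. lra. Qed.

Lemma Feta_eq i : (i < n)%nat ->
  K * Feta n K p Rr Bv i + rsum n (fun j => Fmat n p Rr Bv i j * Feta n K p Rr Bv j) = Frhs n K p Rr Bv i.
Proof. apply (solve_spec n K (2 * H)); [auto|intros; apply Fmat_bound; auto|apply dominance]. Qed.

Lemma Feta_bound i : (i < n)%nat -> Rabs (Feta n K p Rr Bv i) <= 4 * om2 / K * rho.
Proof.
  intros Hi. pose proof om2_nonneg.
  eapply Rle_trans; [apply (dominant_bound n K (2 * H) (Fmat n p Rr Bv) HK (fun i j => Fmat_bound i j) dominance _ (Frhs n K p Rr Bv) (2 * om2 * rho))|].
  - apply Rmult_le_pos; lra.
  - apply Feta_eq.
  - intros; apply Frhs_bound.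
  - auto.
  - right. field. lra.
Qed.

Lemma Fmap_near c : (c <= n)%nat -> hle n (p c) (Fmap n K p Rr Bv) ((H + K * b0 + 4 * om2 / K + 2 * om2 + 2) * rho).
Proof.
  intros Hc. pose proof om2_nonneg as Ho.
  assert (0 <= K * b0) by nra. assert (0 <= 4 * om2 / K) by (apply Rmult_le_pos; [lra|left; now apply Rinv_0_lt_compat]).
  apply hle_of_zdev.
  - intros j Hj. simpl. split.
    + eapply Rle_trans; [apply FX_near; auto|]. apply Rmult_le_compat_r; lra.
    + assert (A : Rabs (itp (bb Rr Bv) (fun c => hy (p c) j) n - hy (p c) j) <= H * rho).
      { apply (itp_near _ (fun c => hy (p c) j)); [intros; apply bb_nonneg|intros; apply osc_hy; auto]. }
      pose proof (Feta_bound j Hj) as B.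
      replace (itp (bb Rr Bv) (fun c => hy (p c) j) n + Feta n K p Rr Bv j - hy (p c) j)
        with ((itp (bb Rr Bv) (fun c => hy (p c) j) n - hy (p c) j) + Feta n K p Rr Bv j) by ring.
      eapply Rle_trans; [apply Rabs_triang|]. nra.
  - unfold zdev. simpl. set (v := ell n p (FX n K p Rr Bv)).
    replace (itp (bb Rr Bv) v n - hz (p c) - rsum n (fun j => hy (p c) j * (FX n K p Rr Bv j - hx (p c) j)))
      with (itp (bb Rr Bv) v n - v c) by (unfold v, ell; ring).
    eapply Rle_trans; [apply (itp_near _ v n (om2 * rho * rho)); [intros; apply bb_nonneg|intros; apply osc_ell; auto]|].
    assert (Hn1 : 1 <= INR n) by (change 1 with (INR 1); apply le_INR; auto).
    set (C := H + K * b0 + 4 * om2 / K + 2 * om2 + 2).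
    assert (2 * om2 + 2 <= C) by (unfold C; lra).
    apply Rle_trans with (1 * ((C * rho)^2 / 2)); [|apply Rmult_le_compat_r; nra].
    assert (2 * om2 <= C * C) by nra. assert (0 <= rho * rho) by nra. nra.
Qed.
End OnePoint.

Section TwoPoints.
Variables (Bv Bv' : nat -> R) (a : R).
Hypothesis HB : forall c, 0 <= Bv c <= b0 * rho.
Hypothesis HB' : forall c, 0 <= Bv' c <= b0 * rho.
Hypothesis Ha : forall c, Rabs (Bv c - Bv' c) <= a.

Let b := bb Rr Bv.
Let b' := bb Rr Bv'.
Let h := a / rho.
Let X := FX n K p Rr Bv.
Let X' := FX n K p Rr Bv'.

Local Lemma Ha0 : 0 <= a.
Proof. eapply Rle_trans; [apply Rabs_pos|apply (Ha O)]. Qed.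
Local Lemma Hh : forall i, Rabs (b i - b' i) <= h.
Proof.
  intros i. unfold b, b', bb, h, Rdiv. rewrite <- Rmult_minus_distr_r. destruct (Rr_inv i).
  apply Rabs_mult_le; [apply Ha|rewrite Rabs_pos_eq; lra].
Qed.
Local Lemma hR : h * rho = a.
Proof. unfold h. field. lra. Qed.
Local Lemma h0 : 0 <= h.
Proof. unfold h. pose proof Ha0. apply Rmult_le_pos; [auto|left; now apply Rinv_0_lt_compat]. Qed.

Definition c1 : R := 3 * INR n * H + K.
Lemma c1_nonneg : 0 <= c1.
Proof. unfold c1. pose proof (pos_INR n). assert (0 <= INR n * H) by nra. lra. Qed.

Local Lemma dX j : (j < n)%nat -> Rabs (X j - X' j) <= c1 * a.
Proof.
  intros Hj. unfold X, X', FX.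
  pose proof (itp_lip b b' h (bb_nonneg _ HB) (bb_nonneg _ HB') Hh n _ _ (osc_hx j Hj)) as A.
  pose proof (Ha (S j)) as B. fold b b'.
  replace (itp b (fun c => hx (p c) j) n + K * Bv (S j) - (itp b' (fun c => hx (p c) j) n + K * Bv' (S j)))
    with ((itp b (fun c => hx (p c) j) n - itp b' (fun c => hx (p c) j) n) + K * (Bv (S j) - Bv' (S j))) by ring.
  eapply Rle_trans; [apply Rabs_triang|]. rewrite Rabs_mult, (Rabs_pos_eq K) by lra. unfold c1.
  replace (3 * INR n * h * (H * rho)) with (3 * INR n * H * (h * rho)) in A by ring. rewrite hR in A.
  assert (K * Rabs (Bv (S j) - Bv' (S j)) <= K * a) by (apply Rmult_le_compat_l; lra). lra.
Qed.

Local Lemma ell_dX c : ell n p X c - ell n p X' c = rsum n (fun j => hy (p c) j * (X j - X' j)).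
Proof.
  unfold ell.
  assert (E : rsum n (fun j => hy (p c) j * (X j - hx (p c) j)) - rsum n (fun j => hy (p c) j * (X' j - hx (p c) j)) = rsum n (fun j => hy (p c) j * (X j - X' j))).
  { rewrite <- rsum_minus. apply rsum_ext; intros; ring. }
  lra.
Qed.

Local Lemma osc_ell_dX : osc n (fun c => ell n p X c + -1 * ell n p X' c) (INR n * H * c1 * a * rho).
Proof.
  intros c c' Hc Hc'.
  replace (ell n p X c + -1 * ell n p X' c - (ell n p X c' + -1 * ell n p X' c'))
    with ((ell n p X c - ell n p X' c) - (ell n p X c' - ell n p X' c')) by ring.
  rewrite !ell_dX, <- rsum_minus.
  replace (INR n * H * c1 * a * rho) with (INR n * ((H * rho) * (c1 * a))) by ring.
  apply rsum_abs_le. intros j Hj.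
  replace (hy (p c) j * (X j - X' j) - hy (p c') j * (X j - X' j)) with ((hy (p c) j - hy (p c') j) * (X j - X' j)) by ring.
  apply Rabs_mult_le; [apply osc_hy; auto|apply dX; auto].
Qed.

Definition c2 : R := 6 * (1 + INR n) * om2 + 2 * INR n * H * c1.
Definition c3 : R := INR n * (6 * (1 + INR n) * H * (4 * om2 / K)).
Definition c4 : R := 3 * INR n * H + 2 * (c2 + c3) / K.
Definition c5 : R := 9 * INR n * INR n * om2 + 3 * INR n * INR n * H * c1 + INR n * (4 * om2 / K * (9 * INR n * INR n * H)).

Local Lemma om2K : 0 <= 4 * om2 / K.
Proof. pose proof om2_nonneg. apply Rmult_le_pos; [lra|left; now apply Rinv_0_lt_compat]. Qed.
Lemma c2_nonneg : 0 <= c2.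
Proof. unfold c2. pose proof (pos_INR n). pose proof om2_nonneg. pose proof c1_nonneg.
  assert (0 <= (1 + INR n) * om2) by (apply Rmult_le_pos; lra). assert (0 <= INR n * H * c1) by (repeat apply Rmult_le_pos; auto). lra. Qed.
Lemma c3_nonneg : 0 <= c3.
Proof. unfold c3. pose proof (pos_INR n). pose proof om2K. set (q := 4 * om2 / K) in *; clearbody q. repeat apply Rmult_le_pos; lra. Qed.
Lemma c5_nonneg : 0 <= c5.
Proof. unfold c5. pose proof (pos_INR n). pose proof om2K. pose proof om2_nonneg. pose proof c1_nonneg.
  set (q := 4 * om2 / K) in *; clearbody q. set (u := om2) in *. set (w := c1) in *. clearbody u w. repeat apply Rplus_le_le_0_compat; repeat apply Rmult_le_pos; lra. Qed.

Local Lemma dFrhs i : Rabs (Frhs n K p Rr Bv i - Frhs n K p Rr Bv' i) <= c2 * a.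
Proof.
  unfold Frhs. fold b b' X X'.
  replace (dit b (ell n p X) n (S i) / Rr (S i) - dit b' (ell n p X') n (S i) / Rr (S i))
    with (((dit b (ell n p X) n (S i) - dit b' (ell n p X) n (S i)) + (dit b' (ell n p X) n (S i) + -1 * dit b' (ell n p X') n (S i))) / Rr (S i))
    by (unfold Rdiv; ring).
  pose proof c2_nonneg. pose proof Ha0.
  apply div_Rr_bound; [nra|]. rewrite <- dit_lin.
  eapply Rle_trans; [apply Rabs_triang|].
  pose proof (dit_lip b b' h (bb_nonneg _ HB) (bb_nonneg _ HB') Hh n _ _ (S i) (osc_ell _ HB)) as A.
  pose proof (dit_bound b' (bb_nonneg _ HB') n _ _ (S i) osc_ell_dX) as B.
  fold X in A. replace (6 * (1 + INR n) * h * (om2 * rho * rho)) with (6 * (1 + INR n) * om2 * (h * rho) * rho) in A by ring. rewrite hR in A.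
  unfold c2. lra.
Qed.

Local Lemma dFmat i j : (j < n)%nat -> Rabs (Fmat n p Rr Bv i j - Fmat n p Rr Bv' i j) <= 6 * (1 + INR n) * H * h.
Proof.
  intros Hj. unfold Fmat. fold b b'. unfold Rdiv. rewrite <- Rmult_minus_distr_r.
  pose proof (pos_INR n). pose proof h0. assert (0 <= 6 * (1 + INR n) * H) by (repeat apply Rmult_le_pos; lra).
  apply div_Rr_bound; [apply Rmult_le_pos; auto|].
  eapply Rle_trans; [apply (dit_lip b b' h (bb_nonneg _ HB) (bb_nonneg _ HB') Hh n _ _ (S i) (osc_hx j Hj))|]. right; ring.
Qed.

Local Lemma dFeta i : (i < n)%nat -> Rabs (Feta n K p Rr Bv i - Feta n K p Rr Bv' i) <= 2 * (c2 + c3) / K * a.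
Proof.
  intros Hi. pose proof c2_nonneg. pose proof c3_nonneg. pose proof Ha0.
  set (e := Feta n K p Rr Bv). set (e' := Feta n K p Rr Bv').
  pose proof (dominant_bound n K (2 * H) (Fmat n p Rr Bv) HK (fun i j => Fmat_bound _ HB i j) dominance
    (fun i => e i - e' i) (fun i => (Frhs n K p Rr Bv i - Frhs n K p Rr Bv' i) - rsum n (fun j => (Fmat n p Rr Bv i j - Fmat n p Rr Bv' i j) * e' j)) ((c2 + c3) * a)) as Q.
  replace (2 * (c2 + c3) / K * a) with (2 * ((c2 + c3) * a) / K) by (field; lra).
  apply Q; auto.
  - nra.
  - intros k Hk. rewrite <- (Feta_eq _ HB k Hk), <- (Feta_eq _ HB' k Hk). fold e e'.
    replace (rsum n (fun j => Fmat n p Rr Bv k j * (e j - e' j))) with (rsum n (fun j => Fmat n p Rr Bv k j * e j) - rsum n (fun j => Fmat n p Rr Bv k j * e' j))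
      by (rewrite <- rsum_minus; apply rsum_ext; intros; ring).
    replace (rsum n (fun j => (Fmat n p Rr Bv k j - Fmat n p Rr Bv' k j) * e' j)) with (rsum n (fun j => Fmat n p Rr Bv k j * e' j) - rsum n (fun j => Fmat n p Rr Bv' k j * e' j))
      by (rewrite <- rsum_minus; apply rsum_ext; intros; ring).
    ring.
  - intros k Hk. unfold Rminus at 1. eapply Rle_trans; [apply Rabs_triang|]. rewrite Rabs_Ropp.
    rewrite Rmult_plus_distr_r. apply Rplus_le_compat; [apply dFrhs|].
    replace (c3 * a) with (INR n * ((6 * (1 + INR n) * H * h) * (4 * om2 / K * rho))) by (unfold c3; rewrite <- hR; ring).
    apply rsum_abs_le. intros j Hj. apply Rabs_mult_le; [apply dFmat; auto|apply Feta_bound; auto].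
Qed.

(** All first-order terms cancel by the horizontality equations. Three terms of second order remain:
    the Taylor remainder [T1] of the interpolated height, the mixed term [T2] where both lifts and
    weights change, and the Taylor remainders [err] of x paired with the slope correction. *)
Lemma dFmap_zdev : Rabs (zdev n (Fmap n K p Rr Bv') (Fmap n K p Rr Bv)) <= c5 * a ^ 2.
Proof.
  unfold zdev. simpl. fold b b' X X'. set (e' := Feta n K p Rr Bv').
  set (v := ell n p X). set (v' := ell n p X').
  set (err := fun j => itp b (fun c => hx (p c) j) n - itp b' (fun c => hx (p c) j) n - rsum n (fun i => dit b' (fun c => hx (p c) j) n (S i) * (b (S i) - b' (S i)))).
  set (T1 := itp b v' n - itp b' v' n - rsum n (fun i => dit b' v' n (S i) * (b (S i) - b' (S i)))).
  set (T2 := itp b (fun c => v c + -1 * v' c) n - itp b' (fun c => v c + -1 * v' c) n).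
  assert (E : itp b v n - itp b' v' n - rsum n (fun j => (itp b' (fun c => hy (p c) j) n + e' j) * (X j - X' j))
     = T1 + T2 - rsum n (fun j => e' j * err j)).
  { assert (E1 : itp b' (fun c => v c + -1 * v' c) n = rsum n (fun j => itp b' (fun c => hy (p c) j) n * (X j - X' j))).
    { rewrite <- (itp_rsum b' n (fun c j => hy (p c) j) (fun j => X j - X' j)). apply itp_ext. intros c _. rewrite <- ell_dX. unfold v, v'. ring. }
    assert (E2 : rsum n (fun j => (itp b' (fun c => hy (p c) j) n + e' j) * (X j - X' j)) = rsum n (fun j => itp b' (fun c => hy (p c) j) n * (X j - X' j)) + rsum n (fun j => e' j * (X j - X' j))).
    { rewrite <- rsum_plus. apply rsum_ext; intros; ring. }
    assert (Db : forall i g, g / Rr (S i) * (Bv (S i) - Bv' (S i)) = g * (b (S i) - b' (S i))) by (intros; unfold b, b', bb, Rdiv; ring).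
    (* The system is used transposed: exchanging the sums turns the equations, one for each
       parameter, into a pairing of [e'] with the linear part of [X - X']. *)
    assert (E3 : rsum n (fun j => e' j * (X j - X' j)) = rsum n (fun j => e' j * err j) + rsum n (fun i => dit b' v' n (S i) * (b (S i) - b' (S i)))).
    { rewrite (rsum_ext n (fun i => dit b' v' n (S i) * (b (S i) - b' (S i))) (fun i => Frhs n K p Rr Bv' i * (Bv (S i) - Bv' (S i)))) by (intros; unfold Frhs; fold b' X' v'; rewrite Db; ring).
      rewrite (rsum_ext n (fun i => Frhs n K p Rr Bv' i * (Bv (S i) - Bv' (S i))) (fun i => K * e' i * (Bv (S i) - Bv' (S i)) + rsum n (fun j => Fmat n p Rr Bv' i j * (Bv (S i) - Bv' (S i)) * e' j))).
      2:{ intros i Hi. rewrite <- (Feta_eq _ HB' i Hi). fold e'. rewrite Rmult_plus_distr_r. f_equal. rewrite Rmult_comm, <- rsum_scal. apply rsum_ext; intros; ring. }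
      rewrite rsum_plus, rsum_exchange, <- !rsum_plus. apply rsum_ext. intros j Hj.
      assert (E4 : rsum n (fun i => Fmat n p Rr Bv' i j * (Bv (S i) - Bv' (S i)) * e' j) = e' j * rsum n (fun i => dit b' (fun c => hx (p c) j) n (S i) * (b (S i) - b' (S i)))).
      { rewrite <- rsum_scal. apply rsum_ext. intros i Hi. unfold Fmat. fold b'. rewrite Db. ring. }
      rewrite E4. unfold err, X, X', FX. fold b b'. ring. }
    rewrite E2, E3, <- E1. unfold T1, T2. rewrite !itp_lin. ring. }
  rewrite E. clear E.
  assert (A1 : Rabs T1 <= 9 * INR n * INR n * om2 * a^2).
  { eapply Rle_trans; [apply (itp_taylor b b' h (bb_nonneg _ HB) (bb_nonneg _ HB') Hh n _ _ (osc_ell _ HB'))|]. rewrite <- hR. right; ring. }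
  assert (A2 : Rabs T2 <= 3 * INR n * INR n * H * c1 * a^2).
  { eapply Rle_trans; [apply (itp_lip b b' h (bb_nonneg _ HB) (bb_nonneg _ HB') Hh n _ _ osc_ell_dX)|]. rewrite <- hR. right; ring. }
  assert (A3 : Rabs (rsum n (fun j => e' j * err j)) <= INR n * ((4 * om2 / K * rho) * (9 * INR n * INR n * h^2 * (H * rho)))).
  { apply rsum_abs_le. intros j Hj. apply Rabs_mult_le; [apply Feta_bound; auto|].
    apply (itp_taylor b b' h (bb_nonneg _ HB) (bb_nonneg _ HB') Hh n _ _ (osc_hx j Hj)). }
  replace (INR n * ((4 * om2 / K * rho) * (9 * INR n * INR n * h^2 * (H * rho)))) with (INR n * (4 * om2 / K * (9 * INR n * INR n * H)) * a^2) in A3 by (rewrite <- hR; ring).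
  unfold c5. apply Rabs_le_iff in A1, A2, A3. apply Rabs_le_iff. lra.
Qed.

Lemma Fmap_lip : hle n (Fmap n K p Rr Bv') (Fmap n K p Rr Bv) ((c1 + c4 + 2 * c5 + 2) * a).
Proof.
  pose proof c1_nonneg. pose proof c2_nonneg. pose proof c3_nonneg. pose proof c5_nonneg. pose proof Ha0. pose proof (pos_INR n).
  assert (0 <= 2 * (c2 + c3) / K) by (apply Rmult_le_pos; [lra|left; now apply Rinv_0_lt_compat]).
  assert (0 <= c4) by (unfold c4; assert (0 <= INR n * H) by nra; lra).
  apply hle_of_zdev.
  - intros j Hj. split.
    + change (Rabs (X j - X' j) <= (c1 + c4 + 2 * c5 + 2) * a). eapply Rle_trans; [apply dX; auto|]. apply Rmult_le_compat_r; lra.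
    + simpl. fold b b'.
      pose proof (itp_lip b b' h (bb_nonneg _ HB) (bb_nonneg _ HB') Hh n _ _ (osc_hy j Hj)) as A.
      replace (3 * INR n * h * (H * rho)) with (3 * INR n * H * (h * rho)) in A by ring. rewrite hR in A.
      pose proof (dFeta j Hj) as B.
      replace (itp b (fun c => hy (p c) j) n + Feta n K p Rr Bv j - (itp b' (fun c => hy (p c) j) n + Feta n K p Rr Bv' j))
        with ((itp b (fun c => hy (p c) j) n - itp b' (fun c => hy (p c) j) n) + (Feta n K p Rr Bv j - Feta n K p Rr Bv' j)) by ring.
      eapply Rle_trans; [apply Rabs_triang|]. apply Rle_trans with (c4 * a); [unfold c4; lra|]. apply Rmult_le_compat_r; lra.
  - eapply Rle_trans; [apply dFmap_zdev|].
    assert (Hn1 : 1 <= INR n) by (change 1 with (INR 1); apply le_INR; auto).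
    set (C := c1 + c4 + 2 * c5 + 2).
    assert (2 * c5 + 2 <= C) by (unfold C; lra).
    apply Rle_trans with (1 * ((C * a)^2 / 2)); [|apply Rmult_le_compat_r; nra].
    assert (2 * c5 <= C * C) by nra. assert (0 <= a * a) by nra. nra.
Qed.
End TwoPoints.
End ColouredSimplexEstimates.

(** Data that differ only in colours of weight 0 or in a hidden background give the same simplex
    point; the slope corrections agree because they solve the same dominant system. This glues the
    simplices of neighbouring cells. *)
Lemma Fmap_indep n K H rho p p' Rr Rr' Bv :
  (1 <= n)%nat -> 0 <= H -> 0 < K -> 4 * INR n * H <= K -> 0 < rho ->
  (forall c, rho <= Rr c) -> (forall c, rho <= Rr' c) -> (forall c, 0 <= Bv c) ->
  (forall c c', (c <= n)%nat -> (c' <= n)%nat -> hle n (p c) (p c') (H * rho)) ->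
  (forall c, (1 <= c <= n)%nat -> (p c = p' c /\ Rr c = Rr' c) \/ Bv c = 0) ->
  (p O = p' O \/ exists c, (1 <= c <= n)%nat /\ Rr c <= Bv c /\ p c = p' c /\ Rr c = Rr' c) ->
  hle n (Fmap n K p Rr Bv) (Fmap n K p' Rr' Bv) 0.
Proof.
  intros Hn HH HK HKH HR HRr HRr' HB Hp Hc H0.
  set (b := bb Rr Bv). set (b' := bb Rr' Bv).
  assert (Ind : forall v v', (forall c, (c <= n)%nat -> p c = p' c -> v c = v' c) ->
     itp b v n = itp b' v' n /\ forall i, dit b v n i = dit b' v' n i).
  { intros v v' Hv. apply itp_dit_indep; [auto| |].
    - intros c Hcn. destruct (Hc c Hcn) as [[E1 E2]|E]; [left|right].
      + split; [unfold b, b', bb; now rewrite E2|apply Hv; auto; lia].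
      + unfold b, b', bb, Rdiv. rewrite E. split; ring.
    - destruct H0 as [E|[c (E1 & E2 & E3 & E4)]]; [left; apply Hv; auto; lia|right].
      exists c. split; auto. split; [|split].
      + unfold b, bb. specialize (HRr c). apply (Rmult_le_reg_r (Rr c)); [lra|]. unfold Rdiv. rewrite Rmult_assoc, Rinv_l by lra. lra.
      + unfold b, b', bb. now rewrite E4.
      + apply Hv; auto; lia. }
  assert (EX : forall j, FX n K p Rr Bv j = FX n K p' Rr' Bv j).
  { intros j. unfold FX. f_equal. apply Ind. intros c _ ->. reflexivity. }
  assert (Eell : forall c, (c <= n)%nat -> p c = p' c -> ell n p (FX n K p Rr Bv) c = ell n p' (FX n K p' Rr' Bv) c).
  { intros c _ E. unfold ell. rewrite E. f_equal. apply rsum_ext; intros j Hj. rewrite EX. reflexivity. }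
  assert (Dz : forall i v v', (i < n)%nat -> (forall c, (c <= n)%nat -> p c = p' c -> v c = v' c) -> dit b v n (S i) / Rr (S i) = dit b' v' n (S i) / Rr' (S i)).
  { intros i v v' Hi Hv. destruct (Ind v v' Hv) as [_ I]. rewrite I.
    destruct (Hc (S i)) as [[E1 E2]|E]; [lia|now rewrite E2|].
    assert (Z : dit b' v' n (S i) = 0).
    { clear - E. assert (Eb : b' (S i) = 0) by (unfold b', bb, Rdiv; rewrite E; ring).
      induction n; [reflexivity|]. cbn [dit]. destruct (Nat.eqb (S i) (S n)) eqn:Q.
      - apply Nat.eqb_eq in Q. rewrite <- Q. rewrite Eb. unfold dps. rewrite Rmin_left by lra. ring.
      - rewrite IHn. ring. }
    rewrite Z. unfold Rdiv; ring. }
  assert (Emat : forall i j, (i < n)%nat -> Fmat n p Rr Bv i j = Fmat n p' Rr' Bv i j).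
  { intros i j Hi. unfold Fmat. apply Dz; auto. intros c _ ->. reflexivity. }
  assert (Erhs : forall i, (i < n)%nat -> Frhs n K p Rr Bv i = Frhs n K p' Rr' Bv i).
  { intros i Hi. unfold Frhs. apply Dz; auto. }
  assert (HEb : forall i j, (i < n)%nat -> (j < n)%nat -> Rabs (Fmat n p Rr Bv i j) <= 2 * H).
  { intros i j Hi Hj. unfold Fmat. apply (div_Rr_bound rho Rr HR HRr); [lra|].
    eapply Rle_trans; [apply (dit_bound _) with (w := H * rho)|lra].
    - intros c. unfold bb. specialize (HRr c). apply Rmult_le_pos; [apply HB|left; apply Rinv_0_lt_compat; lra].
    - intros c c' E1 E2. destruct (Hp c' c E2 E1) as [U _]. apply U; auto. }
  assert (Eeta : forall i, (i < n)%nat -> Feta n K p Rr Bv i = Feta n K p' Rr' Bv i).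
  { intros i Hi. unfold Feta. set (e := solve n K (Fmat n p Rr Bv) (Frhs n K p Rr Bv)). set (e' := solve n K (Fmat n p' Rr' Bv) (Frhs n K p' Rr' Bv)).
    assert (Hdom : INR n * (2 * H) <= K / 2) by lra.
    assert (Q1 : forall i, (i < n)%nat -> K * e i + rsum n (fun j => Fmat n p Rr Bv i j * e j) = Frhs n K p Rr Bv i) by (apply (solve_spec n K (2 * H)); auto).
    assert (Q2 : forall i, (i < n)%nat -> K * e' i + rsum n (fun j => Fmat n p' Rr' Bv i j * e' j) = Frhs n K p' Rr' Bv i).
    { apply (solve_spec n K (2 * H)); auto. intros k j Hk Hj. rewrite <- Emat by auto. auto. }
    assert (Z : Rabs (e i - e' i) <= 2 * 0 / K).
    { apply (dominant_bound n K (2 * H) (Fmat n p Rr Bv) HK HEb Hdom (fun i => e i - e' i) (fun _ => 0)); [lra| |intros; rewrite Rabs_R0; lra|auto].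
      intros k Hk. specialize (Q1 k Hk). specialize (Q2 k Hk). rewrite <- Erhs in Q2 by auto. 
      replace (rsum n (fun j => Fmat n p Rr Bv k j * (e j - e' j))) with (rsum n (fun j => Fmat n p Rr Bv k j * e j) - rsum n (fun j => Fmat n p' Rr' Bv k j * e' j)); [lra|].
      rewrite <- rsum_minus. apply rsum_ext; intros j Hj. rewrite <- Emat by auto. ring. }
    replace (2 * 0 / K) with 0 in Z by (field; lra). apply Rabs_le_iff in Z. lra. }
  apply hle0_eq.
  - intros j Hj. simpl. split; [apply EX|]. rewrite Eeta by auto. f_equal. apply Ind. intros c _ ->. reflexivity.
  - simpl. apply Ind. exact Eell.
Qed.

(** * Extension to the walls of a grid *)

Lemma IZR_lt_1 a b : IZR a < IZR b + 1 -> (a <= b)%Z.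
Proof. intros H. rewrite <- plus_IZR in H. apply lt_IZR in H. lia. Qed.

Lemma IZR_close_eq a b : Rabs (IZR a - IZR b) < 1 -> a = b.
Proof. intros H. apply Rabs_def2 in H. assert (a <= b)%Z by (apply IZR_lt_1; lra). assert (b <= a)%Z by (apply IZR_lt_1; lra). lia. Qed.

Lemma Int_part_bounds x : IZR (Int_part x) <= x < IZR (Int_part x) + 1.
Proof. destruct (base_Int_part x). lra. Qed.

Lemma Int_part_unique x z : IZR z <= x < IZR z + 1 -> Int_part x = z.
Proof. intros H. pose proof (Int_part_bounds x). apply IZR_close_eq. apply Rabs_def1; lra. Qed.

Lemma Int_part_neq_between x y : x < y -> Int_part x <> Int_part y -> exists z, x < IZR z <= y.
Proof.
  intros H N. pose proof (Int_part_bounds x). exists (Int_part x + 1)%Z. rewrite plus_IZR. split; [lra|].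
  apply Rnot_lt_le. intros C. apply N. symmetry. apply Int_part_unique. lra.
Qed.

Definition dz (x : R) : R := Rmin (x - IZR (Int_part x)) (IZR (Int_part x) + 1 - x).

Lemma dz_le x z : dz x <= Rabs (x - IZR z).
Proof.
  unfold dz. pose proof (Int_part_bounds x). destruct (Z_le_gt_dec z (Int_part x)) as [L|L].
  - apply IZR_le in L. eapply Rle_trans; [apply Rmin_l|]. rewrite Rabs_pos_eq; lra.
  - assert (IZR (Int_part x) + 1 <= IZR z) by (rewrite <- plus_IZR; apply IZR_le; lia).
    eapply Rle_trans; [apply Rmin_r|]. rewrite Rabs_left1; lra.
Qed.

Lemma dz_attained x : exists z, dz x = Rabs (x - IZR z).
Proof.
  unfold dz. pose proof (Int_part_bounds x). destruct (Rle_dec (x - IZR (Int_part x)) (IZR (Int_part x) + 1 - x)).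
  - exists (Int_part x). rewrite Rmin_left by auto. rewrite Rabs_pos_eq; lra.
  - exists (Int_part x + 1)%Z. rewrite Rmin_right by lra. rewrite plus_IZR, Rabs_left1; lra.
Qed.

Lemma dz_range x : 0 <= dz x <= / 2.
Proof.
  split.
  - destruct (dz_attained x) as [z ->]. apply Rabs_pos.
  - unfold dz, Rmin. destruct (Rle_dec _ _); lra.
Qed.

Lemma dz_lip x y : Rabs (dz x - dz y) <= Rabs (x - y).
Proof.
  assert (P : forall x y, dz x - dz y <= Rabs (x - y)).
  { clear. intros x y. destruct (dz_attained y) as [z E]. pose proof (dz_le x z).
    replace (x - IZR z) with ((x - y) + (y - IZR z)) in H by ring. pose proof (Rabs_triang (x - y) (y - IZR z)). lra. }
  pose proof (P x y). pose proof (P y x). rewrite Rabs_minus_sym in H0. apply Rabs_le_iff. lra.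
Qed.

Lemma dz_IZR z : dz (IZR z) = 0.
Proof. pose proof (dz_range (IZR z)). pose proof (dz_le (IZR z) z). rewrite Rminus_diag, Rabs_R0 in H0. lra. Qed.

Lemma dz_zero_IZR x : dz x = 0 -> x = IZR (Int_part x).
Proof.
  intros H. destruct (dz_attained x) as [z E]. rewrite H in E.
  assert (Ez : x = IZR z). { destruct (Req_dec (x - IZR z) 0); [lra|]. exfalso. apply (Rabs_no_R0 _ H0); auto. }
  rewrite Ez. f_equal. symmetry. apply Int_part_unique. lra.
Qed.

Lemma round_dist t : Rabs (t - IZR (Int_part (t + / 2))) = dz t.
Proof.
  pose proof (Int_part_bounds (t + /2)) as B. set (q := Int_part (t + / 2)) in *.
  pose proof (dz_le t q). destruct (dz_attained t) as [z E]. pose proof (dz_range t).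
  assert (Rabs (t - IZR q) <= / 2) by (apply Rabs_le_iff; lra).
  destruct (Z.eq_dec z q) as [->|N]; [auto|].
  assert (1 <= Rabs (IZR z - IZR q)).
  { apply Rnot_lt_le. intros C. apply N. now apply IZR_close_eq. }
  replace (IZR z - IZR q) with ((t - IZR q) - (t - IZR z)) in H2 by ring.
  pose proof (Rabs_triang (t - IZR q) (- (t - IZR z))) as T. rewrite Rabs_Ropp in T.
  replace (t - IZR q + - (t - IZR z)) with (t - IZR q - (t - IZR z)) in T by ring. lra.
Qed.

Fixpoint rmin (n : nat) (f : nat -> R) (b : R) : R := match n with O => b | S m => Rmin (rmin m f b) (f m) end.

Lemma rmin_base n f b : rmin n f b <= b.
Proof. induction n; simpl; [lra|]. eapply Rle_trans; [apply Rmin_l|auto]. Qed.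
Lemma rmin_term n f b i : (i < n)%nat -> rmin n f b <= f i.
Proof.
  induction n; intros H; [lia|]. simpl. destruct (Nat.eq_dec i n) as [->|]; [apply Rmin_r|].
  eapply Rle_trans; [apply Rmin_l|]. apply IHn; lia.
Qed.
Lemma rmin_glb n f b x : x <= b -> (forall i, (i < n)%nat -> x <= f i) -> x <= rmin n f b.
Proof. induction n; intros; simpl; auto. apply Rmin_glb; [apply IHn; auto|]; auto. Qed.
Lemma rmin_lt n f b x : rmin n f b < x -> b < x \/ exists i, (i < n)%nat /\ f i < x.
Proof.
  induction n; simpl; auto. intros H. unfold Rmin in H. destruct (Rle_dec _ _).
  - destruct (IHn H) as [|[i [Hi Hf]]]; auto. right; exists i; auto.
  - right; exists n; auto.
Qed.
Lemma rmin_lip n f g b c a : Rabs (b - c) <= a -> (forall i, (i < n)%nat -> Rabs (f i - g i) <= a) -> Rabs (rmin n f b - rmin n g c) <= a.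
Proof.
  intros Hb Hf.
  assert (P : forall f g b c, Rabs (b - c) <= a -> (forall i, (i < n)%nat -> Rabs (f i - g i) <= a) -> rmin n f b - a <= rmin n g c).
  { clear. intros f g b c Hb Hf. apply rmin_glb.
    - pose proof (rmin_base n f b). apply Rabs_le_iff in Hb. lra.
    - intros i Hi. pose proof (rmin_term n f b i Hi). specialize (Hf i Hi). apply Rabs_le_iff in Hf. lra. }
  pose proof (P f g b c Hb Hf). pose proof (P g f c b). 
  assert (rmin n g c - a <= rmin n f b) by (apply H0; [rewrite Rabs_minus_sym; auto|intros; rewrite Rabs_minus_sym; auto]).
  apply Rabs_le_iff. lra.
Qed.

Lemma half_pow_le j j' : (j <= j')%nat -> (/ 2) ^ j' <= (/ 2) ^ j.
Proof. intros H. replace j' with (j + (j' - j))%nat by lia. rewrite pow_add. pose proof (half_pow_pos j).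
  assert ((/2)^(j' - j) <= 1) by (induction (j' - j)%nat; simpl; lra). pose proof (half_pow_pos (j' - j)). nra. Qed.

(** * Whitney cells of n+1 colours near the integer heights *)

Section Whitney.
Variable n : nat.
Hypothesis Hn : (1 <= n)%nat.

(* The offsets lie in (1/4, 3/8], so that doubling them lands in (1/2, 3/4]: the
   grids [2^-j (Z + nu c)] of neighbouring scales and different colours stay apart
   from each other and from the integers. *)
Definition nu (c : nat) : R := / 4 + INR (S (Nat.min c n)) / (8 * INR (n + 2)).
Definition del : R := / (64 * INR (n + 2)).

Lemma n2_ge : 3 <= INR (n + 2).
Proof. replace 3 with (INR 3) by (simpl; lra). apply le_INR. lia. Qed.

Lemma del_pos : 0 < del <= / 192.
Proof. pose proof n2_ge. unfold del. split; [apply Rinv_0_lt_compat; lra|apply Rinv_le_contravar; lra]. Qed.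

Lemma nu_range c : / 4 < nu c <= 3 / 8.
Proof.
  unfold nu. pose proof n2_ge. assert (INR (S (Nat.min c n)) <= INR (n + 2)) by (apply le_INR; lia).
  assert (0 < INR (S (Nat.min c n))) by (apply lt_0_INR; lia).
  split.
  - assert (0 < INR (S (Nat.min c n)) / (8 * INR (n + 2))) by (apply Rdiv_lt_0_compat; lra). lra.
  - assert (INR (S (Nat.min c n)) / (8 * INR (n + 2)) <= / 8); [|lra].
    apply (Rmult_le_reg_r (8 * INR (n + 2))); [lra|]. unfold Rdiv. rewrite Rmult_assoc, Rinv_l by lra. lra.
Qed.

Lemma nu_sep c c' : (c <= n)%nat -> (c' <= n)%nat -> Rabs (nu c - nu c') < 8 * del -> c = c'.
Proof.
  intros H1 H2 H. unfold nu, del in H. rewrite !Nat.min_l in H by auto. pose proof n2_ge.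
  replace (/ 4 + INR (S c) / (8 * INR (n + 2)) - (/ 4 + INR (S c') / (8 * INR (n + 2))))
    with ((INR (S c) - INR (S c')) * / (8 * INR (n + 2))) in H by (field; lra).
  rewrite Rabs_mult, (Rabs_pos_eq (/ _)) in H by (left; apply Rinv_0_lt_compat; lra).
  replace (8 * / (64 * INR (n + 2))) with (1 * / (8 * INR (n + 2))) in H by (field; lra).
  apply Rmult_lt_reg_r in H; [|apply Rinv_0_lt_compat; lra].
  rewrite !INR_IZR_INZ in H. apply IZR_close_eq in H. lia.
Qed.

(** Level of the Whitney layer of colour [c] at distance [T] from the integer heights. The layers
    from [nu c * 2^-j] to [2 * nu c * 2^-j] tile the interval from 0 to [2 * nu c], which contains
    all possible distances because [nu c > / 4]; different colours break at different places. *)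
Definition lev (c : nat) (T : R) : nat :=
  epsilon (inhabits O) (fun j => nu c * (/ 2) ^ j < T <= 2 * nu c * (/ 2) ^ j).

Lemma lev_spec c T : 0 < T <= / 2 -> nu c * (/ 2) ^ lev c T < T <= 2 * nu c * (/ 2) ^ lev c T.
Proof.
  intros HT. unfold lev. apply epsilon_spec. pose proof (nu_range c) as Hnu.
  assert (P : forall N, nu c * (/2) ^ N < T -> exists j, nu c * (/ 2) ^ j < T <= 2 * nu c * (/ 2) ^ j).
  { induction N; intros H.
    - exists O. simpl in *. lra.
    - destruct (Rle_dec T (nu c * (/2)^N)) as [L|L]; [|apply IHN; lra].
      exists (S N). split; auto. simpl. lra. }
  destruct (half_pow_small T) as [N HN]; [lra|]. apply (P N). specialize (HN N (le_n N)).
  pose proof (half_pow_pos N). nra.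
Qed.

Definition rad (c : nat) (T : R) : R := (/ 2) ^ lev c T.

Lemma rad_bounds c T : 0 < T <= / 2 -> T < rad c T < 4 * T.
Proof. intros HT. pose proof (lev_spec c T HT). pose proof (nu_range c). pose proof (half_pow_pos (lev c T)). unfold rad. nra. Qed.


Lemma lev_lt c T T' : 0 < T <= / 2 -> 0 < T' <= / 2 -> (lev c T < lev c T')%nat -> T' <= nu c * rad c T /\ 2 * nu c * rad c T' <= nu c * rad c T.
Proof.
  intros H H' L. pose proof (lev_spec c T' H') as S'. pose proof (nu_range c). fold (rad c T') in S'.
  assert (2 * rad c T' <= rad c T).
  { unfold rad. replace (2 * (/ 2) ^ lev c T') with ((/2) ^ (lev c T' - 1)).
    - apply half_pow_le. lia.
    - replace (lev c T') with (S (lev c T' - 1)) at 2 by lia. simpl. lra. }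
  split; [|]; nra.
Qed.

Definition tdist (w : pt) : R := dz (w O).
Definition du (c : nat) (w : pt) (i : nat) : R := rad c (tdist w) * dz (w (S i) / rad c (tdist w) - nu c).
(** Distance to the boundary of the Whitney cell of colour [c]: to its faces in the n grid
    directions and to the two ends of its layer. *)
Definition Bw (w : pt) (c : nat) : R :=
  rmin n (du c w) (Rmin (tdist w - nu c * rad c (tdist w)) (2 * nu c * rad c (tdist w) - tdist w)).
Definition Rw (w : pt) (c : nat) : R := del * rad c (tdist w).
Definition cellz (c : nat) (w : pt) (i : nat) : Z := Int_part (w (S i) / rad c (tdist w) - nu c).
(** Cells of level 0 reach across the half-integer heights, where the nearest integer jumps, so they
    take the integer below. Cells of higher levels stay near one integer and take that one. In both
    cases the slice is constant on the cell. *)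
Definition slice (c : nat) (w : pt) : Z := if Nat.eqb (lev c (tdist w)) 0 then Int_part (w O) else Int_part (w O + / 2).
Definition rep (c : nat) (w : pt) : pt := fun i => if Nat.ltb i n then rad c (tdist w) * (IZR (cellz c w i) + nu c) else 0.

Lemma rad_pos c T : 0 < rad c T.
Proof. apply half_pow_pos. Qed.

Lemma tdist_range w : 0 <= tdist w <= / 2.
Proof. apply dz_range. Qed.

Lemma Bw_range w c : 0 < tdist w -> 0 <= Bw w c <= 4 * tdist w.
Proof.
  intros H. pose proof (tdist_range w). pose proof (lev_spec c (tdist w) ltac:(lra)) as L. fold (rad c (tdist w)) in L.
  pose proof (rad_bounds c (tdist w) ltac:(lra)). pose proof (nu_range c). pose proof (rad_pos c (tdist w)). unfold Bw. split.
  - apply rmin_glb; [apply Rmin_glb; lra|]. intros i Hi. unfold du. pose proof (dz_range (w (S i) / rad c (tdist w) - nu c)). nra.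
  - eapply Rle_trans; [apply rmin_base|]. eapply Rle_trans; [apply Rmin_r|]. nra.
Qed.

Lemma Rw_ge w c : 0 < tdist w -> del * tdist w <= Rw w c.
Proof.
  intros H. pose proof (tdist_range w). pose proof del_pos. pose proof (rad_bounds c (tdist w) ltac:(lra)). unfold Rw. nra.
Qed.

Definition same_cell (c : nat) (w w' : pt) : Prop :=
  lev c (tdist w) = lev c (tdist w') /\ (forall i, (i < n)%nat -> cellz c w i = cellz c w' i) /\ slice c w = slice c w'.

(** Leaving a cell costs at least the distance to its boundary. Hence the parameter of a colour
    whose cells differ at two points can be set to 0 at a cost of [a]. *)
Lemma Bw_leave c w w' a : 0 < tdist w -> 0 < tdist w' -> cl (S n) w w' a -> 0 <= a -> ~ same_cell c w w' -> Bw w c <= a.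
Proof.
  intros HT HT' Hc Ha HN. pose proof (tdist_range w). pose proof (tdist_range w').
  pose proof (lev_spec c (tdist w) ltac:(lra)) as L. pose proof (lev_spec c (tdist w') ltac:(lra)) as L'.
  fold (rad c (tdist w)) in L. fold (rad c (tdist w')) in L'.
  pose proof (nu_range c) as Hnu. pose proof (rad_pos c (tdist w)) as Hr.
  assert (Ht : Rabs (w O - w' O) <= a) by (apply Hc; lia).
  assert (HTd : Rabs (tdist w - tdist w') <= a) by (eapply Rle_trans; [apply dz_lip|auto]). apply Rabs_le_iff in HTd.
  destruct (Nat.lt_trichotomy (lev c (tdist w)) (lev c (tdist w'))) as [C|[C|C]].
  - destruct (lev_lt c (tdist w) (tdist w') ltac:(lra) ltac:(lra) C).
    eapply Rle_trans; [apply rmin_base|]. eapply Rle_trans; [apply Rmin_l|]. lra.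
  - assert (Er : rad c (tdist w) = rad c (tdist w')) by (unfold rad; now rewrite C).
    destruct (classic (forall i, (i < n)%nat -> cellz c w i = cellz c w' i)) as [Hz|Hz].
    + assert (Hs : slice c w <> slice c w') by (intros E; apply HN; split; auto).
      assert (Hint : forall x y z, Rabs (x - y) <= a -> (x < IZR z <= y \/ y < IZR z <= x) -> dz x <= a).
      { clear. intros x y z Hxy Hz. eapply Rle_trans; [apply (dz_le x z)|]. apply Rabs_le_iff in Hxy. apply Rabs_le_iff. lra. }
      assert (Hbt : forall f, (f = 0 \/ f = / 2) -> Int_part (w O + f) <> Int_part (w' O + f) -> exists z, (w O + f < IZR z <= w' O + f \/ w' O + f < IZR z <= w O + f)).
      { intros f _ Hne. destruct (Rtotal_order (w O + f) (w' O + f)) as [Q|[Q|Q]].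
        - destruct (Int_part_neq_between _ _ Q Hne) as [z Hz']; exists z; auto.
        - rewrite Q in Hne. congruence.
        - destruct (Int_part_neq_between _ _ Q (not_eq_sym Hne)) as [z Hz']; exists z; auto. }
      (* At level 0 an integer lies between the two heights, so [tdist] is at most [a] and so is the
         distance to the lower end of the layer. At a higher level a half-integer does, so [tdist]
         is at least [/ 2 - a], while the layer ends at 3/8 or below. *)
      unfold slice in Hs. rewrite <- C in Hs. destruct (Nat.eqb (lev c (tdist w)) 0) eqn:Q.
      * destruct (Hbt 0 ltac:(auto)) as [z Hzz]; [now rewrite !Rplus_0_r|]. rewrite !Rplus_0_r in Hzz.
        assert (dz (w O) <= a) by (apply (Hint (w O) (w' O) z); auto).
        eapply Rle_trans; [apply rmin_base|]. eapply Rle_trans; [apply Rmin_l|]. fold (tdist w) in *. nra.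
      * destruct (Hbt (/ 2) ltac:(auto)) as [z Hzz]; [auto|].
        apply Nat.eqb_neq in Q. assert (Hr2 : rad c (tdist w) <= / 2).
        { unfold rad. replace (/2) with ((/2)^1) at 2 by lra. apply half_pow_le. lia. }
        assert (Hd : dz (w O + / 2) <= a) by (apply (Hint _ (w' O + / 2) z); auto; replace (w O + / 2 - (w' O + / 2)) with (w O - w' O) by ring; auto).
        destruct (dz_attained (w O + / 2)) as [z' Ez']. rewrite Ez' in Hd.
        assert (/2 - tdist w <= a).
        { pose proof (round_dist (w O)) as RD. fold (tdist w) in RD. pose proof (dz_le (w O) z') as D1. pose proof (dz_le (w O) (z' - 1)) as D2. 
          rewrite minus_IZR in D2. fold (tdist w) in D1, D2.
          destruct (Rle_dec (w O + / 2) (IZR z')) as [Q1|Q1].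
          - rewrite Rabs_left1 in Hd by lra.
            pose proof (Rabs_triang (w O - IZR (Int_part (w O + / 2))) 0) as _.
            apply Rnot_lt_le; intros HC. 
            assert (RR := Int_part_bounds (w O + / 2)). 
            assert (tdist w < / 2 - a) by lra. rewrite <- RD in H1. apply Rabs_def2 in H1.
            assert (Int_part (w O + / 2) = (z' - 1)%Z \/ Int_part (w O + /2) = z') as [E|E].
            { assert (z' - 1 <= Int_part (w O + / 2))%Z by (apply IZR_lt_1; rewrite minus_IZR; lra).
              assert (Int_part (w O + / 2) <= z')%Z by (apply IZR_lt_1; lra). lia. }
            + rewrite E, minus_IZR in *. lra.
            + rewrite E in *. lra.
          - rewrite Rabs_pos_eq in Hd by lra. apply Rnot_lt_le; intros HC.
            assert (RR := Int_part_bounds (w O + / 2)). 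
            assert (tdist w < / 2 - a) by lra. rewrite <- RD in H1. apply Rabs_def2 in H1.
            assert (z' <= Int_part (w O + / 2))%Z by (apply IZR_lt_1; lra). 
            apply IZR_le in H2. lra. }
        eapply Rle_trans; [apply rmin_base|]. eapply Rle_trans; [apply Rmin_r|]. nra.
    + apply not_all_ex_not in Hz. destruct Hz as [i Hz]. apply imply_to_and in Hz. destruct Hz as [Hi Hz].
      eapply Rle_trans; [apply (rmin_term n _ _ i Hi)|]. unfold du.
      unfold cellz in Hz. rewrite <- Er in Hz. set (r := rad c (tdist w)) in *.
      assert (Hi' : Rabs (w (S i) - w' (S i)) <= a) by (apply Hc; lia).
      set (x := w (S i) / r - nu c) in *. set (y := w' (S i) / r - nu c) in *.
      assert (Exy : r * (x - y) = w (S i) - w' (S i)) by (unfold x, y; field; lra).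
      assert (D : exists z, Rabs (x - IZR z) <= Rabs (x - y)).
      { destruct (Rtotal_order x y) as [Q|[Q|Q]].
        - destruct (Int_part_neq_between _ _ Q Hz) as [z Hz']; exists z. rewrite !Rabs_left1; lra.
        - rewrite Q in Hz. congruence.
        - destruct (Int_part_neq_between _ _ Q (not_eq_sym Hz)) as [z Hz']; exists z. rewrite !Rabs_pos_eq; lra. }
      destruct D as [z D]. pose proof (dz_le x z).
      apply Rle_trans with (r * Rabs (x - y)); [apply Rmult_le_compat_l; lra|].
      rewrite <- (Rabs_pos_eq r) at 1 by lra. rewrite <- Rabs_mult, Exy. auto.
  - destruct (lev_lt c (tdist w') (tdist w) ltac:(lra) ltac:(lra) C).
    eapply Rle_trans; [apply rmin_base|]. eapply Rle_trans; [apply Rmin_r|]. lra.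
Qed.

Lemma same_cell_sym c w w' : same_cell c w w' -> same_cell c w' w.
Proof. intros (A & B & C). split; [|split]; auto. intros; symmetry; auto. Qed.

Lemma Bw_same c w w' a : cl (S n) w w' a -> 0 <= a -> same_cell c w w' -> Rabs (Bw w c - Bw w' c) <= a.
Proof.
  intros Hc Ha (E & _ & _). unfold Bw.
  assert (Er : rad c (tdist w) = rad c (tdist w')) by (unfold rad; now rewrite E).
  assert (HTd : Rabs (tdist w - tdist w') <= a) by (eapply Rle_trans; [apply dz_lip|apply Hc; lia]).
  apply rmin_lip.
  - rewrite Er. apply Rabs_le_iff in HTd. apply Rabs_le_iff. unfold Rmin. repeat destruct (Rle_dec _ _); lra.
  - intros i Hi. unfold du. rewrite <- Er. set (r := rad c (tdist w)). assert (0 < r) by apply rad_pos.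
    rewrite <- Rmult_minus_distr_l, Rabs_mult, (Rabs_pos_eq r) by lra.
    eapply Rle_trans; [apply Rmult_le_compat_l; [lra|apply dz_lip]|].
    rewrite <- (Rabs_pos_eq r) at 1 by lra. rewrite <- Rabs_mult.
    replace (r * (w (S i) / r - nu c - (w' (S i) / r - nu c))) with (w (S i) - w' (S i)) by (field; lra).
    apply Hc. lia.
Qed.

(** Pigeonhole. A colour that is not saturated is close to a face of its cell, either an end of its
    layer or a face in one of the n grid directions, and the separated offsets allow at most one
    colour for each of these n+1 kinds. On a wall where coordinate [i0] is an integer that direction
    is excluded, since integers are far from all the grids. So n kinds remain for n+1 colours. *)
Lemma saturated_colour w i0 : 0 < tdist w -> (i0 < n)%nat -> dz (w (S i0)) = 0 ->
  exists c, (c <= n)%nat /\ 2 * Rw w c <= Bw w c.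
Proof.
  intros HT Hi0 Hz0. pose proof (tdist_range w) as HT'. pose proof del_pos as Hdel.
  apply NNPP. intros HN.
  assert (K : forall c, exists k, (c <= n)%nat -> (k = O /\ Rmin (tdist w - nu c * rad c (tdist w)) (2 * nu c * rad c (tdist w) - tdist w) < 2 * Rw w c) \/
     (exists i, k = S i /\ (i < n)%nat /\ du c w i < 2 * Rw w c)).
  { intros c. destruct (Nat.le_gt_cases c n) as [Hc|Hc]; [|exists O; lia].
    assert (Bw w c < 2 * Rw w c) by (apply Rnot_le_lt; intros C; apply HN; exists c; auto).
    destruct (rmin_lt _ _ _ _ H) as [A|[i [Hi A]]]; [exists O; auto|exists (S i)]. intros _. right. exists i; auto. }
  set (k := fun c => proj1_sig (constructive_indefinite_description _ (K c))).
  assert (Hk : forall c, (c <= n)%nat -> (k c = O /\ Rmin (tdist w - nu c * rad c (tdist w)) (2 * nu c * rad c (tdist w) - tdist w) < 2 * Rw w c) \/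
     (exists i, k c = S i /\ (i < n)%nat /\ du c w i < 2 * Rw w c)).
  { intros c. unfold k. destruct (constructive_indefinite_description _ (K c)); auto. }
  assert (Hdu : forall c i, du c w i < 2 * Rw w c -> exists z, Rabs (w (S i) / rad c (tdist w) - nu c - IZR z) < 2 * del).
  { intros c i H. unfold du, Rw in H. pose proof (rad_pos c (tdist w)).
    destruct (dz_attained (w (S i) / rad c (tdist w) - nu c)) as [z E]. exists z. rewrite <- E.
    apply (Rmult_lt_reg_l (rad c (tdist w))); auto. lra. }
  assert (Inj : forall c c', (c <= n)%nat -> (c' <= n)%nat -> k c = k c' -> (lev c (tdist w) <= lev c' (tdist w))%nat -> c = c').
  { intros c c' Hc Hc' E Hlev.
    pose proof (nu_range c) as N. pose proof (nu_range c') as N'.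
    destruct (Hk c Hc) as [[E1 A]|[i [E1 [Hi A]]]]; destruct (Hk c' Hc') as [[E2 A']|[i' [E2 [Hi' A']]]]; try congruence.
    (* Lower and upper ends of layers are treated alike, because the lower end at level j is the
       upper end at level j+1. *)
    - assert (P : forall c, Rmin (tdist w - nu c * rad c (tdist w)) (2 * nu c * rad c (tdist w) - tdist w) < 2 * Rw w c ->
         exists m, Rabs (tdist w - 2 * nu c * (/2)^m) < 4 * del * (/2)^m).
      { clear - Hn HT HT' Hdel. intros c H. pose proof (lev_spec c (tdist w) ltac:(lra)) as L. unfold Rw, rad in *. pose proof (half_pow_pos (lev c (tdist w))).
        unfold Rmin in H. destruct (Rle_dec _ _) in H.
        - exists (S (lev c (tdist w))). simpl. apply Rabs_def1; nra.
        - exists (lev c (tdist w)). apply Rabs_def1; nra. }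
      destruct (P c A) as [m Hm]. destruct (P c' A') as [m' Hm']. clear P.
      apply Rabs_def2 in Hm, Hm'. pose proof (half_pow_pos m). pose proof (half_pow_pos m').
      destruct (Nat.lt_trichotomy m m') as [C|[C|C]].
      + exfalso. assert (2 * (/2)^m' <= (/2)^m).
        { replace (2 * (/2)^m') with ((/2)^(m' - 1)); [apply half_pow_le; lia|]. replace m' with (S (m' - 1)) at 2 by lia. simpl; lra. }
        assert (2 * nu c' * (/2)^m' + 4 * del * (/2)^m' <= (nu c' + 2 * del) * (/2)^m) by nra. nra.
      + subst m'. apply nu_sep; auto. apply Rabs_def1; nra.
      + exfalso. assert (2 * (/2)^m <= (/2)^m').
        { replace (2 * (/2)^m) with ((/2)^(m - 1)); [apply half_pow_le; lia|]. replace m with (S (m - 1)) at 2 by lia. simpl; lra. }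
        assert (2 * nu c * (/2)^m + 4 * del * (/2)^m <= (nu c + 2 * del) * (/2)^m') by nra. nra.
    - assert (i' = i) by congruence. subst i'. destruct (Hdu c i A) as [z Hz]. destruct (Hdu c' i A') as [z' Hz'].
      pose proof (lev_spec c (tdist w) ltac:(lra)) as L. pose proof (lev_spec c' (tdist w) ltac:(lra)) as L'.
      pose proof (half_pow_pos (lev c (tdist w))) as Pr. pose proof (half_pow_pos (lev c' (tdist w))) as Pr'.
      unfold rad in *. apply Rabs_def2 in Hz, Hz'.
      destruct (Nat.eq_dec (lev c (tdist w)) (lev c' (tdist w))) as [Q|Q].
      + rewrite <- Q in *. assert (z = z') by (apply IZR_close_eq; apply Rabs_def1; lra). subst z'.
        apply nu_sep; auto. apply Rabs_def1; lra.
      (* The scales of two colours at one point differ by a factor of at most 2. For the factor 2,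
         the relative offset [2 * nu c - nu c'] lies between 1/8 and 1/2, away from the integers. *)
      + assert (Q' : lev c' (tdist w) = S (lev c (tdist w))).
        { destruct (Nat.eq_dec (lev c' (tdist w)) (S (lev c (tdist w)))); auto. exfalso.
          assert (4 * (/2) ^ lev c' (tdist w) <= (/2) ^ lev c (tdist w)).
          { replace (4 * (/2) ^ lev c' (tdist w)) with ((/2)^(lev c' (tdist w) - 2)); [apply half_pow_le; lia|].
            replace (lev c' (tdist w)) with (S (S (lev c' (tdist w) - 2))) at 2 by lia. simpl; lra. }
          nra. }
        exfalso. rewrite Q' in *. simpl in Hz', L'. set (r := (/2) ^ lev c (tdist w)) in *.
        replace (w (S i) / (/ 2 * r)) with (2 * (w (S i) / r)) in Hz' by (field; lra).
        assert (U : - / 16 < IZR (2 * z - z') + 2 * nu c - nu c' < / 16).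
        { rewrite minus_IZR, mult_IZR. lra. }
        assert ((2 * z - z')%Z < 0)%Z by (apply lt_IZR; lra).
        assert (- 1 < (2 * z - z'))%Z by (apply lt_IZR; lra). lia. }
  assert (Inj' : forall c c', (c <= n)%nat -> (c' <= n)%nat -> k c = k c' -> c = c').
  { intros c c' H H' E. destruct (Nat.le_ge_cases (lev c (tdist w)) (lev c' (tdist w))); [apply Inj; auto|symmetry; apply Inj; auto]. }
  assert (Hnot : forall c, (c <= n)%nat -> k c <> S i0).
  { intros c Hc E. destruct (Hk c Hc) as [[E1 _]|[i [E1 [Hi A]]]]; [congruence|]. assert (i = i0) by congruence. subst i.
    destruct (Hdu c i0 A) as [z Hz]. pose proof (nu_range c). apply dz_zero_IZR in Hz0.
    set (m := Int_part (w (S i0))) in Hz0. clearbody m. unfold rad in Hz. rewrite Hz0 in Hz.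
    replace (IZR m / (/2) ^ lev c (tdist w)) with (IZR (m * 2 ^ Z.of_nat (lev c (tdist w)))) in Hz.
    2:{ rewrite mult_IZR, <- pow_IZR, pow_inv. unfold Rdiv. now rewrite Rinv_inv. }
    set (N := (m * 2 ^ Z.of_nat (lev c (tdist w)))%Z) in *. apply Rabs_def2 in Hz.
    assert (z < N)%Z by (apply lt_IZR; lra). assert (N < z + 1)%Z by (apply lt_IZR; rewrite plus_IZR; lra). lia. }
  assert (L : (length (S i0 :: map k (seq 0 (S n))) <= length (seq 0 (S n)))%nat).
  { apply NoDup_incl_length.
    - constructor.
      + intros H. apply in_map_iff in H. destruct H as [c [E H]]. apply in_seq in H. apply (Hnot c); auto; lia.
      + apply NoDup_map_NoDup_ForallPairs; [|apply seq_NoDup].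
        intros c c' H H' E. apply in_seq in H, H'. apply Inj'; auto; lia.
    - intros x [<-|H]; [apply in_seq; lia|]. apply in_map_iff in H. destruct H as [c [<- H]]. apply in_seq in H. apply in_seq.
      destruct (Hk c ltac:(lia)) as [[-> _]|[i [-> [Hi _]]]]; lia. }
  simpl in L. rewrite length_map, length_seq in L. lia.
Qed.
End Whitney.

(** * Extension of Lipschitz slices to the walls *)

Section WhitneyExtension.
Variable n : nat.
Hypothesis Hn : (1 <= n)%nat.
Variable f : pt -> Z -> hpt.
Hypothesis Hf1 : forall u u' q a, 0 <= a -> cl n u u' a -> hle n (f u q) (f u' q) a.
Hypothesis Hf2 : forall u q, hle n (f u q) (f u (q + 1)%Z) 1.

(** The vertices at [w] are within [16 * tdist w] of each other and the radii are at least
    [del n * tdist w]. Taking 32 instead of 16 leaves a factor 2 for comparisons with a neighbour of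
    smaller [tdist]; [wK] exceeds the dominance threshold [4 * INR n * wH]. *)
Definition wH : R := 32 / del n.
Definition wK : R := 4 * INR n * wH + 1.
Definition wp (w : pt) (c : nat) : hpt := f (rep n c w) (slice n c w).
Definition Aext (w : pt) : hpt :=
  if Req_EM_T (tdist w) 0 then f (ptail w) (Int_part (w O)) else Fmap n wK (wp w) (Rw n w) (Bw n w).

Lemma slices_lip u q q' : hle n (f u q) (f u q') (Rabs (IZR q - IZR q')).
Proof.
  assert (P : forall k, hle n (f u q) (f u (q + Z.of_nat k)%Z) (INR k)).
  { induction k.
    - rewrite Z.add_0_r. apply hle_refl. simpl; lra.
    - rewrite S_INR. replace (q + Z.of_nat (S k))%Z with (q + Z.of_nat k + 1)%Z by lia.
      apply (hle_trans n _ (f u (q + Z.of_nat k)%Z)); auto using pos_INR; lra. }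
  assert (P' : forall q q', (q <= q')%Z -> (forall k, hle n (f u q) (f u (q + Z.of_nat k)%Z) (INR k)) -> hle n (f u q) (f u q') (Rabs (IZR q - IZR q'))).
  { clear. intros q q' L H. specialize (H (Z.to_nat (q' - q))). rewrite Z2Nat.id in H by lia.
    replace (q + (q' - q))%Z with q' in H by lia. rewrite INR_IZR_INZ, Z2Nat.id, minus_IZR in H by lia.
    rewrite Rabs_minus_sym, Rabs_pos_eq; auto. apply IZR_le in L. lra. }
  destruct (Z.le_ge_cases q q'); [apply P'; auto|].
  apply hle_sym. rewrite Rabs_minus_sym. apply P'; [auto|].
  clear - Hf2. induction k.
  - rewrite Z.add_0_r. apply hle_refl. simpl; lra.
  - rewrite S_INR. replace (q' + Z.of_nat (S k))%Z with (q' + Z.of_nat k + 1)%Z by lia.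
    apply (hle_trans n _ (f u (q' + Z.of_nat k)%Z)); auto using pos_INR; lra.
Qed.

Lemma slices_lip2 u u' q q' a b : 0 <= a -> cl n u u' a -> Rabs (IZR q - IZR q') <= b -> hle n (f u q) (f u' q') (a + b).
Proof.
  intros Ha Hc Hb. apply (hle_trans n _ (f u' q)); auto.
  - eapply Rle_trans; [apply Rabs_pos|exact Hb].
  - apply (hle_mono n _ _ (Rabs (IZR q - IZR q'))); auto using Rabs_pos, slices_lip.
Qed.

Lemma rep_near c w : 0 < tdist w -> cl n (rep n c w) (ptail w) (4 * tdist w).
Proof.
  intros HT i Hi. pose proof (tdist_range w). pose proof (rad_bounds n Hn c (tdist w) ltac:(lra)) as B.
  unfold rep, ptail. rewrite (proj2 (Nat.ltb_lt i n) Hi). unfold cellz.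
  pose proof (Int_part_bounds (w (S i) / rad n c (tdist w) - nu n c)) as I.
  set (r := rad n c (tdist w)) in *. set (z := Int_part _) in *.
  assert (E : w (S i) = r * (w (S i) / r)) by (field; lra).
  rewrite E at 1. set (x := w (S i) / r) in *. rewrite <- Rmult_minus_distr_l, Rabs_mult, Rabs_pos_eq by lra.
  assert (Rabs (IZR z + nu n c - x) <= 1) by (apply Rabs_le_iff; lra). nra.
Qed.

Lemma slice_near c w : 0 < tdist w -> Rabs (w O - IZR (slice n c w)) <= 4 * tdist w.
Proof.
  intros HT. pose proof (tdist_range w). unfold slice. destruct (Nat.eqb (lev n c (tdist w)) 0) eqn:Q.
  - apply Nat.eqb_eq in Q. pose proof (rad_bounds n Hn c (tdist w) ltac:(lra)) as B. unfold rad in B. rewrite Q in B. simpl in B.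
    pose proof (Int_part_bounds (w O)). apply Rabs_le_iff. lra.
  - rewrite round_dist. fold (tdist w). lra.
Qed.

Lemma wp_close w c c' : 0 < tdist w -> hle n (wp w c) (wp w c') (16 * tdist w).
Proof.
  intros HT. unfold wp. replace (16 * tdist w) with (8 * tdist w + 8 * tdist w) by ring.
  apply slices_lip2; [lra| |].
  - replace (8 * tdist w) with (4 * tdist w + 4 * tdist w) by ring.
    apply (cl_trans n _ (ptail w)); [apply rep_near; auto|apply cl_sym, rep_near; auto].
  - pose proof (slice_near c w HT). pose proof (slice_near c' w HT).
    replace (IZR (slice n c w) - IZR (slice n c' w)) with (- (w O - IZR (slice n c w)) + (w O - IZR (slice n c' w))) by ring.
    eapply Rle_trans; [apply Rabs_triang|]. rewrite Rabs_Ropp. lra.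
Qed.

Lemma wH_pos : 0 < wH.
Proof. unfold wH. pose proof (del_pos n Hn). apply Rdiv_lt_0_compat; lra. Qed.
Lemma wK_pos : 0 < wK.
Proof. unfold wK. pose proof wH_pos. pose proof (pos_INR n). assert (0 <= INR n * wH) by (apply Rmult_le_pos; lra). lra. Qed.
Lemma wH_del : wH * del n = 32.
Proof. unfold wH. pose proof (del_pos n Hn). field. lra. Qed.

Definition wNear : R := 8 + (wH + wK * wH + 4 * om2 n wK wH wH / wK + 2 * om2 n wK wH wH + 2) * del n.

Lemma wNear_pos : 8 <= wNear.
Proof.
  unfold wNear. pose proof wH_pos. pose proof wK_pos. pose proof (del_pos n Hn).
  assert (O := om2_nonneg n wK wH wH ltac:(lra) ltac:(lra) wK_pos).
  assert (0 <= 4 * om2 n wK wH wH / wK) by (apply Rmult_le_pos; [lra|left; apply Rinv_0_lt_compat; lra]).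
  assert (0 <= wK * wH) by nra.
  assert (0 <= (wH + wK * wH + 4 * om2 n wK wH wH / wK + 2 * om2 n wK wH wH + 2) * del n) by (apply Rmult_le_pos; lra). lra.
Qed.

Lemma Aext_near w : exists q, Rabs (w O - IZR q) <= 4 * tdist w /\ hle n (f (ptail w) q) (Aext w) (wNear * tdist w).
Proof.
  pose proof (tdist_range w) as HT. pose proof wNear_pos. pose proof wH_pos. pose proof wK_pos. pose proof (del_pos n Hn) as Hd. unfold Aext.
  destruct (Req_EM_T (tdist w) 0) as [E|E].
  - exists (Int_part (w O)). rewrite (dz_zero_IZR (w O) E) at 1. rewrite E, Rminus_diag, Rabs_R0, !Rmult_0_r. split; [lra|apply hle_refl; lra].
  - assert (HT' : 0 < tdist w) by lra. exists (slice n O w). split; [apply slice_near; auto|].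
    unfold wNear. rewrite Rmult_plus_distr_r.
    apply (hle_trans n _ (wp w O)); [lra| |replace (8 * tdist w) with (4 * tdist w + 4 * tdist w) by ring; apply slices_lip2|].
    + assert (0 <= (wNear - 8) * tdist w) by (apply Rmult_le_pos; lra). unfold wNear in *. lra.
    + lra.
    + apply cl_sym, rep_near; auto.
    + rewrite Rminus_diag, Rabs_R0. lra.
    + rewrite Rmult_assoc. apply (Fmap_near n wK wH wH (del n * tdist w) (wp w) (Rw n w)); auto; try lra.
      * unfold wK; lra.
      * apply Rmult_lt_0_compat; lra.
      * intros; apply Rw_ge; auto.
      * intros c c' _ _. apply (hle_mono n _ _ (16 * tdist w)); [lra|apply wp_close; auto|]. rewrite <- Rmult_assoc, wH_del. lra.
      * intros c. pose proof (Bw_range n Hn w c HT'). rewrite <- Rmult_assoc, wH_del. lra.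
      * lia.
Qed.

Definition wFlip : R := c1 n wK wH + c4 n wK wH wH + 2 * c5 n wK wH wH + 2.
Definition wC : R := Rmax (2 * wFlip) (8 * (wNear + 2 + 8) / del n + 1).

Lemma wFlip_nonneg : 0 <= wFlip.
Proof.
  pose proof wH_pos. pose proof wK_pos. unfold wFlip.
  pose proof (c1_nonneg n wK wH ltac:(lra) wK_pos). pose proof (c5_nonneg n wK wH wH ltac:(lra) ltac:(lra) wK_pos).
  pose proof (c2_nonneg n wK wH wH ltac:(lra) ltac:(lra) wK_pos). pose proof (c3_nonneg n wK wH wH ltac:(lra) ltac:(lra) wK_pos).
  assert (0 <= c4 n wK wH wH); [|lra]. unfold c4. pose proof (pos_INR n).
  assert (0 <= 2 * (c2 n wK wH wH + c3 n wK wH wH) / wK) by (apply Rmult_le_pos; [lra|left; apply Rinv_0_lt_compat; lra]).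
  assert (0 <= INR n * wH) by (apply Rmult_le_pos; lra). lra.
Qed.

Definition in_walls (w : pt) : Prop := exists i, (i < S n)%nat /\ dz (w i) = 0.

Lemma Aext_far w w' a : cl (S n) w w' a -> 0 <= a -> del n / 4 * tdist w <= a -> del n / 4 * tdist w' <= a ->
  hle n (Aext w) (Aext w') ((8 * (wNear + 2 + 8) / del n + 1) * a).
Proof.
  intros Hc Ha H1 H2. pose proof wNear_pos. pose proof (del_pos n Hn) as Hd.
  pose proof (tdist_range w). pose proof (tdist_range w').
  destruct (Aext_near w) as [q [Q1 Q2]]. destruct (Aext_near w') as [q' [Q1' Q2']].
  set (D := a / del n). assert (ED : del n * D = a) by (unfold D; field; lra). 
  assert (HD : 0 <= D) by (unfold D; apply Rmult_le_pos; [auto|left; apply Rinv_0_lt_compat; lra]).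
  assert (T1 : tdist w <= 4 * D) by nra. assert (T2 : tdist w' <= 4 * D) by nra.
  assert (Da : a <= D) by nra.
  apply (hle_mono n _ _ (wNear * tdist w + ((a + (a + 4 * tdist w + 4 * tdist w')) + wNear * tdist w'))).
  - assert (0 <= wNear * tdist w) by nra. assert (0 <= wNear * tdist w') by nra. lra.
  - apply (hle_trans n _ (f (ptail w) q)); [nra|nra|apply hle_sym; auto|].
    apply (hle_trans n _ (f (ptail w') q')); [nra|nra| |auto].
    apply slices_lip2; auto.
    + intros i Hi. apply Hc. lia.
    + assert (Ht : Rabs (w O - w' O) <= a) by (apply Hc; lia).
      replace (IZR q - IZR q') with (- (w O - IZR q) + (w O - w' O) + (w' O - IZR q')) by ring.
      apply Rabs_le_iff in Q1, Q1', Ht. apply Rabs_le_iff. lra.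
  - replace ((8 * (wNear + 2 + 8) / del n + 1) * a) with (8 * (wNear + 2 + 8) * D + a) by (unfold D; field; lra).
    assert (wNear * tdist w <= wNear * (4 * D)) by (apply Rmult_le_compat_l; lra).
    assert (wNear * tdist w' <= wNear * (4 * D)) by (apply Rmult_le_compat_l; lra). lra.
Qed.

Lemma Fmap_step w Bv Bv' a : 0 < tdist w -> (forall c, 0 <= Bv c <= 4 * tdist w) -> (forall c, 0 <= Bv' c <= 4 * tdist w) ->
  (forall c, Rabs (Bv c - Bv' c) <= a) ->
  hle n (Fmap n wK (wp w) (Rw n w) Bv') (Fmap n wK (wp w) (Rw n w) Bv) (wFlip * a).
Proof.
  intros HT HB HB' Ha. pose proof wH_pos. pose proof wK_pos. pose proof (del_pos n Hn).
  apply (Fmap_lip n wK wH wH (del n * tdist w)); auto; try lra.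
  - unfold wK; lra.
  - apply Rmult_lt_0_compat; lra.
  - intros; apply Rw_ge; auto.
  - intros c c' _ _. apply (hle_mono n _ _ (16 * tdist w)); [lra|apply wp_close; auto|]. rewrite <- Rmult_assoc, wH_del. lra.
  - intros c. specialize (HB c). rewrite <- Rmult_assoc, wH_del. lra.
  - intros c. specialize (HB' c). rewrite <- Rmult_assoc, wH_del. lra.
Qed.

Lemma Aext_near_pair w w' a : cl (S n) w w' a -> 0 <= a -> in_walls w -> 0 < tdist w -> 0 < tdist w' ->
  tdist w <= 2 * tdist w' -> tdist w' <= 2 * tdist w -> a < del n / 2 * tdist w -> hle n (Aext w) (Aext w') (2 * wFlip * a).
Proof.
  intros Hc Ha HJ HT HT' HTT HTT' Hlt. pose proof wH_pos. pose proof wK_pos. pose proof (del_pos n Hn) as Hd. pose proof wFlip_nonneg.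
  pose proof (tdist_range w). pose proof (tdist_range w').
  unfold Aext. destruct (Req_EM_T (tdist w) 0); [lra|]. destruct (Req_EM_T (tdist w') 0); [lra|].
  (* Intermediate parameters: colours whose cells differ at the two points are switched off. This
     costs [a] from either side, and with these parameters the two simplices give the same point. *)
  set (B2 := fun c => if excluded_middle_informative (same_cell n c w w') then Bw n w c else 0).
  assert (RB := fun c => Bw_range n Hn w c HT). assert (RB' := fun c => Bw_range n Hn w' c HT').
  assert (RB2 : forall c, 0 <= B2 c <= 4 * tdist w).
  { intros c. unfold B2. destruct (excluded_middle_informative _); [apply RB|lra]. }
  assert (HB2 : forall c, Rabs (B2 c - Bw n w c) <= a).
  { intros c. unfold B2. destruct (excluded_middle_informative _) as [S|S]; [rewrite Rminus_diag, Rabs_R0; auto|].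
    pose proof (Bw_leave n Hn c w w' a HT HT' Hc Ha S). specialize (RB c). apply Rabs_le_iff. lra. }
  assert (HB2' : forall c, Rabs (Bw n w' c - B2 c) <= a).
  { intros c. unfold B2. destruct (excluded_middle_informative _) as [S|S].
    - rewrite Rabs_minus_sym. apply (Bw_same n Hn c w w'); auto.
    - assert (S' : ~ same_cell n c w' w) by (intros E; apply S, same_cell_sym; auto).
      pose proof (Bw_leave n Hn c w' w a HT' HT (cl_sym _ _ _ _ Hc) Ha S'). specialize (RB' c). apply Rabs_le_iff. lra. }
  assert (RB2' : forall c, 0 <= B2 c <= 4 * tdist w').
  { intros c. unfold B2. destruct (excluded_middle_informative _) as [(S1 & _ & _)|S]; [|lra].
    split; [apply RB|]. eapply Rle_trans; [apply rmin_base|]. eapply Rle_trans; [apply Rmin_r|].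
    pose proof (rad_bounds n Hn c (tdist w') ltac:(lra)) as Q. unfold rad in *. rewrite <- S1 in Q.
    pose proof (nu_range n Hn c). pose proof (half_pow_pos (lev n c (tdist w))). nra. }
  replace (2 * wFlip * a) with (wFlip * a + (0 + wFlip * a)) by ring.
  assert (0 <= wFlip * a) by nra.
  assert (Hsame : forall c, same_cell n c w w' -> wp w c = wp w' c /\ Rw n w c = Rw n w' c).
  { intros c (S1 & S2 & S3). unfold wp, Rw, rad. rewrite S1, S3. split; auto. f_equal.
    apply functional_extensionality. intros i. unfold rep. destruct (Nat.ltb i n) eqn:Q; auto.
    apply Nat.ltb_lt in Q. rewrite (S2 i Q). unfold rad. now rewrite S1. }
  apply (hle_trans n _ (Fmap n wK (wp w) (Rw n w) B2)); [auto|lra|apply Fmap_step; auto|].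
  apply (hle_trans n _ (Fmap n wK (wp w') (Rw n w') B2)); [lra|auto| |apply Fmap_step; auto].
  set (m := Rmin (tdist w) (tdist w')). assert (0 < m) by (apply Rmin_glb_lt; auto).
  assert (m <= tdist w) by apply Rmin_l. assert (m <= tdist w') by apply Rmin_r.
  assert (tdist w <= 2 * m) by (unfold m, Rmin; destruct (Rle_dec _ _); lra).
  apply (Fmap_indep n wK wH (del n * m)); auto; try lra.
  - unfold wK; lra.
  - apply Rmult_lt_0_compat; lra.
  - intros c. pose proof (Rw_ge n Hn w c HT). assert (del n * m <= del n * tdist w) by (apply Rmult_le_compat_l; lra). lra.
  - intros c. pose proof (Rw_ge n Hn w' c HT'). assert (del n * m <= del n * tdist w') by (apply Rmult_le_compat_l; lra). lra.
  - intros c; apply RB2.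
  - intros c c' _ _. apply (hle_mono n _ _ (16 * tdist w)); [lra|apply wp_close; auto|]. rewrite <- Rmult_assoc, wH_del. lra.
  - intros c _. unfold B2. destruct (excluded_middle_informative _); auto.
  (* Here it matters that [w] lies on a wall: when the cell of the background changes, a saturated
     colour hides it. The cell of that colour is the same at both points, since leaving it would
     cost at least [2 * Rw]. *)
  - destruct (classic (same_cell n O w w')) as [S|S]; [left; apply Hsame; auto|right].
    destruct HJ as [i [Hi Hz]]. destruct i; [unfold tdist in HT; lra|].
    destruct (saturated_colour n Hn w i HT ltac:(lia) Hz) as [c [Hcn Hsat]].
    pose proof (Rw_ge n Hn w c HT) as HRc.
    assert (S' : same_cell n c w w').
    { apply NNPP. intros C. pose proof (Bw_leave n Hn c w w' a HT HT' Hc Ha C). nra. }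
    exists c. split; [|split].
    + destruct c; [contradiction|lia].
    + unfold B2. destruct (excluded_middle_informative _); [|contradiction]. nra.
    + apply Hsame; auto.
Qed.

(** If the displacement is at least a fixed fraction of both distances to the integer heights,
    comparison with nearby slices suffices. Otherwise these distances agree up to a factor 2, and
    the simplices of the two points are compared directly. *)
Theorem Aext_lip w w' a : in_walls w -> in_walls w' -> 0 <= a -> cl (S n) w w' a -> hle n (Aext w) (Aext w') (wC * a).
Proof.
  intros HJ HJ' Ha Hc. pose proof (del_pos n Hn) as Hd. pose proof wFlip_nonneg. pose proof wNear_pos.
  pose proof (tdist_range w). pose proof (tdist_range w').
  assert (HTd : Rabs (tdist w - tdist w') <= a) by (eapply Rle_trans; [apply dz_lip|apply Hc; lia]). apply Rabs_le_iff in HTd.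
  assert (M1 : 2 * wFlip <= wC) by apply Rmax_l. assert (M2 : 8 * (wNear + 2 + 8) / del n + 1 <= wC) by apply Rmax_r.
  assert (0 <= 8 * (wNear + 2 + 8) / del n) by (apply Rmult_le_pos; [lra|left; apply Rinv_0_lt_compat; lra]).
  destruct (Rle_dec (del n / 4 * tdist w) a) as [L1|L1]; [destruct (Rle_dec (del n / 4 * tdist w') a) as [L2|L2]|].
  - apply (hle_mono n _ _ ((8 * (wNear + 2 + 8) / del n + 1) * a)); [nra|apply Aext_far; auto|nra].
  - apply (hle_mono n _ _ (2 * wFlip * a)); [nra| |nra]. apply hle_sym.
    apply Aext_near_pair; auto; try nra. apply cl_sym; auto.
  - apply (hle_mono n _ _ (2 * wFlip * a)); [nra| |nra].
    apply Aext_near_pair; auto; nra.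
Qed.
End WhitneyExtension.

(** * The walls of a subdivided cube *)

Definition bdC (d : nat) (x : pt) : Prop := rmaxabs d x = 1.
(* Radial projection to the boundary of the cube; it is 0 at 0. *)
Definition lam0 (d : nat) (x : pt) : pt := fun i => if Nat.ltb i d then x i / rmaxabs d x else 0.

Lemma lam0_lip d x y a m : 0 < m -> m <= rmaxabs d x -> m <= rmaxabs d y -> 0 <= a -> cl d x y a -> cl d (lam0 d x) (lam0 d y) (2 / m * a).
Proof.
  intros Hm Hx Hy Ha H i Hi. unfold lam0. rewrite (proj2 (Nat.ltb_lt i d) Hi).
  pose proof (mx_cl d x y a H Ha) as HM. pose proof (mx_ge d y i Hi) as Hyi. specialize (H i Hi).
  set (X := rmaxabs d x) in *. set (Y := rmaxabs d y) in *.
  replace (x i / X - y i / Y) with ((x i - y i) * / X + (y i * / Y) * ((Y - X) * / X)) by (field; lra).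
  assert (IX : 0 < / X <= / m) by (split; [apply Rinv_0_lt_compat; lra|apply Rinv_le_contravar; lra]).
  assert (B1 : Rabs (y i * / Y) <= 1).
  { rewrite Rabs_mult, (Rabs_pos_eq (/ Y)) by (left; apply Rinv_0_lt_compat; lra).
    apply (Rmult_le_reg_r Y); [lra|]. rewrite Rmult_assoc, Rinv_l; lra. }
  assert (B2 : Rabs ((Y - X) * / X) <= a * / m) by (apply Rabs_mult_le; [rewrite Rabs_minus_sym; auto|rewrite Rabs_pos_eq; lra]).
  assert (B3 : Rabs ((x i - y i) * / X) <= a * / m) by (apply Rabs_mult_le; [auto|rewrite Rabs_pos_eq; lra]).
  pose proof (Rabs_mult_le _ _ _ _ B1 B2). eapply Rle_trans; [apply Rabs_triang|]. unfold Rdiv. lra.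
Qed.

Lemma lam0_bd d x : 0 < rmaxabs d x -> bdC d (lam0 d x).
Proof.
  intros H. unfold bdC. rewrite (mx_ext d _ (fun i => / rmaxabs d x * x i)).
  - rewrite mx_scal, Rabs_pos_eq by (left; now apply Rinv_0_lt_compat). apply Rinv_l. lra.
  - intros i Hi. unfold lam0. rewrite (proj2 (Nat.ltb_lt i d) Hi). f_equal. unfold Rdiv. ring.
Qed.

Definition hlip (n : nat) (P : pt -> Prop) (al : pt -> hpt) (L : R) : Prop :=
  forall x y a, P x -> P y -> 0 <= a -> cl (S n) x y a -> hle n (al x) (al y) (L * a).

Lemma bdC_cl d x y : bdC d x -> bdC d y -> cl d x y 2.
Proof.
  intros Hx Hy i Hi. unfold bdC in *. pose proof (mx_ge d x i Hi). pose proof (mx_ge d y i Hi).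
  rewrite Hx in H. rewrite Hy in H0. apply Rabs_le_iff in H, H0. apply Rabs_le_iff. lra.
Qed.

(** The vertical displacement is [s' ^ 2 - s ^ 2] times that of [p], of first order in the step, so
    the distance behaves like the square root of the step; this is the hypothesis
    [2 * e * b ^ 2 <= r ^ 2]. *)
Lemma hdil_path n p b s s' e r : hle n hzero p b -> 0 <= b -> 0 <= s <= 1 -> 0 <= s' <= 1 -> Rabs (s' - s) <= e ->
  e * b <= r -> 2 * e * b ^ 2 <= r ^ 2 -> hle n (hdil s p) (hdil s' p) r.
Proof.
  intros [H1 H2] Hb Hs Hs' He Hr1 Hr2. assert (He0 : 0 <= e) by (eapply Rle_trans; [apply Rabs_pos|exact He]). split.
  - intros j Hj. destruct (H1 j Hj) as [U V]. simpl in *. rewrite Rminus_0_r in U, V.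
    rewrite <- !Rmult_minus_distr_r. pose proof (Rabs_mult_le _ _ _ _ He U). pose proof (Rabs_mult_le _ _ _ _ He V). lra.
  - replace (zeta n (hdil s p) (hdil s' p)) with (((s' - s) * (s' + s)) * zeta n hzero p).
    + assert (B : Rabs ((s' - s) * (s' + s)) <= e * 2) by (apply Rabs_mult_le; auto; apply Rabs_le_iff; lra).
      pose proof (Rabs_mult_le _ _ _ _ B H2). pose proof (pos_INR n). nra.
    + unfold zeta; simpl.
      replace (rsum n (fun j => (s * hy p j + s' * hy p j) / 2 * (s' * hx p j - s * hx p j)))
        with (((s' - s) * (s' + s)) * rsum n (fun j => (0 + hy p j) / 2 * (hx p j - 0))); [ring|].
      rewrite <- rsum_scal. apply rsum_ext; intros; field.
Qed.

Lemma itp_zero b v m : (forall c, (c <= m)%nat -> v c = 0) -> itp b v m = 0.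
Proof. induction m; intros H; simpl; [apply H; lia|]. rewrite IHm by (intros; apply H; lia). rewrite (H (S m)) by lia. ring. Qed.

Lemma dit_zero_fun b v m i : (forall c, (c <= m)%nat -> v c = 0) -> dit b v m i = 0.
Proof.
  induction m; intros H; [reflexivity|]. cbn [dit]. rewrite itp_zero by (intros; apply H; lia).
  rewrite IHm by (intros; apply H; lia). rewrite (H (S m)) by lia. destruct (Nat.eqb i (S m)); ring.
Qed.

(** Equal vertices do not give a constant simplex, as the spread in x survives. It stays in the
    abelian subgroup of points with vanishing y and z, where x can be cut off freely. *)
Lemma Fmap_flat n K p Rr Bv : 0 < K -> (forall c, (c <= n)%nat -> hle n (p c) hzero 0) ->
  (forall j, (j < n)%nat -> hx (Fmap n K p Rr Bv) j = K * Bv (S j) /\ hy (Fmap n K p Rr Bv) j = 0) /\ hz (Fmap n K p Rr Bv) = 0.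
Proof.
  intros HK Hp.
  assert (Hx : forall c j, (c <= n)%nat -> (j < n)%nat -> hx (p c) j = 0 /\ hy (p c) j = 0).
  { intros c j Hc Hj. destruct (hle0_inv _ _ _ (Hp c Hc)) as [U _]. destruct (U j Hj). auto. }
  assert (Hz : forall c, (c <= n)%nat -> hz (p c) = 0) by (intros c Hc; destruct (hle0_inv _ _ _ (Hp c Hc)) as [_ U]; auto).
  assert (Hell : forall X c, (c <= n)%nat -> ell n p X c = 0).
  { intros X c Hc. unfold ell. rewrite Hz by auto. rewrite rsum_zero; [ring|]. intros j Hj. destruct (Hx c j Hc Hj) as [_ ->]. ring. }
  assert (He : forall i, (i < n)%nat -> Feta n K p Rr Bv i = 0).
  { assert (HE : forall i j, (i < n)%nat -> (j < n)%nat -> Rabs (Fmat n p Rr Bv i j) <= 0).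
    { intros i j Hi Hj. unfold Fmat. rewrite dit_zero_fun by (intros; apply Hx; auto). unfold Rdiv. rewrite Rmult_0_l, Rabs_R0. lra. }
    intros i Hi. assert (Z : Rabs (Feta n K p Rr Bv i) <= 2 * 0 / K).
    { apply (dominant_bound n K 0 (Fmat n p Rr Bv) HK HE ltac:(lra) (Feta n K p Rr Bv) (fun _ => 0)); [lra| |intros; rewrite Rabs_R0; lra|auto].
      intros k Hk. unfold Feta. rewrite (solve_spec n K 0) by (auto; lra). unfold Frhs. rewrite dit_zero_fun by (intros; apply Hell; auto). unfold Rdiv; ring. }
    replace (2 * 0 / K) with 0 in Z by (field; lra). apply Rabs_le_iff in Z. lra. }
  split.
  - intros j Hj. simpl. unfold FX. rewrite He by auto. rewrite !itp_zero by (intros; apply Hx; auto). split; ring.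
  - simpl. apply itp_zero. intros; apply Hell; auto.
Qed.

Lemma rep_bounds n c w i : (1 <= n)%nat -> (i < n)%nat -> w (S i) - 1 <= rep n c w i <= w (S i).
Proof.
  intros Hn Hi. unfold rep. rewrite (proj2 (Nat.ltb_lt i n) Hi). unfold cellz.
  pose proof (Int_part_bounds (w (S i) / rad n c (tdist w) - nu n c)) as I.
  assert (Hr : 0 < rad n c (tdist w) <= 1).
  { split; [apply half_pow_pos|]. unfold rad. exact (half_pow_le 0 _ (Nat.le_0_l _)). }
  set (r := rad n c (tdist w)) in *. set (z := Int_part _) in *.
  assert (E : w (S i) = r * (w (S i) / r)) by (field; lra). rewrite E. set (x := w (S i) / r) in *.
  replace (r * x - 1) with (r * x - 1) by ring. split; nra.
Qed.

(** * Slices, cut-off and rescaling at one level *)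

Section Level.
Variables (n N : nat) (al : pt -> hpt) (L : R).
Hypothesis Hn : (1 <= n)%nat.
Hypothesis HN : (12 <= N)%nat.
Hypothesis HL : 0 < L.
Hypothesis Hal : hlip n (bdC (S n)) al L.

Let NN := INR N.
Let g := al e0.
(** The wrapping has constant [4 / NN] from [vv], 2 from [Vcol] and 32 from the radial projection
    outside the cube of size [/ 16], in all [256 / NN]. Dilating by [/ lam] makes the slices
    1-Lipschitz. *)
Let lam := 256 * L / NN.

(* The box [0,N^2] x [0,N]^n is treated with [t = w 0] as a height: the slice at height [q]
   is wrapped by [Vcol] around the boundary of the (n+1)-cube, its own boundary going to one
   point, and carries [al], translated to start at the identity and dilated by [sq q], which
   decreases from 1 to 0 as the height grows. *)
Definition vv (u : pt) : pt := fun j => (2 * u j - INR N) / (INR N - 6).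
Definition Vcol (v : pt) (m : R) : pt := fun i => match i with O => 2 * m - 1 | S j => (1 - m) * v j end.
Definition sq (q : Z) : R := Rmax 0 (Rmin 1 (1 - IZR q / (INR N * INR N))).
Definition aV (u : pt) : hpt := al (lam0 (S n) (Vcol (vv u) (Rmin 1 (rmaxabs n (vv u))))).
Definition fsl (u : pt) (q : Z) : hpt := hdil (sq q) (hdil (/ lam) (hmul n (hinv n g) (aV u))).

Lemma NN_ge : 12 <= INR N.
Proof. replace 12 with (INR 12) by (simpl; lra). now apply le_INR. Qed.
Lemma lam_pos : 0 < lam.
Proof. unfold lam. pose proof NN_ge. apply Rdiv_lt_0_compat; unfold NN; lra. Qed.

Lemma Vcol_big v m : m = Rmin 1 (rmaxabs n v) -> / 16 <= rmaxabs (S n) (Vcol v m).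
Proof.
  intros Em. rewrite mx_Sl. simpl. pose proof (mx_nonneg n v).
  change (fun i => (1 - m) * v i) with (fun i => (1 - m) * v i). rewrite mx_scal.
  assert (0 <= m <= 1) by (rewrite Em; split; [apply Rmin_glb; lra|apply Rmin_l]).
  assert (m <= rmaxabs n v) by (rewrite Em; apply Rmin_r).
  rewrite (Rabs_pos_eq (1 - m)) by lra.
  destruct (Rle_dec (/ 4) m); [destruct (Rle_dec m (3/4))|].
  - eapply Rle_trans; [|apply Rmax_r]. nra.
  - eapply Rle_trans; [|apply Rmax_l]. rewrite Rabs_pos_eq; lra.
  - eapply Rle_trans; [|apply Rmax_l]. rewrite Rabs_left1; lra.
Qed.

Lemma Vcol_lip v v' a : 0 <= a -> cl n v v' a ->
  cl (S n) (Vcol v (Rmin 1 (rmaxabs n v))) (Vcol v' (Rmin 1 (rmaxabs n v'))) (2 * a).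
Proof.
  intros Ha H. pose proof (mx_cl n v v' a H Ha) as HM. set (M := rmaxabs n v) in *. set (M' := rmaxabs n v') in *.
  assert (Hm : Rabs (Rmin 1 M - Rmin 1 M') <= a).
  { apply Rabs_le_iff in HM. apply Rabs_le_iff. unfold Rmin. repeat destruct (Rle_dec _ _); lra. }
  assert (0 <= M) by apply mx_nonneg. assert (0 <= M') by apply mx_nonneg.
  intros [|j] Hj; simpl.
  - replace (2 * Rmin 1 M - 1 - (2 * Rmin 1 M' - 1)) with (2 * (Rmin 1 M - Rmin 1 M')) by ring.
    rewrite Rabs_mult, Rabs_pos_eq by lra. lra.
  - assert (Hj' : (j < n)%nat) by lia. specialize (H j Hj').
    pose proof (mx_ge n v j Hj') as Hv. pose proof (mx_ge n v' j Hj') as Hv'. fold M in Hv. fold M' in Hv'.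
    destruct (Rle_dec M 1) as [A|A]; destruct (Rle_dec M' 1) as [A'|A'].
    + rewrite !Rmin_right in * by lra.
      replace ((1 - M) * v j - (1 - M') * v' j) with ((1 - M) * (v j - v' j) + (- (M - M')) * v' j) by ring.
      eapply Rle_trans; [apply Rabs_triang|].
      assert (Rabs ((1 - M) * (v j - v' j)) <= 1 * a) by (apply Rabs_mult_le; auto; apply Rabs_le_iff; lra).
      assert (Rabs (- (M - M') * v' j) <= a * 1) by (apply Rabs_mult_le; [rewrite Rabs_Ropp; auto|lra]). lra.
    + rewrite (Rmin_right 1 M), (Rmin_left 1 M') in * by lra.
      replace ((1 - M) * v j - (1 - 1) * v' j) with ((1 - M) * v j) by ring.
      apply Rabs_le_iff in HM.
      assert (Rabs ((1 - M) * v j) <= a * 1) by (apply Rabs_mult_le; [apply Rabs_le_iff|]; lra). lra.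
    + rewrite (Rmin_left 1 M), (Rmin_right 1 M') in * by lra.
      replace ((1 - 1) * v j - (1 - M') * v' j) with (- ((1 - M') * v' j)) by ring. rewrite Rabs_Ropp.
      apply Rabs_le_iff in HM.
      assert (Rabs ((1 - M') * v' j) <= a * 1) by (apply Rabs_mult_le; [apply Rabs_le_iff|]; lra). lra.
    + rewrite !Rmin_left by lra. replace ((1 - 1) * v j - (1 - 1) * v' j) with 0 by ring. rewrite Rabs_R0. lra.
Qed.

Lemma e0_bd : bdC (S n) e0.
Proof.
  unfold bdC. rewrite mx_Sl. simpl. rewrite Rabs_R1, Rmax_left; auto. apply mx_le; [lra|]. intros. rewrite Rabs_R0. lra.
Qed.

Lemma aV_bd u : bdC (S n) (lam0 (S n) (Vcol (vv u) (Rmin 1 (rmaxabs n (vv u))))).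
Proof. apply lam0_bd. pose proof (Vcol_big (vv u) _ eq_refl). lra. Qed.

Lemma aV_lip u u' a : 0 <= a -> cl n u u' a -> hle n (aV u) (aV u') (256 * L / NN * a).
Proof.
  intros Ha H. pose proof NN_ge as HNN.
  assert (Hv : cl n (vv u) (vv u') (4 / NN * a)).
  { intros i Hi. unfold vv. fold NN. specialize (H i Hi). unfold NN in *.
    replace ((2 * u i - INR N) / (INR N - 6) - (2 * u' i - INR N) / (INR N - 6)) with ((2 / (INR N - 6)) * (u i - u' i)) by (field; lra).
    apply Rabs_mult_le; auto. rewrite Rabs_pos_eq by (left; apply Rdiv_lt_0_compat; lra).
    apply (Rmult_le_reg_r ((INR N - 6) * INR N)); [nra|].
    replace (2 / (INR N - 6) * ((INR N - 6) * INR N)) with (2 * INR N) by (field; lra).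
    replace (4 / INR N * ((INR N - 6) * INR N)) with (4 * (INR N - 6)) by (field; lra). lra. }
  assert (H4 : 0 <= 4 / NN * a) by (apply Rmult_le_pos; auto; left; apply Rdiv_lt_0_compat; unfold NN; lra).
  replace (256 * L / NN * a) with (L * (2 / / 16 * (2 * (4 / NN * a)))) by (field; unfold NN; lra).
  apply Hal; try apply aV_bd.
  - rewrite Rdiv_def, Rinv_inv. nra.
  - apply lam0_lip; try lra; try (apply (Vcol_big _ _ eq_refl)); try nra. apply Vcol_lip; auto.
Qed.

Lemma fsl_lip1 u u' q a : 0 <= a -> cl n u u' a -> hle n (fsl u q) (fsl u' q) a.
Proof.
  intros Ha H. unfold fsl. pose proof lam_pos.
  assert (Hs : 0 <= sq q <= 1).
  { unfold sq. split; [apply Rmax_l|]. apply Rmax_lub; [lra|apply Rmin_l]. }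
  apply (hle_mono n _ _ (Rabs (sq q) * (Rabs (/ lam) * (lam * a)))).
  - assert (0 <= lam * a) by (apply Rmult_le_pos; lra). apply Rmult_le_pos; [apply Rabs_pos|]. apply Rmult_le_pos; [apply Rabs_pos|auto].
  - apply hle_dil, hle_dil, hle_ltr. unfold lam. apply aV_lip; auto.
  - rewrite (Rabs_pos_eq (sq q)), (Rabs_pos_eq (/ lam)) by (lra || (left; now apply Rinv_0_lt_compat)).
    replace (/ lam * (lam * a)) with a by (field; lra). nra.
Qed.

Lemma base_zero : hle n (hmul n (hinv n g) g) hzero 0.
Proof.
  apply hle0_eq; simpl; [intros; lra|].
  replace (rsum n (fun j => - hy g j * hx g j)) with (-1 * rsum n (fun j => hy g j * hx g j)); [ring|].
  rewrite <- rsum_scal. apply rsum_ext; intros; ring.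
Qed.

Lemma hdil_hzero s : hle n (hdil s hzero) hzero 0.
Proof. apply hle0_eq; simpl; [intros; lra|lra]. Qed.

(** The rescaled slices stay within [2 * L / lam = NN / 128] of the identity, and [sq] changes by at
    most [/ (NN * NN)] per unit of height, which meets the condition of [hdil_path] with distance
    1. *)
Lemma fsl_lip2 u q : hle n (fsl u q) (fsl u (q + 1)) 1.
Proof.
  unfold fsl. pose proof lam_pos as Hl. pose proof NN_ge as HNN.
  set (p := hdil (/ lam) (hmul n (hinv n g) (aV u))).
  assert (Hp : hle n hzero p (NN / 128)).
  { apply (hle_l0 n _ (hdil (/ lam) hzero)); [unfold NN; lra|apply hle_sym, hdil_hzero|].
    apply (hle_l0 n _ (hdil (/ lam) (hmul n (hinv n g) g))); [unfold NN; lra| |].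
    - replace 0 with (Rabs (/ lam) * 0) by ring. apply hle_dil, hle_sym, base_zero.
    - replace (NN / 128) with (Rabs (/ lam) * (L * 2)).
      + apply hle_dil, hle_ltr. apply Hal; [apply e0_bd|apply aV_bd|lra|apply bdC_cl; [apply e0_bd|apply aV_bd]].
      + rewrite Rabs_pos_eq by (left; now apply Rinv_0_lt_compat). unfold lam. field. unfold NN; lra. }
  assert (Hs : forall q, 0 <= sq q <= 1).
  { intros q'. unfold sq. split; [apply Rmax_l|]. apply Rmax_lub; [lra|apply Rmin_l]. }
  assert (P : 0 < NN * NN) by (unfold NN; nra).
  apply (hdil_path n p (NN / 128) _ _ (/ (NN * NN))); auto.
  - unfold NN; lra.
  - assert (E : IZR (q + 1) / (INR N * INR N) = IZR q / (INR N * INR N) + / (NN * NN)) by (rewrite plus_IZR; unfold NN; field; lra).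
    unfold sq. rewrite E. assert (0 < / (NN * NN)) by now apply Rinv_0_lt_compat.
    set (x := IZR q / (INR N * INR N)). set (e := / (NN * NN)) in *. apply Rabs_le_iff.
    unfold Rmax, Rmin. repeat destruct (Rle_dec _ _); lra.
  - apply (Rmult_le_reg_l (NN * NN)); auto. replace (NN * NN * (/ (NN * NN) * (NN / 128))) with (NN / 128) by (field; unfold NN; lra). unfold NN; nra.
  - apply (Rmult_le_reg_l (NN * NN)); auto. replace (NN * NN * (2 * / (NN * NN) * (NN / 128) ^ 2)) with (NN * NN / 8192) by (field; unfold NN; lra). lra.
Qed.

Lemma hzero_of_base p q : hle n p g 0 -> hle n (hdil (sq q) (hdil (/ lam) (hmul n (hinv n g) p))) hzero 0.
Proof.
  intros H.
  apply (hle_l0 n _ (hdil (sq q) hzero)); [lra| |apply hdil_hzero].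
  replace 0 with (Rabs (sq q) * 0) by ring. apply hle_dil.
  apply (hle_l0 n _ (hdil (/ lam) hzero)); [lra| |apply hdil_hzero].
  replace 0 with (Rabs (/ lam) * 0) by ring. apply hle_dil.
  apply (hle_l0 n _ (hmul n (hinv n g) g)); [lra|apply hle_ltr; auto|apply base_zero].
Qed.

Lemma al_base v : hle n (al (lam0 (S n) (Vcol v 1))) g 0.
Proof.
  assert (E : rmaxabs (S n) (Vcol v 1) = 1).
  { rewrite mx_Sl. simpl. replace (2 * 1 - 1) with 1 by ring. rewrite Rabs_R1. apply Rmax_left. apply mx_le; [lra|].
    intros. rewrite Rminus_diag, Rmult_0_l, Rabs_R0. lra. }
  replace 0 with (L * 0) by ring. apply Hal; [apply lam0_bd; lra|apply e0_bd|lra|].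
  intros i Hi. unfold lam0. rewrite (proj2 (Nat.ltb_lt _ _) Hi), E. destruct i; simpl.
  - replace ((2 * 1 - 1) / 1 - 1) with 0 by field. rewrite Rabs_R0; lra.
  - replace ((1 - 1) * v i / 1 - 0) with 0 by field. rewrite Rabs_R0; lra.
Qed.

(** The 6 in [vv] leaves margins of width 3 along the sides where the slices are trivial. The
    representative of a cell is within 1 of its points, so up to distance 2 from the sides all
    vertices of the simplices are the identity. *)
Lemma fsl_flat u q i : (i < n)%nat -> u i <= 3 \/ INR N - 3 <= u i -> hle n (fsl u q) hzero 0.
Proof.
  intros Hi Hu. pose proof NN_ge as HNN. apply hzero_of_base. unfold aV.
  replace (Rmin 1 (rmaxabs n (vv u))) with 1; [apply al_base|].
  symmetry. apply Rmin_left. eapply Rle_trans; [|apply (mx_ge n (vv u) i Hi)]. unfold vv.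
  destruct Hu.
  - rewrite Rabs_left1.
    + apply (Rmult_le_reg_r (INR N - 6)); [lra|]. replace (- ((2 * u i - INR N) / (INR N - 6)) * (INR N - 6)) with (INR N - 2 * u i) by (field; lra). lra.
    + apply (Rmult_le_reg_r (INR N - 6)); [lra|]. replace ((2 * u i - INR N) / (INR N - 6) * (INR N - 6)) with (2 * u i - INR N) by (field; lra). lra.
  - rewrite Rabs_pos_eq.
    + apply (Rmult_le_reg_r (INR N - 6)); [lra|]. replace ((2 * u i - INR N) / (INR N - 6) * (INR N - 6)) with (2 * u i - INR N) by (field; lra). lra.
    + apply (Rmult_le_reg_r (INR N - 6)); [lra|]. replace ((2 * u i - INR N) / (INR N - 6) * (INR N - 6)) with (2 * u i - INR N) by (field; lra). lra.
Qed.

Definition sdist (w : pt) : R := rmin n (fun i => Rmin (w (S i)) (INR N - w (S i))) (INR N).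
Definition chi (w : pt) : R := Rmax 0 (Rmin 1 (sdist w)).
Let A0 := Aext n fsl.
(** Close to the sides, where all vertices are the identity, the x-coordinates of [A0] still carry
    the spread. Scaling them by the cut-off [chi] removes it on the sides. Where [chi] is below 1
    the y- and z-coordinates vanish, so horizontality is not disturbed. *)
Definition A1 (w : pt) : hpt := mkH (fun j => chi w * hx (A0 w) j) (hy (A0 w)) (hz (A0 w)).
Definition Alev (w : pt) : hpt := hmul n g (hdil lam (A1 w)).

Lemma sdist_lip w w' a : cl (S n) w w' a -> 0 <= a -> Rabs (sdist w - sdist w') <= a.
Proof.
  intros H Ha. apply rmin_lip.
  - rewrite Rminus_diag, Rabs_R0; auto.
  - intros i Hi. assert (Hi' : (S i < S n)%nat) by lia. specialize (H (S i) Hi'). apply Rabs_le_iff in H. apply Rabs_le_iff.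
    unfold Rmin. repeat destruct (Rle_dec _ _); lra.
Qed.

Lemma chi_range w : 0 <= chi w <= 1.
Proof. unfold chi. split; [apply Rmax_l|]. apply Rmax_lub; [lra|apply Rmin_l]. Qed.

Lemma A0_flat w : sdist w <= 2 -> (forall j, (j < n)%nat -> Rabs (hx (A0 w) j) <= 2 * wK n /\ hy (A0 w) j = 0) /\ hz (A0 w) = 0.
Proof.
  intros H. pose proof NN_ge as HNN. pose proof (wK_pos n Hn) as HK.
  assert (Hi : exists i, (i < n)%nat /\ (w (S i) <= 2 \/ INR N - 2 <= w (S i))).
  { destruct (rmin_lt n (fun i => Rmin (w (S i)) (INR N - w (S i))) (INR N) 3) as [A|[i [Hi A]]]; [unfold sdist in H; lra|lra|].
    clear A Hi i. apply NNPP. intros C. apply (Rlt_irrefl 2). eapply Rlt_le_trans; [|exact H].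
    assert (Q : forall k, (k <= n)%nat -> 2 < rmin k (fun i => Rmin (w (S i)) (INR N - w (S i))) (INR N)).
    { induction k; simpl; intros Hk; [lra|]. apply Rmin_glb_lt; [apply IHk; lia|].
      apply Rmin_glb_lt; apply Rnot_le_lt; intros D; apply C; exists k; split; auto; lra. }
    apply Q; auto. }
  destruct Hi as [i [Hi Hu]]. unfold A0, Aext. destruct (Req_EM_T (tdist w) 0) as [E|E].
  - destruct (hle0_inv n (fsl (ptail w) (Int_part (w O))) hzero) as [U V].
    + apply (fsl_flat _ _ i Hi). unfold ptail. lra.
    + split; auto. intros j Hj. destruct (U j Hj) as [U1 U2]. rewrite U1, U2. simpl. rewrite Rabs_R0. split; lra.
  - pose proof (tdist_range w).
    destruct (Fmap_flat n (wK n) (wp n fsl w) (Rw n w) (Bw n w) HK) as [U V].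
    + intros c _. unfold wp. apply (fsl_flat _ _ i Hi). pose proof (rep_bounds n c w i Hn Hi). lra.
    + split; auto. intros j Hj. destruct (U j Hj) as [U1 U2]. rewrite U1, U2. split; auto.
      pose proof (Bw_range n Hn w (S j) ltac:(lra)). rewrite Rabs_pos_eq by (apply Rmult_le_pos; lra). nra.
Qed.

Lemma A1_same w : 1 <= sdist w -> hle n (A1 w) (A0 w) 0.
Proof.
  intros H. apply hle0_eq; simpl; auto. intros j Hj. unfold chi. rewrite Rmin_left, Rmax_right by lra. split; ring.
Qed.

Lemma A1_near w : hle n (A1 w) (A0 w) (2 * wK n).
Proof.
  pose proof (wK_pos n Hn).
  destruct (Rle_dec 1 (sdist w)) as [C|C]; [apply (hle_mono n _ _ 0); [lra|apply A1_same; auto|lra]|].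
  destruct (A0_flat w ltac:(lra)) as [U V]. pose proof (chi_range w). apply hle_of_zdev.
  - intros j Hj. destruct (U j Hj) as [U1 U2]. simpl. rewrite Rminus_diag, Rabs_R0. split; [|lra].
    replace (hx (A0 w) j - chi w * hx (A0 w) j) with ((1 - chi w) * hx (A0 w) j) by ring.
    rewrite <- (Rmult_1_l (2 * wK n)). apply Rabs_mult_le; auto. apply Rabs_le_iff; lra.
  - unfold zdev. simpl. rewrite rsum_zero. { rewrite Rminus_diag, Rminus_0_r, Rabs_R0. apply Rmult_le_pos; [apply pos_INR|nra]. }
    intros j Hj. destruct (U j Hj) as [_ ->]. ring.
Qed.

Lemma wC_nonneg : 0 <= wC n.
Proof. pose proof (wFlip_nonneg n Hn). unfold wC. eapply Rle_trans; [|apply Rmax_l]. lra. Qed.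

(** If one point is closer than 1 to the sides and the other farther than 2, then [a >= 1] and
    [A1_near] pays for the change. Otherwise either the cut-off is inactive at both points or both
    lie in the flat region, where only x varies. *)
Lemma A1_lip w w' a : in_walls n w -> in_walls n w' -> 0 <= a -> cl (S n) w w' a -> hle n (A1 w) (A1 w') ((wC n + 4 * wK n) * a).
Proof.
  intros HJ HJ' Ha Hc. pose proof (wK_pos n Hn) as HK. pose proof wC_nonneg as HC.
  assert (HA : hle n (A0 w) (A0 w') (wC n * a)).
  { apply Aext_lip; auto. - intros; apply fsl_lip1; auto. - intros; apply fsl_lip2. }
  pose proof (sdist_lip w w' a Hc Ha) as Hs. apply Rabs_le_iff in Hs.
  assert (HCa : 0 <= wC n * a) by nra. assert (HKa : 0 <= wK n * a) by nra.
  destruct (Rle_dec 1 (sdist w)) as [S1|S1]; destruct (Rle_dec 1 (sdist w')) as [S1'|S1'];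
    [apply (hle_mono n _ _ (wC n * a)); [auto| |lra];
      apply (hle_l0 n _ (A0 w)); [auto|apply A1_same; auto|]; apply (hle_r0 n _ (A0 w')); [auto|auto|apply hle_sym, A1_same; auto]| | |].
  all: destruct (Rle_dec (sdist w) 2) as [S2|S2]; destruct (Rle_dec (sdist w') 2) as [S2'|S2']; try lra.
  all: try (apply (hle_mono n _ _ (2 * wK n + (wC n * a + 2 * wK n))); [lra| |nra];
      apply (hle_trans n _ (A0 w)); [lra|lra|apply A1_near|]; apply (hle_trans n _ (A0 w')); [lra|lra|auto|apply hle_sym, A1_near]).
  all: destruct (A0_flat w S2) as [U V]; destruct (A0_flat w' S2') as [U' V'].
  all: apply hle_of_zdev; [|unfold zdev; simpl; rewrite V, V', rsum_zero; [replace (0 - 0 - 0) with 0 by ring; rewrite Rabs_R0; apply Rmult_le_pos; [apply pos_INR|nra]|intros j Hj; destruct (U j Hj) as [_ ->]; ring]].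
  all: intros j Hj; destruct (U j Hj) as [U1 U2]; destruct (U' j Hj) as [U1' U2']; simpl; rewrite U2, U2', Rminus_diag, Rabs_R0; split; [|nra].
  all: destruct HA as [HA _]; destruct (HA j Hj) as [HA1 _].
  all: assert (Hchi : Rabs (chi w' - chi w) <= a) by (apply Rabs_le_iff; unfold chi, Rmax, Rmin; repeat destruct (Rle_dec _ _); lra).
  all: replace (chi w' * hx (A0 w') j - chi w * hx (A0 w) j) with ((chi w' - chi w) * hx (A0 w') j + chi w * (hx (A0 w') j - hx (A0 w) j)) by ring.
  all: pose proof (Rabs_mult_le _ _ _ _ Hchi U1').
  all: assert (Rabs (chi w * (hx (A0 w') j - hx (A0 w) j)) <= 1 * (wC n * a)) by (apply Rabs_mult_le; auto; pose proof (chi_range w); apply Rabs_le_iff; lra).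
  all: eapply Rle_trans; [apply Rabs_triang|]; lra.
Qed.

Lemma Alev_lip w w' a : in_walls n w -> in_walls n w' -> 0 <= a -> cl (S n) w w' a ->
  hle n (Alev w) (Alev w') (256 * (wC n + 4 * wK n) * (L / INR N) * a).
Proof.
  intros HJ HJ' Ha Hc. unfold Alev. apply hle_ltr.
  replace (256 * (wC n + 4 * wK n) * (L / INR N) * a) with (Rabs lam * ((wC n + 4 * wK n) * a)).
  - apply hle_dil, A1_lip; auto.
  - pose proof NN_ge. rewrite Rabs_pos_eq by (left; apply lam_pos). unfold lam, NN. field. lra.
Qed.

Definition kap : R := INR N / (INR N - 6).
Definition boxN (x : pt) : pt := fun i => match i with O => INR N * INR N * (x O + 1) / 2 | S j => INR N * (x (S j) + 1) / 2 end.
(** One formula for the collapse on the whole boundary of the cube: on the bottom face it is the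
    truncated radius of [vv], and on all other faces it is 1, where everything goes to the base
    point. *)
Definition mhat (x : pt) : R := Rmin 1 (kap * rmaxabs n (ptail x) + (x O + 1)).
Definition colhat (x : pt) : pt := Vcol (fun j => kap * x (S j)) (mhat x).

Lemma Alev_base w : hle n (A1 w) hzero 0 -> hle n (Alev w) g 0.
Proof.
  intros H. unfold Alev. apply (hle_l0 n _ (hmul n g hzero)); [lra| |].
  - apply hle_ltr. apply (hle_l0 n _ (hdil lam hzero)); [lra| |apply hdil_hzero].
    replace 0 with (Rabs lam * 0) by ring. apply hle_dil; auto.
  - apply hle0_eq; simpl; [intros; lra|]. rewrite rsum_zero by (intros; ring). ring.
Qed.

(** On the boundary of the box only the bottom face carries [al], through the wrapping: [sq]
    vanishes at the top and the cut-off trivialises the sides. The restriction is thus not [al]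
    itself but [al] after a collapse, which is why a collar is needed. *)
Lemma Alev_box x : bdC (S n) x -> hle n (Alev (boxN x)) (al (lam0 (S n) (colhat x))) 0.
Proof.
  intros Hx. pose proof NN_ge as HNN. pose proof lam_pos as Hlam.
  assert (Hk : 1 <= kap) by (unfold kap; apply (Rmult_le_reg_r (INR N - 6)); [lra|]; unfold Rdiv; rewrite Rmult_assoc, Rinv_l; lra).
  assert (Hm0 := mx_nonneg n (ptail x)).
  assert (Hb : forall i, (i < S n)%nat -> -1 <= x i <= 1) by (apply mx_le_inv; unfold bdC in Hx; lra).
  assert (Hbase : mhat x = 1 -> hle n (A1 (boxN x)) hzero 0 -> hle n (Alev (boxN x)) (al (lam0 (S n) (colhat x))) 0).
  { intros Em H. apply (hle_l0 n _ g); [lra|apply Alev_base; auto|]. apply hle_sym. unfold colhat. rewrite Em. apply al_base. }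
  destruct (mx_attained (S n) x) as [i [Hi Ei]]; [lia|]. unfold bdC in Hx. rewrite Hx in Ei.
  assert (Hflat : forall u q, hle n (fsl u q) hzero 0 -> tdist (boxN x) = 0 -> A0 (boxN x) = fsl u q -> hle n (A1 (boxN x)) hzero 0).
  { intros u q H _ E. unfold A1. rewrite E. clear E. set (z := fsl u q) in *. clearbody z. destruct (hle0_inv _ _ _ H) as [U V]. apply hle0_eq; simpl; auto.
    intros j Hj. destruct (U j Hj) as [-> ->]. simpl. split; ring. }
  destruct (classic (exists j, (j < n)%nat /\ Rabs (x (S j)) = 1)) as [[j [Hj Ej]]|Hside].
  - assert (Hmx : 1 <= rmaxabs n (ptail x)) by (rewrite <- Ej; apply (mx_ge n (ptail x) j Hj)).
    apply Hbase.
    + unfold mhat. apply Rmin_left. specialize (Hb O ltac:(lia)). nra.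
    + assert (Hsd : sdist (boxN x) <= 0).
      { eapply Rle_trans; [apply (rmin_term n _ _ j Hj)|]. simpl. unfold Rabs in Ej. destruct (Rcase_abs (x (S j))).
        - eapply Rle_trans; [apply Rmin_l|]. replace (x (S j)) with (-1) by lra. lra.
        - eapply Rle_trans; [apply Rmin_r|]. replace (x (S j)) with 1 by lra. lra. }
      destruct (A0_flat (boxN x) ltac:(lra)) as [U V]. apply hle0_eq; simpl; auto.
      intros i' Hi'. destruct (U i' Hi') as [_ ->]. unfold chi. rewrite Rmin_right, Rmax_left by lra. split; ring.
  - destruct i as [|j]; [|exfalso; apply Hside; exists j; split; [lia|auto]].
    assert (Ht : forall z, boxN x O = IZR z -> tdist (boxN x) = 0 /\ A0 (boxN x) = fsl (ptail (boxN x)) z).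
    { intros z E. assert (Et : tdist (boxN x) = 0) by (unfold tdist; rewrite E; apply dz_IZR). split; auto.
      unfold A0, Aext. destruct (Req_EM_T (tdist (boxN x)) 0); [|lra]. f_equal. rewrite E. apply Int_part_unique. lra. }
    unfold Rabs in Ei. destruct (Rcase_abs (x O)) as [C|C].
    + assert (Ex : x O = -1) by lra.
      destruct (Ht 0%Z) as [Et EA]; [simpl; rewrite Ex; lra|].
      assert (Emh : mhat x = Rmin 1 (rmaxabs n (vv (ptail (boxN x))))).
      { unfold mhat. rewrite Ex. replace (kap * rmaxabs n (ptail x) + (-1 + 1)) with (Rabs kap * rmaxabs n (ptail x)) by (rewrite Rabs_pos_eq; lra).
        rewrite <- mx_scal. f_equal. apply mx_ext. intros i' Hi'. f_equal. unfold vv, ptail, boxN, kap. field. lra. }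
      assert (Ecol : hle n (al (lam0 (S n) (colhat x))) (aV (ptail (boxN x))) 0).
      { assert (Hcl : cl (S n) (colhat x) (Vcol (vv (ptail (boxN x))) (Rmin 1 (rmaxabs n (vv (ptail (boxN x)))))) 0).
        { intros i' Hi'. unfold colhat. rewrite Emh. destruct i' as [|i']; simpl; [rewrite Rminus_diag, Rabs_R0; lra|].
          match goal with |- Rabs (?a * ?b - ?a * ?c) <= 0 => replace b with c; [rewrite Rminus_diag, Rabs_R0; lra|] end.
          unfold vv, ptail, boxN, kap. field. lra. }
        assert (Hbig : / 16 <= rmaxabs (S n) (colhat x)).
        { pose proof (mx_cl _ _ _ _ Hcl (Rle_refl 0)) as Q. apply Rabs_le_iff in Q. pose proof (Vcol_big (vv (ptail (boxN x))) _ eq_refl). lra. }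
        replace 0 with (L * (2 / / 16 * 0)) by ring. unfold aV. apply Hal; [apply lam0_bd; lra|apply aV_bd|lra|].
        apply lam0_lip; auto; try lra. apply (Vcol_big _ _ eq_refl). }
      apply (hle_r0 n _ (aV (ptail (boxN x)))); [lra| |apply hle_sym; auto].
      assert (EA1 : hle n (A1 (boxN x)) (fsl (ptail (boxN x)) 0) 0).
      { destruct (Rle_dec 1 (sdist (boxN x))) as [D|D]; [rewrite <- EA; apply A1_same; auto|].
        destruct (A0_flat (boxN x) ltac:(lra)) as [_ _]. 
        assert (Hz : hle n (fsl (ptail (boxN x)) 0) hzero 0).
        { destruct (rmin_lt n (fun i => Rmin (boxN x (S i)) (INR N - boxN x (S i))) (INR N) 1) as [A|[i' [Hi' A]]]; [unfold sdist in D; lra|lra|].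
          apply (fsl_flat _ _ i' Hi'). unfold ptail. unfold Rmin in A. destruct (Rle_dec _ _) in A; lra. }
        apply (hle_r0 n _ hzero); [lra| |apply hle_sym; auto]. apply (Hflat _ _ Hz Et EA). }
      unfold Alev. apply (hle_l0 n _ (hmul n g (hdil lam (fsl (ptail (boxN x)) 0)))); [lra| |].
      { apply hle_ltr. replace 0 with (Rabs lam * 0) by ring. apply hle_dil; auto. }
      apply (hle_l0 n _ (hmul n g (hmul n (hinv n g) (aV (ptail (boxN x)))))); [lra| |apply hle_ltr_inv].
      apply hle_ltr. unfold fsl.
      replace (sq 0) with 1 by (unfold sq; rewrite Rdiv_0_l, Rminus_0_r, Rmin_left, Rmax_right; lra).
      apply (hle_l0 n _ (hdil lam (hdil (/ lam) (hmul n (hinv n g) (aV (ptail (boxN x))))))); [lra| |apply hdil_dil; field; lra].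
      replace 0 with (Rabs lam * 0) by ring. apply hle_dil. apply hle0_eq; simpl; [intros; split; ring|ring].
    + assert (Ex : x O = 1) by lra.
      destruct (Ht (Z.of_nat (N * N))) as [Et EA]; [simpl; rewrite Ex, <- INR_IZR_INZ, mult_INR; lra|].
      apply Hbase; [unfold mhat; apply Rmin_left; nra|].
      apply (Hflat _ _) with (2 := Et) (3 := EA). unfold fsl.
      replace (sq (Z.of_nat (N * N))) with 0; [apply hle0_eq; simpl; [intros; split; ring|ring]|].
      unfold sq. rewrite <- INR_IZR_INZ, mult_INR. replace (INR N * INR N / (INR N * INR N)) with 1 by (field; lra).
      rewrite Rmin_right, Rmax_left; lra.
Qed.
End Level.

(* Straight homotopy from the identity of the boundary of the cube to the collapse that
   the walls construction realises. *)
Definition Gcol (n N : nat) (th : R) (x : pt) : pt := fun i => (1 - th) * x i + th * colhat n N x i.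

(** * The collar homotopy *)

Section Collar.
Variables (n N : nat).
Hypothesis Hn : (1 <= n)%nat.
Hypothesis HN : (12 <= N)%nat.

Lemma kap_bounds : 1 <= kap N <= 2.
Proof.
  pose proof (NN_ge N HN). assert (0 < / (INR N - 6)) by (apply Rinv_0_lt_compat; lra). unfold kap.
  split; apply (Rmult_le_reg_r (INR N - 6)); try lra; unfold Rdiv; rewrite Rmult_assoc, Rinv_l; lra.
Qed.

Lemma mhat_range x : bdC (S n) x -> 0 <= mhat n N x <= 1.
Proof.
  intros Hx. pose proof kap_bounds. assert (-1 <= x O <= 1) by (apply (mx_le_inv (S n)); [unfold bdC in Hx; lra|lia]).
  pose proof (mx_nonneg n (ptail x)). unfold mhat. split; [|apply Rmin_l]. apply Rmin_glb; [lra|]. nra.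
Qed.

(** The segment from a boundary point to its collapse must miss the origin in order to be projected
    radially. The coordinates other than 0 are all scaled by the same nonnegative factor, and where
    they become small, coordinate 0 stays away from 0. *)
Lemma Gcol_big th x : bdC (S n) x -> 0 <= th <= 1 -> / 32 <= rmaxabs (S n) (Gcol n N th x).
Proof.
  intros Hx Hth. pose proof kap_bounds as Hk. pose proof (mhat_range x Hx) as Hm.
  assert (B0 : -1 <= x O <= 1) by (apply (mx_le_inv (S n)); [unfold bdC in Hx; lra|lia]).
  set (q := rmaxabs n (ptail x)). pose proof (mx_nonneg n (ptail x)) as Hq. fold q in Hq.
  unfold bdC in Hx. rewrite mx_Sl in Hx. change (fun i => x (S i)) with (ptail x) in Hx. fold q in Hx.
  rewrite mx_Sl. set (m := mhat n N x) in *. assert (Em : m = Rmin 1 (kap N * q + (x O + 1))) by reflexivity.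
  set (f := (1 - th) + th * ((1 - m) * kap N)).
  assert (E' : rmaxabs n (fun i => Gcol n N th x (S i)) = f * q).
  { rewrite (mx_ext n _ (fun i => f * ptail x i)).
    - rewrite mx_scal, Rabs_pos_eq; [reflexivity|]. unfold f. assert (0 <= th * ((1 - m) * kap N)) by (apply Rmult_le_pos; [|apply Rmult_le_pos]; lra). lra.
    - intros i Hi. f_equal. unfold Gcol, colhat, Vcol, ptail, f. fold m. ring. }
  rewrite E'. assert (E0 : Gcol n N th x O = (1 - th) * x O + th * (2 * m - 1)) by reflexivity. rewrite E0. clear E0 E'.
  assert (Ff : 1 - th + th * (1 - m) <= f) by (assert (0 <= th * (1 - m) * (kap N - 1)) by (apply Rmult_le_pos; [apply Rmult_le_pos|]; lra); unfold f; lra).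
  assert (c0 : forall a, / 32 <= Rabs a -> / 32 <= Rmax (Rabs a) (f * q)) by (intros a Ha; eapply Rle_trans; [exact Ha|apply Rmax_l]).
  assert (c1 : forall a, / 32 <= f * q -> / 32 <= Rmax (Rabs a) (f * q)) by (intros a Ha; eapply Rle_trans; [exact Ha|apply Rmax_r]).
  destruct (Req_dec q 1) as [Q1|Q1].
  - assert (M1 : m = 1) by (rewrite Em, Q1; apply Rmin_left; lra). rewrite M1 in Ff |- *.
    destruct (Rle_dec th (/ 2 + / 8)); [apply c1; rewrite Q1; lra|apply c0].
    assert (- (1 - th) <= (1 - th) * x O) by nra. rewrite Rabs_pos_eq; lra.
  - assert (A0 : Rabs (x O) = 1) by (unfold Rmax in Hx; destruct (Rle_dec _ _); lra).
    destruct (Rle_dec 0 (x O)) as [P|P].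
    + assert (x O = 1) as E by (rewrite Rabs_pos_eq in A0; lra). assert (M1 : m = 1) by (rewrite Em, E; apply Rmin_left; nra).
      apply c0. rewrite M1, E, Rabs_pos_eq; lra.
    + assert (x O = -1) as E by (rewrite Rabs_left in A0; lra). rewrite E in *.
      destruct (Rle_dec m (/ 4)); [assert (0 <= th * (/ 4 - m)) by (apply Rmult_le_pos; lra); apply c0; rewrite Rabs_left1; lra|].
      assert (m <= kap N * q) by (rewrite Em at 1; eapply Rle_trans; [apply Rmin_r|lra]). assert (/ 8 <= q) by nra.
      assert (0 <= th * (1 - m)) by (apply Rmult_le_pos; lra).
      destruct (Rle_dec th (3 / 4)); [apply c1; nra|]. destruct (Rle_dec m (3 / 4)); [apply c1; assert (/ 4 * th <= th * (1 - m)) by nra; nra|].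
      assert (9 / 16 <= th * m) by nra. apply c0. rewrite Rabs_pos_eq; lra.
Qed.

Lemma colhat_cl x y a : bdC (S n) x -> bdC (S n) y -> 0 <= a -> cl (S n) x y a -> cl (S n) (colhat n N x) (colhat n N y) (8 * a).
Proof.
  intros Hx Hy Ha C. pose proof kap_bounds as Hk. pose proof (mhat_range x Hx) as Mx. pose proof (mhat_range y Hy) as My.
  assert (Bx := mx_le_inv (S n) x 1 ltac:(unfold bdC in Hx; lra)).
  assert (Hm : Rabs (mhat n N x - mhat n N y) <= 3 * a).
  { assert (CT : Rabs (rmaxabs n (ptail x) - rmaxabs n (ptail y)) <= a) by (apply mx_cl; auto; intros i Hi; apply C; lia).
    assert (C0 := C O ltac:(lia)). apply Rabs_le_iff in CT, C0. unfold mhat.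
    assert (-2 * a <= kap N * (rmaxabs n (ptail x) - rmaxabs n (ptail y)) <= 2 * a) by nra.
    apply Rabs_le_iff. unfold Rmin. repeat destruct (Rle_dec _ _); lra. }
  intros [|i] Hi; simpl.
  - replace (2 * mhat n N x - 1 - (2 * mhat n N y - 1)) with (2 * (mhat n N x - mhat n N y)) by ring. rewrite Rabs_mult, (Rabs_pos_eq 2) by lra. lra.
  - specialize (C (S i) Hi). specialize (Bx (S i) Hi).
    replace ((1 - mhat n N x) * (kap N * x (S i)) - (1 - mhat n N y) * (kap N * y (S i))) with
      (- (mhat n N x - mhat n N y) * (kap N * x (S i)) + (1 - mhat n N y) * (kap N * (x (S i) - y (S i)))) by ring.
    eapply Rle_trans; [apply Rabs_triang|]. replace (8 * a) with (3 * a * (2 * 1) + 1 * (2 * a)) by ring.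
    apply Rplus_le_compat; repeat apply Rabs_mult_le; auto; rewrite ?Rabs_Ropp; auto; apply Rabs_le_iff; lra.
Qed.

Lemma Gcol_cl th th' x y a b : bdC (S n) x -> bdC (S n) y -> 0 <= a -> cl (S n) x y a -> 0 <= th <= 1 -> Rabs (th - th') <= b ->
  cl (S n) (Gcol n N th x) (Gcol n N th' y) (8 * a + 3 * b).
Proof.
  intros Hx Hy Ha C Hth Hb i Hi. pose proof (colhat_cl x y a Hx Hy Ha C i Hi) as CC. specialize (C i Hi).
  assert (Ky : Rabs (colhat n N y i - y i) <= 3).
  { pose proof kap_bounds. pose proof (mhat_range y Hy). assert (By := mx_le_inv (S n) y 1 ltac:(unfold bdC in Hy; lra)).
    apply Rabs_le_iff. pose proof (By i Hi). destruct i as [|i]; simpl; [lra|].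
    assert (-1 <= (1 - mhat n N y) * y (S i) <= 1) by nra.
    replace ((1 - mhat n N y) * (kap N * y (S i))) with (kap N * ((1 - mhat n N y) * y (S i))) by ring. nra. }
  unfold Gcol. replace ((1 - th) * x i + th * colhat n N x i - ((1 - th') * y i + th' * colhat n N y i)) with
    ((1 - th) * (x i - y i) + th * (colhat n N x i - colhat n N y i) + (th - th') * (colhat n N y i - y i)) by ring.
  eapply Rle_trans; [apply Rabs_triang|]. apply Rplus_le_compat; [|rewrite Rmult_comm; rewrite (Rmult_comm 3); rewrite Rmult_comm; apply Rabs_mult_le; auto].
  apply Rabs_le_iff in C, CC. apply Rabs_le_iff. nra.
Qed.
End Collar.

(** * Continuity and compactness *)

Definition sc (d : nat) (A : pt -> Prop) (g : pt -> R) : Prop :=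
  forall x, A x -> forall e, e > 0 -> exists del, del > 0 /\ forall y, A y -> cl d x y del -> Rabs (g x - g y) < e.
Definition vc (d : nat) (A : pt -> Prop) (e : nat) (f : pt -> pt) : Prop :=
  forall i, (i < e)%nat -> sc d A (fun x => f x i).

Section ScalarContinuity.
Variables (d : nat) (A : pt -> Prop).

Lemma sc_const c : sc d A (fun _ => c).
Proof. intros x _ e He. exists 1. split; [lra|]. intros. rewrite Rminus_diag, Rabs_R0. lra. Qed.

Lemma sc_coord i : (i < d)%nat -> sc d A (fun x => x i).
Proof. intros Hi x _ e He. exists (e / 2). split; [lra|]. intros y _ H. specialize (H i Hi). lra. Qed.

Lemma sc_ext g h : (forall x, A x -> g x = h x) -> sc d A g -> sc d A h.
Proof.
  intros E H x Hx e He. destruct (H x Hx e He) as [dl [Hd K]]. exists dl. split; auto.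
  intros y Hy Hc. rewrite <- !E by auto. auto.
Qed.

Lemma sc_plus g h : sc d A g -> sc d A h -> sc d A (fun x => g x + h x).
Proof.
  intros G H x Hx e He. destruct (G x Hx (e/2) ltac:(lra)) as [d1 [D1 K1]]. destruct (H x Hx (e/2) ltac:(lra)) as [d2 [D2 K2]].
  exists (Rmin d1 d2). split; [apply Rmin_glb_lt; auto|]. intros y Hy Hc.
  specialize (K1 y Hy (cl_mono _ _ _ _ _ Hc (Rmin_l _ _))). specialize (K2 y Hy (cl_mono _ _ _ _ _ Hc (Rmin_r _ _))).
  apply Rabs_def2 in K1, K2. apply Rabs_def1; lra.
Qed.

Lemma sc_comp (F : R -> R) g : (forall x, A x -> continuity_pt F (g x)) -> sc d A g -> sc d A (fun x => F (g x)).
Proof.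
  intros HF G x Hx e He. destruct (HF x Hx e He) as [al [Ha K]]. destruct (G x Hx al Ha) as [d1 [D1 K1]].
  exists d1. split; auto. intros y Hy Hc. specialize (K1 y Hy Hc).
  destruct (Req_dec (g y) (g x)) as [E|E]; [rewrite E, Rminus_diag, Rabs_R0; auto|].
  rewrite Rabs_minus_sym. apply (K (g y)). split; [split; [exact I|auto]|]. simpl. unfold Rdist. rewrite Rabs_minus_sym. auto.
Qed.

Lemma sc_scal c g : sc d A g -> sc d A (fun x => c * g x).
Proof. apply (sc_comp (fun r => c * r)). intros. apply derivable_continuous_pt. apply derivable_pt_scal, derivable_pt_id. Qed.

Lemma sc_opp g : sc d A g -> sc d A (fun x => - g x).
Proof. intros. apply (sc_ext (fun x => -1 * g x)); [intros; ring|]. now apply sc_scal. Qed.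

Lemma sc_minus g h : sc d A g -> sc d A h -> sc d A (fun x => g x - h x).
Proof. intros. apply sc_plus; auto. now apply sc_opp. Qed.

Lemma sc_mult g h : sc d A g -> sc d A h -> sc d A (fun x => g x * h x).
Proof.
  intros G H. apply (sc_ext (fun x => / 4 * (Rsqr (g x + h x) - Rsqr (g x - h x)))); [intros; unfold Rsqr; field|].
  apply sc_scal, sc_minus; apply (sc_comp Rsqr); try (intros; apply derivable_continuous_pt, derivable_pt_Rsqr).
  - now apply sc_plus.
  - now apply sc_minus.
Qed.

Lemma sc_abs g : sc d A g -> sc d A (fun x => Rabs (g x)).
Proof. apply (sc_comp Rabs). intros. apply Rcontinuity_abs. Qed.

Lemma sc_max g h : sc d A g -> sc d A h -> sc d A (fun x => Rmax (g x) (h x)).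
Proof.
  intros G H. apply (sc_ext (fun x => / 2 * ((g x + h x) + Rabs (g x - h x)))).
  - intros x _. unfold Rmax, Rabs. destruct (Rle_dec _ _), (Rcase_abs _); lra.
  - apply sc_scal, sc_plus; [now apply sc_plus|]. now apply sc_abs, sc_minus.
Qed.

Lemma sc_min g h : sc d A g -> sc d A h -> sc d A (fun x => Rmin (g x) (h x)).
Proof.
  intros G H. apply (sc_ext (fun x => / 2 * ((g x + h x) - Rabs (g x - h x)))).
  - intros x _. unfold Rmin, Rabs. destruct (Rle_dec _ _), (Rcase_abs _); lra.
  - apply sc_scal, sc_minus; [now apply sc_plus|]. now apply sc_abs, sc_minus.
Qed.

Lemma sc_div g h : (forall x, A x -> h x <> 0) -> sc d A g -> sc d A h -> sc d A (fun x => g x / h x).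
Proof.
  intros N G H. apply sc_mult; auto. apply (sc_comp Rinv); auto. intros x Hx.
  apply (continuity_pt_inv id); [apply derivable_continuous_pt, derivable_pt_id|]. apply N; auto.
Qed.

Lemma sc_sqrt g : (forall x, A x -> 0 <= g x) -> sc d A g -> sc d A (fun x => sqrt (g x)).
Proof. intros N. apply (sc_comp sqrt). intros. apply continuity_pt_sqrt. auto. Qed.

Lemma sc_rsum m (g : nat -> pt -> R) : (forall i, (i < m)%nat -> sc d A (g i)) -> sc d A (fun x => rsum m (fun i => g i x)).
Proof. induction m; simpl; intros H; [apply sc_const|]. apply (sc_plus (fun x => rsum m (fun i => g i x)) (g m)); auto. Qed.

Lemma sc_mx m (f : pt -> pt) : (forall i, (i < m)%nat -> sc d A (fun x => f x i)) -> sc d A (fun x => rmaxabs m (f x)).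
Proof. induction m; simpl; intros H; [apply sc_const|]. apply sc_max; [apply IHm; intros; apply H; lia|]. apply sc_abs, H; lia. Qed.

Lemma sc_pre (A' : pt -> Prop) d' g f : (forall x, A x -> A' (f x)) -> vc d A d' f -> sc d' A' g -> sc d A (fun x => g (f x)).
Proof.
  intros M F G x Hx e He. destruct (G (f x) (M x Hx) e He) as [dl [D K]].
  assert (P : forall m, (m <= d')%nat -> exists dd, dd > 0 /\ forall y, A y -> cl d x y dd -> cl m (f x) (f y) dl).
  { induction m; intros Hm.
    - exists 1. split; [lra|]. intros y _ _ i Hi. lia.
    - destruct (IHm ltac:(lia)) as [d1 [D1 K1]]. destruct (F m ltac:(lia) x Hx dl D) as [d2 [D2 K2]].
      exists (Rmin d1 d2). split; [apply Rmin_glb_lt; auto|]. intros y Hy Hc i Hi.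
      destruct (Nat.eq_dec i m) as [->|].
      + left. apply K2; auto. apply (cl_mono _ _ _ _ _ Hc (Rmin_r _ _)).
      + apply K1; auto; [|lia]. apply (cl_mono _ _ _ _ _ Hc (Rmin_l _ _)). }
  destruct (P d' (le_n _)) as [dd [DD KK]]. exists dd. split; auto.
Qed.

Lemma sc_glue (q : pt -> R) g : sc d A q -> sc d (fun x => A x /\ q x <= 0) g -> sc d (fun x => A x /\ 0 <= q x) g -> sc d A g.
Proof.
  intros Q G1 G2 x Hx e He. destruct (Rtotal_order (q x) 0) as [C|[C|C]].
  - destruct (G1 x ltac:(split; auto; lra) e He) as [d1 [D1 K1]]. destruct (Q x Hx (- q x) ltac:(lra)) as [d2 [D2 K2]].
    exists (Rmin d1 d2). split; [apply Rmin_glb_lt; auto|]. intros y Hy Hc.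
    specialize (K2 y Hy (cl_mono _ _ _ _ _ Hc (Rmin_r _ _))). apply Rabs_def2 in K2.
    apply K1; [split; auto; lra|]. apply (cl_mono _ _ _ _ _ Hc (Rmin_l _ _)).
  - destruct (G1 x ltac:(split; auto; lra) e He) as [d1 [D1 K1]]. destruct (G2 x ltac:(split; auto; lra) e He) as [d2 [D2 K2]].
    exists (Rmin d1 d2). split; [apply Rmin_glb_lt; auto|]. intros y Hy Hc.
    destruct (Rle_dec (q y) 0).
    + apply K1; [split; auto|]. apply (cl_mono _ _ _ _ _ Hc (Rmin_l _ _)).
    + apply K2; [split; auto; lra|]. apply (cl_mono _ _ _ _ _ Hc (Rmin_r _ _)).
  - destruct (G2 x ltac:(split; auto; lra) e He) as [d1 [D1 K1]]. destruct (Q x Hx (q x) ltac:(lra)) as [d2 [D2 K2]].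
    exists (Rmin d1 d2). split; [apply Rmin_glb_lt; auto|]. intros y Hy Hc.
    specialize (K2 y Hy (cl_mono _ _ _ _ _ Hc (Rmin_r _ _))). apply Rabs_def2 in K2.
    apply K1; [split; auto; lra|]. apply (cl_mono _ _ _ _ _ Hc (Rmin_l _ _)).
Qed.
End ScalarContinuity.

Lemma vc_ext d A e f g : (forall x, A x -> forall i, (i < e)%nat -> f x i = g x i) -> vc d A e f -> vc d A e g.
Proof. intros E F i Hi. apply (sc_ext d A (fun x => f x i)); auto. Qed.

Lemma vc_comp d A d' A' e f g : (forall x, A x -> A' (f x)) -> vc d A d' f -> vc d' A' e g -> vc d A e (fun x => g (f x)).
Proof. intros M F G i Hi. apply (sc_pre d A A' d' (fun y => g y i) f); auto. Qed.

Lemma vc_glue d A e (q : pt -> R) f : sc d A q -> vc d (fun x => A x /\ q x <= 0) e f -> vc d (fun x => A x /\ 0 <= q x) e f -> vc d A e f.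
Proof. intros Q F G i Hi. apply (sc_glue d A q); auto. Qed.

Lemma cl_of_dist_lt d x y a : dist d x y < a -> cl d x y a.
Proof. intros H. apply (cl_mono d x y (dist d x y)); [|lra]. apply dist_cl. lra. Qed.

Lemma vc_of_cont_on d e A f : cont_on d e A f -> vc d A e f.
Proof.
  intros H i Hi x Hx ep Hep. destruct (H x Hx ep Hep) as [dl [D K]].
  exists (dl / (INR d + 1)). pose proof (pos_INR d).
  assert (HD : dl / (INR d + 1) > 0) by (apply Rdiv_lt_0_compat; lra). split; auto.
  intros y Hy Hc.
  assert (L : dist d x y < dl).
  { eapply Rle_lt_trans; [apply cl_dist; [|exact Hc]; lra|]. 
    apply (Rmult_lt_reg_r (INR d + 1)); [lra|]. replace (INR d * (dl / (INR d + 1)) * (INR d + 1)) with (INR d * dl) by (field; lra). nra. }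
  specialize (K y Hy L). apply Rle_lt_trans with (dist e (f x) (f y)); [|exact K].
  apply (dist_cl e (f x) (f y)); [lra|auto].
Qed.

Lemma cont_on_of_vc d e A f : vc d A e f -> cont_on d e A f.
Proof.
  intros F x Hx ep Hep. pose proof (pos_INR e).
  assert (HP : ep / (INR e + 1) > 0) by (apply Rdiv_lt_0_compat; lra).
  assert (P : forall m, (m <= e)%nat -> exists dd, dd > 0 /\ forall y, A y -> cl d x y dd -> cl m (f x) (f y) (ep / (INR e + 1))).
  { induction m; intros Hm.
    - exists 1. split; [lra|]. intros y _ _ i Hi. lia.
    - destruct (IHm ltac:(lia)) as [d1 [D1 K1]]. destruct (F m ltac:(lia) x Hx _ HP) as [d2 [D2 K2]].
      exists (Rmin d1 d2). split; [apply Rmin_glb_lt; auto|]. intros y Hy Hc i Hi.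
      destruct (Nat.eq_dec i m) as [->|].
      + left. apply K2; auto. apply (cl_mono _ _ _ _ _ Hc (Rmin_r _ _)).
      + apply K1; auto; [|lia]. apply (cl_mono _ _ _ _ _ Hc (Rmin_l _ _)). }
  destruct (P e (le_n _)) as [dd [DD KK]]. exists dd. split; auto. intros y Hy Hd.
  eapply Rle_lt_trans; [apply cl_dist; [|apply (KK y Hy); apply cl_of_dist_lt; auto]; lra|].
  apply (Rmult_lt_reg_r (INR e + 1)); [lra|]. replace (INR e * (ep / (INR e + 1)) * (INR e + 1)) with (INR e * ep) by (field; lra). nra.
Qed.

(** * Compactness *)

Lemma inv_S_small e : 0 < e -> exists N, forall k, (N <= k)%nat -> / (INR k + 1) <= e.
Proof.
  intros He. destruct (INR_unbounded (/ e)) as [N HN]. exists N. intros k Hk.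
  assert (INR N <= INR k) by (apply le_INR; auto).
  rewrite <- (Rinv_inv e). apply Rinv_le_contravar; [now apply Rinv_0_lt_compat|lra].
Qed.

Lemma cluster_point d (u : nat -> pt) M : (forall m i, (i < d)%nat -> Rabs (u m i) <= M) ->
  exists l : pt, forall e N, 0 < e -> exists m, (N <= m)%nat /\ cl d (u m) l e.
Proof.
  induction d; intros H.
  - exists (fun _ => 0). intros e N _. exists N. split; auto. intros i Hi; lia.
  - destruct IHd as [l Hl]; [intros; apply H; lia|].
    assert (C : forall k, exists m, (k <= m)%nat /\ cl d (u m) l (/ (INR k + 1))).
    { intros k. apply Hl. apply Rinv_0_lt_compat. pose proof (pos_INR k). lra. }
    set (phi := fun k => proj1_sig (constructive_indefinite_description _ (C k))).
    assert (Hphi : forall k, (k <= phi k)%nat /\ cl d (u (phi k)) l (/ (INR k + 1))).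
    { intros k. unfold phi. destruct (constructive_indefinite_description _ (C k)); auto. }
    destruct (Bolzano_Weierstrass (fun k => u (phi k) d) (fun c => - M <= c <= M) (compact_P3 (- M) M)) as [c Hc].
    { intros k. apply Rabs_le_iff. apply H. lia. }
    exists (fun i => if Nat.eqb i d then c else l i). intros e N He.
    destruct (inv_S_small e He) as [K HK].
    destruct (Hc (fun x => Rabs (x - c) < e) (Nat.max N K)) as [p [Hp Vp]].
    { exists (mkposreal e He). intros x Hx. exact Hx. }
    destruct (Hphi p) as [P1 P2]. exists (phi p). split; [lia|]. intros i Hi.
    destruct (Nat.eqb_spec i d) as [->|]; [left; exact Vp|].
    eapply Rle_trans; [apply P2; lia|]. apply HK. lia.
Qed.

(* Points agree only up to their first [d] coordinates, hence the extra witness. *)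
Definition compactR (d : nat) (Q : pt -> Prop) : Prop :=
  (exists M, forall x, Q x -> forall i, (i < d)%nat -> Rabs (x i) <= M) /\
  (forall l, (forall e, 0 < e -> exists x, Q x /\ cl d x l e) -> exists l', Q l' /\ cl d l' l 0).

Lemma compact_cluster d Q (u : nat -> pt) : compactR d Q -> (forall k, Q (u k)) ->
  exists l, Q l /\ forall e N, 0 < e -> exists m, (N <= m)%nat /\ cl d (u m) l e.
Proof.
  intros [[M HM] HC] Hu. destruct (cluster_point d u M) as [l Hl]; [intros; apply HM; auto|].
  destruct (HC l) as [l' [Hl' E]].
  - intros e He. destruct (Hl e O He) as [m [_ Hm]]. exists (u m); auto.
  - exists l'. split; auto. intros e N He. destruct (Hl e N He) as [m [Hm K]]. exists m. split; auto.
    replace e with (e + 0) by lra. eapply cl_trans; [exact K|]. apply cl_sym; auto.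
Qed.

Lemma sc_uniform d Q g : compactR d Q -> sc d Q g -> forall e, e > 0 -> exists del, del > 0 /\
  forall x y, Q x -> Q y -> cl d x y del -> Rabs (g x - g y) < e.
Proof.
  intros HQ G e He. apply NNPP. intros HN.
  assert (C : forall k : nat, exists xy : pt * pt, Q (fst xy) /\ Q (snd xy) /\ cl d (fst xy) (snd xy) (/ (INR k + 1)) /\ e <= Rabs (g (fst xy) - g (snd xy))).
  { intros k. apply NNPP. intros HN'. apply HN. exists (/ (INR k + 1)). pose proof (pos_INR k). split; [apply Rinv_0_lt_compat; lra|].
    intros x y Hx Hy Hc. apply Rnot_le_lt. intros L. apply HN'. exists (x, y). auto. }
  set (u := fun k => proj1_sig (constructive_indefinite_description _ (C k))).
  assert (Hu : forall k, Q (fst (u k)) /\ Q (snd (u k)) /\ cl d (fst (u k)) (snd (u k)) (/ (INR k + 1)) /\ e <= Rabs (g (fst (u k)) - g (snd (u k)))).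
  { intros k. unfold u. destruct (constructive_indefinite_description _ (C k)); auto. }
  destruct (compact_cluster d Q (fun k => fst (u k)) HQ) as [l [Hl K]]; [intros k; apply Hu|].
  destruct (G l Hl (e / 2) ltac:(lra)) as [dl [D HD]].
  destruct (inv_S_small (dl / 2) ltac:(lra)) as [N HN2]. destruct (K (dl / 2) N ltac:(lra)) as [m [Hm Hc]].
  destruct (Hu m) as (U1 & U2 & U3 & U4). specialize (HN2 m Hm).
  assert (A1 : Rabs (g l - g (fst (u m))) < e / 2) by (apply HD; auto; apply cl_sym; apply (cl_mono _ _ _ _ _ Hc); lra).
  assert (A2 : Rabs (g l - g (snd (u m))) < e / 2).
  { apply HD; auto. apply cl_sym. replace dl with (dl / 2 + dl / 2) by lra.
    apply (cl_trans d _ (fst (u m))); [apply cl_sym; apply (cl_mono _ _ _ _ _ U3); lra|auto]. }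
  apply Rabs_def2 in A1, A2. assert (Rabs (g (fst (u m)) - g (snd (u m))) < e) by (apply Rabs_def1; lra). lra.
Qed.

Lemma sc_bounded d Q g : compactR d Q -> sc d Q g -> exists M, 0 < M /\ forall x, Q x -> Rabs (g x) <= M.
Proof.
  intros HQ G. apply NNPP. intros HN.
  assert (C : forall k : nat, exists x, Q x /\ INR k + 1 < Rabs (g x)).
  { intros k. apply NNPP. intros HN'. apply HN. exists (INR k + 1). pose proof (pos_INR k). split; [lra|].
    intros x Hx. apply Rnot_lt_le. intros L. apply HN'. exists x; auto. }
  set (u := fun k => proj1_sig (constructive_indefinite_description _ (C k))).
  assert (Hu : forall k, Q (u k) /\ INR k + 1 < Rabs (g (u k))).
  { intros k. unfold u. destruct (constructive_indefinite_description _ (C k)); auto. }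
  destruct (compact_cluster d Q u HQ) as [l [Hl K]]; [intros k; apply Hu|].
  destruct (G l Hl 1 ltac:(lra)) as [dl [D HD]].
  destruct (INR_unbounded (Rabs (g l))) as [N HN2]. destruct (K dl N ltac:(lra)) as [m [Hm Hc]].
  destruct (Hu m) as (U1 & U2). specialize (HD (u m) U1 (cl_sym _ _ _ _ Hc)). apply le_INR in Hm.
  pose proof (Rabs_triang (g l) (- (g l - g (u m)))) as T. rewrite Rabs_Ropp in T.
  replace (g l + - (g l - g (u m))) with (g (u m)) in T by ring. lra.
Qed.

Lemma sc_pos_lower d Q g : compactR d Q -> sc d Q g -> (forall x, Q x -> 0 < g x) -> exists m, 0 < m /\ forall x, Q x -> m <= g x.
Proof.
  intros HQ G HP. destruct (sc_bounded d Q (fun x => 1 / g x) HQ) as [M [HM K]].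
  - apply sc_div; auto; [|apply sc_const]. intros x Hx. specialize (HP x Hx). lra.
  - exists (/ M). split; [now apply Rinv_0_lt_compat|]. intros x Hx. specialize (K x Hx). specialize (HP x Hx).
    assert (0 < / g x) by now apply Rinv_0_lt_compat. rewrite Rdiv_1_l, Rabs_pos_eq in K by lra.
    rewrite <- (Rinv_inv (g x)). apply Rinv_le_contravar; auto.
Qed.

Lemma sc_quotient d K dY Y (q : pt -> pt) phi s : compactR d K -> vc d K dY q -> (forall t, K t -> Y (q t)) ->
  (forall y, Y y -> exists t, K t /\ q t = y) -> (forall y y', Y y -> Y y' -> cl dY y y' 0 -> y = y') ->
  sc d K phi -> (forall t, K t -> s (q t) = phi t) -> sc dY Y s.
Proof.
  intros HK Hq HY Honto Hsep Hphi Hs y Hy e He. apply NNPP. intros HN.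
  assert (C : forall k : nat, exists t, K t /\ cl dY y (q t) (/ (INR k + 1)) /\ e <= Rabs (s y - phi t)).
  { intros k. apply NNPP. intros HN'. apply HN. exists (/ (INR k + 1)). pose proof (pos_INR k). split; [apply Rinv_0_lt_compat; lra|].
    intros z Hz Hc. apply Rnot_le_lt. intros L. apply HN'. destruct (Honto z Hz) as [t [Ht E]]. exists t. rewrite <- Hs, E by auto. auto. }
  set (u := fun k => proj1_sig (constructive_indefinite_description _ (C k))).
  assert (Hu : forall k, K (u k) /\ cl dY y (q (u k)) (/ (INR k + 1)) /\ e <= Rabs (s y - phi (u k))).
  { intros k. unfold u. destruct (constructive_indefinite_description _ (C k)); auto. }
  destruct (compact_cluster d K u HK) as [l [Hl KK]]; [intros k; apply Hu|].
  assert (E : q l = y).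
  { apply Hsep; auto. intros i Hi. apply Rnot_lt_le. intros L. set (eta := Rabs (q l i - y i)) in *.
    destruct (Hq i Hi l Hl (eta / 2) ltac:(lra)) as [dl [D HD]].
    destruct (inv_S_small (eta / 4) ltac:(lra)) as [N HN2]. destruct (KK dl N ltac:(lra)) as [m [Hm Hc]].
    destruct (Hu m) as (U1 & U2 & _). specialize (HD (u m) U1 (cl_sym _ _ _ _ Hc)). specialize (U2 i Hi). specialize (HN2 m Hm).
    pose proof (Rabs_triang (q l i - q (u m) i) (- (y i - q (u m) i))) as T. rewrite Rabs_Ropp in T.
    replace (q l i - q (u m) i + - (y i - q (u m) i)) with (q l i - y i) in T by ring. fold eta in T. lra. }
  destruct (Hphi l Hl e He) as [dl [D HD]]. destruct (KK dl O ltac:(lra)) as [m [_ Hc]].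
  destruct (Hu m) as (U1 & _ & U3). specialize (HD (u m) U1 (cl_sym _ _ _ _ Hc)).
  rewrite <- Hs, E in HD by auto. lra.
Qed.

(* Inf-convolution: the values on [A] are kept, those off [A] are raised by [e], so
   that a steep enough cone at a point of [A] lies above none of the data. *)
Lemma lipschitz_approximation d Q (A : pt -> Prop) g L0 e : compactR d Q -> (exists x, Q x) -> (forall x, A x -> Q x) -> sc d Q g -> 0 < e -> 0 <= L0 ->
  (forall x y a, A x -> A y -> cl d x y a -> 0 <= a -> Rabs (g x - g y) <= L0 * a) ->
  exists h L, 0 <= L /\ (forall x y a, cl d x y a -> 0 <= a -> Rabs (h x - h y) <= L * a) /\
    (forall x, A x -> h x = g x) /\ (forall x, Q x -> Rabs (h x - g x) <= e).
Proof.
  intros HQ [x0 Hx0] HAQ G He HL0 HA.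
  destruct (sc_uniform d Q g HQ G e He) as [dl [Hdl HU]]. destruct (sc_bounded d Q g HQ G) as [M [HM HB]].
  set (L := L0 + 2 * M / dl).
  assert (HMd : 0 < 2 * M / dl) by (apply Rdiv_lt_0_compat; lra).
  set (phi := fun y => if excluded_middle_informative (A y) then g y else g y + e).
  assert (Hphi : forall y, g y <= phi y <= g y + e) by (intros y; unfold phi; destruct (excluded_middle_informative _); lra).
  set (nrm := fun x y : pt => rmaxabs d (fun i => x i - y i)).
  assert (Hn0 : forall x y, 0 <= nrm x y) by (intros; apply mx_nonneg).
  set (E := fun x r => exists y, Q y /\ r = - (phi y + L * nrm x y)).
  assert (HS : forall x, exists m, is_lub (E x) m).
  { intros x. destruct (completeness (E x)) as [m Hm].
    - exists M. intros r [y [Hy ->]]. specialize (HB y Hy). apply Rabs_le_iff in HB. destruct (Hphi y). specialize (Hn0 x y).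
      assert (0 <= L * nrm x y) by (apply Rmult_le_pos; unfold L; lra). lra.
    - exists (- (phi x0 + L * nrm x x0)). exists x0; auto.
    - exists m; auto. }
  set (h := fun x => - proj1_sig (constructive_indefinite_description _ (HS x))).
  assert (Hh1 : forall x y, Q y -> h x <= phi y + L * nrm x y).
  { intros x y Hy. unfold h. destruct (constructive_indefinite_description _ (HS x)) as [m Hm]. simpl. destruct Hm as [U _].
    assert (- (phi y + L * nrm x y) <= m) by (apply U; exists y; auto). lra. }
  assert (Hh2 : forall x b, (forall y, Q y -> b <= phi y + L * nrm x y) -> b <= h x).
  { intros x b Hb. unfold h. destruct (constructive_indefinite_description _ (HS x)) as [m Hm]. simpl. destruct Hm as [_ U].
    assert (m <= - b); [|lra]. apply U. intros r [y [Hy ->]]. specialize (Hb y Hy). lra. }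
  assert (Hnx : forall x, nrm x x = 0).
  { intros x. apply Rle_antisym; [|apply Hn0]. apply mx_le; [lra|]. intros. rewrite Rminus_diag, Rabs_R0. lra. }
  assert (Hfar : forall x y, Q x -> Q y -> g x - e <= phi y + L * nrm x y).
  { intros x y Hx Hy. destruct (Hphi y). destruct (Rle_dec (nrm x y) dl) as [C|C].
    - assert (Rabs (g x - g y) < e) as B by (apply HU; auto; intros i Hi; eapply Rle_trans; [apply (mx_ge d (fun i => x i - y i) i Hi)|exact C]).
      apply Rabs_def2 in B. specialize (Hn0 x y). assert (0 <= L * nrm x y) by (apply Rmult_le_pos; unfold L; lra). lra.
    - pose proof (HB x Hx) as B1. pose proof (HB y Hy) as B2. apply Rabs_le_iff in B1, B2.
      assert (2 * M <= L * nrm x y); [|lra]. apply Rle_trans with (2 * M / dl * dl); [right; field; lra|].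
      apply Rmult_le_compat; unfold L; lra. }
  exists h, L. split; [unfold L; lra|]. split; [|split].
  - assert (P : forall x y a, cl d x y a -> 0 <= a -> h x - L * a <= h y).
    { intros x y a Hc Ha. apply Hh2. intros z Hz. specialize (Hh1 x z Hz).
      assert (nrm x z <= nrm y z + a).
      { pose proof (mx_cl d (fun i => x i - z i) (fun i => y i - z i) a) as Q1. assert (cl d (fun i => x i - z i) (fun i => y i - z i) a) as Q2.
        { intros i Hi. replace (x i - z i - (y i - z i)) with (x i - y i) by ring. auto. }
        specialize (Q1 Q2 Ha). apply Rabs_le_iff in Q1. unfold nrm. lra. }
      assert (L * nrm x z <= L * (nrm y z + a)) by (apply Rmult_le_compat_l; unfold L; lra). lra. }
    intros x y a Hc Ha. pose proof (P x y a Hc Ha). pose proof (P y x a (cl_sym _ _ _ _ Hc) Ha). apply Rabs_le_iff. lra.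
  - intros x Hx. apply Rle_antisym.
    + specialize (Hh1 x x (HAQ x Hx)). rewrite Hnx in Hh1. unfold phi in Hh1. destruct (excluded_middle_informative _); [lra|contradiction].
    + apply Hh2. intros y Hy. unfold phi. destruct (excluded_middle_informative (A y)) as [Ay|Ay].
      * assert (B : Rabs (g x - g y) <= L0 * nrm x y) by (apply HA; auto; intros i Hi; apply (mx_ge d (fun i => x i - y i) i Hi)).
        apply Rabs_le_iff in B. specialize (Hn0 x y). assert (L0 * nrm x y <= L * nrm x y) by (apply Rmult_le_compat_r; unfold L; lra). lra.
      * specialize (Hfar x y (HAQ x Hx) Hy). unfold phi in Hfar. destruct (excluded_middle_informative (A y)); [contradiction|].
        destruct (Rle_dec (nrm x y) dl) as [C|C].
        -- assert (Rabs (g x - g y) < e) as B by (apply HU; auto; intros i Hi; eapply Rle_trans; [apply (mx_ge d (fun i => x i - y i) i Hi)|exact C]).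
           apply Rabs_def2 in B. specialize (Hn0 x y). assert (0 <= L * nrm x y) by (apply Rmult_le_pos; unfold L; lra). lra.
        -- pose proof (HB x (HAQ x Hx)) as B1. pose proof (HB y Hy) as B2. apply Rabs_le_iff in B1, B2.
           assert (2 * M <= L * nrm x y); [|lra]. apply Rle_trans with (2 * M / dl * dl); [right; field; lra|].
           apply Rmult_le_compat; unfold L; lra.
  - intros x Hx. apply Rabs_le_iff. split.
    + assert (g x - e <= h x); [|lra]. apply Hh2. intros y Hy. apply Hfar; auto.
    + specialize (Hh1 x x Hx). rewrite Hnx in Hh1. destruct (Hphi x). lra.
Qed.

(** * The pinch map *)

(** For quotients with a removable singularity on the zero set of [q]: a majorant that vanishes
    there replaces the formula. The case in mind is [qmap] at the centre of the cube. *)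
Lemma sc_vanish d A (q r f : pt -> R) : sc d A q -> (forall x, A x -> 0 <= q x) -> sc d A r -> (forall x, A x -> q x = 0 -> r x = 0) ->
  (forall x, A x -> Rabs (f x) <= r x) -> sc d (fun x => A x /\ 0 < q x) f -> sc d A f.
Proof.
  intros Q Q0 R R0 F G x Hx e He. destruct (Req_dec (q x) 0) as [E|E].
  - destruct (R x Hx e He) as [dl [D K]]. exists dl. split; auto. intros y Hy Hc. specialize (K y Hy Hc).
    pose proof (F x Hx) as Fx. pose proof (F y Hy) as Fy. rewrite (R0 x Hx E) in *.
    assert (f x = 0) as -> by (apply Rabs_le_iff in Fx; lra). apply Rabs_def2 in K. rewrite Rminus_0_l, Rabs_Ropp. lra.
  - specialize (Q0 x Hx). assert (P : 0 < q x) by lra.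
    destruct (G x (conj Hx P) e He) as [d1 [D1 K1]]. destruct (Q x Hx (q x) P) as [d2 [D2 K2]].
    exists (Rmin d1 d2). split; [apply Rmin_glb_lt; auto|]. intros y Hy Hc.
    specialize (K2 y Hy (cl_mono _ _ _ _ _ Hc (Rmin_r _ _))). apply Rabs_def2 in K2.
    apply K1; [split; auto; lra|]. apply (cl_mono _ _ _ _ _ Hc (Rmin_l _ _)).
Qed.

(** * The quotient map from the cube to the sphere *)

Lemma norm_sq d x : norm d x * norm d x = rsum d (fun i => x i ^ 2).
Proof. unfold norm. apply sqrt_sqrt. apply rsum_nonneg. intros; apply pow2_ge_0. Qed.

Lemma norm_ge0 d x : 0 <= norm d x.
Proof. apply sqrt_pos. Qed.

Lemma norm_mx d x : rmaxabs d x <= norm d x.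
Proof.
  apply mx_le; [apply norm_ge0|]. intros i Hi. unfold norm. rewrite <- sqrt_Rsqr_abs. apply sqrt_le_1_alt.
  rewrite Rsqr_pow2. exact (rsum_term_le d (fun i => x i ^ 2) i ltac:(intros; apply pow2_ge_0) Hi).
Qed.

Lemma norm_zero_iff d x : norm d x = 0 <-> rmaxabs d x = 0.
Proof.
  split; intros H.
  - pose proof (norm_mx d x). pose proof (mx_nonneg d x). lra.
  - assert (norm d x * norm d x = 0).
    { rewrite norm_sq. apply rsum_zero. intros i Hi. pose proof (mx_ge d x i Hi) as M. rewrite H in M. apply Rabs_le_iff in M. replace (x i) with 0 by lra. ring. }
    apply Rsqr_0_uniq. exact H0.
Qed.

Lemma sphere_ext n x y : sphere n x -> sphere n y -> cl (S n) x y 0 -> x = y.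
Proof.
  intros [_ X] [_ Y] H. apply functional_extensionality. intros i. destruct (Nat.lt_ge_cases i (S n)) as [L|L].
  - specialize (H i L). apply Rabs_le_iff in H. lra.
  - rewrite X, Y; auto.
Qed.

Lemma sphere_mx n y : sphere n y -> 0 < rmaxabs (S n) y <= 1.
Proof.
  intros [Y _]. pose proof (mx_nonneg (S n) y) as M0. split.
  - destruct (Req_dec (rmaxabs (S n) y) 0) as [E|E]; [|lra]. exfalso.
    apply norm_zero_iff in E. pose proof (norm_sq (S n) y) as N. rewrite E, Y in N. lra.
  - pose proof (norm_mx (S n) y). pose proof (norm_sq (S n) y) as N. rewrite Y in N. pose proof (norm_ge0 (S n) y). nra.
Qed.

Lemma bp_sphere n : sphere n bp.
Proof.
  split.
  - rewrite rsum_Sl. simpl. rewrite rsum_zero; [ring|intros; simpl; ring].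
  - intros [|i] H; [lia|reflexivity].
Qed.

Definition ucube (k : nat) (t : pt) : pt := fun i => if (i <? k)%nat then 2 * t i - 1 else 0.

Lemma ucube_mx k t : cube k t -> 0 <= rmaxabs k (ucube k t) <= 1.
Proof.
  intros H. split; [apply mx_nonneg|]. apply mx_le; [lra|]. intros i Hi. unfold ucube. rewrite (proj2 (Nat.ltb_lt i k) Hi).
  specialize (H i Hi). apply Rabs_le_iff. lra.
Qed.

Lemma qmap_0 k t : qmap k t O = cos (PI * rmaxabs k (ucube k t)).
Proof. reflexivity. Qed.

Lemma qmap_S k t i : qmap k t (S i) = if Req_EM_T (norm k (ucube k t)) 0 then 0 else sin (PI * rmaxabs k (ucube k t)) * ucube k t i / norm k (ucube k t).
Proof. reflexivity. Qed.

Lemma ucube_ext k t t' : (forall i, (i < k)%nat -> t i = t' i) -> ucube k t = ucube k t'.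
Proof.
  intros H. apply functional_extensionality. intros i. unfold ucube. destruct (i <? k)%nat eqn:E; auto.
  apply Nat.ltb_lt in E. rewrite H; auto.
Qed.

Lemma qmap_ext k t t' : (forall i, (i < k)%nat -> t i = t' i) -> qmap k t = qmap k t'.
Proof.
  intros H. apply functional_extensionality. intros [|i]; rewrite ?qmap_0, ?qmap_S, (ucube_ext k t t' H); reflexivity.
Qed.

Lemma qmap_sphere k t : sphere k (qmap k t).
Proof.
  split.
  - rewrite rsum_Sl, qmap_0. set (m := rmaxabs k (ucube k t)).
    rewrite (rsum_ext k _ (fun i => (if Req_EM_T (norm k (ucube k t)) 0 then 0 else sin (PI * m) / norm k (ucube k t)) ^ 2 * ucube k t i ^ 2)).
    + rewrite rsum_scal, <- norm_sq. destruct (Req_EM_T _ _) as [E|E].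
      * rewrite E. apply norm_zero_iff in E. unfold m. rewrite E, Rmult_0_r, cos_0. ring.
      * replace ((sin (PI * m) / norm k (ucube k t)) ^ 2 * (norm k (ucube k t) * norm k (ucube k t))) with (Rsqr (sin (PI * m))) by (unfold Rsqr; field; auto).
        rewrite <- Rsqr_pow2, Rplus_comm. apply sin2_cos2.
    + intros i Hi. rewrite qmap_S. fold m. destruct (Req_EM_T _ _) as [E|E]; [ring|field; auto].
  - intros [|i] Hi; [lia|]. rewrite qmap_S. destruct (Req_EM_T _ _) as [E|E]; auto.
    unfold ucube at 2. rewrite (proj2 (Nat.ltb_ge i k)) by lia. field. exact E.
Qed.

Lemma cube_bd_mx k t : cube k t -> (cube_bd k t <-> rmaxabs k (ucube k t) = 1).
Proof.
  intros H. split.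
  - intros [i [Hi E]]. apply Rle_antisym; [apply ucube_mx; auto|]. eapply Rle_trans; [|apply (mx_ge k (ucube k t) i Hi)].
    unfold ucube. rewrite (proj2 (Nat.ltb_lt i k) Hi). destruct E as [-> | ->].
    + rewrite Rabs_left1; lra.
    + rewrite Rabs_pos_eq; lra.
  - intros E. destruct k; [simpl in E; lra|]. destruct (mx_attained (S k) (ucube (S k) t)) as [i [Hi Ei]]; [lia|].
    exists i. split; auto. rewrite E in Ei. unfold ucube in Ei. rewrite (proj2 (Nat.ltb_lt i _) Hi) in Ei.
    unfold Rabs in Ei. destruct (Rcase_abs _) in Ei; lra.
Qed.

Lemma qmap_m1 k t : rmaxabs k (ucube k t) = 1 -> qmap k t = bp.
Proof.
  intros E. apply functional_extensionality. intros [|i].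
  - rewrite qmap_0, E, Rmult_1_r, cos_PI. reflexivity.
  - rewrite qmap_S, E, Rmult_1_r, sin_PI. simpl. destruct (Req_EM_T _ _) as [E'|E']; auto. field. exact E'.
Qed.

Lemma qmap_bd k t : cube k t -> cube_bd k t -> qmap k t = bp.
Proof. intros H B. apply qmap_m1, cube_bd_mx; auto. Qed.

Lemma sc_ucube_mx k A : sc k A (fun t => rmaxabs k (ucube k t)).
Proof.
  apply (sc_mx k A k (ucube k)). intros i Hi. unfold ucube. rewrite (proj2 (Nat.ltb_lt i k) Hi).
  apply sc_minus; [apply sc_scal, sc_coord; auto|apply sc_const].
Qed.

Lemma continuity_PI_sin : forall r, continuity_pt (fun m => sin (PI * m)) r.
Proof. intros r. apply (continuity_pt_comp (fun m => PI * m) sin); [apply derivable_continuous_pt, derivable_pt_scal, derivable_pt_id|apply continuity_sin]. Qed.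
Lemma continuity_PI_cos : forall r, continuity_pt (fun m => cos (PI * m)) r.
Proof. intros r. apply (continuity_pt_comp (fun m => PI * m) cos); [apply derivable_continuous_pt, derivable_pt_scal, derivable_pt_id|apply continuity_cos]. Qed.

Lemma norm_term d x i : (i < d)%nat -> Rabs (x i) <= norm d x.
Proof. intros Hi. eapply Rle_trans; [apply (mx_ge d x i Hi)|apply norm_mx]. Qed.

Lemma vc_qmap k A : vc k A (S k) (qmap k).
Proof.
  intros [|i] Hi.
  - apply (sc_ext _ _ (fun t => cos (PI * rmaxabs k (ucube k t)))); [reflexivity|].
    apply (sc_comp k A (fun m => cos (PI * m)) (fun t => rmaxabs k (ucube k t))); [intros; apply continuity_PI_cos|apply sc_ucube_mx].
  - apply (sc_vanish k A (fun t => rmaxabs k (ucube k t)) (fun t => Rabs (sin (PI * rmaxabs k (ucube k t))))).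
    + apply sc_ucube_mx.
    + intros; apply mx_nonneg.
    + apply sc_abs. apply (sc_comp k A (fun m => sin (PI * m)) (fun t => rmaxabs k (ucube k t))); [intros; apply continuity_PI_sin|apply sc_ucube_mx].
    + intros x _ E. rewrite E, Rmult_0_r, sin_0, Rabs_R0. reflexivity.
    + intros x _. rewrite qmap_S. destruct (Req_EM_T _ _) as [E|E]; [rewrite Rabs_R0; apply Rabs_pos|].
      unfold Rdiv. rewrite Rmult_assoc, Rabs_mult. rewrite <- (Rmult_1_r (Rabs (sin _))) at 2. apply Rmult_le_compat_l; [apply Rabs_pos|].
      pose proof (norm_ge0 k (ucube k x)). rewrite Rabs_mult, (Rabs_pos_eq (/ _)) by (left; apply Rinv_0_lt_compat; lra).
      apply (Rmult_le_reg_r (norm k (ucube k x))); [lra|]. rewrite Rmult_assoc, Rinv_l, Rmult_1_l, Rmult_1_r by lra.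
      apply norm_term. lia.
    + apply (sc_ext _ _ (fun t => sin (PI * rmaxabs k (ucube k t)) * ucube k t i / norm k (ucube k t))).
      * intros x [_ P]. rewrite qmap_S. destruct (Req_EM_T _ _) as [E|E]; [|reflexivity]. apply norm_zero_iff in E. lra.
      * apply sc_div.
        -- intros x [_ P] E. apply norm_zero_iff in E. lra.
        -- apply sc_mult.
           ++ apply (sc_comp k _ (fun m => sin (PI * m)) (fun t => rmaxabs k (ucube k t))); [intros; apply continuity_PI_sin|apply sc_ucube_mx].
           ++ unfold ucube. rewrite (proj2 (Nat.ltb_lt i k)) by lia. apply sc_minus; [apply sc_scal, sc_coord; lia|apply sc_const].
        -- unfold norm. apply sc_sqrt; [intros; apply rsum_nonneg; intros; apply pow2_ge_0|].
           apply (sc_rsum k _ k (fun i t => ucube k t i ^ 2)). intros j Hj. simpl.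
           assert (J : sc k (fun x => A x /\ 0 < rmaxabs k (ucube k x)) (fun t => ucube k t j)).
           { unfold ucube. rewrite (proj2 (Nat.ltb_lt j k) Hj). apply sc_minus; [apply sc_scal, sc_coord; lia|apply sc_const]. }
           apply sc_mult; auto. apply sc_mult; auto. apply sc_const.
Qed.

Lemma sphere_y0 n y : sphere n y -> -1 <= y O <= 1 /\ norm n (ptail y) * norm n (ptail y) = 1 - y O * y O.
Proof.
  intros Y. destruct (sphere_mx n y Y) as [_ M]. pose proof (mx_le_inv _ _ _ M O ltac:(lia)). split; auto.
  destruct Y as [Y _]. rewrite rsum_Sl in Y. rewrite norm_sq. unfold ptail. simpl in *. lra.
Qed.

Lemma qmap_onto n y : (1 <= n)%nat -> sphere n y -> exists t, cube n t /\ qmap n t = y.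
Proof.
  intros Hn Y. destruct (sphere_y0 n y Y) as [B Nt]. pose proof PI_RGT_0 as HPI.
  set (th := acos (y O)). assert (Hth : 0 <= th <= PI) by apply acos_bound.
  assert (Hcos : cos th = y O) by (apply cos_acos; auto).
  assert (Hsin : sin th = norm n (ptail y)).
  { pose proof (sin2_cos2 th) as SC. unfold Rsqr in SC. rewrite Hcos in SC.
    pose proof (sin_ge_0 th ltac:(lra) ltac:(lra)). pose proof (norm_ge0 n (ptail y)). nra. }
  set (m := th / PI). assert (Hm : 0 <= m <= 1).
  { unfold m. split; [apply Rmult_le_pos; [lra|left; now apply Rinv_0_lt_compat]|]. apply (Rmult_le_reg_r PI); auto. unfold Rdiv. rewrite Rmult_assoc, Rinv_l; lra. }
  assert (Em : PI * m = th) by (unfold m; field; lra).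
  destruct (Req_dec (rmaxabs n (ptail y)) 0) as [E|E].
  - assert (Nz : norm n (ptail y) = 0) by (apply norm_zero_iff; auto).
    assert (Yt : forall i, (i < n)%nat -> y (S i) = 0).
    { intros i Hi. pose proof (mx_ge n (ptail y) i Hi) as Q. rewrite E in Q. apply Rabs_le_iff in Q. unfold ptail in Q. lra. }
    destruct (Req_dec (y O) 1) as [E1|E1].
    + exists (fun _ => / 2). split; [intros i Hi; lra|]. apply (sphere_ext n); [apply qmap_sphere|auto|].
      assert (U0 : rmaxabs n (ucube n (fun _ => / 2)) = 0).
      { apply Rle_antisym; [|apply mx_nonneg]. apply mx_le; [lra|]. intros i Hi. unfold ucube. destruct (i <? n)%nat; apply Rabs_le_iff; lra. }
      intros [|i] Hi.
      * rewrite qmap_0, U0, Rmult_0_r, cos_0, E1, Rminus_diag, Rabs_R0. lra.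
      * rewrite qmap_S, Yt by lia. apply norm_zero_iff in U0. destruct (Req_EM_T _ _); [|contradiction]. rewrite Rminus_diag, Rabs_R0; lra.
    + assert (E2 : y O = -1) by (rewrite Nz in Nt; nra).
      exists (fun _ => 0). split; [intros i Hi; lra|]. rewrite qmap_bd; [|intros i Hi; lra|exists O; split; [lia|auto]].
      apply (sphere_ext n); [apply bp_sphere|auto|]. intros [|i] Hi; simpl; [rewrite E2|rewrite Yt by lia]; rewrite Rminus_diag, Rabs_R0; lra.
  - pose proof (mx_nonneg n (ptail y)) as M0. set (M := rmaxabs n (ptail y)) in *.
    set (t := fun i => (m * (y (S i) / M) + 1) / 2).
    assert (Ht : forall i, (i < n)%nat -> Rabs (y (S i) / M) <= 1).
    { intros i Hi. unfold Rdiv. rewrite Rabs_mult, (Rabs_pos_eq (/ M)) by (left; apply Rinv_0_lt_compat; lra).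
      apply (Rmult_le_reg_r M); [lra|]. rewrite Rmult_assoc, Rinv_l by lra. pose proof (mx_ge n (ptail y) i Hi) as Q. change (ptail y i) with (y (S i)) in Q. fold M in Q. lra. }
    assert (Hc : cube n t).
    { intros i Hi. specialize (Ht i Hi). apply Rabs_le_iff in Ht. unfold t. set (v := y (S i) / M) in *. assert (-1 <= m * v <= 1) by (split; nra). lra. }
    exists t. split; auto. apply (sphere_ext n); [apply qmap_sphere|auto|].
    assert (Eu : forall i, (i < n)%nat -> ucube n t i = (m / M) * ptail y i).
    { intros i Hi. unfold ucube. rewrite (proj2 (Nat.ltb_lt i n) Hi). unfold t, ptail. field. lra. }
    assert (P : 0 <= m / M) by (apply Rmult_le_pos; [lra|left; apply Rinv_0_lt_compat; lra]).
    assert (Umx : rmaxabs n (ucube n t) = m).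
    { rewrite (mx_ext n _ (fun i => (m / M) * ptail y i)) by (intros; rewrite Eu; auto). rewrite mx_scal, Rabs_pos_eq by auto. fold M. field. lra. }
    assert (Unm : norm n (ucube n t) = (m / M) * norm n (ptail y)).
    { unfold norm. rewrite (rsum_ext n _ (fun i => (m / M) ^ 2 * ptail y i ^ 2)) by (intros; rewrite Eu by auto; ring).
      rewrite rsum_scal, sqrt_mult_alt, sqrt_pow2 by (auto; apply pow2_ge_0). reflexivity. }
    intros [|i] Hi.
    + rewrite qmap_0, Umx, Em, Hcos, Rminus_diag, Rabs_R0. lra.
    + rewrite qmap_S, Umx, Em, Hsin, Eu, Unm by lia.
      assert (Nnz : norm n (ptail y) <> 0) by (intros Q; apply norm_zero_iff in Q; auto).
      destruct (Req_EM_T _ _) as [Q|Q].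
      * exfalso. apply Rmult_integral in Q. destruct Q as [Q|Q]; [|auto]. 
        assert (m = 0) by (replace m with (m / M * M) by (field; lra); rewrite Q; ring).
        rewrite <- Em, H, Rmult_0_r, sin_0 in Hsin. auto.
      * replace (norm n (ptail y) * (m / M * ptail y i) / (m / M * norm n (ptail y)) - y (S i)) with 0; [rewrite Rabs_R0; lra|].
        assert (m <> 0) by (intros Z; apply Q; rewrite Z; unfold Rdiv; ring). unfold ptail. field. auto.
Qed.

Lemma qmap_inj k t t' : cube k t -> cube k t' -> qmap k t = qmap k t' ->
  (forall i, (i < k)%nat -> t i = t' i) \/ (cube_bd k t /\ cube_bd k t').
Proof.
  intros H H' E. pose proof (ucube_mx k t H) as B. pose proof (ucube_mx k t' H') as B'. pose proof PI_RGT_0 as HPI.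
  assert (Em : rmaxabs k (ucube k t) = rmaxabs k (ucube k t')).
  { pose proof (f_equal (fun f => f O) E) as E0. cbv beta in E0. rewrite !qmap_0 in E0. apply cos_inj in E0; [|split; nra|split; nra].
    apply (Rmult_eq_reg_l PI); lra. }
  set (m := rmaxabs k (ucube k t)) in *.
  destruct (Req_dec m 1) as [E1|E1]; [right; rewrite !cube_bd_mx by auto; fold m; rewrite <- Em; auto|left].
  assert (Hu : forall i, (i < k)%nat -> ucube k t i = ucube k t' i).
  { intros i Hi. destruct (Req_dec m 0) as [E0|E0].
    - pose proof (mx_ge k (ucube k t) i Hi) as Q. pose proof (mx_ge k (ucube k t') i Hi) as Q'. fold m in Q. rewrite <- Em in Q'. rewrite E0 in Q, Q'.
      apply Rabs_le_iff in Q, Q'. lra.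
    - assert (Hs : 0 < sin (PI * m)) by (apply sin_gt_0; nra).
      set (r := norm k (ucube k t)). set (r' := norm k (ucube k t')).
      assert (Hr : 0 < r) by (pose proof (norm_mx k (ucube k t)); fold m r in H0; lra).
      assert (Hr' : 0 < r') by (pose proof (norm_mx k (ucube k t')); fold r' in H0; lra).
      assert (Ei : forall i, ucube k t i = (r / r') * ucube k t' i).
      { intros j. pose proof (f_equal (fun f => f (S j)) E) as Ej. cbv beta in Ej. rewrite !qmap_S in Ej. fold m r r' in Ej. rewrite <- Em in Ej.
        destruct (Req_EM_T r 0); [lra|]. destruct (Req_EM_T r' 0); [lra|].
        apply (Rmult_eq_reg_l (sin (PI * m) / r)); [|unfold Rdiv; apply Rmult_integral_contrapositive_currified; [lra|apply Rinv_neq_0_compat; lra]].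
        replace (sin (PI * m) / r * ucube k t j) with (sin (PI * m) * ucube k t j / r) by (field; lra). rewrite Ej. field. lra. }
      assert (Eq : m = r / r' * m).
      { unfold m at 1. rewrite (mx_ext k _ (fun i => (r / r') * ucube k t' i)) by (intros; rewrite Ei; auto). rewrite mx_scal, <- Em.
        rewrite Rabs_pos_eq; auto. apply Rmult_le_pos; [lra|left; now apply Rinv_0_lt_compat]. }
      rewrite Ei. assert (r / r' = 1) as -> by (apply (Rmult_eq_reg_r m); lra). ring. }
  intros i Hi. specialize (Hu i Hi). unfold ucube in Hu. rewrite (proj2 (Nat.ltb_lt i k) Hi) in Hu. lra.
Qed.

Lemma cube_compact k : compactR k (cube k).
Proof.
  split.
  - exists 1. intros x H i Hi. specialize (H i Hi). apply Rabs_le_iff. lra.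
  - intros l H. exists l. split; [|apply cl_refl; lra]. intros i Hi. split; apply Rnot_lt_le; intros C.
    + destruct (H (- l i / 2) ltac:(lra)) as [x [Hx Hc]]. specialize (Hx i Hi). specialize (Hc i Hi). apply Rabs_le_iff in Hc. lra.
    + destruct (H ((l i - 1) / 2) ltac:(lra)) as [x [Hx Hc]]. specialize (Hx i Hi). specialize (Hc i Hi). apply Rabs_le_iff in Hc. lra.
Qed.

Lemma concat_two (f1 f2 : pt -> pt) t : 0 <= t O <= 1 ->
  concat (f1 :: f2 :: nil) t = if Rlt_dec (t O) (/ 2) then f1 (fun i => match i with O => 2 * t O | S _ => t i end)
    else f2 (fun i => match i with O => 2 * t O - 1 | S _ => t i end).
Proof.
  intros H. unfold concat. change (length (f1 :: f2 :: nil)) with 2%nat. replace (INR 2) with 2 by (simpl; ring).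
  destruct (archimed (2 * t O)) as [A1 A2]. destruct (Rlt_dec (t O) (/ 2)) as [L|L].
  - assert (E : up (2 * t O) = 1%Z).
    { assert (0 < up (2 * t O))%Z by (apply lt_IZR; lra). assert (up (2 * t O) < 2)%Z by (apply lt_IZR; lra). lia. }
    unfold floorZ. rewrite E. simpl. f_equal. apply functional_extensionality. intros [|i]; simpl; lra.
  - assert (E : Nat.min (2 - 1) (Z.to_nat (floorZ (2 * t O))) = 1%nat).
    { assert (1 < up (2 * t O))%Z by (apply lt_IZR; lra). unfold floorZ. lia. }
    rewrite E. reflexivity.
Qed.

(** * Two half boxes and the maps into their complement *)

Definition sgn1 (s : R) : Prop := s = 1 \/ s = -1.

(* [cpt s] is the centre of the half box of sign [s]; away from both centres, space
   retracts onto the boundaries of the two half boxes. *)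
Definition cpt (s : R) : pt := fun i => if Nat.eqb i 1 then s / 2 else 0.
Definition U (n : nat) (u : pt) : Prop := forall s, sgn1 s -> ~ (forall i, (i < S n)%nat -> u i = cpt s i).

Definition tau (y : pt) : R := Rmax 0 (- y O).
(** A sphere of radius [/ 2] about the centre [cpt s], sheared by [tau] so that the base point goes
    to [bst] for both signs and the two images fit together on a wedge. Direction 1 is used because
    [qmap] sends the first cube coordinate, the one split by [concat], to coordinate 1. *)
Definition gmap (n : nat) (s : R) (y : pt) : pt :=
  fun i => if Nat.ltb i (S n) then (if Nat.eqb i 1 then s / 2 + y 1%nat / 2 - s * tau y / 2 else y i / 2) else 0.
Definition Tmap (s : R) (w : pt) : pt := fun i => if Nat.eqb i 1 then (w 1%nat + s) / 2 else w i.
Definition bst : pt := fun i => match i with O => -1 / 2 | _ => 0 end.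

Lemma U_ext n u v : (forall i, (i < S n)%nat -> u i = v i) -> U n u -> U n v.
Proof. intros E H s Hs K. apply (H s Hs). intros i Hi. rewrite E by auto. auto. Qed.

Lemma U_mx n u : U n u -> forall s, sgn1 s -> 0 < rmaxabs (S n) (fun i => u i - cpt s i).
Proof.
  intros H s Hs. destruct (Req_dec (rmaxabs (S n) (fun i => u i - cpt s i)) 0) as [E|E].
  - exfalso. apply (H s Hs). intros i Hi. pose proof (mx_ge (S n) (fun i => u i - cpt s i) i Hi) as Q. rewrite E in Q. cbv beta in Q. apply Rabs_le_iff in Q. lra.
  - pose proof (mx_nonneg (S n) (fun i => u i - cpt s i)). lra.
Qed.

Lemma U_of_mx1 n u : rmaxabs (S n) u = 1 -> U n u.
Proof.
  intros E s Hs K. assert (rmaxabs (S n) u <= / 2); [|lra]. apply mx_le; [lra|]. intros i Hi. rewrite K by auto.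
  unfold cpt. destruct (Nat.eqb i 1); [|rewrite Rabs_R0; lra]. destruct Hs as [-> | ->].
  - rewrite Rabs_pos_eq; lra.
  - rewrite Rabs_left1; lra.
Qed.

Lemma gmap_bp n s : gmap n s bp = bst.
Proof.
  apply functional_extensionality. intros i. unfold gmap, bst, tau. simpl bp. 
  destruct i as [|[|i]]; simpl.
  - field.
  - destruct (Nat.ltb 1 (S n)); [|reflexivity]. rewrite Rmax_right by lra. field.
  - destruct (Nat.ltb _ _); [field|reflexivity].
Qed.

Lemma sphere_nonzero n y : sphere n y -> (forall i, (i < S n)%nat -> y i = 0) -> False.
Proof. intros [Y _] H. rewrite rsum_zero in Y; [lra|]. intros i Hi. rewrite H by auto. ring. Qed.

Lemma lam0_in d y i : (i < d)%nat -> lam0 d y i = y i / rmaxabs d y.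
Proof. intros Hi. unfold lam0. now rewrite (proj2 (Nat.ltb_lt i d) Hi). Qed.

Lemma sgn_cases s s' : sgn1 s -> sgn1 s' -> s' = s \/ s' = - s.
Proof. intros [-> | ->] [-> | ->]; lra. Qed.

(** Every coordinate except 1 is a positive multiple of that of [y], so meeting a centre forces [y]
    to be a unit vector in direction 1, up to sign. There the segment is constant with coordinate 1
    equal to 0 or [s], whereas the centres have plus or minus [/ 2]. *)
Lemma gmap_Tmap_segment n s y th : sgn1 s -> sphere n y -> 0 <= th <= 1 ->
  U n (fun i => (1 - th) * gmap n s y i + th * Tmap s (lam0 (S n) y) i).
Proof.
  intros Hs Y Hth s' Hs' K. destruct (sphere_mx n y Y) as [M0 M1]. set (M := rmaxabs (S n) y) in *.
  set (a := (1 - th) / 2 + th * / M).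
  assert (IM : 1 <= / M) by (rewrite <- Rinv_1; apply Rinv_le_contravar; lra).
  assert (Ha : 0 < a) by (unfold a; nra).
  assert (Hoth : forall i, (i < S n)%nat -> i <> 1%nat -> y i = 0).
  { intros i Hi Hne. specialize (K i Hi). unfold gmap, Tmap, cpt in K. rewrite (proj2 (Nat.ltb_lt _ _) Hi), (proj2 (Nat.eqb_neq i 1) Hne), (lam0_in _ _ i Hi) in K. fold M in K.
    assert (a * y i = 0) by (rewrite <- K; unfold a; field; lra).
    apply Rmult_integral in H. destruct H; lra. }
  assert (Y0 : y O = 0) by (apply Hoth; lia).
  destruct (Nat.le_gt_cases 1 n) as [Hn|Hn].
  2:{ apply (sphere_nonzero n y Y). intros i Hi. apply Hoth; lia. }
  assert (K1 := K 1%nat ltac:(lia)). unfold gmap, Tmap, cpt in K1. rewrite lam0_in in K1 by lia. fold M in K1.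
  rewrite (proj2 (Nat.ltb_lt 1 (S n))) in K1 by lia. simpl in K1. unfold tau in K1. rewrite Y0, Ropp_0, Rmax_left in K1 by lra.
  set (b := (1 - th) / 2 + th * / M / 2). assert (Hb : 0 < b) by (unfold b; nra).
  assert (K2 : s / 2 + b * y 1%nat = s' / 2).
  { rewrite <- K1. unfold b. field. lra. }
  destruct (sgn_cases s s' Hs Hs') as [E|E]; subst s'.
  - assert (b * y 1%nat = 0) by lra. apply Rmult_integral in H. destruct H as [H|H]; [lra|].
    apply (sphere_nonzero n y Y). intros i Hi. destruct (Nat.eq_dec i 1) as [->|]; auto.
  - assert (Yq : y 1%nat * y 1%nat = 1).
    { destruct Y as [Y _]. destruct n; [lia|]. rewrite !rsum_Sl in Y. rewrite rsum_zero in Y.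
      - rewrite Y0 in Y. lra.
      - intros i Hi. rewrite Hoth by lia. ring. }
    assert (EM : M = 1).
    { apply Rle_antisym; auto. pose proof (mx_ge (S n) y 1 ltac:(lia)) as Q. fold M in Q.
      assert (1 <= Rabs (y 1%nat)); [|lra]. rewrite <- (Rabs_pos_eq 1) by lra. apply Rsqr_le_abs_0. unfold Rsqr. lra. }
    unfold b in K2. rewrite EM, Rinv_1 in K2.
    assert (y 1%nat = -1 * (2 * s)) by lra.
    assert (s * s = 1) by (destruct Hs as [-> | ->]; ring). rewrite H in Yq. nra.
Qed.

Lemma gmap_U n s y : sgn1 s -> sphere n y -> U n (gmap n s y).
Proof.
  intros Hs Y. apply (U_ext n (fun i => (1 - 0) * gmap n s y i + 0 * Tmap s (lam0 (S n) y) i)); [intros; ring|].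
  apply gmap_Tmap_segment; auto; lra.
Qed.

(* The planar case: [C] and [S] are the cosine and sine of the angle of the outer point,
   which the pinch doubles. *)
Lemma planar_segment C S mu th : C * C + S * S = 1 -> 0 <= S -> 1 <= mu -> 0 <= th <= 1 ->
  (1 - th) * ((1 - 2 * (C * C)) / 2) + th * (mu * C) = 0 ->
  forall v, (1 - th) * (/ 2 - S * C - Rmax 0 (2 * (C * C) - 1) / 2) + th * (mu * S) = v -> v <> / 2 /\ v <> - / 2.
Proof.
  intros HCS HS Hmu Hth E0 v E1.
  assert (P1 : 0 <= (S - C) * (S - C)) by apply Rle_0_sqr. assert (P2 : 0 <= (S + C) * (S + C)) by apply Rle_0_sqr.
  set (ta := Rmax 0 (2 * (C * C) - 1)) in *.
  assert (Hta : 0 <= ta <= 1) by (unfold ta; split; [apply Rmax_l|apply Rmax_lub; nra]).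
  split; intros Ev; subst v.
  - assert (E2 : (1 - th) * (2 * S * C + ta) = th * (2 * mu * S - 1)) by lra.
    destruct (Rlt_dec 0 C) as [HC|HC].
    + assert (HmC : 0 <= th * (mu * C)) by (repeat apply Rmult_le_pos; lra).
      destruct (Rle_dec (2 * (C * C) - 1) 0) as [Q|Q].
      * unfold ta in *. rewrite Rmax_left in * by auto.
        assert (Z1 : 0 <= (1 - th) * ((1 - 2 * (C * C)) / 2)) by (apply Rmult_le_pos; lra).
        assert (Z2 : th * (mu * C) = 0) by lra. assert (0 < mu * C) by nra. assert (th = 0) by nra. subst th.
        assert (S * C = 0) by lra. assert (S = 0) by nra. subst S. nra.
      * assert (Et : ta = 2 * (C * C) - 1) by (unfold ta; apply Rmax_right; lra).
        assert (E3 : th * (2 * mu * C) = (1 - th) * ta) by (rewrite Et; lra).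
        assert (HSC : S < C) by nra.
        assert (E4 : (1 - th) * (2 * S * C) + th * (2 * mu * (C - S) + 1) = 0) by lra.
        assert (0 <= (1 - th) * (2 * S * C)) by (apply Rmult_le_pos; [lra|nra]).
        assert (0 < 2 * mu * (C - S) + 1) by nra. assert (0 <= th * (2 * mu * (C - S) + 1)) by nra.
        assert (th = 0) by nra. subst th. lra.
    + assert (HmC : th * (mu * C) <= 0) by (assert (mu * C <= 0) by nra; nra).
      destruct (Rle_dec (2 * (C * C) - 1) 0) as [Q|Q].
      * unfold ta in *. rewrite Rmax_left in * by auto.
        assert (HS2 : / 2 < S) by nra.
        assert (A1 : (1 - th) * (2 * S * C + 0) <= 0) by (assert (S * C <= 0) by nra; nra).
        assert (A2 : 0 <= th * (2 * mu * S - 1)) by (apply Rmult_le_pos; nra).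
        assert (A3 : th * (2 * mu * S - 1) = 0) by lra. assert (0 < 2 * mu * S - 1) by nra. assert (th = 0) by nra. subst th. nra.
      * assert ((1 - th) * ((1 - 2 * (C * C)) / 2) <= 0) by nra.
        assert (A1 : th * (mu * C) = 0) by lra. assert (A2 : (1 - th) * ((1 - 2 * (C * C)) / 2) = 0) by lra.
        assert (C <> 0) by nra. assert (mu * C <> 0) by nra. assert (th = 0) by nra. subst th. nra.
  - assert (HmS : 0 <= th * (mu * S)) by (assert (0 <= mu * S) by nra; nra).
    assert (A : 2 * S * C + ta < 2).
    { assert (2 * S * C <= 1) by nra. unfold ta. destruct (Rle_dec (2 * (C * C) - 1) 0) as [Q|Q]; [rewrite Rmax_left; lra|rewrite Rmax_right by lra].
      assert (Q2 : (2 * S * C) * (2 * S * C) + (2 * (C * C) - 1) * (2 * (C * C) - 1) = 1).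
      { replace ((2 * S * C) * (2 * S * C)) with (4 * (C * C) * (S * S)) by ring. replace (S * S) with (1 - C * C) by lra. ring. }
      set (p := 2 * S * C) in *. set (q := 2 * (C * C) - 1) in *. nra. }
    assert (B : (1 - th) * (2 - (2 * S * C + ta)) <= 0 - th * (1 + 2 * (mu * S)) + 0) by lra.
    assert (0 <= (1 - th) * (2 - (2 * S * C + ta))) by (apply Rmult_le_pos; lra).
    assert (th = 0) by nra. subst th. lra.
Qed.

Section Pinch.
Variable n : nat.
Hypothesis Hn : (1 <= n)%nat.

Definition half_t (s : R) (t : pt) : pt := fun i => match i with O => 2 * t O - (s + 1) / 2 | S _ => t i end.

(* On the half of sign [s] the pinch map is [gmap n s] of the rescaled point. *)
Lemma pinch_segment s t th : sgn1 s -> cube n t -> cube n (half_t s t) -> 0 <= th <= 1 ->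
  U n (fun i => (1 - th) * gmap n s (qmap n (half_t s t)) i + th * lam0 (S n) (qmap n t) i).
Proof.
  intros Hs Ht Hx Hth s' Hs' K.
  set (y := qmap n t) in *. set (x := qmap n (half_t s t)) in *.
  assert (Y : sphere n y) by apply qmap_sphere. assert (X : sphere n x) by apply qmap_sphere.
  destruct (sphere_mx n y Y) as [M0 M1]. set (M := rmaxabs (S n) y) in *.
  assert (IM : 1 <= / M) by (rewrite <- Rinv_1; apply Rinv_le_contravar; lra).
  set (u := ucube n t). set (v := ucube n (half_t s t)). set (m := rmaxabs n u). set (m' := rmaxabs n v).
  pose proof PI_RGT_0 as HPI.
  assert (Bm : 0 <= m <= 1) by (apply ucube_mx; auto). assert (Bm' : 0 <= m' <= 1) by (apply ucube_mx; auto).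
  assert (Hss : 0 <= sin (PI * m)) by (apply sin_ge_0; nra). assert (Hss' : 0 <= sin (PI * m')) by (apply sin_ge_0; nra).
  assert (Huv : forall i, (1 <= i < n)%nat -> v i = u i).
  { intros i Hi. unfold u, v, ucube. rewrite (proj2 (Nat.ltb_lt i n)) by lia. destruct i; [lia|reflexivity]. }
  assert (Hv0 : v O = 2 * u O - s).
  { unfold u, v, ucube. rewrite (proj2 (Nat.ltb_lt 0 n)) by lia. simpl. field. }
  assert (Ey : forall i, y (S i) = if Req_EM_T (norm n u) 0 then 0 else sin (PI * m) * u i / norm n u) by reflexivity.
  assert (Ex : forall i, x (S i) = if Req_EM_T (norm n v) 0 then 0 else sin (PI * m') * v i / norm n v) by reflexivity.
  assert (Nu := norm_mx n u). assert (Nv := norm_mx n v). fold m in Nu. fold m' in Nv.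
  destruct (classic (forall i, (1 <= i < n)%nat -> u i = 0)) as [Hz|Hz].
  (* Planar case: only the first cube coordinate is off centre. Up to the sign [s], the point has
     angle [PI * p] with [p = s * u 0] and the rescaled one [PI * (2 * p - 1)]; the double angle
     formulas then lead to [planar_segment]. *)
  - assert (Hmu : m = Rabs (u O)).
    { apply Rle_antisym; [|apply mx_ge; lia]. apply mx_le; [apply Rabs_pos|]. intros [|i] Hi; [lra|]. rewrite Hz by lia. rewrite Rabs_R0. apply Rabs_pos. }
    assert (Hmv : m' = Rabs (v O)).
    { apply Rle_antisym; [|apply mx_ge; lia]. apply mx_le; [apply Rabs_pos|]. intros [|i] Hi; [lra|]. rewrite Huv, Hz by lia. rewrite Rabs_R0. apply Rabs_pos. }
    assert (Hnorm : forall w, (forall i, (1 <= i < n)%nat -> w i = 0) -> norm n w = Rabs (w O)).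
    { clear - Hn. intros w H. unfold norm. destruct n; [lia|]. rewrite rsum_Sl, rsum_zero by (intros; rewrite H by lia; ring).
      rewrite Rplus_0_r, <- Rsqr_pow2. apply sqrt_Rsqr_abs. }
    assert (Eu : norm n u = Rabs (u O)) by (apply Hnorm; auto).
    assert (Ev : norm n v = Rabs (v O)) by (apply Hnorm; intros; rewrite Huv, Hz; auto).
    assert (Hodd : forall r, (if Req_EM_T (Rabs r) 0 then 0 else sin (PI * Rabs r) * r / Rabs r) = sin (PI * r)).
    { intros r. destruct (Req_EM_T (Rabs r) 0) as [E|E].
      - assert (r = 0) as -> by (destruct (Req_dec r 0); auto; apply Rabs_no_R0 in H; contradiction). rewrite Rmult_0_r, sin_0; auto.
      - unfold Rabs in *. destruct (Rcase_abs r).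
        + replace (PI * - r) with (- (PI * r)) by ring. rewrite sin_neg. field. lra.
        + field. lra. }
    assert (Hcos : forall r, cos (PI * Rabs r) = cos (PI * r)).
    { intros r. unfold Rabs. destruct (Rcase_abs r); auto. replace (PI * - r) with (- (PI * r)) by ring. apply cos_neg. }
    assert (y0 : y O = cos (PI * u O)) by (unfold y; rewrite qmap_0; fold u m; rewrite Hmu; apply Hcos).
    assert (x0 : x O = cos (PI * v O)) by (unfold x; rewrite qmap_0; fold v m'; rewrite Hmv; apply Hcos).
    assert (y1 : y 1%nat = sin (PI * u O)) by (rewrite Ey, Hmu, Eu; apply Hodd).
    assert (x1 : x 1%nat = sin (PI * v O)) by (rewrite Ex, Hmv, Ev; apply Hodd).
    set (p := s * u O).
    assert (Hp : 0 <= p <= 1).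
    { assert (-1 <= u O <= 1) by (apply Rabs_le_iff; lra). assert (-1 <= v O <= 1) by (apply Rabs_le_iff; lra). unfold p. destruct Hs; subst s; lra. }
    set (C := cos (PI * p)). set (Sn := sin (PI * p)).
    assert (HCS : C * C + Sn * Sn = 1) by (pose proof (sin2_cos2 (PI * p)) as Q; unfold Rsqr in Q; unfold C, Sn; lra).
    assert (HSn : 0 <= Sn) by (apply sin_ge_0; nra).
    assert (y0' : y O = C).
    { rewrite y0. unfold C, p. destruct Hs; subst s; [f_equal; ring|]. replace (PI * (-1 * u O)) with (- (PI * u O)) by ring. now rewrite cos_neg. }
    assert (y1' : y 1%nat = s * Sn).
    { rewrite y1. unfold Sn, p. destruct Hs; subst s; [rewrite !Rmult_1_l; auto|]. replace (PI * (-1 * u O)) with (- (PI * u O)) by ring. rewrite sin_neg. ring. }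
    assert (Hdouble : cos (PI * (2 * p - 1)) = 1 - 2 * (C * C) /\ sin (PI * (2 * p - 1)) = - (2 * Sn * C)).
    { replace (PI * (2 * p - 1)) with (- (PI - 2 * (PI * p))) by ring. rewrite cos_neg, sin_neg, Rtrigo_facts.cos_pi_minus, sin_PI_x, cos_2a, sin_2a.
      fold C Sn. split; lra. }
    destruct Hdouble as [D1 D2].
    assert (x0' : x O = 1 - 2 * (C * C)).
    { rewrite x0, <- D1, Hv0. unfold p. destruct Hs; subst s; [f_equal; ring|]. rewrite <- cos_neg. f_equal; ring. }
    assert (x1' : x 1%nat = - s * (2 * Sn * C)).
    { rewrite x1, Hv0. destruct Hs; subst s.
      - replace (PI * (2 * u O - 1)) with (PI * (2 * p - 1)) by (unfold p; ring). rewrite D2. ring.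
      - replace (PI * (2 * u O - -1)) with (- (PI * (2 * p - 1))) by (unfold p; ring). rewrite sin_neg, D2. ring. }
    clearbody x y. assert (K0 := K O ltac:(lia)). assert (K1 := K 1%nat ltac:(lia)).
    unfold gmap, cpt in K0, K1. rewrite lam0_in in K0, K1 by lia. fold M in K0, K1.
    rewrite (proj2 (Nat.ltb_lt 0 (S n))) in K0 by lia. rewrite (proj2 (Nat.ltb_lt 1 (S n))) in K1 by lia. simpl in K0, K1. unfold tau in K1.
    rewrite x0', y0' in K0. rewrite x0', x1', y1' in K1.
    assert (K1' : (1 - th) * (/ 2 - Sn * C - Rmax 0 (2 * (C * C) - 1) / 2) + th * (/ M * Sn) = s * s' / 2).
    { replace (- (1 - 2 * (C * C))) with (2 * (C * C) - 1) in K1 by ring. set (ta := Rmax 0 (2 * (C * C) - 1)) in *.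
      assert (s * s = 1) by (destruct Hs; subst s; ring).
      replace (s * s' / 2) with (s * (s' / 2)) by field. rewrite <- K1.
      replace (s * ((1 - th) * (s / 2 + - s * (2 * Sn * C) / 2 - s * ta / 2) + th * (s * Sn / M)))
        with ((s * s) * ((1 - th) * (/ 2 - Sn * C - ta / 2) + th * (/ M * Sn))) by (field; lra). rewrite H. ring. }
    destruct (planar_segment C Sn (/ M) th HCS HSn IM Hth ltac:(rewrite <- K0; field; lra) _ K1') as [N1 N2].
    destruct (sgn_cases s s' Hs Hs'); subst s'; assert (s * s = 1) by (destruct Hs; subst s; ring); [apply N1|apply N2]; lra.
  (* Otherwise some coordinate of both end points is a nonnegative multiple of the same nonzero
     [u i]. It can vanish strictly inside the segment only if both spherical points are the base
     point, and then coordinate 0 is negative. *)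
  - apply not_all_ex_not in Hz. destruct Hz as [i Hz]. apply imply_to_and in Hz. destruct Hz as [Hi Hz].
    assert (Hiu : Rabs (u i) <= m) by (apply mx_ge; lia). assert (Hiv : Rabs (v i) <= m') by (apply mx_ge; lia). rewrite Huv in Hiv by auto.
    assert (0 < Rabs (u i)) by (apply Rabs_pos_lt; auto).
    assert (Ki := K (S i) ltac:(lia)). unfold gmap, cpt in Ki. rewrite lam0_in in Ki by lia. fold M in Ki.
    rewrite (proj2 (Nat.ltb_lt _ _)) in Ki by lia. rewrite (proj2 (Nat.eqb_neq (S i) 1)) in Ki by lia. rewrite Ey, Ex, Huv in Ki by auto.
    destruct (Req_EM_T (norm n u) 0); [lra|]. destruct (Req_EM_T (norm n v) 0); [lra|].
    set (a := (1 - th) * (sin (PI * m') * / (2 * norm n v))). set (b := th * (sin (PI * m) * / (norm n u * M))).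
    assert (0 < / (2 * norm n v)) by (apply Rinv_0_lt_compat; lra). assert (0 < / (norm n u * M)) by (apply Rinv_0_lt_compat; nra).
    assert (A0 : 0 <= a) by (unfold a; repeat apply Rmult_le_pos; lra). assert (B0 : 0 <= b) by (unfold b; repeat apply Rmult_le_pos; lra).
    assert (Eab : (a + b) * u i = 0) by (rewrite <- Ki; unfold a, b; field; repeat split; lra).
    apply Rmult_integral in Eab. destruct Eab as [Eab|]; [|contradiction].
    assert (Ea : a = 0) by lra. assert (Eb : b = 0) by lra.
    destruct (Req_dec th 0) as [T0|T0]; [|destruct (Req_dec th 1) as [T1|T1]].
    + subst th. apply (gmap_U n s x Hs X s' Hs'). intros j Hj. rewrite <- (K j Hj). ring.
    + subst th. apply (U_of_mx1 n (lam0 (S n) y)) with (s := s'); auto; [apply lam0_bd; auto|]. intros j Hj. rewrite <- (K j Hj). ring.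
    + assert (Z : forall mm, 0 <= mm <= 1 -> 0 < mm -> sin (PI * mm) = 0 -> mm = 1).
      { intros mm Hmm Hp Hsn. destruct (Req_dec mm 1); auto. pose proof (sin_gt_0 (PI * mm) ltac:(nra) ltac:(nra)). lra. }
      assert (m = 1).
      { apply Z; try lra. unfold b in Eb. apply Rmult_integral in Eb. destruct Eb as [|Eb]; [contradiction|]. apply Rmult_integral in Eb. destruct Eb; lra. }
      assert (m' = 1).
      { apply Z; try lra. unfold a in Ea. apply Rmult_integral in Ea. destruct Ea as [|Ea]; [lra|]. apply Rmult_integral in Ea. destruct Ea; lra. }
      assert (Eyb : y = bp) by (apply qmap_m1; auto). assert (Exb : x = bp) by (apply qmap_m1; auto).
      assert (K0 := K O ltac:(lia)). rewrite Exb, gmap_bp in K0. rewrite lam0_in in K0 by lia. fold M in K0. rewrite Eyb in K0. unfold cpt in K0. simpl in K0.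
      assert (-1 / M <= -1) by (unfold Rdiv; lra). nra.
Qed.

Definition tl (t : pt) : pt := fun i => match i with O => Rmin 1 (2 * t O) | S _ => t i end.
Definition tr (t : pt) : pt := fun i => match i with O => Rmax 0 (2 * t O - 1) | S _ => t i end.
(** At every [t] in the cube one of the two summands is the wedge point, which is the origin. Adding
    thus implements the case distinction and makes continuity immediate. *)
Definition pinch_t (t : pt) : pt := fun i => incl 1 (qmap n (tl t)) i + incl 2 (qmap n (tr t)) i.
Definition qinv (y : pt) : pt := epsilon (inhabits (fun _ => 0)) (fun t => cube n t /\ qmap n t = y).
Definition pinch (y : pt) : pt := pinch_t (qinv y).

Lemma tl_cube t : cube n t -> cube n (tl t).
Proof. intros H i Hi. destruct i; simpl; [|apply H; auto]. specialize (H O Hi). split; [apply Rmin_glb; lra|apply Rmin_l]. Qed.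
Lemma tr_cube t : cube n t -> cube n (tr t).
Proof. intros H i Hi. destruct i; simpl; [|apply H; auto]. specialize (H O Hi). split; [apply Rmax_l|apply Rmax_lub; lra]. Qed.

Lemma incl_bp j : incl j bp = origin.
Proof. apply functional_extensionality. intros [|i]; unfold incl, bp, e0, origin; unfold Rdiv; ring. Qed.

Lemma pinch_t_left t : cube n t -> t O <= / 2 -> pinch_t t = incl 1 (qmap n (tl t)).
Proof.
  intros H L. unfold pinch_t. rewrite (qmap_bd n (tr t)), incl_bp.
  - apply functional_extensionality. intros i. unfold origin. ring.
  - apply tr_cube; auto.
  - exists O. split; [lia|]. left. simpl. apply Rmax_left. lra.
Qed.

Lemma pinch_t_right t : cube n t -> / 2 <= t O -> pinch_t t = incl 2 (qmap n (tr t)).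
Proof.
  intros H L. unfold pinch_t. rewrite (qmap_bd n (tl t)), incl_bp.
  - apply functional_extensionality. intros i. unfold origin. ring.
  - apply tl_cube; auto.
  - exists O. split; [lia|]. right. simpl. apply Rmin_left. lra.
Qed.

Lemma pinch_t_bd t : cube n t -> cube_bd n t -> pinch_t t = origin.
Proof.
  intros H [i [Hi Hb]]. unfold pinch_t. rewrite (qmap_bd n (tl t)), (qmap_bd n (tr t)), !incl_bp.
  - apply functional_extensionality. intros j. unfold origin. ring.
  - apply tr_cube; auto.
  - exists i. split; auto. destruct i; simpl; auto. destruct Hb as [-> | ->]; [left; apply Rmax_left|right; rewrite Rmax_right]; lra.
  - apply tl_cube; auto.
  - exists i. split; auto. destruct i; simpl; auto. destruct Hb as [-> | ->]; [left; rewrite Rmin_right|right; apply Rmin_left]; lra.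
Qed.

Lemma qinv_spec y : sphere n y -> cube n (qinv y) /\ qmap n (qinv y) = y.
Proof. intros Y. unfold qinv. apply epsilon_spec. apply qmap_onto; auto. Qed.

Lemma pinch_qmap t : cube n t -> pinch (qmap n t) = pinch_t t.
Proof.
  intros H. unfold pinch. destruct (qinv_spec (qmap n t) (qmap_sphere n t)) as [H1 H2].
  destruct (qmap_inj n _ _ H1 H H2) as [E|[B1 B2]].
  - unfold pinch_t. rewrite (qmap_ext n (tl (qinv (qmap n t))) (tl t)), (qmap_ext n (tr (qinv (qmap n t))) (tr t)); [reflexivity| |];
      intros [|j] Hj; simpl; rewrite E by lia; reflexivity.
  - rewrite !pinch_t_bd; auto.
Qed.
End Pinch.

(** * From the wedge of two spheres to the complement of two points *)

Definition unincl (j : R) (w : pt) : pt := fun i => j * w i - e0 i.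
Definition Ewedge (n : nat) (w : pt) : pt :=
  if excluded_middle_informative (sphere n (unincl 1 w)) then gmap n (-1) (unincl 1 w) else gmap n 1 (unincl 2 w).

Lemma unincl1 x : unincl 1 (incl 1 x) = x.
Proof. apply functional_extensionality. intros i. unfold unincl, incl. simpl. field. Qed.
Lemma unincl2 x : unincl 2 (incl 2 x) = x.
Proof. apply functional_extensionality. intros i. unfold unincl, incl. simpl. field. Qed.

Lemma wedge2_cases n w : wedge n 2 w <-> sphere n (unincl 1 w) \/ sphere n (unincl 2 w).
Proof.
  split.
  - intros [j [Hj H]]. assert (j = 1 \/ j = 2)%nat as [-> | ->] by lia; [left|right]; exact H.
  - intros [H|H]; [exists 1%nat|exists 2%nat]; split; auto.
Qed.

Lemma unincl_rsum n j w : rsum (S n) (fun i => unincl j w i ^ 2) = j * j * rsum (S n) (fun i => w i ^ 2) - 2 * j * w O + 1.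
Proof.
  rewrite !rsum_Sl. unfold unincl. simpl e0.
  rewrite (rsum_ext n _ (fun i => j * j * w (S i) ^ 2)) by (intros; simpl; ring). rewrite rsum_scal. simpl. ring.
Qed.

Lemma both_spheres n w : sphere n (unincl 1 w) -> sphere n (unincl 2 w) -> unincl 1 w = bp /\ unincl 2 w = bp.
Proof.
  intros H1 H2. destruct (H1) as [A1 B1]. destruct (H2) as [A2 B2]. rewrite unincl_rsum in A1, A2.
  assert (W0 : w O = 0) by lra. assert (Ws : rsum (S n) (fun i => w i ^ 2) = 0) by lra.
  assert (W : forall i, w i = 0).
  { intros i. destruct (Nat.lt_ge_cases i (S n)) as [L|L].
    - pose proof (rsum_term_le (S n) (fun i => w i ^ 2) i ltac:(intros; apply pow2_ge_0) L) as Q. cbv beta in Q. nra.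
    - specialize (B1 i L). unfold unincl in B1. destruct i; [lia|]. simpl in B1. lra. }
  split; apply functional_extensionality; intros i; unfold unincl; rewrite W; destruct i; simpl; ring.
Qed.

Lemma Ewedge_1 n w : sphere n (unincl 1 w) -> Ewedge n w = gmap n (-1) (unincl 1 w).
Proof. intros H. unfold Ewedge. destruct (excluded_middle_informative _); [reflexivity|contradiction]. Qed.

Lemma Ewedge_2 n w : sphere n (unincl 2 w) -> Ewedge n w = gmap n 1 (unincl 2 w).
Proof.
  intros H. unfold Ewedge. destruct (excluded_middle_informative _) as [H1|]; [|reflexivity].
  destruct (both_spheres n w H1 H) as [-> ->]. now rewrite !gmap_bp.
Qed.

Lemma Ewedge_U n w : wedge n 2 w -> U n (Ewedge n w).
Proof.
  intros H. apply wedge2_cases in H. destruct H as [H|H]; [rewrite Ewedge_1 by auto|rewrite Ewedge_2 by auto]; apply gmap_U; auto; [right|left]; auto.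
Qed.

Lemma Ewedge_origin n : Ewedge n origin = bst.
Proof.
  assert (E : unincl 1 origin = bp) by (apply functional_extensionality; intros [|i]; unfold unincl, origin, e0, bp; ring).
  rewrite Ewedge_1; rewrite E; [apply gmap_bp|apply bp_sphere].
Qed.

Lemma vc_gmap n s A d f : (1 <= n)%nat -> vc d A (S n) f -> vc d A (S n) (fun x => gmap n s (f x)).
Proof.
  intros Hn H i Hi. unfold gmap. rewrite (proj2 (Nat.ltb_lt _ _) Hi). destruct (Nat.eqb i 1).
  - apply sc_minus.
    + apply sc_plus; [apply sc_const|]. apply (sc_ext d A (fun x => / 2 * f x 1%nat)); [intros; field|]. apply sc_scal, H; lia.
    + apply (sc_ext d A (fun x => (s / 2) * tau (f x))); [intros; field|]. apply sc_scal. apply sc_max; [apply sc_const|]. apply sc_opp, H. lia.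
  - apply (sc_ext d A (fun x => / 2 * f x i)); [intros; field|]. apply sc_scal, H; auto.
Qed.

Lemma vc_id d A e : (e <= d)%nat -> vc d A e (fun x => x).
Proof. intros H i Hi. apply sc_coord. lia. Qed.

Lemma vc_Ewedge n : (1 <= n)%nat -> vc (S n) (wedge n 2) (S n) (Ewedge n).
Proof.
  intros Hn.
  assert (Vu : forall j A, vc (S n) A (S n) (unincl j)).
  { intros j A i Hi. apply sc_minus; [apply sc_scal, sc_coord; auto|apply sc_const]. }
  (* On sphere number j of the wedge [|w|^2 = 2 * w 0 / j], so this function is [w 0 / 2 >= 0] on
     the first sphere and [- w 0 / 2 <= 0] on the second. *)
  apply (vc_glue _ _ _ (fun w => rsum (S n) (fun i => w i ^ 2) - 3 / 2 * w O)).
  - apply sc_minus; [|apply sc_scal, sc_coord; lia]. apply (sc_rsum _ _ (S n) (fun i w => w i ^ 2)). intros i Hi. simpl.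
    apply sc_mult; [apply sc_coord; auto|]. apply sc_mult; [apply sc_coord; auto|apply sc_const].
  - apply (vc_ext _ _ _ (fun w => gmap n 1 (unincl 2 w))); [|apply vc_gmap; auto].
    intros w [Hw Hq] i Hi. rewrite Ewedge_2; auto. apply wedge2_cases in Hw. destruct Hw as [Hw|]; auto.
    assert (A := proj1 Hw). rewrite unincl_rsum in A. 
    assert (W0 : w O <= 0) by lra. assert (0 <= rsum (S n) (fun i => w i ^ 2)) by (apply rsum_nonneg; intros; apply pow2_ge_0).
    split; [rewrite unincl_rsum; lra|]. intros i' Hi'. destruct Hw as [_ Hw]. specialize (Hw i' Hi'). unfold unincl in *.
    destruct i'; [lia|]. simpl in *. lra.
  - apply (vc_ext _ _ _ (fun w => gmap n (-1) (unincl 1 w))); [|apply vc_gmap; auto].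
    intros w [Hw Hq] i Hi. rewrite Ewedge_1; auto. apply wedge2_cases in Hw. destruct Hw as [|Hw]; auto.
    assert (A := proj1 Hw). rewrite unincl_rsum in A. 
    assert (0 <= rsum (S n) (fun i => w i ^ 2)) by (apply rsum_nonneg; intros; apply pow2_ge_0).
    split; [rewrite unincl_rsum; lra|]. intros i' Hi'. destruct Hw as [_ Hw]. specialize (Hw i' Hi'). unfold unincl in *.
    destruct i'; [lia|]. simpl in *. lra.
Qed.

Section PinchStar.
Variable n : nat.
Hypothesis Hn : (1 <= n)%nat.

Lemma vc_pinch_t : vc n (cube n) (S n) (pinch_t n).
Proof.
  assert (Vl : vc n (cube n) n tl).
  { intros [|i] Hi; simpl; [apply sc_min; [apply sc_const|apply sc_scal, sc_coord; auto]|apply sc_coord; auto]. }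
  assert (Vr : vc n (cube n) n tr).
  { intros [|i] Hi; simpl; [apply sc_max; [apply sc_const|apply sc_minus; [apply sc_scal, sc_coord; auto|apply sc_const]]|apply sc_coord; auto]. }
  assert (Vq : forall f, vc n (cube n) n f -> (forall t, cube n t -> cube n (f t)) -> vc n (cube n) (S n) (fun t => qmap n (f t))).
  { intros f Vf Hf. apply (vc_comp n (cube n) n (cube n)); auto. apply vc_qmap. }
  intros i Hi. unfold pinch_t, incl. apply sc_plus; unfold Rdiv.
  - apply sc_mult; [|apply sc_const]. apply sc_plus; [|apply sc_const]. apply Vq; auto using tl_cube.
  - apply sc_mult; [|apply sc_const]. apply sc_plus; [|apply sc_const]. apply Vq; auto using tr_cube.
Qed.

Lemma vc_pinch : vc (S n) (sphere n) (S n) (pinch n).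
Proof.
  intros i Hi. apply (sc_quotient n (cube n) (S n) (sphere n) (qmap n) (fun t => pinch_t n t i)).
  - apply cube_compact.
  - apply vc_qmap.
  - intros; apply qmap_sphere.
  - intros y Y. apply qmap_onto; auto.
  - intros y y' Y Y'. apply sphere_ext; auto.
  - apply vc_pinch_t; auto.
  - intros t Ht. now rewrite pinch_qmap.
Qed.

Lemma pinch_wedge y : sphere n y -> wedge n 2 (pinch n y).
Proof.
  intros Y. destruct (qinv_spec n Hn y Y) as [H1 H2]. rewrite <- H2, pinch_qmap by auto. apply wedge2_cases.
  destruct (Rle_dec (qinv n y O) (/ 2)).
  - left. rewrite pinch_t_left, unincl1 by auto. apply qmap_sphere.
  - right. rewrite pinch_t_right, unincl2 by (auto; lra). apply qmap_sphere.
Qed.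

Lemma cube_zero : cube n (fun _ => 0).
Proof. intros i Hi. lra. Qed.

Lemma pinch_bp : pinch n bp = origin.
Proof.
  assert (B : cube_bd n (fun _ => 0)) by (exists O; split; [lia|auto]).
  rewrite <- (qmap_bd n _ cube_zero B). rewrite pinch_qmap by (auto using cube_zero). apply pinch_t_bd; auto using cube_zero.
Qed.

Lemma half_t_tl t i : t O <= / 2 -> half_t (-1) t i = tl t i.
Proof. intros H. destruct i; simpl; [rewrite Rmin_right; lra|reflexivity]. Qed.
Lemma half_t_tr t i : / 2 <= t O -> half_t 1 t i = tr t i.
Proof. intros H. destruct i; simpl; [rewrite Rmax_right; lra|reflexivity]. Qed.

Lemma Epinch_segment y th : sphere n y -> 0 <= th <= 1 -> U n (fun i => (1 - th) * Ewedge n (pinch n y) i + th * lam0 (S n) y i).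
Proof.
  intros Y Hth. destruct (qinv_spec n Hn y Y) as [H1 H2]. rewrite <- H2. set (t := qinv n y) in *. rewrite pinch_qmap by auto.
  destruct (Rle_dec (t O) (/ 2)) as [L|L].
  - rewrite pinch_t_left by auto. rewrite Ewedge_1; rewrite unincl1; [|apply qmap_sphere].
    rewrite <- (qmap_ext n (half_t (-1) t) (tl t)) by (intros; apply half_t_tl; auto).
    apply pinch_segment; auto; [right; auto|]. intros i Hi. rewrite half_t_tl by auto. apply (tl_cube n t H1 i Hi).
  - assert (L' : / 2 <= t O) by lra. rewrite pinch_t_right by auto. rewrite Ewedge_2; rewrite unincl2; [|apply qmap_sphere].
    rewrite <- (qmap_ext n (half_t 1 t) (tr t)) by (intros; apply half_t_tr; auto).
    apply pinch_segment; auto; [left; auto|]. intros i Hi. rewrite half_t_tr by auto. apply (tr_cube n t H1 i Hi).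
Qed.

(** [pinch] after [qmap] is the concatenation of the two inclusions on the nose. A constant homotopy
    therefore shows that [pinch] represents their sum, and the star condition applies with m = 2. *)
Lemma star_pinch k b : star_condition n k b ->
  rel_homotopic k (S n) (wedge n 2) origin (fun t => pinch n (b (qmap k t)))
    (concat ((fun t => incl 1 (b (qmap k t))) :: (fun t => incl 2 (b (qmap k t))) :: nil)).
Proof.
  intros St. apply (St 2%nat ltac:(lia) (pinch n)).
  - apply cont_on_of_vc, vc_pinch.
  - intros y Y. apply pinch_wedge; auto.
  - intros i. now rewrite pinch_bp.
  - exists (fun p => pinch n (qmap n (ptail p))).
    assert (Vt : vc (S n) (cube (S n)) n ptail) by (intros i Hi; apply (sc_coord (S n) (cube (S n)) (S i)); lia).
    assert (Mt : forall p, cube (S n) p -> cube n (ptail p)) by (intros p H i Hi; apply H; lia).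
    split; [|split; [|split]].
    + apply cont_on_of_vc. apply (vc_comp _ _ (S n) (sphere n)).
      * intros; apply qmap_sphere.
      * apply (vc_comp _ _ n (cube n)); auto. apply vc_qmap.
      * apply vc_pinch.
    + intros p Hp. apply pinch_wedge, qmap_sphere.
    + intros t Ht i. split; [reflexivity|]. change (ptail (pcons 1 t)) with (fun i => t i). change (fun i => t i) with t.
      rewrite pinch_qmap by auto. simpl map. assert (Ht0 : 0 <= t O <= 1) by (apply Ht; lia).
      rewrite concat_two by auto. destruct (Rlt_dec (t O) (/ 2)) as [L|L].
      * rewrite pinch_t_left by (auto; lra). f_equal. apply qmap_ext. intros [|j] Hj; simpl; [rewrite Rmin_right; lra|reflexivity].
      * rewrite pinch_t_right by (auto; lra). f_equal. apply qmap_ext. intros [|j] Hj; simpl; [rewrite Rmax_right; lra|reflexivity].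
    + intros s t Hs Ht Hb i. change (ptail (pcons s t)) with t. rewrite qmap_bd by auto. now rewrite pinch_bp.
Qed.
End PinchStar.

(** * Splitting *)

Definition std (d : nat) (x : pt) : pt := fun i => if Nat.ltb i d then x i / norm d x else 0.

Lemma std_sphere n x : 0 < norm (S n) x -> sphere n (std (S n) x).
Proof.
  intros H. split.
  - rewrite (rsum_ext (S n) _ (fun i => (/ norm (S n) x) ^ 2 * x i ^ 2)).
    + rewrite rsum_scal, <- norm_sq. field. lra.
    + intros i Hi. unfold std. rewrite (proj2 (Nat.ltb_lt _ _) Hi). field. lra.
  - intros i Hi. unfold std. rewrite (proj2 (Nat.ltb_ge i (S n))); auto.
Qed.

Lemma bd_norm d x : bdC d x -> 1 <= norm d x.
Proof. intros H. rewrite <- H. apply norm_mx. Qed.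

Lemma std_bd_sphere n x : bdC (S n) x -> sphere n (std (S n) x).
Proof. intros H. apply std_sphere. pose proof (bd_norm _ _ H). lra. Qed.

Lemma sc_norm d A m f : vc d A m f -> sc d A (fun x => norm m (f x)).
Proof.
  intros V. unfold norm. apply sc_sqrt; [intros; apply rsum_nonneg; intros; apply pow2_ge_0|].
  apply (sc_rsum d A m (fun i x => f x i ^ 2)). intros i Hi. simpl. apply sc_mult; [apply V; auto|]. apply sc_mult; [apply V; auto|apply sc_const].
Qed.

Lemma vc_std d A m f : vc d A m f -> (forall x, A x -> 0 < norm m (f x)) -> vc d A m (fun x => std m (f x)).
Proof.
  intros V H i Hi. unfold std. rewrite (proj2 (Nat.ltb_lt _ _) Hi). apply sc_div; [|apply V; auto|apply sc_norm; auto].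
  intros x Hx. specialize (H x Hx). lra.
Qed.

Lemma vc_lam0 d A m f : vc d A m f -> (forall x, A x -> 0 < rmaxabs m (f x)) -> vc d A m (fun x => lam0 m (f x)).
Proof.
  intros V H i Hi. unfold lam0. rewrite (proj2 (Nat.ltb_lt _ _) Hi). apply sc_div; [|apply V; auto|apply sc_mx; auto].
  intros x Hx. specialize (H x Hx). lra.
Qed.

Lemma vc_pcons d A e g f : sc d A g -> vc d A e f -> vc d A (S e) (fun x => pcons (g x) (f x)).
Proof. intros G F [|i] Hi; simpl; auto. apply F. lia. Qed.

Section Homotopy.
Variables n k : nat.

Definition Dom (p : pt) : Prop := 0 <= p O <= 1 /\ bdC (S k) (ptail p).

Definition hmt (F F' : pt -> pt) : Prop := exists H : pt -> pt,
  vc (S (S k)) Dom (S n) H /\ (forall p, Dom p -> U n (H p)) /\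
  (forall x i, bdC (S k) x -> (i < S n)%nat -> H (pcons 0 x) i = F x i /\ H (pcons 1 x) i = F' x i).

Lemma sc_time : sc (S (S k)) Dom (fun p => p O).
Proof. apply sc_coord. lia. Qed.
Lemma vc_ptail A : vc (S (S k)) A (S k) ptail.
Proof. intros i Hi. apply (sc_coord _ _ (S i)). lia. Qed.

Lemma hmt_sym F F' : hmt F F' -> hmt F' F.
Proof.
  intros (H & V & HU & E). exists (fun p => H (pcons (1 - p O) (ptail p))).
  assert (M : forall p, Dom p -> Dom (pcons (1 - p O) (ptail p))) by (intros p [A B]; split; [simpl; lra|exact B]).
  split; [|split].
  - apply (vc_comp _ _ (S (S k)) Dom); auto. apply vc_pcons; [apply sc_minus; [apply sc_const|apply sc_time]|apply vc_ptail].
  - intros p Hp. apply HU, M; auto.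
  - intros x i Hx Hi. change (ptail (pcons 0 x)) with x. change (ptail (pcons 1 x)) with x. simpl.
    rewrite Rminus_0_r, Rminus_diag. destruct (E x i Hx Hi); auto.
Qed.

(** The homotopies are concatenated by a sum, which avoids glueing: in the first half of the time
    the last two terms cancel, in the second half the first and the last do, since both equal the
    intermediate map. *)
Lemma hmt_trans F F' F'' : hmt F F' -> hmt F' F'' -> hmt F F''.
Proof.
  intros (H & V & HU & E) (H' & V' & HU' & E').
  exists (fun p i => H (pcons (Rmin 1 (2 * p O)) (ptail p)) i + H' (pcons (Rmax 0 (2 * p O - 1)) (ptail p)) i - H' (pcons 0 (ptail p)) i).
  assert (M1 : forall p, Dom p -> Dom (pcons (Rmin 1 (2 * p O)) (ptail p))).
  { intros p [A B]; split; [simpl; split; [apply Rmin_glb; lra|apply Rmin_l]|exact B]. }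
  assert (M2 : forall p, Dom p -> Dom (pcons (Rmax 0 (2 * p O - 1)) (ptail p))).
  { intros p [A B]; split; [simpl; split; [apply Rmax_l|apply Rmax_lub; lra]|exact B]. }
  assert (M3 : forall p, Dom p -> Dom (pcons 0 (ptail p))) by (intros p [A B]; split; [simpl; lra|exact B]).
  split; [|split].
  - intros i Hi. apply sc_minus; [apply sc_plus|].
    + apply (vc_comp _ Dom (S (S k)) Dom (S n) (fun p => pcons (Rmin 1 (2 * p O)) (ptail p)) H M1); auto.
      apply vc_pcons; [|apply vc_ptail]. apply sc_min; [apply sc_const|apply sc_scal, sc_time].
    + apply (vc_comp _ Dom (S (S k)) Dom (S n) (fun p => pcons (Rmax 0 (2 * p O - 1)) (ptail p)) H' M2); auto.
      apply vc_pcons; [|apply vc_ptail]. apply sc_max; [apply sc_const|apply sc_minus; [apply sc_scal, sc_time|apply sc_const]].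
    + apply (vc_comp _ Dom (S (S k)) Dom (S n) (fun p => pcons 0 (ptail p)) H' M3); auto.
      apply vc_pcons; [apply sc_const|apply vc_ptail].
  - intros p Hp. destruct Hp as [A B]. destruct (Rle_dec (p O) (/ 2)) as [L|L].
    + apply (U_ext n (H (pcons (Rmin 1 (2 * p O)) (ptail p)))); [|apply HU, M1; split; auto].
      intros i Hi. rewrite (Rmax_left 0) by lra. ring.
    + apply (U_ext n (H' (pcons (Rmax 0 (2 * p O - 1)) (ptail p)))); [|apply HU', M2; split; auto].
      intros i Hi. rewrite (Rmin_left 1) by lra. destruct (E (ptail p) i B Hi) as [_ ->]. destruct (E' (ptail p) i B Hi) as [-> _]. ring.
  - intros x i Hx Hi. change (ptail (pcons 0 x)) with x. change (ptail (pcons 1 x)) with x.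
    destruct (E x i Hx Hi) as [E1 E2]. destruct (E' x i Hx Hi) as [E1' E2']. simpl.
    rewrite (Rmin_right 1 (2 * 0)), (Rmax_left 0 (2 * 0 - 1)), (Rmin_left 1 (2 * 1)), (Rmax_right 0 (2 * 1 - 1)) by lra.
    replace (2 * 0) with 0 by ring. replace (2 * 1 - 1) with 1 by ring. rewrite E1, E2, E1', E2'. split; ring.
Qed.

Lemma vc_tail_comp f : vc (S k) (bdC (S k)) (S n) f -> vc (S (S k)) Dom (S n) (fun p => f (ptail p)).
Proof. intros V. apply (vc_comp _ Dom (S k) (bdC (S k))); auto; [intros p [_ B]; exact B|apply vc_ptail]. Qed.

Lemma hmt_segment F F' : vc (S k) (bdC (S k)) (S n) F -> vc (S k) (bdC (S k)) (S n) F' ->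
  (forall x th, bdC (S k) x -> 0 <= th <= 1 -> U n (fun i => (1 - th) * F x i + th * F' x i)) -> hmt F F'.
Proof.
  intros V V' HU. exists (fun p i => (1 - p O) * F (ptail p) i + p O * F' (ptail p) i). split; [|split].
  - intros i Hi. pose proof (vc_tail_comp F V i Hi) as W. pose proof (vc_tail_comp F' V' i Hi) as W'. cbv beta in W, W'.
    apply sc_plus; apply sc_mult; auto using sc_time. apply sc_minus; [apply sc_const|apply sc_time].
  - intros p [A B]. apply HU; auto.
  - intros x i Hx Hi. change (ptail (pcons 0 x)) with x. change (ptail (pcons 1 x)) with x. simpl. split; ring.
Qed.

Lemma hmt_free beta b G : free_homotopic k n beta b -> vc (S n) (sphere n) (S n) G -> (forall y, sphere n y -> U n (G y)) ->
  maps_to (sphere k) (sphere n) beta -> maps_to (sphere k) (sphere n) b ->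
  hmt (fun x => G (beta (std (S k) x))) (fun x => G (b (std (S k) x))).
Proof.
  intros (H & C & M & E) VG HG Mbeta Mb. apply vc_of_cont_on in C.
  assert (Hd : forall p, Dom p -> 0 <= pcons (p O) (std (S k) (ptail p)) O <= 1 /\ sphere k (ptail (pcons (p O) (std (S k) (ptail p))))).
  { intros p [A B]. split; [exact A|]. exact (std_bd_sphere k _ B). }
  exists (fun p => G (H (pcons (p O) (std (S k) (ptail p))))). split; [|split].
  - apply (vc_comp _ Dom (S n) (sphere n)); auto.
    + intros p Hp. apply M; apply Hd; auto.
    + apply (vc_comp _ Dom (S (S k)) (fun p => 0 <= p O <= 1 /\ sphere k (ptail p))); auto.
      apply vc_pcons; [apply sc_time|]. apply vc_std; [apply vc_ptail|]. intros p [_ B]. pose proof (bd_norm _ _ B). lra.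
  - intros p Hp. apply HG, M; apply Hd; auto.
  - intros x i Hx Hi. change (ptail (pcons 0 x)) with x. change (ptail (pcons 1 x)) with x. simpl (pcons _ x O).
    pose proof (std_bd_sphere k x Hx) as Sx. specialize (E _ Sx).
    assert (E0 : H (pcons 0 (std (S k) x)) = beta (std (S k) x)) by (apply functional_extensionality; intros j; apply E).
    assert (E1 : H (pcons 1 (std (S k) x)) = b (std (S k) x)) by (apply functional_extensionality; intros j; apply E).
    rewrite E0, E1. auto.
Qed.

(* [x 0 = 1] is the top face; its other coordinates, rescaled to the unit cube, are [ttop x]. *)
Definition ttop (x : pt) : pt := fun i => (x (S i) + 1) / 2.

Lemma ttop_cube x : bdC (S k) x -> cube k (ttop x).
Proof. intros H i Hi. unfold ttop. assert (-1 <= x (S i) <= 1) by (apply (mx_le_inv (S k)); [unfold bdC in H; lra|lia]). lra. Qed.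

Lemma ttop_bd x : bdC (S k) x -> rmaxabs k (ptail x) = 1 -> cube_bd k (ttop x).
Proof.
  intros H E. destruct k as [|k']; [simpl in E; lra|]. destruct (mx_attained (S k') (ptail x)) as [i [Hi Ei]]; [lia|].
  exists i. split; auto. rewrite E in Ei. unfold ptail in Ei. unfold ttop. unfold Rabs in Ei. destruct (Rcase_abs _) in Ei; lra.
Qed.

(** Turns homotopies of cube maps relative to the boundary, the language of homotopy groups, into
    homotopies on the whole boundary of a cube. *)
Lemma vc_topglue phi y0 : vc (S k) (cube (S k)) (S n) phi ->
  (forall th t i, 0 <= th <= 1 -> cube k t -> cube_bd k t -> phi (pcons th t) i = y0 i) ->
  vc (S (S k)) Dom (S n) (fun p => if Req_EM_T (p 1%nat) 1 then phi (pcons (p O) (ttop (ptail p))) else y0).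
Proof.
  intros V Hb.
  assert (Hp : forall p, Dom p -> cube (S k) (pcons (p O) (ttop (ptail p)))).
  { intros p [A B] [|i] Hi; simpl; [exact A|]. apply (ttop_cube _ B). lia. }
  assert (Fb : forall p, Dom p -> Rmax (Rabs (p 1%nat)) (rmaxabs k (ptail (ptail p))) = 1).
  { intros p [_ B]. unfold bdC in B. rewrite mx_Sl in B. exact B. }
  apply (vc_glue _ _ _ (fun p => p 1%nat - rmaxabs k (ptail (ptail p)))).
  - apply sc_minus; [apply sc_coord; lia|]. apply (sc_mx _ _ k (fun p => ptail (ptail p))). intros i Hi. apply (sc_coord _ _ (S (S i))). lia.
  - apply (vc_ext _ _ _ (fun _ => y0)); [|intros i Hi; apply sc_const].
    intros p [Hd Hq] i Hi. specialize (Fb p Hd). destruct (Req_EM_T (p 1%nat) 1) as [E|E]; auto. symmetry.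
    destruct Hd as [A B]. apply Hb; auto; [apply ttop_cube; auto|]. apply ttop_bd; auto.
    rewrite E, Rabs_R1 in Fb. unfold Rmax in Fb. destruct (Rle_dec _ _) in Fb; lra.
  - apply (vc_ext _ _ _ (fun p => phi (pcons (p O) (ttop (ptail p))))).
    + intros p [Hd Hq] i Hi. specialize (Fb p Hd). destruct (Req_EM_T (p 1%nat) 1) as [E|E]; auto. exfalso. apply E.
      pose proof (mx_nonneg k (ptail (ptail p))). rewrite Rabs_pos_eq in Fb by lra. unfold Rmax in Fb. destruct (Rle_dec _ _) in Fb; lra.
    + apply (vc_comp _ _ (S k) (cube (S k))); auto; [intros p [Hd _]; auto|].
      apply vc_pcons; [apply sc_coord; lia|]. intros i Hi. unfold ttop, ptail.
      apply (sc_ext _ _ (fun p => / 2 * (p (S (S i)) + 1))); [intros; field|]. apply sc_scal, sc_plus; [apply sc_coord; lia|apply sc_const].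
Qed.

(* A map of degree one that is constant off the top face. *)
Definition kappa (x : pt) : pt := if Req_EM_T (x O) 1 then qmap k (ttop x) else bp.

Lemma kappa_sphere x : sphere k (kappa x).
Proof. unfold kappa. destruct (Req_EM_T _ _); [apply qmap_sphere|apply bp_sphere]. Qed.

(** Away from coordinate 0 the coordinates of [std] are positive multiples and those of [kappa]
    nonnegative multiples of those of [x]. A zero inside the segment would force [x] to the centre
    of the top or the bottom face, where the two end points coincide. Hence [kappa] is homotopic to
    the radial projection. *)
Lemma std_kappa_segment x th : bdC (S k) x -> 0 <= th <= 1 -> 0 < norm (S k) (fun i => (1 - th) * std (S k) x i + th * kappa x i).
Proof.
  intros Hx Hth. pose proof (bd_norm _ _ Hx) as Hr. set (r := norm (S k) x) in *.
  set (v := fun i => (1 - th) * std (S k) x i + th * kappa x i).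
  pose proof (norm_ge0 (S k) v) as N0. destruct (Req_dec (norm (S k) v) 0) as [E|E]; [exfalso|lra].
  assert (Z : forall i, (i < S k)%nat -> v i = 0).
  { intros i Hi. apply norm_zero_iff in E. pose proof (mx_ge (S k) v i Hi) as Q. rewrite E in Q. apply Rabs_le_iff in Q. lra. }
  assert (Hst : forall i, (i < S k)%nat -> std (S k) x i = x i / r) by (intros i Hi; unfold std; rewrite (proj2 (Nat.ltb_lt _ _) Hi); auto).
  assert (Ir : 0 < / r) by (apply Rinv_0_lt_compat; lra).
  assert (Z0 := Z O ltac:(lia)). unfold v in Z0. rewrite Hst in Z0 by lia.
  destruct (Req_dec th 1) as [T1|T1].
  { apply (sphere_nonzero k (kappa x) (kappa_sphere x)). intros i Hi. specialize (Z i Hi). unfold v in Z. rewrite T1 in Z. lra. }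
  assert (Hall : forall c, (forall i, (i < k)%nat -> 0 <= c i /\ kappa x (S i) = c i * x (S i)) -> forall i, (i < k)%nat -> x (S i) = 0).
  { intros c Hc i Hi. destruct (Hc i Hi) as [C0 C1]. specialize (Z (S i) ltac:(lia)). unfold v in Z. rewrite Hst, C1 in Z by lia.
    assert (Q : ((1 - th) * / r + th * c i) * x (S i) = 0) by (rewrite <- Z; unfold Rdiv; ring).
    apply Rmult_integral in Q. destruct Q as [Q|]; auto. exfalso. assert (0 < (1 - th) * / r) by nra. assert (0 <= th * c i) by nra. lra. }
  assert (Mx : rmaxabs (S k) x = 1) by exact Hx. rewrite mx_Sl in Mx.
  unfold kappa in Hall, Z0. destruct (Req_EM_T (x O) 1) as [E1|E1].
  - set (u := ucube k (ttop x)) in *.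
    assert (Hu : forall i, (i < k)%nat -> u i = x (S i)) by (intros i Hi; unfold u, ucube, ttop; rewrite (proj2 (Nat.ltb_lt _ _) Hi); field).
    assert (Bm : 0 <= rmaxabs k u <= 1) by (apply ucube_mx, ttop_cube; auto).
    assert (H0 : forall i, (i < k)%nat -> x (S i) = 0).
    { apply (Hall (fun _ => if Req_EM_T (norm k u) 0 then 0 else sin (PI * rmaxabs k u) / norm k u)). intros i Hi. rewrite qmap_S. fold u.
      destruct (Req_EM_T (norm k u) 0) as [En|En]; [split; lra|]. pose proof (norm_ge0 k u). pose proof PI_RGT_0. split.
      - apply Rmult_le_pos; [apply sin_ge_0; nra|left; apply Rinv_0_lt_compat; lra].
      - rewrite Hu by auto. field. auto. }
    assert (Em : rmaxabs k u = 0).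
    { apply Rle_antisym; [|apply mx_nonneg]. apply mx_le; [lra|]. intros i Hi. rewrite Hu, H0 by auto. rewrite Rabs_R0. lra. }
    rewrite qmap_0 in Z0. fold u in Z0. rewrite Em, Rmult_0_r, cos_0, E1 in Z0. assert (0 < (1 - th) * (1 / r)) by (unfold Rdiv; nra). lra.
  - assert (H0 : forall i, (i < k)%nat -> x (S i) = 0) by (apply (Hall (fun _ => 0)); intros i Hi; simpl; lra).
    assert (rmaxabs k (fun i => x (S i)) <= 0) by (apply mx_le; [lra|]; intros i Hi; rewrite H0 by auto; rewrite Rabs_R0; lra).
    pose proof (mx_nonneg k (fun i => x (S i))). assert (Ex : Rabs (x O) = 1) by (unfold Rmax in Mx; destruct (Rle_dec _ _) in Mx; lra).
    assert (x O = -1) by (unfold Rabs in Ex; destruct (Rcase_abs _) in Ex; lra).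
    simpl in Z0. rewrite H2 in Z0. assert (0 < (1 - th) * / r) by nra. unfold Rdiv in Z0. lra.
Qed.

End Homotopy.

Lemma vc_kappa_dom k : vc (S (S k)) (Dom k) (S k) (fun p => kappa k (ptail p)).
Proof.
  apply (vc_topglue k k (fun p => qmap k (ptail p)) bp).
  - apply (vc_comp _ _ k (fun _ => True)); auto; [intros i Hi; apply (sc_coord _ _ (S i)); lia|apply vc_qmap].
  - intros th t i Hth Ht Hb. change (ptail (pcons th t)) with t. now rewrite qmap_bd.
Qed.

Section Homotopy2.
Variables n k : nat.

Lemma hmt_kappa G : vc (S k) (sphere k) (S n) G -> (forall y, sphere k y -> U n (G y)) ->
  hmt n k (fun x => G (std (S k) x)) (fun x => G (kappa k x)).
Proof.
  intros VG HG. set (w := fun p i => (1 - p O) * std (S k) (ptail p) i + p O * kappa k (ptail p) i).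
  assert (Vw : vc (S (S k)) (Dom k) (S k) w).
  { intros i Hi. apply sc_plus; apply sc_mult.
    - apply sc_minus; [apply sc_const|apply sc_time].
    - apply (vc_std (S (S k)) (Dom k) (S k) ptail); auto; [apply vc_ptail|]. intros p [_ B]. pose proof (bd_norm _ _ B). lra.
    - apply sc_time.
    - apply (vc_kappa_dom k); auto. }
  assert (Pw : forall p, Dom k p -> 0 < norm (S k) (w p)) by (intros p [A B]; apply std_kappa_segment; auto).
  exists (fun p => G (std (S k) (w p))). split; [|split].
  - apply (vc_comp _ _ (S k) (sphere k)); auto; [intros p Hp; apply std_sphere; auto|apply vc_std; auto].
  - intros p Hp. apply HG, std_sphere; auto.
  - intros x i Hx Hi.
    assert (Id : forall y, sphere k y -> std (S k) y = y).
    { intros y [Y Y']. apply functional_extensionality. intros j. unfold std, norm. rewrite Y, sqrt_1.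
      destruct (Nat.ltb j (S k)) eqn:Q; [field|]. apply Nat.ltb_ge in Q. rewrite Y'; auto. }
    assert (E0 : w (pcons 0 x) = std (S k) x) by (apply functional_extensionality; intros j; unfold w; simpl; change (ptail (pcons 0 x)) with x; ring).
    assert (E1 : w (pcons 1 x) = kappa k x) by (apply functional_extensionality; intros j; unfold w; simpl; change (ptail (pcons 1 x)) with x; ring).
    rewrite E0, E1, (Id _ (std_bd_sphere k x Hx)), (Id _ (kappa_sphere k x)). auto.
Qed.
End Homotopy2.

Lemma std_ext d x y : (forall i, (i < d)%nat -> x i = y i) -> std d x = std d y.
Proof.
  intros H. apply functional_extensionality. intros i. unfold std. destruct (Nat.ltb i d) eqn:Q; auto. apply Nat.ltb_lt in Q.
  rewrite H by auto. f_equal. unfold norm. f_equal. apply rsum_ext. intros j Hj. rewrite H; auto.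
Qed.

Lemma lam0_bd_in d x i : bdC d x -> (i < d)%nat -> lam0 d x i = x i.
Proof. intros H Hi. rewrite lam0_in by auto. unfold bdC in H. rewrite H. field. Qed.

(** * The splitting map *)

Definition halfz (s : R) (y : pt) : pt := fun i => if Nat.eqb i 1 then 2 * y 1%nat - s else y i.
Definition Bmap (n k : nat) (beta : pt -> pt) (x : pt) : pt := lam0 (S n) (beta (std (S k) x)).
Definition zof (rho s : R) (x : pt) : pt := halfz s (fun i => x i / rho).
(* [hol rho s] parametrises the boundary of the hole of sign [s] by the boundary of the
   cube. *)
Definition hol (rho s : R) (w : pt) : pt := fun i => if Nat.eqb i 1 then rho * (s + rho * w 1%nat) / 2 else rho * rho * w i.
(** The cube of size [rho] is cut into two half boxes. In the coordinates [zof] each of them is the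
    unit cube, and its hole is the concentric cube of size [rho]. Three shells remain, each with
    room for one homotopy. *)
Definition Qdom (k : nat) (rho : R) (x : pt) : Prop :=
  rmaxabs (S k) x <= 1 /\ rho <= rmaxabs (S k) (zof rho (-1) x) /\ rho <= rmaxabs (S k) (zof rho 1 x).

Section Splitting.
Variables (n k : nat) (beta b : pt -> pt).
Hypothesis Hn : (1 <= n)%nat.
Hypothesis Hk : (1 <= k)%nat.
Hypothesis Mbeta : maps_to (sphere k) (sphere n) beta.
Hypothesis Vbeta : vc (S k) (sphere k) (S n) beta.
Hypothesis Mb : maps_to (sphere k) (sphere n) b.
Hypothesis Vb : vc (S k) (sphere k) (S n) b.
Hypothesis Hbp : b bp = bp.
Hypothesis Hfree : free_homotopic k n beta b.
Hypothesis Hstar : star_condition n k b.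

Let B := Bmap n k beta.

Lemma vc_std_bd : vc (S k) (bdC (S k)) (S k) (std (S k)).
Proof. apply (vc_std (S k) (bdC (S k)) (S k) (fun x => x)); [apply vc_id; auto|]. intros x Hx. pose proof (bd_norm _ _ Hx). lra. Qed.

Lemma vc_post_std f G : maps_to (sphere k) (sphere n) f -> vc (S k) (sphere k) (S n) f -> vc (S n) (sphere n) (S n) G ->
  vc (S k) (bdC (S k)) (S n) (fun x => G (f (std (S k) x))).
Proof.
  intros M V VG. apply (vc_comp _ _ (S n) (sphere n)); auto.
  - intros x Hx. apply M, std_bd_sphere; auto.
  - apply (vc_comp _ _ (S k) (sphere k)); auto; [intros; apply std_bd_sphere; auto|apply vc_std_bd].
Qed.

Lemma vc_lam0_sphere : vc (S n) (sphere n) (S n) (lam0 (S n)).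
Proof. apply (vc_lam0 (S n) (sphere n) (S n) (fun y => y)); [apply vc_id; auto|]. intros y Y. apply sphere_mx; auto. Qed.

Lemma U_lam0 y : sphere n y -> U n (lam0 (S n) y).
Proof. intros Y. apply U_of_mx1, lam0_bd, sphere_mx; auto. Qed.

Lemma vc_Epinch : vc (S n) (sphere n) (S n) (fun y => Ewedge n (pinch n y)).
Proof.
  apply (vc_comp _ _ (S n) (wedge n 2)); [intros; apply pinch_wedge; auto|apply vc_pinch; auto|apply vc_Ewedge; auto].
Qed.

Lemma vc_gmap_sphere s : vc (S n) (sphere n) (S n) (gmap n s).
Proof. apply (vc_gmap n s (sphere n) (S n) (fun y => y)); auto. apply vc_id; auto. Qed.

(** Homotopy for an inner shell: it undoes [kappa], returns from [b] to [beta], and straightens the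
    sheared sphere to the boundary of the half box. *)
Lemma hmt_half s : sgn1 s -> hmt n k (fun x => gmap n s (b (kappa k x))) (fun x => Tmap s (B x)).
Proof.
  intros Hs. apply (hmt_trans n k _ (fun x => gmap n s (b (std (S k) x)))).
  - apply hmt_sym. apply (hmt_kappa n k (fun y => gmap n s (b y))).
    + apply (vc_comp _ _ (S n) (sphere n)); auto. apply vc_gmap_sphere.
    + intros y Y. apply gmap_U; auto.
  - apply (hmt_trans n k _ (fun x => gmap n s (beta (std (S k) x)))).
    + apply hmt_sym. apply hmt_free; auto; [apply vc_gmap_sphere|intros; apply gmap_U; auto].
    + apply hmt_segment.
      * apply vc_post_std; auto. apply vc_gmap_sphere.
      * intros i Hi. pose proof (vc_post_std beta (lam0 (S n)) Mbeta Vbeta vc_lam0_sphere) as V. unfold Tmap, B, Bmap. destruct (Nat.eqb i 1).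
        -- apply (sc_ext _ _ (fun x => / 2 * (lam0 (S n) (beta (std (S k) x)) 1%nat + s))); [intros; field|].
           apply sc_scal, sc_plus; [apply (V 1%nat); lia|apply sc_const].
        -- apply V; auto.
      * intros x th Hx Hth. apply gmap_Tmap_segment; auto. apply Mbeta, std_bd_sphere; auto.
Qed.

Definition f1of (H : pt -> pt) (x : pt) : pt := if Req_EM_T (x O) 1 then Ewedge n (H (pcons 1 (ttop x))) else bst.

(** Homotopy for the outer shell, in four stages: from [beta] to its based representative [b], from
    the radial projection of the target to the pinch followed by [Ewedge], from the radial
    projection of the domain to [kappa], and finally along the homotopy that the star condition
    provides, placed on the top face. *)
Lemma hmt_outer H : cont_on (S k) (S n) (cube (S k)) H -> maps_to (cube (S k)) (wedge n 2) H ->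
  (forall t, cube k t -> forall i, H (pcons 0 t) i = pinch n (b (qmap k t)) i) ->
  (forall s t, 0 <= s <= 1 -> cube k t -> cube_bd k t -> forall i, H (pcons s t) i = origin i) ->
  hmt n k B (f1of H).
Proof.
  intros HC HM H0 Hbd. apply vc_of_cont_on in HC.
  apply (hmt_trans n k _ (fun x => lam0 (S n) (b (std (S k) x)))).
  { apply hmt_free; auto; [apply vc_lam0_sphere|apply U_lam0]. }
  apply (hmt_trans n k _ (fun x => Ewedge n (pinch n (b (std (S k) x))))).
  { apply hmt_sym. apply hmt_segment.
    - apply (vc_post_std b (fun y => Ewedge n (pinch n y))); auto. apply vc_Epinch.
    - apply vc_post_std; auto. apply vc_lam0_sphere.
    - intros x th Hx Hth. apply Epinch_segment; auto. apply Mb, std_bd_sphere; auto. }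
  apply (hmt_trans n k _ (fun x => Ewedge n (pinch n (b (kappa k x))))).
  { apply (hmt_kappa n k (fun y => Ewedge n (pinch n (b y)))).
    - apply (vc_comp _ _ (S n) (sphere n) _ b (fun y => Ewedge n (pinch n y))); auto. apply vc_Epinch.
    - intros y Y. apply Ewedge_U, pinch_wedge; auto. }
  assert (Hbd' : forall th t, 0 <= th <= 1 -> cube k t -> cube_bd k t -> H (pcons th t) = origin).
  { intros th t A1 A2 A3. apply functional_extensionality. intros i. apply Hbd; auto. }
  exists (fun p => if Req_EM_T (p 1%nat) 1 then Ewedge n (H (pcons (p O) (ttop (ptail p)))) else bst). split; [|split].
  - apply (vc_topglue n k (fun p => Ewedge n (H p)) bst).
    + apply (vc_comp _ _ (S n) (wedge n 2)); auto. apply vc_Ewedge; auto.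
    + intros th t i A1 A2 A3. rewrite Hbd', Ewedge_origin by auto. reflexivity.
  - intros p [A C]. destruct (Req_EM_T _ _).
    + apply Ewedge_U, HM. intros [|i] Hi; simpl; [exact A|]. apply (ttop_cube k _ C). lia.
    + rewrite <- (gmap_bp n 1). apply gmap_U; [left; auto|apply bp_sphere].
  - intros x i Hx Hi. change (ptail (pcons 0 x)) with x. change (ptail (pcons 1 x)) with x. simpl (pcons _ x _). split.
    + unfold kappa. destruct (Req_EM_T (x O) 1).
      * f_equal. f_equal. apply functional_extensionality. intros j. apply H0, ttop_cube; auto.
      * rewrite Hbp, pinch_bp, Ewedge_origin by auto. reflexivity.
    + reflexivity.
Qed.

Lemma kappa_mid z : bdC (S k) z -> Rabs (z 1%nat) = 1 -> kappa k z = bp.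
Proof.
  intros Hz E. unfold kappa. destruct (Req_EM_T (z O) 1); auto. apply qmap_bd; [apply ttop_cube; auto|].
  exists O. split; [lia|]. unfold ttop. unfold Rabs in E. destruct (Rcase_abs _) in E; lra.
Qed.

(** Compatibility of the shells: seen on either half, the concatenation is a single copy of [b]. On
    the middle plane and off the top face all maps take the base value. *)
Lemma f1_half H s y z i : (forall t, cube k t -> forall i, H (pcons 1 t) i =
     concat ((fun t => incl 1 (b (qmap k t))) :: (fun t => incl 2 (b (qmap k t))) :: nil) t i) ->
  sgn1 s -> bdC (S k) y -> bdC (S k) z -> 0 <= s * y 1%nat -> (forall j, (j < S k)%nat -> z j = halfz s y j) ->
  f1of H y i = gmap n s (b (kappa k z)) i.
Proof.
  intros H1 Hs Hy Hz Hsy Ez. unfold f1of, kappa.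
  assert (Ez0 : z O = y O) by (rewrite Ez by lia; reflexivity). rewrite Ez0.
  destruct (Req_EM_T (y O) 1) as [E1|E1]; [|rewrite Hbp, gmap_bp; reflexivity].
  assert (Ct := ttop_cube k y Hy). assert (Cz := ttop_cube k z Hz).
  assert (EH : H (pcons 1 (ttop y)) = concat ((fun t => incl 1 (b (qmap k t))) :: (fun t => incl 2 (b (qmap k t))) :: nil) (ttop y)).
  { apply functional_extensionality. intros j. apply H1; auto. }
  rewrite EH, concat_two by (apply Ct; lia).
  assert (Ez1 : z 1%nat = 2 * y 1%nat - s) by (rewrite Ez by lia; reflexivity).
  assert (Hmatch : forall c, (z 1%nat + 1) / 2 = c -> qmap k (fun i => match i with O => c | S _ => ttop y i end) = qmap k (ttop z)).
  { intros c Ec. apply qmap_ext. intros [|j] Hj; [rewrite <- Ec; reflexivity|]. unfold ttop. rewrite (Ez (S (S j))) by lia. reflexivity. }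
  change (ttop y O) with ((y 1%nat + 1) / 2) in *.
  destruct (Rlt_dec ((y 1%nat + 1) / 2) (/ 2)) as [L|L].
  - assert (s = -1) by (destruct Hs; subst s; [exfalso; lra|reflexivity]). subst s.
    rewrite Ewedge_1; rewrite unincl1; [|apply Mb, qmap_sphere]. rewrite (Hmatch (2 * ((y 1%nat + 1) / 2))) by (rewrite Ez1; field). reflexivity.
  - rewrite Ewedge_2; rewrite unincl2; [|apply Mb, qmap_sphere].
    destruct Hs; subst s.
    + rewrite (Hmatch (2 * ((y 1%nat + 1) / 2) - 1)) by (rewrite Ez1; field). reflexivity.
    + assert (Ey1 : y 1%nat = 0) by lra.
      rewrite (qmap_bd k (ttop z)); auto.
      2:{ exists O. split; [lia|]. unfold ttop. rewrite Ez1, Ey1. right; field. }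
      rewrite qmap_bd, Hbp, !gmap_bp; auto.
      * intros [|j] Hj; [rewrite Ey1; lra|]. apply Ct. auto.
      * exists O. split; [lia|]. left. rewrite Ey1. field.
Qed.

(** The homotopy of [hmt_outer] runs along the radius of the outer shell, those of [hmt_half] along
    the radius of [zof] in the half boxes. They agree where the shells meet: on the cube of size
    [rho] by [f1_half], and on the middle plane because both inner maps are constantly [bst]
    there. *)
Theorem splitting_map rho : 0 < rho < 1 -> exists h : pt -> pt,
  vc (S k) (Qdom k rho) (S n) h /\ (forall x, Qdom k rho x -> U n (h x)) /\
  (forall x i, bdC (S k) x -> (i < S n)%nat -> h x i = B x i) /\
  (forall s w i, sgn1 s -> bdC (S k) w -> (i < S n)%nat -> Qdom k rho (hol rho s w) /\ h (hol rho s w) i = Tmap s (B w) i).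
Proof.
  intros Hrho. destruct (star_pinch n Hn k b Hstar) as (H & HC & HM & HE & Hbd).
  destruct (hmt_outer H HC HM (fun t Ht i => proj1 (HE t Ht i)) Hbd) as (Ho & Vo & Uo & Eo).
  assert (HI : forall s, exists Hi : pt -> pt, sgn1 s -> vc (S (S k)) (Dom k) (S n) Hi /\ (forall p, Dom k p -> U n (Hi p)) /\
     (forall x i, bdC (S k) x -> (i < S n)%nat -> Hi (pcons 0 x) i = gmap n s (b (kappa k x)) i /\ Hi (pcons 1 x) i = Tmap s (B x) i)).
  { intros s. destruct (classic (sgn1 s)) as [Hs|Hs]; [|exists (fun x => x); intros; contradiction].
    destruct (hmt_half s Hs) as (Hi & A1 & A2 & A3). exists Hi; auto. }
  set (Hin := fun s => proj1_sig (constructive_indefinite_description _ (HI s))).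
  assert (HHin : forall s, sgn1 s -> vc (S (S k)) (Dom k) (S n) (Hin s) /\ (forall p, Dom k p -> U n (Hin s p)) /\
     (forall x i, bdC (S k) x -> (i < S n)%nat -> Hin s (pcons 0 x) i = gmap n s (b (kappa k x)) i /\ Hin s (pcons 1 x) i = Tmap s (B x) i)).
  { intros s Hs. unfold Hin. destruct (constructive_indefinite_description _ (HI s)) as [Hi P]. simpl. auto. }
  clearbody Hin. clear HI.
  set (N := rmaxabs (S k)).
  set (po := fun x => pcons ((1 - N x) / (1 - rho)) (lam0 (S k) x)).
  set (pin := fun s x => pcons ((1 - N (zof rho s x)) / (1 - rho)) (lam0 (S k) (zof rho s x))).
  set (h := fun x => if Rle_dec rho (N x) then Ho (po x) else if Rle_dec (x 1%nat) 0 then Hin (-1) (pin (-1) x) else Hin 1 (pin 1 x)).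
  assert (Hth : forall a, rho <= a <= 1 -> 0 <= (1 - a) / (1 - rho) <= 1).
  { intros a Ha. split; [apply Rmult_le_pos; [lra|left; apply Rinv_0_lt_compat; lra]|].
    apply (Rmult_le_reg_r (1 - rho)); [lra|]. unfold Rdiv. rewrite Rmult_assoc, Rinv_l; lra. }
  assert (Sm1 : sgn1 (-1)) by (right; auto). assert (Sp1 : sgn1 1) by (left; auto).
  assert (HQ : forall s x, sgn1 s -> Qdom k rho x -> rho <= N (zof rho s x)) by (intros s x [-> | ->] (A1 & A2 & A3); auto).
  assert (Hz1 : forall s x, sgn1 s -> N x <= rho -> 0 <= s * x 1%nat -> N (zof rho s x) <= 1).
  { intros s x Hs HN Hsx. apply mx_le; [lra|]. intros i Hi. unfold zof, halfz.
    pose proof (mx_le_inv _ _ _ HN) as HN'. assert (Q : forall j, (j < S k)%nat -> -1 <= x j / rho <= 1).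
    { intros j Hj. specialize (HN' j Hj). split; apply (Rmult_le_reg_r rho); try lra; unfold Rdiv; rewrite Rmult_assoc, Rinv_l; lra. }
    destruct (Nat.eqb i 1); [|apply Rabs_le_iff, Q; auto]. specialize (Q 1%nat ltac:(lia)).
    assert (0 <= s * (x 1%nat / rho)) by (replace (s * (x 1%nat / rho)) with (s * x 1%nat * / rho) by (unfold Rdiv; ring); apply Rmult_le_pos; [lra|left; apply Rinv_0_lt_compat; lra]).
    apply Rabs_le_iff. destruct Hs; subst s; lra. }
  assert (Dpo : forall x, N x <= 1 -> rho <= N x -> Dom k (po x)).
  { intros x A1 A2. split; [apply Hth; lra|]. apply lam0_bd. fold N. lra. }
  assert (Dpin : forall s x, sgn1 s -> Qdom k rho x -> N x <= rho -> 0 <= s * x 1%nat -> Dom k (pin s x)).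
  { intros s x Hs Hq HN Hsx. specialize (HQ s x Hs Hq). split; [apply Hth; split; auto|]. apply lam0_bd. fold N. lra. }
  assert (Vz : forall s A, vc (S k) A (S k) (zof rho s)).
  { intros s A i Hi. unfold zof, halfz. destruct (Nat.eqb i 1).
    - apply sc_minus; [|apply sc_const]. apply (sc_ext _ _ (fun x => (2 / rho) * x 1%nat)); [intros; field; lra|]. apply sc_scal, sc_coord; lia.
    - apply (sc_ext _ _ (fun x => / rho * x i)); [intros; field; lra|]. apply sc_scal, sc_coord; auto. }
  assert (Vr : forall A d g, sc d A g -> sc d A (fun x => (1 - g x) / (1 - rho))).
  { intros A d g G. apply sc_mult; [apply sc_minus; [apply sc_const|auto]|apply sc_const]. }
  assert (VN : forall A, sc (S k) A N) by (intros A; apply (sc_mx (S k) A (S k) (fun x => x)); intros; apply sc_coord; auto).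

  assert (Pin0 : forall s x, sgn1 s -> N (zof rho s x) = 1 -> pin s x = pcons 0 (lam0 (S k) (zof rho s x))).
  { intros s x Hs E. unfold pin. rewrite E. f_equal. unfold Rdiv; ring. }
  assert (Ginner : forall s x i, sgn1 s -> (i < S n)%nat -> N x = rho -> 0 <= s * x 1%nat -> Ho (po x) i = Hin s (pin s x) i).
  { intros s x i Hs Hi EN Hsx.
    assert (Ez : N (zof rho s x) = 1).
    { apply Rle_antisym; [apply Hz1; auto; lra|]. destruct (mx_attained (S k) x) as [j [Hj Ej]]; [lia|]. fold N in Ej. rewrite EN in Ej.
      assert (Q : Rabs (x j / rho) = 1) by (unfold Rdiv; rewrite Rabs_mult, Ej, Rabs_pos_eq by (left; apply Rinv_0_lt_compat; lra); field; lra).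
      rewrite <- Q. destruct (Nat.eq_dec j 1) as [->|Nj].
      - eapply Rle_trans; [|apply (mx_ge (S k) _ 1%nat ltac:(lia))]. unfold zof, halfz. simpl.
        assert (0 <= s * (x 1%nat / rho)) by (replace (s * (x 1%nat / rho)) with (s * x 1%nat * / rho) by (unfold Rdiv; ring); apply Rmult_le_pos; [lra|left; apply Rinv_0_lt_compat; lra]).
        assert (x 1%nat / rho = s) as -> by (revert Q; unfold Rabs; destruct (Rcase_abs _); intros Q; destruct Hs; subst s; lra).
        destruct Hs; subst s; unfold Rabs; repeat destruct (Rcase_abs _); lra.
      - eapply Rle_trans; [|apply (mx_ge (S k) _ j Hj)]. unfold zof, halfz. rewrite (proj2 (Nat.eqb_neq j 1) Nj). lra. }
    rewrite Pin0 by auto. replace (po x) with (pcons 1 (lam0 (S k) x)) by (unfold po; rewrite EN; f_equal; field; lra).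
    assert (Bx : bdC (S k) (lam0 (S k) x)) by (apply lam0_bd; fold N; lra).
    assert (Bz : bdC (S k) (lam0 (S k) (zof rho s x))) by (apply lam0_bd; fold N; lra).
    destruct (Eo _ i Bx Hi) as [_ ->]. destruct (HHin s Hs) as (_ & _ & E). destruct (E _ i Bz Hi) as [-> _].
    apply f1_half; auto.
    - intros t Ht j. apply HE; auto.
    - rewrite lam0_in by lia. fold N. rewrite EN. replace (s * (x 1%nat / rho)) with (s * x 1%nat * / rho) by (unfold Rdiv; ring). apply Rmult_le_pos; [auto|left; apply Rinv_0_lt_compat; lra].
    - intros j Hj. rewrite lam0_in by auto. fold N. rewrite Ez. unfold zof, halfz. rewrite !lam0_in by lia. fold N. rewrite EN. destruct (Nat.eqb j 1); field; lra. }
  assert (Gmid : forall s x i, sgn1 s -> (i < S n)%nat -> N x <= rho -> x 1%nat = 0 -> Hin s (pin s x) i = bst i).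
  { intros s x i Hs Hi HN E0.
    assert (Zs : zof rho s x 1%nat = - s) by (unfold zof, halfz; simpl; rewrite E0; field; lra).
    assert (As : Rabs (- s) = 1) by (destruct Hs; subst s; [rewrite Rabs_left|rewrite Rabs_pos_eq]; lra).
    assert (Ez : N (zof rho s x) = 1).
    { apply Rle_antisym; [apply Hz1; auto; rewrite E0; lra|]. rewrite <- As, <- Zs. apply (mx_ge (S k)). lia. }
    rewrite Pin0 by auto. assert (Bz : bdC (S k) (lam0 (S k) (zof rho s x))) by (apply lam0_bd; fold N; lra).
    destruct (HHin s Hs) as (_ & _ & E). destruct (E _ i Bz Hi) as [-> _]. rewrite kappa_mid, Hbp, gmap_bp; auto.
    rewrite lam0_in by lia. fold N. rewrite Ez, Zs. replace (- s / 1) with (- s) by field. auto. }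
  exists h. split; [|split; [|split]].
  - apply (vc_glue _ _ _ (fun x => N x - rho)); [apply sc_minus; [apply VN|apply sc_const]| |].
    + apply (vc_glue _ _ _ (fun x => x 1%nat)); [apply sc_coord; lia| |].
      * apply (vc_ext _ _ _ (fun x => Hin (-1) (pin (-1) x))).
        -- intros x [[Hq A1] A2] i Hi. unfold h. destruct (Rle_dec rho (N x)).
           ++ symmetry. apply Ginner; auto; lra.
           ++ destruct (Rle_dec (x 1%nat) 0); [reflexivity|lra].
        -- apply (vc_comp _ _ (S (S k)) (Dom k)); [intros x [[Hq A1] A2]; apply Dpin; auto; lra| |apply HHin; auto].
           apply vc_pcons; [apply Vr, (sc_mx _ _ (S k) (zof rho (-1))), Vz|].
           apply vc_lam0; [apply Vz|]. intros x [[Hq A1] A2]. specialize (HQ (-1) x Sm1 Hq). fold N. lra.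
      * apply (vc_ext _ _ _ (fun x => Hin 1 (pin 1 x))).
        -- intros x [[Hq A1] A2] i Hi. unfold h. destruct (Rle_dec rho (N x)).
           ++ symmetry. apply Ginner; auto; lra.
           ++ destruct (Rle_dec (x 1%nat) 0); [|reflexivity]. rewrite !Gmid; auto; lra.
        -- apply (vc_comp _ _ (S (S k)) (Dom k)); [intros x [[Hq A1] A2]; apply Dpin; auto; lra| |apply HHin; auto].
           apply vc_pcons; [apply Vr, (sc_mx _ _ (S k) (zof rho 1)), Vz|].
           apply vc_lam0; [apply Vz|]. intros x [[Hq A1] A2]. specialize (HQ 1 x Sp1 Hq). fold N. lra.
    + apply (vc_ext _ _ _ (fun x => Ho (po x))).
      * intros x [Hq A1] i Hi. unfold h. destruct (Rle_dec rho (N x)); [reflexivity|lra].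
      * apply (vc_comp _ _ (S (S k)) (Dom k)); [intros x [(Hq & _) A1]; apply Dpo; auto; lra| |auto].
        apply vc_pcons; [apply Vr, VN|]. apply (vc_lam0 _ _ (S k) (fun x => x)); [apply vc_id; auto|]. intros x [_ A1]. fold N. lra.
  - intros x Hq. unfold h. destruct (Rle_dec rho (N x)); [apply Uo, Dpo; auto; apply Hq|].
    destruct (Rle_dec (x 1%nat) 0).
    + destruct (HHin (-1) Sm1) as (_ & HU & _). apply HU, Dpin; auto; lra.
    + destruct (HHin 1 Sp1) as (_ & HU & _). apply HU, Dpin; auto; lra.
  - intros x i Hx Hi. unfold h. assert (EN : N x = 1) by exact Hx. destruct (Rle_dec rho (N x)); [|lra].
    replace (po x) with (pcons 0 (lam0 (S k) x)) by (unfold po; rewrite EN; f_equal; field; lra).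
    destruct (Eo (lam0 (S k) x) i) as [-> _]; [apply lam0_bd; fold N; lra|auto|].
    unfold B, Bmap. rewrite (std_ext (S k) (lam0 (S k) x) x); [reflexivity|]. intros j Hj. apply lam0_bd_in; auto.
  - intros s w i Hs Hw Hi.
    assert (Ez : forall j, zof rho s (hol rho s w) j = rho * w j).
    { intros j. unfold zof, halfz, hol. destruct (Nat.eqb j 1) eqn:Qj; simpl; [apply Nat.eqb_eq in Qj; subst j|]; field; lra. }
    assert (Nz : N (zof rho s (hol rho s w)) = rho).
    { unfold N. rewrite (mx_ext (S k) _ (fun j => rho * w j)) by (intros; rewrite Ez; auto). rewrite mx_scal, Rabs_pos_eq by lra.
      unfold bdC in Hw. rewrite Hw. ring. }
    assert (Bw : forall j, (j < S k)%nat -> -1 <= w j <= 1) by (apply mx_le_inv; unfold bdC in Hw; lra).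
    assert (Nlt : N (hol rho s w) < rho).
    { apply Rle_lt_trans with (rho * ((1 + rho) / 2)); [|nra]. apply mx_le; [nra|]. intros j Hj. unfold hol. specialize (Bw j Hj).
      destruct (Nat.eqb j 1) eqn:Qj.
      - apply Nat.eqb_eq in Qj. subst j. replace (rho * (s + rho * w 1%nat) / 2) with (rho * ((s + rho * w 1%nat) / 2)) by field.
        rewrite Rabs_mult, (Rabs_pos_eq rho) by lra. apply Rmult_le_compat_l; [lra|]. apply Rabs_le_iff. destruct Hs; subst s; nra.
      - rewrite Rmult_assoc, Rabs_mult, (Rabs_pos_eq rho) by lra. apply Rmult_le_compat_l; [lra|]. apply Rabs_le_iff. nra. }
    assert (W1 := Bw 1%nat ltac:(lia)).
    assert (Hop : forall s', s' = - s -> rho <= N (zof rho s' (hol rho s w))).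
    { intros s' ->. eapply Rle_trans; [|apply (mx_ge (S k) _ 1%nat ltac:(lia))]. unfold zof, halfz, hol. simpl.
      replace (2 * (rho * (s + rho * w 1%nat) / 2 / rho) - - s) with (2 * s + rho * w 1%nat) by (field; lra).
      destruct Hs; subst s; [rewrite Rabs_pos_eq by nra|rewrite Rabs_left by nra]; nra. }
    assert (Hq : Qdom k rho (hol rho s w)).
    { split; [fold N; lra|]. destruct Hs; subst s; split; fold N; solve [lra | apply Hop; lra]. }
    split; auto. unfold h. destruct (Rle_dec rho (N (hol rho s w))); [lra|].
    assert (Epin : pin s (hol rho s w) = pcons 1 (lam0 (S k) (zof rho s (hol rho s w)))) by (unfold pin; rewrite Nz; f_equal; field; lra).
    assert (Hfin : Hin s (pin s (hol rho s w)) i = Tmap s (B w) i).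
    { rewrite Epin. destruct (HHin s Hs) as (_ & _ & E).
      destruct (E (lam0 (S k) (zof rho s (hol rho s w))) i) as [_ ->]; [apply lam0_bd; fold N; lra|auto|].
      unfold B, Bmap. rewrite (std_ext (S k) (lam0 (S k) (zof rho s (hol rho s w))) w); [reflexivity|].
      intros j Hj. rewrite lam0_in by auto. fold N. rewrite Nz, Ez. field. lra. }
    assert (Hsign : s * hol rho s w 1%nat > 0).
    { unfold hol. simpl. destruct Hs; subst s; nra. }
    destruct (Rle_dec (hol rho s w 1%nat) 0).
    + assert (s = -1) by (destruct Hs; subst s; [exfalso; lra|reflexivity]). subst s. auto.
    + assert (s = 1) by (destruct Hs; subst s; [reflexivity|exfalso; lra]). subst s. auto.
Qed.
End Splitting.

(** * Lipschitz retraction onto the walls of the two half boxes *)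

Definition clamp1 (t : R) : R := Rmax (-1) (Rmin 1 t).

Lemma clamp1_bound t : -1 <= clamp1 t <= 1.
Proof. unfold clamp1, Rmax, Rmin. repeat destruct (Rle_dec _ _); lra. Qed.

Lemma clamp1_id t : -1 <= t <= 1 -> clamp1 t = t.
Proof. unfold clamp1, Rmax, Rmin. intros. repeat destruct (Rle_dec _ _); lra. Qed.

Lemma clamp1_lip a b : Rabs (clamp1 a - clamp1 b) <= Rabs (a - b).
Proof. unfold clamp1, Rmax, Rmin, Rabs. repeat destruct (Rle_dec _ _); repeat destruct (Rcase_abs _); lra. Qed.

Definition Wall (n : nat) (w : pt) : Prop := exists s z, sgn1 s /\ bdC (S n) z /\ forall i, (i < S n)%nat -> w i = Tmap s z i.

Definition hret (n : nat) (s : R) (v : pt) : pt := Tmap s (lam0 (S n) (halfz s v)).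
(** Clamping to the cube precedes the retraction, since the maps to be retracted are only known to
    avoid the centres and may leave the cube. *)
Definition retn (n : nat) (u : pt) : pt :=
  let v := fun i => clamp1 (u i) in hret n (if Rle_dec (v 1%nat) 0 then -1 else 1) v.

Section Retraction.
Variable n : nat.
Hypothesis Hn : (1 <= n)%nat.

Lemma halfz_mx s v : rmaxabs (S n) (fun i => v i - cpt s i) <= rmaxabs (S n) (halfz s v).
Proof.
  apply mx_le; [apply mx_nonneg|]. intros i Hi. eapply Rle_trans; [|apply (mx_ge (S n) _ i Hi)].
  unfold halfz, cpt. destruct (Nat.eqb i 1) eqn:Q; [apply Nat.eqb_eq in Q; subst i|rewrite Rminus_0_r; lra].
  unfold Rabs. repeat destruct (Rcase_abs _); lra.
Qed.

Lemma Tmap_cl s z z' a : 0 <= a -> cl (S n) z z' a -> cl (S n) (Tmap s z) (Tmap s z') a.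
Proof.
  intros Ha H i Hi. unfold Tmap. specialize (H i Hi). destruct (Nat.eqb i 1) eqn:Q; auto. apply Nat.eqb_eq in Q. subst i.
  apply Rabs_le_iff in H. apply Rabs_le_iff. lra.
Qed.

Lemma hret_lip s v v' a m : 0 < m -> m <= rmaxabs (S n) (fun i => v i - cpt s i) -> m <= rmaxabs (S n) (fun i => v' i - cpt s i) ->
  0 <= a -> cl (S n) v v' a -> cl (S n) (hret n s v) (hret n s v') (4 / m * a).
Proof.
  intros Hm H H' Ha C. pose proof (halfz_mx s v). pose proof (halfz_mx s v').
  replace (4 / m * a) with (2 / m * (2 * a)) by (field; lra).
  assert (0 <= 2 / m * (2 * a)) by (repeat apply Rmult_le_pos; try lra; left; apply Rinv_0_lt_compat; lra).
  apply Tmap_cl; auto. apply lam0_lip; try lra. intros i Hi. unfold halfz. specialize (C i Hi).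
  destruct (Nat.eqb i 1) eqn:Q; [|lra]. apply Nat.eqb_eq in Q. subst i. apply Rabs_le_iff in C. apply Rabs_le_iff. lra.
Qed.

Lemma halfz_mid_bd s v : sgn1 s -> (forall i, (i < S n)%nat -> -1 <= v i <= 1) -> v 1%nat = 0 -> bdC (S n) (halfz s v).
Proof.
  intros Hs Hv E. apply Rle_antisym.
  - apply mx_le; [lra|]. intros i Hi. unfold halfz. destruct (Nat.eqb i 1); apply Rabs_le_iff; [rewrite E; destruct Hs; subst; lra|apply Hv; auto].
  - eapply Rle_trans; [|apply (mx_ge (S n) _ 1%nat ltac:(lia))]. unfold halfz. simpl. rewrite E.
    unfold Rabs. destruct (Rcase_abs _); destruct Hs; subst; lra.
Qed.

(** Inside the cube the middle plane is a common face of the two half boxes, so both radial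
    retractions fix it. This makes the choice of the sign in [retn] harmless. *)
Lemma hret_mid s v i : sgn1 s -> (forall i, (i < S n)%nat -> -1 <= v i <= 1) -> v 1%nat = 0 -> (i < S n)%nat -> hret n s v i = v i.
Proof.
  intros Hs Hv E Hi. pose proof (halfz_mid_bd s v Hs Hv E) as B. unfold hret, Tmap.
  rewrite !lam0_bd_in by (auto; lia). unfold halfz. destruct (Nat.eqb i 1) eqn:Q; [|reflexivity].
  apply Nat.eqb_eq in Q. subst i. simpl. rewrite E. field.
Qed.

Lemma retn_lip u u' a m : 0 < m <= / 2 -> (forall s, sgn1 s -> m <= rmaxabs (S n) (fun i => u i - cpt s i)) ->
  (forall s, sgn1 s -> m <= rmaxabs (S n) (fun i => u' i - cpt s i)) ->
  0 <= a -> cl (S n) u u' a -> cl (S n) (retn n u) (retn n u') (8 / m * a).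
Proof.
  intros Hm H H' Ha C.
  assert (K : forall u, (forall s, sgn1 s -> m <= rmaxabs (S n) (fun i => u i - cpt s i)) ->
     forall s, sgn1 s -> m <= rmaxabs (S n) (fun i => clamp1 (u i) - cpt s i)).
  { intros v Hv s Hs. destruct (mx_attained (S n) (fun i => v i - cpt s i)) as [i [Hi E]]; [lia|].
    specialize (Hv s Hs). rewrite <- E in Hv. eapply Rle_trans; [|apply (mx_ge (S n) _ i Hi)]. simpl.
    assert (- / 2 <= cpt s i <= / 2) by (unfold cpt; destruct (Nat.eqb i 1); [destruct Hs; subst s|]; lra).
    revert Hv. unfold clamp1, Rmax, Rmin, Rabs. repeat destruct (Rle_dec _ _); repeat destruct (Rcase_abs _); lra. }
  set (v := fun i => clamp1 (u i)). set (v' := fun i => clamp1 (u' i)).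
  change (retn n u) with (hret n (if Rle_dec (v 1%nat) 0 then -1 else 1) v).
  change (retn n u') with (hret n (if Rle_dec (v' 1%nat) 0 then -1 else 1) v').
  pose proof (K u H) as Kv. pose proof (K u' H') as Kv'. 
  change (forall s, sgn1 s -> m <= rmaxabs (S n) (fun i => v i - cpt s i)) in Kv.
  change (forall s, sgn1 s -> m <= rmaxabs (S n) (fun i => v' i - cpt s i)) in Kv'.
  assert (C' : cl (S n) v v' a) by (intros i Hi; eapply Rle_trans; [apply clamp1_lip|apply C; auto]).
  assert (Bv : forall i, -1 <= v i <= 1) by (intros; apply clamp1_bound).
  assert (Bv' : forall i, -1 <= v' i <= 1) by (intros; apply clamp1_bound).
  clearbody v v'. clear K H H' C u u'.
  assert (Sm : sgn1 (-1)) by (right; auto). assert (Sp : sgn1 1) by (left; auto).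
  assert (P4 : 0 <= 4 / m * a) by (repeat apply Rmult_le_pos; try lra; left; apply Rinv_0_lt_compat; lra).
  assert (E8 : 8 / m * a = 4 / m * a + 4 / m * a) by (field; lra).
  assert (cross : forall s s' v v', sgn1 s -> sgn1 s' -> (forall i, -1 <= v i <= 1) -> (forall i, -1 <= v' i <= 1) ->
     (forall s, sgn1 s -> m <= rmaxabs (S n) (fun i => v i - cpt s i)) -> (forall s, sgn1 s -> m <= rmaxabs (S n) (fun i => v' i - cpt s i)) ->
     cl (S n) v v' a -> v 1%nat <= 0 -> 0 < v' 1%nat -> cl (S n) (hret n s v) (hret n s' v') (8 / m * a)).
  (* The segment is cut where it meets the middle plane. Both retractions are the identity there, so
     the bounds on the two pieces add up. *)
  { clear v v' C' Bv Bv' Kv Kv'. intros s s' v v' Hs Hs' Bv Bv' Kv Kv' C' H0 H1. set (t := - v 1%nat / (v' 1%nat - v 1%nat)).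
    assert (Ht : 0 <= t <= 1).
    { unfold t. split; [apply Rmult_le_pos; [lra|left; apply Rinv_0_lt_compat; lra]|].
      apply (Rmult_le_reg_r (v' 1%nat - v 1%nat)); [lra|]. unfold Rdiv. rewrite Rmult_assoc, Rinv_l; lra. }
    set (w := fun i => v i + t * (v' i - v i)).
    assert (Bw : forall i, -1 <= w i <= 1) by (intros i; unfold w; specialize (Bv i); specialize (Bv' i); nra).
    assert (W1 : w 1%nat = 0) by (unfold w, t; field; lra).
    assert (Kw : forall s, sgn1 s -> m <= rmaxabs (S n) (fun i => w i - cpt s i)).
    { intros r Hr. eapply Rle_trans; [|apply (mx_ge (S n) _ 1%nat ltac:(lia))]. simpl. rewrite W1. unfold cpt, Rabs. simpl.
      destruct (Rcase_abs _); destruct Hr; subst r; lra. }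
    assert (Cw : cl (S n) v w a /\ cl (S n) w v' a).
    { split; intros i Hi; specialize (C' i Hi); apply Rabs_le_iff in C'; apply Rabs_le_iff; unfold w; nra. }
    rewrite E8. apply (cl_trans _ _ (hret n s w)); [apply hret_lip; try lra; auto; apply Cw|].
    replace (4 / m * a) with (0 + 4 / m * a) by ring. apply (cl_trans _ _ (hret n s' w)).
    - intros i Hi. rewrite !hret_mid by auto. rewrite Rminus_diag, Rabs_R0. lra.
    - apply hret_lip; try lra; auto; apply Cw. }
  destruct (Rle_dec (v 1%nat) 0), (Rle_dec (v' 1%nat) 0).
  - apply (cl_mono _ _ _ (4 / m * a)); [|lra]. apply hret_lip; auto; lra.
  - apply cross; auto; lra.
  - apply cl_sym, cross; auto; [apply cl_sym; auto|lra].
  - apply (cl_mono _ _ _ (4 / m * a)); [|lra]. apply hret_lip; auto; lra.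
Qed.

Lemma retn_wall m u : 0 < m <= / 2 -> (forall s, sgn1 s -> m <= rmaxabs (S n) (fun i => u i - cpt s i)) -> Wall n (retn n u).
Proof.
  intros Hm H. unfold retn. set (v := fun i => clamp1 (u i)). set (s := if Rle_dec (v 1%nat) 0 then -1 else 1).
  assert (Hs : sgn1 s) by (unfold s; destruct (Rle_dec _ _); [right|left]; auto).
  exists s, (lam0 (S n) (halfz s v)). split; [auto|split; [|reflexivity]]. apply lam0_bd.
  apply Rlt_le_trans with m; [lra|]. eapply Rle_trans; [|apply halfz_mx].
  destruct (mx_attained (S n) (fun i => u i - cpt s i)) as [i [Hi E]]; [lia|].
  specialize (H s Hs). rewrite <- E in H. eapply Rle_trans; [|apply (mx_ge (S n) _ i Hi)]. simpl.
  assert (- / 2 <= cpt s i <= / 2) by (unfold cpt; destruct (Nat.eqb i 1); [destruct Hs as [-> | ->]|]; lra).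
  revert H. unfold v, clamp1, Rmax, Rmin, Rabs. repeat destruct (Rle_dec _ _); repeat destruct (Rcase_abs _); lra.
Qed.

Lemma bdC_wall z : bdC (S n) z -> Wall n z.
Proof.
  intros Hz. assert (B := mx_le_inv (S n) z 1 ltac:(unfold bdC in Hz; lra)).
  assert (K : forall s, sgn1 s -> 0 <= s * z 1%nat -> Wall n z).
  { intros s Hs Hsz. pose proof (B 1%nat ltac:(lia)) as B1. exists s, (halfz s z). split; [auto|split].
    - apply Rle_antisym.
      + apply mx_le; [lra|]. intros i Hi. unfold halfz. apply Rabs_le_iff. destruct (Nat.eqb i 1); [destruct Hs; subst s; lra|apply B; auto].
      + destruct (mx_attained (S n) z) as [j [Hj E]]; [lia|]. rewrite Hz in E. rewrite <- E. eapply Rle_trans; [|apply (mx_ge (S n) _ j Hj)].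
        unfold halfz. destruct (Nat.eqb j 1) eqn:Q; [apply Nat.eqb_eq in Q; subst j|lra].
        revert E. unfold Rabs; repeat destruct (Rcase_abs _); destruct Hs; subst s; lra.
    - intros i Hi. unfold Tmap, halfz. destruct (Nat.eqb i 1) eqn:Q; [apply Nat.eqb_eq in Q; subst i; simpl; field|reflexivity]. }
  destruct (Rle_dec 0 (z 1%nat)); [apply (K 1)|apply (K (-1))]; try (left; reflexivity); try (right; reflexivity); lra.
Qed.

Lemma retn_id u : Wall n u -> cl (S n) (retn n u) u 0.
Proof.
  intros (s & z & Hs & Hz & E) i Hi.
  assert (Bz : forall i, (i < S n)%nat -> -1 <= z i <= 1) by (apply mx_le_inv; unfold bdC in Hz; lra).
  assert (Bu : forall i, (i < S n)%nat -> -1 <= u i <= 1).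
  { intros j Hj. rewrite E by auto. unfold Tmap. destruct (Nat.eqb j 1); [|auto]. specialize (Bz 1%nat ltac:(lia)). destruct Hs; subst s; lra. }
  set (v := fun i => clamp1 (u i)). change (retn n u) with (hret n (if Rle_dec (v 1%nat) 0 then -1 else 1) v).
  assert (Ev : forall j, (j < S n)%nat -> v j = u j) by (intros; apply clamp1_id; auto).
  assert (v1 : v 1%nat = (z 1%nat + s) / 2) by (rewrite Ev, E by lia; reflexivity).
  enough (KK : forall r, sgn1 r -> 0 <= r * v 1%nat -> hret n r v i = u i).
  - rewrite KK; [rewrite Rminus_diag, Rabs_R0; lra|destruct (Rle_dec _ _); [right|left]; auto|destruct (Rle_dec _ _); lra].
  - intros r Hr K. destruct (Req_dec r s) as [->|Nrs].
    + assert (Eh : forall j, (j < S n)%nat -> halfz s v j = z j).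
      { intros j Hj. unfold halfz. destruct (Nat.eqb j 1) eqn:Q; [apply Nat.eqb_eq in Q; subst j; rewrite v1; field|].
        rewrite Ev, E by auto. unfold Tmap. rewrite Q. reflexivity. }
      assert (Bh : bdC (S n) (halfz s v)) by (unfold bdC; rewrite (mx_ext (S n) _ z) by (intros; rewrite Eh; auto); exact Hz).
      unfold hret, Tmap. rewrite !lam0_bd_in by (auto; lia). rewrite !Eh, E by (auto; lia). reflexivity.
    + rewrite hret_mid; auto; [intros; rewrite Ev; auto|]. specialize (Bz 1%nat ltac:(lia)).
      rewrite v1 in K |- *. destruct Hr, Hs; subst; try (exfalso; apply Nrs; reflexivity); lra.
Qed.
End Retraction.

(** * Lipschitz splitting maps *)

Lemma zof_cl k rho s x y a : 0 < rho <= 1 -> 0 <= a -> cl (S k) x y a -> cl (S k) (zof rho s x) (zof rho s y) (2 / rho * a).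
Proof.
  intros Hr Ha C i Hi. specialize (C i Hi). unfold zof, halfz. assert (P : 0 < / rho) by (apply Rinv_0_lt_compat; lra).
  assert (Q : Rabs (x i / rho - y i / rho) <= / rho * a).
  { replace (x i / rho - y i / rho) with (/ rho * (x i - y i)) by (unfold Rdiv; ring). apply Rabs_mult_le; auto. rewrite Rabs_pos_eq; lra. }
  apply Rabs_le_iff in Q. unfold Rdiv at 1. assert (0 <= / rho * a) by (apply Rmult_le_pos; lra).
  destruct (Nat.eqb i 1) eqn:E; [apply Nat.eqb_eq in E; subst i|]; apply Rabs_le_iff; lra.
Qed.

Lemma Qdom_compact k rho : 0 < rho <= 1 -> compactR (S k) (Qdom k rho).
Proof.
  intros Hr. assert (P : 0 < / rho) by (apply Rinv_0_lt_compat; lra). split.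
  - exists 1. intros x [H _] i Hi. eapply Rle_trans; [apply (mx_ge (S k) x i Hi)|exact H].
  - intros l Hl. exists l. split; [|apply cl_refl; lra].
    assert (K : forall s, s = -1 \/ s = 1 -> rho <= rmaxabs (S k) (zof rho s l)).
    { intros s Hs. apply le_epsilon. intros e He. assert (Pe : 0 < rho / 2 * e) by (apply Rmult_lt_0_compat; lra). destruct (Hl (rho / 2 * e) Pe) as (x & (X1 & X2 & X3) & C).
      pose proof (zof_cl k rho s x l _ Hr (Rlt_le _ _ Pe) C) as C'. apply mx_cl in C'; [|apply Rmult_le_pos; [unfold Rdiv; lra|lra]].
      replace (2 / rho * (rho / 2 * e)) with e in C' by (field; lra). apply Rabs_le_iff in C'. destruct Hs; subst s; lra. }
    split; [|split; apply K; auto].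
    apply le_epsilon. intros e He. destruct (Hl e He) as (x & (X1 & _) & C). apply mx_cl in C; [|lra]. apply Rabs_le_iff in C. lra.
Qed.

Lemma bdC_Qdom k rho x : (1 <= k)%nat -> 0 < rho < 1 -> bdC (S k) x -> Qdom k rho x.
Proof.
  intros Hk Hr Hx. assert (P : 1 < / rho) by (rewrite <- Rinv_1; apply Rinv_lt_contravar; lra).
  assert (K : forall s, s = -1 \/ s = 1 -> rho <= rmaxabs (S k) (zof rho s x)).
  { intros s Hs. destruct (mx_attained (S k) x) as [j [Hj E]]; [lia|]. rewrite Hx in E.
    eapply Rle_trans; [|apply (mx_ge (S k) _ j Hj)]. unfold zof, halfz, Rdiv.
    destruct (Nat.eqb j 1) eqn:Q; [apply Nat.eqb_eq in Q; subst j|]; revert E; unfold Rabs; repeat destruct (Rcase_abs _); destruct Hs; subst s; nra. }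
  split; [unfold bdC in Hx; lra|split; apply K; auto].
Qed.

Definition splits (n k : nat) (B : pt -> pt) (rho : R) (g : pt -> pt) (L : R) : Prop :=
  0 <= L /\
  (forall x y a, Qdom k rho x -> Qdom k rho y -> 0 <= a -> cl (S k) x y a -> cl (S n) (g x) (g y) (L * a)) /\
  (forall x, Qdom k rho x -> Wall n (g x)) /\
  (forall x, bdC (S k) x -> cl (S n) (g x) (B x) 0) /\
  (forall s w, sgn1 s -> bdC (S k) w -> cl (S n) (g (hol rho s w)) (Tmap s (B w)) 0).

Section LipschitzSplitting.
Variables (n k : nat) (B h : pt -> pt) (rho LB : R).
Hypothesis Hn : (1 <= n)%nat.
Hypothesis Hk : (1 <= k)%nat.
Hypothesis Hr : 0 < rho < 1.
Hypothesis HLB : 0 <= LB.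
Hypothesis HB : forall x, bdC (S k) x -> bdC (S n) (B x).
Hypothesis LipB : forall x y a, bdC (S k) x -> bdC (S k) y -> 0 <= a -> cl (S k) x y a -> cl (S n) (B x) (B y) (LB * a).
Hypothesis Vh : vc (S k) (Qdom k rho) (S n) h.
Hypothesis Uh : forall x, Qdom k rho x -> U n (h x).
Hypothesis Eh : forall x i, bdC (S k) x -> (i < S n)%nat -> h x i = B x i.
Hypothesis Hol : forall s w i, sgn1 s -> bdC (S k) w -> (i < S n)%nat -> Qdom k rho (hol rho s w) /\ h (hol rho s w) i = Tmap s (B w) i.

Definition Abd (x : pt) : Prop := bdC (S k) x \/ exists s w, sgn1 s /\ bdC (S k) w /\ x = hol rho s w.

(** The prescribed values are Lipschitz on each boundary piece, and distinct pieces are a definite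
    distance apart: [1 - rho] between the outer boundary and a hole, [rho * (1 - rho)] between the
    two holes. *)
Lemma Abd_lip : exists L0, 0 <= L0 /\ forall x y a, Abd x -> Abd y -> 0 <= a -> cl (S k) x y a -> cl (S n) (h x) (h y) (L0 * a).
Proof.
  assert (P1 : 0 < / (rho * rho)) by (apply Rinv_0_lt_compat; nra).
  assert (P2 : 0 < / (1 - rho)) by (apply Rinv_0_lt_compat; lra).
  assert (P3 : 0 < / (rho * (1 - rho))) by (apply Rinv_0_lt_compat; nra).
  assert (P4 : 0 <= LB * (2 * / (rho * rho))) by (apply Rmult_le_pos; lra).
  set (L0 := LB + LB * (2 * / (rho * rho)) + 2 * / (1 - rho) + 2 * / (rho * (1 - rho))).
  assert (HL0 : LB <= L0 /\ LB * (2 * / (rho * rho)) <= L0 /\ 2 * / (1 - rho) <= L0 /\ 2 * / (rho * (1 - rho)) <= L0) by (unfold L0; lra).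
  clearbody L0. exists L0. split; [lra|].
  assert (mono : forall x y c a, c <= L0 -> 0 <= a -> cl (S n) x y (c * a) -> cl (S n) x y (L0 * a)).
  { intros. apply (cl_mono _ _ _ (c * a)); auto. apply Rmult_le_compat_r; auto. }
  assert (bnd : forall x, Abd x -> forall i, (i < S n)%nat -> -1 <= h x i <= 1).
  { assert (Q : forall x, bdC (S k) x -> forall i, (i < S n)%nat -> -1 <= B x i <= 1).
    { intros x Hx. apply mx_le_inv. specialize (HB x Hx). unfold bdC in HB. lra. }
    intros x [Hx|(s & w & Hs & Hw & ->)] i Hi; [rewrite Eh by auto; apply Q; auto|].
    destruct (Hol s w i Hs Hw Hi) as [_ ->]. unfold Tmap. destruct (Nat.eqb i 1); [|apply Q; auto].
    specialize (Q w Hw 1%nat ltac:(lia)). destruct Hs; subst s; lra. }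
  assert (far : forall x y c a d, Abd x -> Abd y -> 0 < d -> c = 2 * / d -> c <= L0 -> d <= a -> cl (S n) (h x) (h y) (L0 * a)).
  { intros x y c a d Hx Hy Hd -> Hc Hda. apply (mono _ _ (2 * / d)); auto; [lra|].
    assert (0 < / d) by (apply Rinv_0_lt_compat; auto). assert (1 <= / d * a) by (rewrite <- (Rinv_l d) by lra; apply Rmult_le_compat_l; lra).
    intros i Hi. pose proof (bnd x Hx i Hi). pose proof (bnd y Hy i Hi). apply Rabs_le_iff. lra. }
  assert (bdhol : forall x s w a, bdC (S k) x -> sgn1 s -> bdC (S k) w -> cl (S k) x (hol rho s w) a -> 0 <= a -> 1 - rho <= a).
  { intros x s w a Hx Hs Hw C Ha. apply mx_cl in C; auto. unfold bdC in Hx. rewrite Hx in C. apply Rabs_le_iff in C.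
    enough (rmaxabs (S k) (hol rho s w) <= rho) by lra. apply mx_le; [lra|]. intros j Hj.
    assert (Bw : forall j, (j < S k)%nat -> -1 <= w j <= 1) by (apply mx_le_inv; unfold bdC in Hw; lra).
    unfold hol. apply Rabs_le_iff. destruct (Nat.eqb j 1); [specialize (Bw 1%nat ltac:(lia)); destruct Hs; subst s|specialize (Bw j Hj)]; nra. }
  intros x y a [Hx|(s & w & Hs & Hw & ->)] [Hy|(s' & w' & Hs' & Hw' & ->)] Ha C.
  - apply (mono _ _ LB); try tauto. intros i Hi. rewrite !Eh by auto. apply LipB; auto.
  - apply (far _ _ (2 * / (1 - rho)) _ (1 - rho)); try tauto; try lra; [left; auto|right; exists s', w'; auto|]. apply (bdhol x s' w'); auto.
  - apply (far _ _ (2 * / (1 - rho)) _ (1 - rho)); try tauto; try lra; [right; exists s, w; auto|left; auto|]. apply (bdhol y s w); auto. apply cl_sym; auto.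
  - destruct (Req_dec s s') as [->|N].
    + assert (Cw : cl (S k) w w' (2 * / (rho * rho) * a)).
      { intros j Hj. specialize (C j Hj). unfold hol in C. apply (Rmult_le_reg_l (rho * rho)); [nra|].
        replace (rho * rho * (2 * / (rho * rho) * a)) with (2 * a) by (field; lra).
        rewrite <- (Rabs_pos_eq (rho * rho)) at 1 by nra. rewrite <- Rabs_mult. apply Rabs_le_iff in C. apply Rabs_le_iff.
        destruct (Nat.eqb j 1) eqn:Q; [apply Nat.eqb_eq in Q; subst j|]; lra. }
      apply (mono _ _ (LB * (2 * / (rho * rho)))); try tauto. rewrite Rmult_assoc.
      intros i Hi. destruct (Hol s' w i Hs Hw Hi) as [_ ->]. destruct (Hol s' w' i Hs' Hw' Hi) as [_ ->].
      assert (0 <= 2 * / (rho * rho) * a) by (apply Rmult_le_pos; lra).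
      apply (Tmap_cl n); auto. apply Rmult_le_pos; auto.
    + apply (far _ _ (2 * / (rho * (1 - rho))) _ (rho * (1 - rho))); try tauto; try nra; [right; exists s, w; auto|right; exists s', w'; auto|].
      assert (Bw := mx_le_inv (S k) w 1 ltac:(unfold bdC in Hw; lra) 1%nat ltac:(lia)).
      assert (Bw' := mx_le_inv (S k) w' 1 ltac:(unfold bdC in Hw'; lra) 1%nat ltac:(lia)).
      specialize (C 1%nat ltac:(lia)). unfold hol in C. simpl in C. apply Rabs_le_iff in C.
      assert (s = 1 /\ s' = -1 \/ s = -1 /\ s' = 1) as [[-> ->]|[-> ->]] by (destruct Hs, Hs'; subst; try (exfalso; apply N; reflexivity); auto); nra.
Qed.

(** The continuous splitting map is approximated, coordinate by coordinate, by a Lipschitz one with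
    the same prescribed boundary values. By compactness it stays [2 * m] away from the centres, so
    an error [m] is affordable, and the retraction then moves the values to the walls while fixing
    those on the boundary, which are there already. *)
Lemma lipschitz_splitting : exists g L, splits n k B rho g L.
Proof.
  destruct Abd_lip as (L0 & HL0 & LA).
  assert (HQ : compactR (S k) (Qdom k rho)) by (apply Qdom_compact; lra).
  assert (SA : forall x, Abd x -> Qdom k rho x).
  { intros x [Hx|(s & w & Hs & Hw & ->)]; [apply bdC_Qdom; auto|apply (Hol s w O); auto; lia]. }
  assert (Hlow : exists m, 0 < m <= / 2 /\ forall s, sgn1 s -> forall x, Qdom k rho x -> 2 * m <= rmaxabs (S n) (fun i => h x i - cpt s i)).
  { assert (P : forall s, sgn1 s -> exists m, 0 < m /\ forall x, Qdom k rho x -> m <= rmaxabs (S n) (fun i => h x i - cpt s i)).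
    { intros s Hs. apply (sc_pos_lower (S k)); auto.
      - apply (sc_mx (S k) (Qdom k rho) (S n) (fun x i => h x i - cpt s i)). intros i Hi. apply sc_minus; [apply Vh; auto|apply sc_const].
      - intros x Hx. apply U_mx; auto. }
    destruct (P 1 ltac:(left; auto)) as (m1 & M1 & K1). destruct (P (-1) ltac:(right; auto)) as (m2 & M2 & K2).
    set (m0 := Rmin m1 (Rmin m2 1)).
    assert (0 < m0 /\ m0 <= m1 /\ m0 <= m2 /\ m0 <= 1) as (A1 & A2 & A3 & A4) by (unfold m0, Rmin; repeat destruct (Rle_dec _ _); lra).
    exists (m0 / 2). split; [lra|]. intros s [-> | ->] x Hx; [specialize (K1 x Hx)|specialize (K2 x Hx)]; lra. }
  destruct Hlow as (m & Hm & Low).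
  assert (AP : forall i, exists fL : (pt -> R) * R, (i < S n)%nat -> 0 <= snd fL /\
     (forall x y a, cl (S k) x y a -> 0 <= a -> Rabs (fst fL x - fst fL y) <= snd fL * a) /\
     (forall x, Abd x -> fst fL x = h x i) /\ (forall x, Qdom k rho x -> Rabs (fst fL x - h x i) <= m)).
  { intros i. destruct (Nat.lt_ge_cases i (S n)) as [Hi|Hi]; [|exists (fun _ => 0, 0); intros; lia].
    destruct (lipschitz_approximation (S k) (Qdom k rho) Abd (fun x => h x i) L0 m) as (f & L & A1 & A2 & A3 & A4); auto; try lra.
    - exists (hol rho 1 e0). apply (Hol 1 e0 O); [left; auto| |lia]. unfold bdC. apply Rle_antisym.
      + apply mx_le; [lra|]. intros [|j] Hj; simpl; [rewrite Rabs_R1|rewrite Rabs_R0]; lra.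
      + rewrite <- Rabs_R1 at 1. apply (mx_ge (S k) e0 O). lia.
    - intros x y a Hx Hy C Ha. apply LA; auto.
    - exists (f, L). auto. }
  set (fL := fun i => proj1_sig (constructive_indefinite_description _ (AP i))).
  assert (HfL : forall i, (i < S n)%nat -> 0 <= snd (fL i) /\
     (forall x y a, cl (S k) x y a -> 0 <= a -> Rabs (fst (fL i) x - fst (fL i) y) <= snd (fL i) * a) /\
     (forall x, Abd x -> fst (fL i) x = h x i) /\ (forall x, Qdom k rho x -> Rabs (fst (fL i) x - h x i) <= m)).
  { intros i. unfold fL. destruct (constructive_indefinite_description _ (AP i)) as [p Hp]. exact Hp. }
  clearbody fL. clear AP.
  set (u := fun x i => fst (fL i) x). set (Lu := rsum (S n) (fun i => snd (fL i))).
  assert (HLu : 0 <= Lu) by (apply rsum_nonneg; intros; apply HfL; auto).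
  assert (Lipu : forall x y a, cl (S k) x y a -> 0 <= a -> cl (S n) (u x) (u y) (Lu * a)).
  { intros x y a C Ha i Hi. destruct (HfL i Hi) as (A1 & A2 & _). eapply Rle_trans; [apply A2; eauto|]. apply Rmult_le_compat_r; auto.
    apply (rsum_term_le (S n) (fun i => snd (fL i))); auto. intros; apply HfL; auto. }
  assert (Lowu : forall x, Qdom k rho x -> forall s, sgn1 s -> m <= rmaxabs (S n) (fun i => u x i - cpt s i)).
  { intros x Hx s Hs. specialize (Low s Hs x Hx).
    assert (C : cl (S n) (fun i => u x i - cpt s i) (fun i => h x i - cpt s i) m).
    { intros i Hi. destruct (HfL i Hi) as (_ & _ & _ & A4). specialize (A4 x Hx).
      replace (u x i - cpt s i - (h x i - cpt s i)) with (fst (fL i) x - h x i) by (unfold u; ring). auto. }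
    apply mx_cl in C; [|lra]. apply Rabs_le_iff in C. lra. }
  assert (Wb : forall x w, Abd x -> (forall i, (i < S n)%nat -> h x i = w i) -> Wall n w -> cl (S n) (retn n (u x)) w 0).
  { intros x w Hx E Hw.
    assert (E' : forall i, (i < S n)%nat -> u x i = w i).
    { intros i Hi. rewrite <- E by auto. apply (HfL i Hi). auto. }
    assert (Hu : Wall n (u x)) by (destruct Hw as (s & z & W1 & W2 & W3); exists s, z; split; [|split]; auto; intros; rewrite E' by auto; auto).
    intros i Hi. rewrite <- E' by auto. apply (retn_id n Hn (u x) Hu); auto. }
  assert (P8 : 0 <= 8 / m) by (apply Rmult_le_pos; [lra|left; apply Rinv_0_lt_compat; lra]).
  exists (fun x => retn n (u x)), (8 / m * Lu). split; [apply Rmult_le_pos; auto|]. split; [|split; [|split]].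
  - intros x y a Hx Hy Ha C. rewrite Rmult_assoc. apply (retn_lip n Hn); auto. apply Rmult_le_pos; auto.
  - intros x Hx. apply (retn_wall n Hn m); auto.
  - intros x Hx. apply Wb; [left; auto|auto|]. apply bdC_wall; auto.
  - intros s w Hs Hw. apply Wb; [right; exists s, w; auto| |].
    + intros i Hi. apply Hol; auto.
    + exists s, (B w). auto.
Qed.
End LipschitzSplitting.

Definition cll (d : nat) (A : pt -> Prop) (e : nat) (f : pt -> pt) (L : R) : Prop :=
  forall x y a, A x -> A y -> 0 <= a -> cl d x y a -> cl e (f x) (f y) (L * a).

Lemma cll_of_lipschitz_on d e A f : lipschitz_on d e A f -> exists L, 0 <= L /\ cll d A e f L.
Proof.
  intros (L & HL & H). exists (L * INR d). pose proof (pos_INR d). split; [apply Rmult_le_pos; auto|].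
  intros x y a Hx Hy Ha C. apply dist_cl. eapply Rle_trans; [apply H; auto|]. rewrite Rmult_assoc. apply Rmult_le_compat_l; auto.
  apply cl_dist; auto.
Qed.

Lemma vc_of_cll d A e f L : 0 <= L -> cll d A e f L -> vc d A e f.
Proof.
  intros HL H i Hi x Hx ep Hep. assert (P : 0 < ep / (L + 1)) by (apply Rdiv_lt_0_compat; lra). exists (ep / (L + 1)). split; [auto|].
  intros y Hy C. eapply Rle_lt_trans; [apply (H x y _ Hx Hy (Rlt_le _ _ P) C i Hi)|].
  apply (Rmult_lt_reg_r (L + 1)); [lra|]. unfold Rdiv. rewrite Rmult_assoc, (Rmult_assoc ep), Rinv_l by lra. nra.
Qed.

Lemma norm_cl d x y a : 0 <= a -> cl d x y a -> Rabs (norm d x - norm d y) <= INR d * a.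
Proof.
  intros Ha C. pose proof (norm_mx d x). pose proof (norm_mx d y). pose proof (mx_nonneg d x). pose proof (mx_nonneg d y). pose proof (pos_INR d).
  set (X := norm d x) in *. set (Y := norm d y) in *.
  assert (K : Rabs (X * X - Y * Y) <= INR d * ((X + Y) * a)).
  { unfold X, Y. rewrite !norm_sq, <- rsum_minus. apply rsum_abs_le. intros i Hi. specialize (C i Hi).
    pose proof (mx_ge d x i Hi) as Bx. pose proof (mx_ge d y i Hi) as By. apply Rabs_le_iff in Bx, By. fold X Y.
    replace (x i ^ 2 - y i ^ 2) with ((x i + y i) * (x i - y i)) by ring. apply Rabs_mult_le; auto. apply Rabs_le_iff. lra. }
  set (D := INR d * a) in *. assert (0 <= D) by (apply Rmult_le_pos; auto). replace (INR d * ((X + Y) * a)) with ((X + Y) * D) in K by (unfold D; ring).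
  clearbody D X Y. destruct (Req_dec (X + Y) 0); [replace (X - Y) with 0 by lra; rewrite Rabs_R0; auto|].
  replace (X * X - Y * Y) with ((X + Y) * (X - Y)) in K by ring. rewrite Rabs_mult, Rabs_pos_eq in K by lra. apply (Rmult_le_reg_l (X + Y)); lra.
Qed.

Lemma std_cll d : cll d (bdC d) d (std d) (1 + INR d).
Proof.
  intros x y a Hx Hy Ha C i Hi. pose proof (norm_cl d x y a Ha C) as HN. pose proof (bd_norm d x Hx). pose proof (bd_norm d y Hy).
  assert (By := mx_le_inv d y 1 ltac:(unfold bdC in Hy; lra) i Hi). specialize (C i Hi). unfold std. rewrite (proj2 (Nat.ltb_lt _ _) Hi).
  set (r := norm d x) in *. set (r' := norm d y) in *.
  replace (x i / r - y i / r') with (/ r * (x i - y i) + (/ r * (/ r' * y i)) * (r' - r)) by (field; lra).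
  assert (Q : forall t, 1 <= t -> 0 < / t <= 1) by (intros t Ht; split; [apply Rinv_0_lt_compat; lra|rewrite <- Rinv_1; apply Rinv_le_contravar; lra]).
  pose proof (Q r ltac:(auto)) as Q1. pose proof (Q r' ltac:(auto)) as Q2.
  assert (I : forall t b, 0 < t <= 1 -> Rabs b <= 1 -> Rabs (t * b) <= 1).
  { intros t b Ht Hb. replace 1 with (1 * 1) by ring. apply Rabs_mult_le; auto. rewrite Rabs_pos_eq; lra. }
  eapply Rle_trans; [apply Rabs_triang|]. replace ((1 + INR d) * a) with (1 * a + 1 * (INR d * a)) by ring. apply Rplus_le_compat; apply Rabs_mult_le.
  - rewrite Rabs_pos_eq; lra.
  - auto.
  - apply I, I; auto. apply Rabs_le_iff; lra.
  - rewrite Rabs_minus_sym. auto.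
Qed.

Lemma sphere_mx_lower n y : sphere n y -> / INR (S n) <= rmaxabs (S n) y.
Proof.
  intros Y. destruct (sphere_mx n y Y) as [M0 M1]. destruct Y as [Y _]. pose proof (lt_0_INR (S n) ltac:(lia)) as P.
  assert (1 <= INR (S n) * rmaxabs (S n) y).
  { rewrite <- rsum_const, <- Y. apply rsum_le. intros i Hi. pose proof (mx_ge (S n) y i Hi) as G. pose proof (Rabs_pos (y i)).
    rewrite <- Rsqr_pow2, Rsqr_abs. unfold Rsqr. nra. }
  apply (Rmult_le_reg_l (INR (S n))); auto. rewrite Rinv_r; lra.
Qed.

Lemma Bmap_bd n k beta x : maps_to (sphere k) (sphere n) beta -> bdC (S k) x -> bdC (S n) (Bmap n k beta x).
Proof. intros M Hx. apply lam0_bd. apply (sphere_mx n), M, std_bd_sphere; auto. Qed.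

Lemma Bmap_cll n k beta L : 0 <= L -> maps_to (sphere k) (sphere n) beta -> cll (S k) (sphere k) (S n) beta L ->
  exists L', 0 <= L' /\ cll (S k) (bdC (S k)) (S n) (Bmap n k beta) L'.
Proof.
  intros HL M H. pose proof (pos_INR (S k)). pose proof (lt_0_INR (S n) ltac:(lia)) as P.
  exists (2 * INR (S n) * (L * (1 + INR (S k)))). split; [repeat apply Rmult_le_pos; lra|].
  intros x y a Hx Hy Ha C. assert (0 <= (1 + INR (S k)) * a) by (apply Rmult_le_pos; lra).
  replace (2 * INR (S n) * (L * (1 + INR (S k))) * a) with (2 / (/ INR (S n)) * (L * ((1 + INR (S k)) * a))) by (field; lra).
  apply lam0_lip.
  - apply Rinv_0_lt_compat; auto.
  - apply sphere_mx_lower, M, std_bd_sphere; auto.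
  - apply sphere_mx_lower, M, std_bd_sphere; auto.
  - apply Rmult_le_pos; auto.
  - apply H; auto; try (apply std_bd_sphere; auto). apply std_cll; auto.
Qed.

(** * Splitting along arbitrary axes *)

Definition rot (i : nat) (c s : R) (x : pt) : pt :=
  if Nat.eqb i 1 then x else fun t => if Nat.eqb t 1 then c * x 1%nat + s * x i else if Nat.eqb t i then c * x i - s * x 1%nat else x t.

Lemma rsum_two d f g i : (1 < d)%nat -> (i < d)%nat -> i <> 1%nat -> (forall t, t <> 1%nat -> t <> i -> f t = g t) ->
  f 1%nat + f i = g 1%nat + g i -> rsum d f = rsum d g.
Proof.
  intros H1 Hi Ni E E2.
  assert (K : forall d f, rsum d (fun t => if Nat.eqb t 1 then f 1%nat else if Nat.eqb t i then f i else 0) =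
      (if Nat.ltb 1 d then f 1%nat else 0) + (if Nat.ltb i d then f i else 0)).
  { clear - Ni. intros d f. induction d; [simpl; ring|]. simpl rsum. rewrite IHd.
    destruct (Nat.ltb_spec 1 d), (Nat.ltb_spec 1 (S d)), (Nat.ltb_spec i d), (Nat.ltb_spec i (S d)), (Nat.eqb_spec d 1), (Nat.eqb_spec d i); try lia; try ring. }
  assert (K' : rsum d (fun t => f t - g t) = 0).
  { rewrite (rsum_ext d _ (fun t => if Nat.eqb t 1 then (fun t => f t - g t) 1%nat else if Nat.eqb t i then (fun t => f t - g t) i else 0)).
    - pose proof (K d (fun t => f t - g t)) as K1. cbv beta in K1 |- *. rewrite K1, (proj2 (Nat.ltb_lt _ _) H1), (proj2 (Nat.ltb_lt _ _) Hi). lra.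
    - intros t Ht. destruct (Nat.eqb_spec t 1); [subst; auto|]. destruct (Nat.eqb_spec t i); [subst; auto|]. rewrite E by auto. ring. }
  rewrite rsum_minus in K'. lra.
Qed.

Lemma rot_sq d i c s x : (1 < d)%nat -> (i < d)%nat -> c * c + s * s = 1 -> rsum d (fun t => rot i c s x t ^ 2) = rsum d (fun t => x t ^ 2).
Proof.
  intros H1 Hi E. unfold rot. destruct (Nat.eqb_spec i 1); [reflexivity|]. apply (rsum_two d _ _ i); auto.
  - intros t N1 N2. rewrite (proj2 (Nat.eqb_neq t 1)), (proj2 (Nat.eqb_neq t i)) by auto. reflexivity.
  - rewrite Nat.eqb_refl, (proj2 (Nat.eqb_neq i 1)), Nat.eqb_refl by auto. simpl. 
    replace (x 1%nat * (x 1%nat * 1) + x i * (x i * 1)) with ((c * c + s * s) * (x 1%nat * x 1%nat + x i * x i)) by (rewrite E; ring). ring.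
Qed.

Lemma rot_norm d i c s x : (1 < d)%nat -> (i < d)%nat -> c * c + s * s = 1 -> norm d (rot i c s x) = norm d x.
Proof. intros. unfold norm. rewrite rot_sq; auto. Qed.

Lemma rot_sphere d i c s x : (1 <= d)%nat -> (i < S d)%nat -> c * c + s * s = 1 -> sphere d x -> sphere d (rot i c s x).
Proof.
  intros H1 Hi E [X1 X2]. split; [rewrite rot_sq; auto; lia|]. intros t Ht. unfold rot. destruct (Nat.eqb_spec i 1); [auto|].
  rewrite (proj2 (Nat.eqb_neq t 1)), (proj2 (Nat.eqb_neq t i)) by lia. auto.
Qed.

Lemma rot_id i x : rot i 1 0 x = x.
Proof.
  unfold rot. destruct (Nat.eqb i 1); auto. apply functional_extensionality. intros t.
  destruct (Nat.eqb_spec t 1); [subst; ring|]. destruct (Nat.eqb_spec t i); [subst; ring|reflexivity].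
Qed.

Lemma rot_inv i s x : s * s = 1 -> rot i 0 s (rot i 0 (- s) x) = x.
Proof.
  intros E. unfold rot. destruct (Nat.eqb_spec i 1); auto. apply functional_extensionality. intros t.
  rewrite ?Nat.eqb_refl. rewrite (proj2 (Nat.eqb_neq i 1)) by auto. rewrite ?Nat.eqb_refl.
  destruct (Nat.eqb_spec t 1); [subst; replace (0 * (0 * x 1%nat + - s * x i) + s * (0 * x i - - s * x 1%nat)) with (s * s * x 1%nat) by ring; rewrite E; ring|].
  destruct (Nat.eqb_spec t i); [subst; replace (0 * (0 * x i - - s * x 1%nat) - s * (0 * x 1%nat + - s * x i)) with (s * s * x i) by ring; rewrite E; ring|reflexivity].
Qed.

Lemma rot_cl d i s x y a : (1 < d)%nat -> (i < d)%nat -> s * s = 1 -> cl d x y a -> cl d (rot i 0 s x) (rot i 0 s y) a.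
Proof.
  intros H1 Hi E C t Ht. unfold rot. destruct (Nat.eqb i 1); [apply C; auto|].
  assert (As : Rabs s = 1) by (unfold Rabs; destruct (Rcase_abs _); nra).
  destruct (Nat.eqb t 1); [|destruct (Nat.eqb t i); [|apply C; auto]].
  - replace (0 * x 1%nat + s * x i - (0 * y 1%nat + s * y i)) with (s * (x i - y i)) by ring. rewrite Rabs_mult, As, Rmult_1_l. apply C; auto.
  - replace (0 * x i - s * x 1%nat - (0 * y i - s * y 1%nat)) with (- s * (x 1%nat - y 1%nat)) by ring. rewrite Rabs_mult, Rabs_Ropp, As, Rmult_1_l. apply C; auto.
Qed.

Lemma rot_mx_le d i s x : (1 < d)%nat -> (i < d)%nat -> s * s = 1 -> rmaxabs d (rot i 0 s x) <= rmaxabs d x.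
Proof.
  intros H1 Hi E. apply mx_le; [apply mx_nonneg|]. intros t Ht.
  pose proof (rot_cl d i s x (fun _ => 0) (rmaxabs d x) H1 Hi E) as C. 
  assert (Z : rot i 0 s (fun _ => 0) t = 0) by (unfold rot; destruct (Nat.eqb i 1); auto; destruct (Nat.eqb t 1); [ring|destruct (Nat.eqb t i); ring]).
  rewrite <- (Rminus_0_r (rot i 0 s x t)). rewrite <- Z at 2. apply C; auto. intros u Hu. rewrite Rminus_0_r. apply mx_ge; auto.
Qed.

Lemma rot_mx d i s x : (1 < d)%nat -> (i < d)%nat -> s * s = 1 -> rmaxabs d (rot i 0 s x) = rmaxabs d x.
Proof.
  intros H1 Hi E. apply Rle_antisym; [apply rot_mx_le; auto|]. 
  assert (E' : - s * - s = 1) by lra. pose proof (rot_inv i (- s) x E') as I. rewrite Ropp_involutive in I.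
  rewrite <- I at 1. apply rot_mx_le; auto.
Qed.

Lemma rot_bd d i s x : (1 < d)%nat -> (i < d)%nat -> s * s = 1 -> bdC d x -> bdC d (rot i 0 s x).
Proof. unfold bdC. intros. rewrite rot_mx; auto. Qed.

Lemma rot_std d i s x : (1 < d)%nat -> (i < d)%nat -> s * s = 1 -> std d (rot i 0 s x) = rot i 0 s (std d x).
Proof.
  intros H1 Hi E. apply functional_extensionality. intros t. unfold std at 1. rewrite rot_norm by (auto; lra). unfold rot.
  destruct (Nat.eqb i 1); [reflexivity|]. unfold std. rewrite (proj2 (Nat.ltb_lt _ _) H1), (proj2 (Nat.ltb_lt _ _) Hi).
  destruct (Nat.eqb_spec t 1); [subst; rewrite (proj2 (Nat.ltb_lt _ _) H1); unfold Rdiv; ring|].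
  destruct (Nat.eqb_spec t i); [subst; rewrite (proj2 (Nat.ltb_lt _ _) Hi); unfold Rdiv; ring|reflexivity].
Qed.

Lemma rot_lam0 d i s x : (1 < d)%nat -> (i < d)%nat -> s * s = 1 -> lam0 d (rot i 0 s x) = rot i 0 s (lam0 d x).
Proof.
  intros H1 Hi E. apply functional_extensionality. intros t. unfold lam0 at 1. rewrite rot_mx by (auto; lra). unfold rot.
  destruct (Nat.eqb i 1); [reflexivity|]. unfold lam0. rewrite (proj2 (Nat.ltb_lt _ _) H1), (proj2 (Nat.ltb_lt _ _) Hi).
  destruct (Nat.eqb_spec t 1); [subst; rewrite (proj2 (Nat.ltb_lt _ _) H1); unfold Rdiv; ring|].
  destruct (Nat.eqb_spec t i); [subst; rewrite (proj2 (Nat.ltb_lt _ _) Hi); unfold Rdiv; ring|reflexivity].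
Qed.

Lemma vc_rot d A e i c s f : (1 < e)%nat -> (i < e)%nat -> sc d A c -> sc d A s -> vc d A e f -> vc d A e (fun p => rot i (c p) (s p) (f p)).
Proof.
  intros H1 Hi C S F t Ht. unfold rot. destruct (Nat.eqb i 1); [apply F; auto|]. destruct (Nat.eqb t 1); [|destruct (Nat.eqb t i); [|apply F; auto]].
  - apply sc_plus; apply sc_mult; auto; apply F; auto.
  - apply sc_minus; apply sc_mult; auto; apply F; auto.
Qed.

(** Axes are exchanged by quarter turns instead of transpositions. A quarter turn preserves the sup
    norm as well, and it can be turned back continuously from angle PI/2 to 0, so the homotopy class
    of [beta] does not change and the star condition remains available. *)
Lemma free_homotopic_rot n k i j beta b : (1 <= n)%nat -> (1 <= k)%nat -> (i < S k)%nat -> (j < S n)%nat -> free_homotopic k n beta b ->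
  free_homotopic k n (fun x => rot j 0 1 (beta (rot i 0 (-1) x))) b.
Proof.
  intros Hn Hk Hi Hj (H & HC & HS & HE). apply vc_of_cont_on in HC.
  set (D := fun p => 0 <= p O <= 1 /\ sphere k (ptail p)) in *.
  set (c := fun p : pt => cos (PI / 2 * (1 - p O))). set (s := fun p : pt => sin (PI / 2 * (1 - p O))).
  assert (Ecs : forall p, c p * c p + s p * s p = 1) by (intros p; unfold c, s; pose proof (sin2_cos2 (PI / 2 * (1 - p O))) as E; unfold Rsqr in E; lra).
  assert (Ecs' : forall p, c p * c p + - s p * - s p = 1) by (intros p; pose proof (Ecs p); lra).
  assert (Vth : sc (S (S k)) D (fun p => PI / 2 * (1 - p O))) by (apply sc_scal, sc_minus; [apply sc_const|apply sc_coord; lia]).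
  assert (Vc : sc (S (S k)) D c) by (apply (sc_comp _ _ cos); auto; intros; apply continuity_cos).
  assert (Vs : sc (S (S k)) D s) by (apply (sc_comp _ _ sin); auto; intros; apply continuity_sin).
  set (inn := fun p => pcons (p O) (rot i (c p) (- s p) (ptail p))).
  assert (MD : forall p, D p -> D (inn p)).
  { intros p [A B]. split; [exact A|]. apply (rot_sphere k i); auto. }
  exists (fun p => rot j (c p) (s p) (H (inn p))). split; [|split].
  - apply cont_on_of_vc. apply vc_rot; auto; try lia. apply (vc_comp _ _ (S (S k)) D); auto.
    apply vc_pcons; [apply sc_coord; lia|]. apply (vc_rot _ _ _ i c (fun p => - s p) ptail); auto; try lia; [apply sc_opp; auto|apply vc_ptail].
  - intros p A B. apply rot_sphere; auto. apply HS; apply (MD p (conj A B)).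
  - intros x Hx t. unfold inn, c, s. change (ptail (pcons 0 x)) with x. change (ptail (pcons 1 x)) with x. simpl (pcons _ x O).
    replace (PI / 2 * (1 - 0)) with (PI / 2) by ring. replace (PI / 2 * (1 - 1)) with 0 by ring.
    rewrite cos_PI2, sin_PI2, cos_0, sin_0, Ropp_0, !rot_id. split; [|apply HE; auto].
    replace (H (pcons 0 (rot i 0 (- (1)) x))) with (beta (rot i 0 (-1) x)).
    + reflexivity.
    + apply functional_extensionality. intros u. symmetry. apply HE. apply rot_sphere; auto. lra.
Qed.

Definition hctr (i : nat) (rho s : R) : pt := fun t => if Nat.eqb t i then rho * s / 2 else 0.
Definition hsiz (i : nat) (rho : R) : pt := fun t => if Nat.eqb t i then rho * rho / 2 else rho * rho.
Definition TmapA (j : nat) (s : R) (z : pt) : pt := fun t => if Nat.eqb t j then (z j + s) / 2 else z t.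
Definition QA (k i : nat) (rho : R) (x : pt) : Prop :=
  rmaxabs (S k) x <= 1 /\ forall s, sgn1 s -> ~ forall t, (t < S k)%nat -> Rabs (x t - hctr i rho s t) < hsiz i rho t.

Definition splits_axes (n k i j : nat) (B : pt -> pt) (rho : R) (g : pt -> pt) (L : R) : Prop :=
  0 <= L /\ cll (S k) (QA k i rho) (S n) g L /\
  (forall x, QA k i rho x -> exists s z, sgn1 s /\ bdC (S n) z /\ cl (S n) (g x) (TmapA j s z) 0) /\
  (forall x, bdC (S k) x -> cl (S n) (g x) (B x) 0) /\
  (forall s w, sgn1 s -> bdC (S k) w -> cl (S n) (g (fun t => hctr i rho s t + hsiz i rho t * w t)) (TmapA j s (B w)) 0).

Lemma QA_rot k i rho x : (1 <= k)%nat -> (i < S k)%nat -> 0 < rho -> QA k i rho x -> Qdom k rho (rot i 0 1 x).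
Proof.
  intros Hk Hi Hr [X1 X2]. assert (P : 0 < / rho) by (apply Rinv_0_lt_compat; auto).
  assert (K : forall s, sgn1 s -> rho <= rmaxabs (S k) (zof rho s (rot i 0 1 x))).
  { intros s Hs. apply Rnot_lt_le. intros C. apply (X2 s Hs). intros t Ht. unfold hctr, hsiz.
    assert (G : forall u, (u < S k)%nat -> Rabs (zof rho s (rot i 0 1 x) u) < rho) by (intros u Hu; eapply Rle_lt_trans; [apply (mx_ge (S k) _ u Hu)|exact C]).
    assert (M : forall a b, Rabs (a / rho) < rho -> Rabs b = Rabs a -> Rabs b < rho * rho).
    { intros a b A ->. unfold Rdiv in A. rewrite Rabs_mult, (Rabs_pos_eq (/ rho)) in A by lra.
      apply (Rmult_lt_compat_r rho) in A; auto. rewrite Rmult_assoc, Rinv_l in A by lra. lra. }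
    destruct (Nat.eqb_spec t i) as [->|N].
    - specialize (G 1%nat ltac:(lia)). unfold zof, halfz in G. simpl in G.
      replace (rot i 0 1 x 1%nat) with (x i) in G by (unfold rot; destruct (Nat.eqb_spec i 1); [subst; reflexivity|simpl; ring]).
      assert (Rabs (2 * x i - rho * s) < rho * rho); [|rewrite <- Rabs_Ropp in H; unfold Rabs in *; repeat destruct (Rcase_abs _); lra].
      apply (M (2 * x i - rho * s)); auto. replace ((2 * x i - rho * s) / rho) with (2 * (x i / rho) - s) by (field; lra). auto.
    - rewrite Rminus_0_r. destruct (Nat.eq_dec i 1) as [->|Ni].
      + specialize (G t Ht). unfold zof, halfz in G. rewrite (proj2 (Nat.eqb_neq t 1) N) in G. apply (M (x t)); auto.
      + destruct (Nat.eq_dec t 1) as [->|N1].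
        * specialize (G i Hi). unfold zof, halfz, rot in G. rewrite !(proj2 (Nat.eqb_neq i 1) Ni), Nat.eqb_refl in G.
          apply (M (0 * x i - 1 * x 1%nat)); auto. replace (0 * x i - 1 * x 1%nat) with (- x 1%nat) by ring. symmetry; apply Rabs_Ropp.
        * specialize (G t Ht). unfold zof, halfz, rot in G. rewrite (proj2 (Nat.eqb_neq i 1) Ni), (proj2 (Nat.eqb_neq t 1) N1), (proj2 (Nat.eqb_neq t i) N) in G.
          apply (M (x t)); auto. }
  split; [|split; apply K; [right|left]; auto]. rewrite rot_mx; auto; lra || lia.
Qed.

Lemma rot_hol i rho s w : rot i 0 1 (fun t => hctr i rho s t + hsiz i rho t * w t) = hol rho s (rot i 0 1 w).
Proof.
  apply functional_extensionality. intros t. unfold rot, hctr, hsiz, hol. destruct (Nat.eqb_spec i 1).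
  - subst. destruct (Nat.eqb_spec t 1); [subst; field|ring].
  - rewrite Nat.eqb_refl. simpl Nat.eqb at 1. rewrite (proj2 (Nat.eqb_neq 1 i)) by auto. 
    destruct (Nat.eqb_spec t 1); [subst; simpl; field|]. destruct (Nat.eqb_spec t i); [subst; ring|ring].
Qed.

Lemma rot_Tmap j s z : rot j 0 (-1) (Tmap s z) = TmapA j s (rot j 0 (-1) z).
Proof.
  apply functional_extensionality. intros t. unfold rot, TmapA, Tmap. destruct (Nat.eqb_spec j 1).
  - subst. destruct (Nat.eqb_spec t 1); [subst; reflexivity|reflexivity].
  - rewrite !Nat.eqb_refl, (proj2 (Nat.eqb_neq j 1)) by auto. simpl Nat.eqb at 1 2.
    destruct (Nat.eqb_spec t 1); [subst; rewrite (proj2 (Nat.eqb_neq 1 j)) by auto; simpl; ring|].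
    destruct (Nat.eqb_spec t j); [subst; simpl; field|reflexivity].
Qed.

(** The splitting along axis 1 is applied to [beta] conjugated by quarter turns; conjugating back
    moves it to axis [i] of the domain and axis [j] of the target. *)
Theorem splits_axes_exist n k beta i j rho : (1 <= n)%nat -> (1 <= k)%nat -> (i < S k)%nat -> (j < S n)%nat -> 0 < rho < 1 ->
  maps_to (sphere k) (sphere n) beta -> lipschitz_on (S k) (S n) (sphere k) beta -> satisfies_star n k beta ->
  exists g L, splits_axes n k i j (Bmap n k beta) rho g L.
Proof.
  intros Hn Hk Hi Hj Hr M HL (b & Cb & Mb & Ebp & Hf & Hstar).
  destruct (cll_of_lipschitz_on _ _ _ _ HL) as (L1 & HL1 & Lip).
  set (beta' := fun x => rot j 0 1 (beta (rot i 0 (-1) x))).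
  assert (M' : maps_to (sphere k) (sphere n) beta') by (intros x Hx; apply rot_sphere; auto; [lra|apply M, rot_sphere; auto; lra]).
  assert (Lip' : cll (S k) (sphere k) (S n) beta' L1).
  { intros x y a Hx Hy Ha C. apply rot_cl; try lra; try lia. apply Lip; auto; try (apply rot_sphere; auto; lra). apply rot_cl; try lra; auto; lia. }
  destruct (Bmap_cll n k beta' L1 HL1 M' Lip') as (LB & HLB & LipB).
  destruct (splitting_map n k beta' b Hn Hk M' (vc_of_cll _ _ _ _ _ HL1 Lip') Mb (vc_of_cont_on _ _ _ _ Cb)
    (functional_extensionality _ _ Ebp) (free_homotopic_rot n k i j beta b Hn Hk Hi Hj Hf) Hstar rho Hr) as (h & Vh & Uh & Eh & Hol).
  destruct (lipschitz_splitting n k (Bmap n k beta') h rho LB Hn Hk Hr HLB (fun x Hx => Bmap_bd n k beta' x M' Hx) LipB Vh Uh Eh Hol)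
    as (g & L & HL0 & G1 & G2 & G3 & G4).
  assert (s1 : 1 * 1 = 1) by ring. assert (s2 : -1 * -1 = 1) by ring. assert (Kn : (1 < S n)%nat) by lia. assert (Kk : (1 < S k)%nat) by lia.
  assert (I1 : forall j x, rot j 0 (-1) (rot j 0 1 x) = x).
  { intros j0 x. pose proof (rot_inv j0 (-1) x s2) as I. replace (- -1) with 1 in I by ring. exact I. }
  assert (EB : forall x, bdC (S k) x -> rot j 0 (-1) (Bmap n k beta' (rot i 0 1 x)) = Bmap n k beta x).
  { intros x Hx. unfold Bmap, beta'. rewrite rot_std, I1, rot_lam0, I1 by auto. reflexivity. }
  exists (fun x => rot j 0 (-1) (g (rot i 0 1 x))), L. split; [auto|split; [|split; [|split]]].
  - intros x y a Hx Hy Ha C. apply rot_cl; auto. apply G1; auto; try (apply QA_rot; auto; lra). apply rot_cl; auto.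
  - intros x Hx. destruct (G2 (rot i 0 1 x)) as (s & z & Hs & Hz & E); [apply QA_rot; auto; lra|].
    exists s, (rot j 0 (-1) z). split; [auto|split; [apply rot_bd; auto|]]. rewrite <- rot_Tmap. apply rot_cl; auto.
    intros t Ht. rewrite E, Rminus_diag, Rabs_R0 by auto. lra.
  - intros x Hx. rewrite <- EB by auto. apply rot_cl; auto. apply G3. apply rot_bd; auto.
  - intros s w Hs Hw. rewrite rot_hol, <- EB, <- rot_Tmap by auto. apply rot_cl; auto. apply G4; auto. apply rot_bd; auto.
Qed.

(** * Subdivision of the domain *)

Definition hn (d : nat) (eta c x : pt) : R := rmaxabs d (fun i => (x i - c i) / eta i).

Section Glue.
Variables (d : nat) (eta : pt).
Hypothesis Heta : forall i, 0 < eta i.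

Lemma hn_lt c x : (1 <= d)%nat -> hn d eta c x < 1 <-> forall i, (i < d)%nat -> Rabs (x i - c i) < eta i.
Proof.
  intros Hd. assert (K : forall i, Rabs ((x i - c i) / eta i) < 1 <-> Rabs (x i - c i) < eta i).
  { intros i. specialize (Heta i). unfold Rdiv. rewrite Rabs_mult, (Rabs_pos_eq (/ eta i)) by (left; apply Rinv_0_lt_compat; auto).
    split; intros H; [apply (Rmult_lt_compat_r (eta i)) in H; auto|apply (Rmult_lt_reg_r (eta i)); auto]; rewrite ?Rmult_assoc, ?Rinv_l in *; lra. }
  split; intros H.
  - intros i Hi. apply K. eapply Rle_lt_trans; [apply (mx_ge d (fun i => (x i - c i) / eta i) i Hi)|exact H].
  - destruct (mx_attained d (fun i => (x i - c i) / eta i)) as [i [Hi E]]; [lia|]. unfold hn. rewrite <- E. apply K; auto.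
Qed.

Lemma hn_loc c w : hn d eta c (fun i => c i + eta i * w i) = rmaxabs d w.
Proof. unfold hn. apply mx_ext. intros i _. f_equal. specialize (Heta i). field. lra. Qed.

(* The points where a segment leaves the holes cut it into pieces whose lengths add up
   exactly, so glueing does not increase the Lipschitz constant. *)
Lemma hn_exit c x y : hn d eta c x < 1 -> 1 <= hn d eta c y -> exists t, 0 <= t <= 1 /\ hn d eta c (fun i => x i + t * (y i - x i)) = 1.
Proof.
  intros Hx Hy. set (M := rmaxabs d (fun i => (y i - x i) / eta i)). pose proof (mx_nonneg d (fun i => (y i - x i) / eta i)) as HM. fold M in HM.
  set (f := fun t => hn d eta c (fun i => x i + t * (y i - x i)) - 1).
  assert (Lf : forall s t, Rabs (f s - f t) <= M * Rabs (s - t)).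
  { intros s t. unfold f, hn. match goal with |- Rabs (?a - 1 - (?b - 1)) <= _ => replace (a - 1 - (b - 1)) with (a - b) by ring end.
    apply mx_cl; [|apply Rmult_le_pos; auto; apply Rabs_pos]. intros i Hi. specialize (Heta i).
    replace ((x i + s * (y i - x i) - c i) / eta i - (x i + t * (y i - x i) - c i) / eta i) with ((y i - x i) / eta i * (s - t)) by (field; lra).
    rewrite Rabs_mult. apply Rmult_le_compat_r; [apply Rabs_pos|]. apply (mx_ge d (fun i => (y i - x i) / eta i)); auto. }
  assert (Cf : continuity f).
  { intros s e He. exists (e / (M + 1)). split; [apply Rdiv_lt_0_compat; lra|]. intros t [_ Ht]. simpl in *. unfold R_dist in *.
    eapply Rle_lt_trans; [apply Lf|]. apply Rle_lt_trans with (M * (e / (M + 1))); [apply Rmult_le_compat_l; lra|].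
    apply (Rmult_lt_reg_r (M + 1)); [lra|]. unfold Rdiv. rewrite !Rmult_assoc, Rinv_l by lra. nra. }
  assert (F0 : f 0 < 0).
  { unfold f. replace (fun i => x i + 0 * (y i - x i)) with x by (apply functional_extensionality; intros; ring). lra. }
  assert (F1 : 0 <= f 1).
  { unfold f. replace (fun i => x i + 1 * (y i - x i)) with y by (apply functional_extensionality; intros; ring). lra. }
  destruct (IVT_cor f 0 1 Cf) as [t [Ht E]]; [lra|nra|]. exists t. split; auto. unfold f in E. lra.
Qed.

(** If the boundary of one hole met the interior of another, moving slightly towards the first
    centre would reach a point of both. Disjoint open holes are thus enough for exit points to lie
    outside all holes. *)
Lemma hn_boundary c c' z : hn d eta c z = 1 -> hn d eta c' z < 1 -> exists y, hn d eta c y < 1 /\ hn d eta c' y < 1.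
Proof.
  intros H1 H2. set (t := (1 - hn d eta c' z) / 2). assert (Ht : 0 < t < 1) by (unfold t; pose proof (mx_nonneg d (fun i => (z i - c' i) / eta i)) as P; change (0 <= hn d eta c' z) in P; lra).
  exists (fun i => z i + t * (c i - z i)).
  assert (K : hn d eta c (fun i => z i + t * (c i - z i)) = (1 - t) * hn d eta c z).
  { unfold hn. rewrite <- (Rabs_pos_eq (1 - t)) at 1 by lra. rewrite <- mx_scal. apply mx_ext. intros i _. f_equal.
    specialize (Heta i). field. lra. }
  split; [rewrite K, H1; lra|]. assert (C : Rabs (hn d eta c' (fun i => z i + t * (c i - z i)) - hn d eta c' z) <= t).
  { unfold hn. apply mx_cl; [|lra]. intros i Hi. specialize (Heta i).
    replace ((z i + t * (c i - z i) - c' i) / eta i - (z i - c' i) / eta i) with (- t * ((z i - c i) / eta i)) by (field; lra).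
    rewrite Rabs_mult, Rabs_Ropp, Rabs_pos_eq by lra. pose proof (mx_ge d (fun i => (z i - c i) / eta i) i Hi) as G. change (Rabs ((z i - c i) / eta i) <= hn d eta c z) in G. nra. }
  apply Rabs_le_iff in C. unfold t in *. lra.
Qed.

(** The relation is abstract because the glueing is used with [cl] for maps into the grid and with
    [hle] for maps into the group. *)
Variables (T : Type) (rel : T -> T -> R -> Prop).
Hypothesis rel_sym : forall x y a, rel x y a -> rel y x a.
Hypothesis rel_mono : forall x y a b, 0 <= a -> rel x y a -> a <= b -> rel x y b.
Hypothesis rel_trans : forall x y z a b, 0 <= a -> 0 <= b -> rel x y a -> rel y z b -> rel x z (a + b).

Variables (Hs P : pt -> Prop) (F : pt -> T) (Lam eps : R).
Definition Qof (x : pt) : Prop := rmaxabs d x <= 1 /\ forall c, Hs c -> 1 <= hn d eta c x.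
Hypothesis HLam : 0 <= Lam.
Hypothesis Heps : 0 <= eps.
Hypothesis HP : forall x, P x -> rmaxabs d x <= 1.
Hypothesis Hdisj : forall c c' x, Hs c -> Hs c' -> hn d eta c x < 1 -> hn d eta c' x < 1 -> c = c'.
Hypothesis HQ : forall x y a, Qof x -> Qof y -> 0 <= a -> cl d x y a -> rel (F x) (F y) (Lam * a).
Hypothesis Hin : forall c x y a, Hs c -> P x -> P y -> hn d eta c x < 1 -> hn d eta c y < 1 -> 0 <= a -> cl d x y a -> rel (F x) (F y) (Lam * a + 2 * eps).
Hypothesis Hbd : forall c x y a, Hs c -> P x -> Qof y -> hn d eta c x < 1 -> hn d eta c y = 1 -> 0 <= a -> cl d x y a -> rel (F x) (F y) (Lam * a + eps).

Lemma Qof_or_hole x : rmaxabs d x <= 1 -> Qof x \/ exists c, Hs c /\ hn d eta c x < 1.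
Proof.
  intros Hx. destruct (classic (exists c, Hs c /\ hn d eta c x < 1)) as [E|N]; [auto|left]. split; auto.
  intros c Hc. apply Rnot_lt_le. intros K. apply N. exists c; auto.
Qed.

Lemma exit_point c x y a : Hs c -> P x -> rmaxabs d y <= 1 -> hn d eta c x < 1 -> 1 <= hn d eta c y -> 0 <= a -> cl d x y a ->
  exists t z, 0 <= t <= 1 /\ Qof z /\ rel (F x) (F z) (Lam * (t * a) + eps) /\ cl d z y ((1 - t) * a).
Proof.
  intros Hc Px Hy Hx1 Hy1 Ha C. destruct (hn_exit c x y Hx1 Hy1) as (t & Ht & E). exists t. eexists. split; [auto|].
  assert (Qz : Qof (fun i => x i + t * (y i - x i))).
  { split.
    - apply mx_le; [lra|]. intros i Hi. pose proof (mx_le_inv d x 1 (HP x Px) i Hi). pose proof (mx_le_inv d y 1 Hy i Hi). apply Rabs_le_iff. nra.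
    - intros c' Hc'. apply Rnot_lt_le. intros K. destruct (hn_boundary c c' _ E K) as (u & U1 & U2).
      assert (c = c') by (apply (Hdisj c c' u); auto). subst c'. lra. }
  split; [exact Qz|]. split.
  - apply (Hbd c); auto; [apply Rmult_le_pos; lra|]. intros i Hi. specialize (C i Hi). replace (x i - (x i + t * (y i - x i))) with (t * (x i - y i)) by ring.
    rewrite Rabs_mult, Rabs_pos_eq by lra. apply Rmult_le_compat_l; lra.
  - intros i Hi. specialize (C i Hi). replace (x i + t * (y i - x i) - y i) with ((1 - t) * (x i - y i)) by ring.
    rewrite Rabs_mult, Rabs_pos_eq by lra. apply Rmult_le_compat_l; lra.
Qed.

Lemma glue_Q x y a : P x -> Qof y -> 0 <= a -> cl d x y a -> rel (F x) (F y) (Lam * a + eps).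
Proof.
  intros Px Qy Ha C. assert (0 <= Lam * a) by (apply Rmult_le_pos; auto). destruct (Qof_or_hole x (HP x Px)) as [Qx|(c & Hc & Hx)].
  - apply (rel_mono _ _ (Lam * a)); auto; lra.
  - destruct (exit_point c x y a) as (t & z & Ht & Qz & R1 & C1); auto; [apply Qy|apply Qy; auto|].
    assert (0 <= Lam * (t * a)) by (repeat apply Rmult_le_pos; lra). assert (0 <= Lam * ((1 - t) * a)) by (repeat apply Rmult_le_pos; lra).
    replace (Lam * a + eps) with (Lam * (t * a) + eps + Lam * ((1 - t) * a)) by ring.
    apply (rel_trans _ (F z)); auto; [lra|]. apply HQ; auto. apply Rmult_le_pos; lra.
Qed.

(** Only the holes that contain the two end points contribute an error: between the exit points [HQ]
    applies directly, whatever other holes the segment crosses. Errors therefore do not accumulate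
    with the number of holes. *)
Lemma glue_holes x y a : P x -> P y -> 0 <= a -> cl d x y a -> rel (F x) (F y) (Lam * a + 2 * eps).
Proof.
  intros Px Py Ha C. assert (0 <= Lam * a) by (apply Rmult_le_pos; auto).
  destruct (Qof_or_hole y (HP y Py)) as [Qy|(c' & Hc' & Hy)]; [apply (rel_mono _ _ (Lam * a + eps)); [lra|apply glue_Q; auto|lra]|].
  destruct (Qof_or_hole x (HP x Px)) as [Qx|(c & Hc & Hx)]; [apply (rel_mono _ _ (Lam * a + eps)); [lra|apply rel_sym, glue_Q; auto; apply cl_sym; auto|lra]|].
  destruct (Rlt_le_dec (hn d eta c y) 1) as [K|K]; [apply (Hin c); auto|].
  destruct (exit_point c x y a) as (t & z & Ht & Qz & R1 & C1); auto.
  assert (0 <= Lam * (t * a)) by (repeat apply Rmult_le_pos; lra). assert (0 <= Lam * ((1 - t) * a)) by (repeat apply Rmult_le_pos; lra).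
  replace (Lam * a + 2 * eps) with (Lam * (t * a) + eps + (Lam * ((1 - t) * a) + eps)) by ring.
  apply (rel_trans _ (F z)); auto; try lra. apply rel_sym, glue_Q; auto; [apply Rmult_le_pos; lra|apply cl_sym; auto].
Qed.
End Glue.

(** * Systems of holes mapped to the cells of a grid *)

Definition boxS (N y : pt) : pt := fun i => N i * (y i + 1) / 2.
Definition cellb (v y : pt) : pt := fun i => v i + (y i + 1) / 2.
Definition isZ (x : R) : Prop := exists z, x = IZR z.

Lemma in_walls_isZ n w : in_walls n w <-> exists i, (i < S n)%nat /\ isZ (w i).
Proof.
  split; intros (i & Hi & E); exists i; split; auto; [exists (Int_part (w i)); apply dz_zero_IZR; auto|destruct E as [z ->]; apply dz_IZR].
Qed.

Lemma isZ_plus x y : isZ x -> isZ y -> isZ (x + y).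
Proof. intros [a ->] [b ->]. exists (a + b)%Z. now rewrite plus_IZR. Qed.
Lemma isZ_double x : isZ x -> isZ (2 * x).
Proof. intros [a ->]. exists (2 * a)%Z. now rewrite mult_IZR. Qed.
Lemma isZ_half_sgn y : Rabs y = 1 -> isZ ((y + 1) / 2).
Proof. unfold Rabs. destruct (Rcase_abs y); intros E; [exists 0%Z; replace y with (-1) by lra|exists 1%Z; rewrite E]; lra. Qed.
Lemma isZ_cl0 n w w' : cl (S n) w w' 0 -> in_walls n w' -> in_walls n w.
Proof.
  rewrite !in_walls_isZ. intros C (i & Hi & z & E). exists i. split; auto. exists z. rewrite <- E. specialize (C i Hi). apply Rabs_le_iff in C. lra.
Qed.


Definition HsC (Hs : pt -> pt -> Prop) (c : pt) : Prop := exists v, Hs c v.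
Definition locc (eta c x : pt) : pt := fun i => (x i - c i) / eta i.

(* The cube minus a family of boxes with half sizes [eta] (the holes), mapped by [g] to the
   walls of the unit grid in the box of side lengths [N]: [g] is [B] on the outer boundary,
   and on the boundary of the hole with centre [c] it is [B] into the unit cell with corner [v]. *)
Record system (n k : nat) (B : pt -> pt) (N eta : pt) (Hs : pt -> pt -> Prop) (g : pt -> pt) (L : R) : Prop := {
  sy_eta : forall i, 0 < eta i;
  sy_L : 0 <= L;
  sy_in : forall c v i, Hs c v -> (i < S k)%nat -> Rabs (c i) + eta i <= 1;
  sy_disj : forall c v c' v' x, Hs c v -> Hs c' v' -> hn (S k) eta c x < 1 -> hn (S k) eta c' x < 1 -> c = c' /\ v = v';
  sy_lip : cll (S k) (Qof (S k) eta (HsC Hs)) (S n) g L;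
  sy_wall : forall x, Qof (S k) eta (HsC Hs) x -> in_walls n (g x);
  sy_bd : forall x, bdC (S k) x -> cl (S n) (g x) (boxS N (B x)) 0;
  sy_hole : forall c v w, Hs c v -> bdC (S k) w -> cl (S n) (g (fun i => c i + eta i * w i)) (cellb v (B w)) 0;
  sy_int : forall c v i, Hs c v -> (i < S n)%nat -> isZ (v i) }.

Lemma hn_locc d eta c x : hn d eta c x = rmaxabs d (locc eta c x).
Proof. reflexivity. Qed.

Lemma locc_inv eta c x : (forall i, 0 < eta i) -> (fun i => c i + eta i * locc eta c x i) = x.
Proof. intros H. apply functional_extensionality. intros i. unfold locc. specialize (H i). field. lra. Qed.

Lemma locc_of eta c w : (forall i, 0 < eta i) -> locc eta c (fun i => c i + eta i * w i) = w.
Proof. intros H. apply functional_extensionality. intros i. unfold locc. specialize (H i). field. lra. Qed.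

Lemma locc_cl d eta c x y a : (forall i, 0 < eta i) -> 0 <= a -> cl d x y a -> cl d (locc eta c x) (locc eta c y) (rsum d (fun i => / eta i) * a).
Proof.
  intros H Ha C i Hi. specialize (C i Hi). unfold locc.
  assert (P : forall i, 0 < / eta i) by (intros; apply Rinv_0_lt_compat; auto).
  replace ((x i - c i) / eta i - (y i - c i) / eta i) with (/ eta i * (x i - y i)) by (field; specialize (H i); lra).
  apply Rabs_mult_le; auto. rewrite Rabs_pos_eq by (left; auto). apply (rsum_term_le d (fun i => / eta i)); auto. intros; left; auto.
Qed.

Section Systems.
Variables (n k : nat) (B : pt -> pt) (LB : R).
Hypothesis Hk : (1 <= k)%nat.
Hypothesis HLB : 0 <= LB.
Hypothesis HB : forall x, bdC (S k) x -> bdC (S n) (B x).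
Hypothesis LipB : cll (S k) (bdC (S k)) (S n) B LB.

(** Start of the subdivision: the whole cube is the only hole, so the map lives on its boundary, and
    the grid has a single cell. *)
Lemma system_base : system n k B (fun _ => 1) (fun _ => 1) (fun c v => c = (fun _ => 0) /\ v = (fun _ => 0)) (fun x => cellb (fun _ => 0) (B x)) LB.
Proof.
  assert (HN : forall x, hn (S k) (fun _ => 1) (fun _ => 0) x = rmaxabs (S k) x).
  { intros x. apply mx_ext. intros i _. f_equal. field. }
  assert (HQ : forall x, Qof (S k) (fun _ => 1) (HsC (fun c v => c = (fun _ => 0) /\ v = (fun _ : nat => 0))) x -> bdC (S k) x).
  { intros x [X1 X2]. specialize (X2 (fun _ => 0) (ex_intro _ (fun _ => 0) (conj eq_refl eq_refl))). rewrite HN in X2. unfold bdC. lra. }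
  split; auto; try (intros; lra).
  - intros c v i [-> ->] Hi. rewrite Rabs_R0. lra.
  - intros c v c' v' x [-> ->] [-> ->]; auto.
  - intros x y a Hx Hy Ha C i Hi. pose proof (LipB x y a (HQ x Hx) (HQ y Hy) Ha C i Hi) as K. unfold cellb.
    apply Rabs_le_iff in K. apply Rabs_le_iff. lra.
  - intros x Hx. pose proof (HB x (HQ x Hx)) as K. destruct (mx_attained (S n) (B x)) as [i [Hi E]]; [lia|]. rewrite K in E.
    apply in_walls_isZ. exists i. split; auto. unfold cellb. apply isZ_plus; [exists 0%Z; auto|apply isZ_half_sgn; auto].
  - intros x Hx i Hi. unfold cellb, boxS. match goal with |- Rabs ?a <= _ => replace a with 0 by field end. rewrite Rabs_R0; lra.
  - intros c v w [-> ->] Hw i Hi. replace (fun i => 0 + 1 * w i) with w by (apply functional_extensionality; intros; ring).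
    rewrite Rminus_diag, Rabs_R0; lra.
  - intros c v i [-> ->] Hi. exists 0%Z; auto.
Qed.

Lemma bdC_Qof N eta Hs g L x : system n k B N eta Hs g L -> bdC (S k) x -> Qof (S k) eta (HsC Hs) x.
Proof.
  intros Sy Hx. split; [unfold bdC in Hx; lra|]. intros c [v Hc]. apply Rnot_lt_le. intros K.
  rewrite hn_lt in K by (first [apply Sy | lia]). destruct (mx_attained (S k) x) as [i [Hi E]]; [lia|]. rewrite Hx in E.
  specialize (K i Hi). pose proof (sy_in _ _ _ _ _ _ _ _ Sy c v i Hc Hi). 
  pose proof (Rabs_triang (x i - c i) (c i)) as T. replace (x i - c i + c i) with (x i) in T by ring. lra.
Qed.

Variables (i0 j0 : nat) (rho Ls : R) (gs : pt -> pt).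
Hypothesis Hi0 : (i0 < S k)%nat.
Hypothesis Hj0 : (j0 < S n)%nat.
Hypothesis Hrho : 0 < rho < 1.
Hypothesis Hsp : splits_axes n k i0 j0 B rho gs Ls.

Lemma hsiz_bounds s t : sgn1 s -> 0 < hsiz i0 rho t /\ Rabs (hctr i0 rho s t) + hsiz i0 rho t < 1.
Proof.
  intros Hs. unfold hsiz, hctr. destruct (Nat.eqb t i0); [|rewrite Rabs_R0; nra]. 
  assert (Rabs (rho * s / 2) = rho / 2) as -> by (destruct Hs; subst s; [rewrite Rabs_pos_eq|rewrite Rabs_left1]; lra). nra.
Qed.

Lemma bdC_QA w : bdC (S k) w -> QA k i0 rho w.
Proof.
  intros Hw. split; [unfold bdC in Hw; lra|]. intros s Hs K. destruct (mx_attained (S k) w) as [t [Ht E]]; [lia|]. rewrite Hw in E.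
  specialize (K t Ht). pose proof (hsiz_bounds s t Hs). pose proof (Rabs_triang (w t - hctr i0 rho s t) (hctr i0 rho s t)) as T.
  replace (w t - hctr i0 rho s t + hctr i0 rho s t) with (w t) in T by ring. lra.
Qed.

Variables (N eta : pt) (Hs : pt -> pt -> Prop) (g : pt -> pt) (L : R).
Hypothesis Sy : system n k B N eta Hs g L.

Definition dbl (v : pt) : pt := fun t => if Nat.eqb t j0 then 2 * v t else v t.
Definition nN : pt := fun t => if Nat.eqb t j0 then 2 * N t else N t.
Definition neta : pt := fun t => eta t * hsiz i0 rho t.
Definition nctr (c : pt) (s : R) : pt := fun t => c t + eta t * hctr i0 rho s t.
Definition ncor (v : pt) (s : R) : pt := fun t => dbl v t + (if Nat.eqb t j0 then (s + 1) / 2 else 0).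
Definition nHs (c' v' : pt) : Prop := exists c v s, Hs c v /\ sgn1 s /\ c' = nctr c s /\ v' = ncor v s.
(** A rescaled splitting map is inserted in every hole, leaving two smaller ones. Doubling direction
    [j0] of the target afterwards turns the two half cells into unit cells. *)
Definition ng (x : pt) : pt :=
  match excluded_middle_informative (exists cv : pt * pt, Hs (fst cv) (snd cv) /\ hn (S k) eta (fst cv) x < 1) with
  | left E => let cv := proj1_sig (constructive_indefinite_description _ E) in dbl (cellb (snd cv) (gs (locc eta (fst cv) x)))
  | right _ => dbl (g x)
  end.

Lemma ng_hole c v x : Hs c v -> hn (S k) eta c x < 1 -> ng x = dbl (cellb v (gs (locc eta c x))).
Proof.
  intros Hc Hx. unfold ng. destruct (excluded_middle_informative _) as [E|E]; [|exfalso; apply E; exists (c, v); auto].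
  destruct (constructive_indefinite_description _ E) as [[c' v'] [H1 H2]]. simpl in *.
  destruct (sy_disj _ _ _ _ _ _ _ _ Sy c v c' v' x) as [-> ->]; auto.
Qed.

Lemma ng_Q x : Qof (S k) eta (HsC Hs) x -> ng x = dbl (g x).
Proof.
  intros [_ Q]. unfold ng. destruct (excluded_middle_informative _) as [[[c v] [H1 H2]]|E]; [|reflexivity].
  exfalso. simpl in *. specialize (Q c (ex_intro _ v H1)). lra.
Qed.

Lemma dbl_cl v w a : 0 <= a -> cl (S n) v w a -> cl (S n) (dbl v) (dbl w) (2 * a).
Proof. intros Ha C t Ht. specialize (C t Ht). apply Rabs_le_iff in C. apply Rabs_le_iff. unfold dbl. destruct (Nat.eqb t j0); lra. Qed.

Lemma cellb_cl v y z a : 0 <= a -> cl (S n) y z a -> cl (S n) (cellb v y) (cellb v z) (/ 2 * a).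
Proof. intros Ha C t Ht. specialize (C t Ht). apply Rabs_le_iff in C. apply Rabs_le_iff. unfold cellb. lra. Qed.

Lemma dbl_cellb_cl v y z a : 0 <= a -> cl (S n) y z a -> cl (S n) (dbl (cellb v y)) (dbl (cellb v z)) a.
Proof. intros Ha C. replace a with (2 * (/ 2 * a)) by field. apply dbl_cl; [lra|]. apply cellb_cl; auto. Qed.

Lemma neta_pos t : 0 < neta t.
Proof. apply Rmult_lt_0_compat; [apply Sy|]. apply (hsiz_bounds 1); left; auto. Qed.

Lemma hn_nctr c s x : hn (S k) neta (nctr c s) x < 1 <-> forall t, (t < S k)%nat -> Rabs (locc eta c x t - hctr i0 rho s t) < hsiz i0 rho t.
Proof.
  rewrite hn_lt by (try apply neta_pos; lia). assert (K : forall t, Rabs (x t - nctr c s t) = eta t * Rabs (locc eta c x t - hctr i0 rho s t)).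
  { intros t. pose proof (sy_eta _ _ _ _ _ _ _ _ Sy t) as P. replace (x t - nctr c s t) with (eta t * (locc eta c x t - hctr i0 rho s t)) by (unfold nctr, locc; field; lra).
    rewrite Rabs_mult, (Rabs_pos_eq (eta t)) by lra. reflexivity. }
  split; intros H t Ht; specialize (H t Ht); pose proof (sy_eta _ _ _ _ _ _ _ _ Sy t) as P; rewrite K in *; unfold neta in *.
  - apply (Rmult_lt_reg_l (eta t)); auto.
  - apply Rmult_lt_compat_l; auto.
Qed.

Lemma hn_nctr_hole c s x : sgn1 s -> hn (S k) neta (nctr c s) x < 1 -> hn (S k) eta c x < 1.
Proof.
  intros Hs1 H. rewrite hn_nctr in H. rewrite hn_locc. destruct (mx_attained (S k) (locc eta c x)) as [t [Ht E]]; [lia|]. rewrite <- E.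
  specialize (H t Ht). pose proof (hsiz_bounds s t Hs1). pose proof (Rabs_triang (locc eta c x t - hctr i0 rho s t) (hctr i0 rho s t)) as T.
  replace (locc eta c x t - hctr i0 rho s t + hctr i0 rho s t) with (locc eta c x t) in T by ring. lra.
Qed.

Let P := Qof (S k) neta (HsC nHs).

Lemma P_QA c v x : P x -> Hs c v -> hn (S k) eta c x < 1 -> QA k i0 rho (locc eta c x).
Proof.
  intros [X1 X2] Hc Hx. split; [rewrite <- hn_locc; lra|]. intros s Hs1 K. rewrite <- hn_nctr in K.
  assert (C : HsC nHs (nctr c s)) by (exists (ncor v s), c, v, s; auto). specialize (X2 _ C). lra.
Qed.

Lemma TmapA_isZ v s z : (forall t, (t < S n)%nat -> isZ (v t)) -> sgn1 s -> bdC (S n) z -> exists t, (t < S n)%nat /\ isZ (dbl (cellb v (TmapA j0 s z)) t).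
Proof.
  intros Hv Hs1 Hz. destruct (mx_attained (S n) z) as [t [Ht E]]; [lia|]. rewrite Hz in E. exists t. split; auto.
  unfold dbl, cellb, TmapA. destruct (Nat.eqb_spec t j0) as [->|Nt].
  - replace (2 * (v j0 + ((z j0 + s) / 2 + 1) / 2)) with (2 * v j0 + (z j0 + 1) / 2 + (s + 1) / 2) by field.
    apply isZ_plus; [apply isZ_plus; [apply isZ_double; auto|apply isZ_half_sgn; auto]|].
    apply isZ_half_sgn. destruct Hs1; subst s; [apply Rabs_R1|rewrite Rabs_left; lra].
  - apply isZ_plus; [auto|apply isZ_half_sgn; auto].
Qed.

(** The Lipschitz constant deteriorates with [/ eta]. This is acceptable, because the number of
    subdivisions is fixed once for all and the resulting system is reused at every level of the
    recursion. *)
Lemma system_step : system n k B nN neta nHs ng (2 * L + Ls * rsum (S k) (fun i => / eta i)).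
Proof.
  destruct Hsp as (HLs & S1 & S2 & S3 & S4). pose proof (sy_eta _ _ _ _ _ _ _ _ Sy) as He. pose proof (sy_L _ _ _ _ _ _ _ _ Sy) as HL.
  set (ke := rsum (S k) (fun i => / eta i)). assert (Hke : 0 <= ke) by (apply rsum_nonneg; intros; left; apply Rinv_0_lt_compat; auto).
  assert (HLk : 0 <= Ls * ke) by (apply Rmult_le_pos; auto).
  assert (HinL : forall c v x y a, Hs c v -> QA k i0 rho (locc eta c x) -> QA k i0 rho (locc eta c y) -> 0 <= a -> cl (S k) x y a ->
    cl (S n) (dbl (cellb v (gs (locc eta c x)))) (dbl (cellb v (gs (locc eta c y)))) ((2 * L + Ls * ke) * a)).
  { intros c v x y a Hc Qx Qy Ha C. assert (0 <= L * a) by (apply Rmult_le_pos; auto). assert (0 <= ke * a) by (apply Rmult_le_pos; auto).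
    apply (cl_mono _ _ _ (Ls * (ke * a))); [|lra].
    apply dbl_cellb_cl; [apply Rmult_le_pos; auto|]. apply S1; auto. apply locc_cl; auto. }
  split; auto.
  - apply neta_pos.
  - lra.
  - intros c' v' t (c & v & s & Hc & Hs1 & -> & ->) Ht. pose proof (sy_in _ _ _ _ _ _ _ _ Sy c v t Hc Ht) as I. pose proof (hsiz_bounds s t Hs1) as HB1.
    unfold nctr, neta. specialize (He t). pose proof (Rabs_triang (c t) (eta t * hctr i0 rho s t)) as T. rewrite Rabs_mult, (Rabs_pos_eq (eta t)) in T by lra. nra.
  - intros c1 v1 c2 v2 x (c & v & s & Hc & Hs1 & -> & ->) (c' & v' & s' & Hc' & Hs1' & -> & ->) H1 H2.
    destruct (sy_disj _ _ _ _ _ _ _ _ Sy c v c' v' x) as [-> ->]; auto; [apply (hn_nctr_hole _ s); auto|apply (hn_nctr_hole _ s'); auto|].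
    assert (s = s') as ->; [|auto]. rewrite hn_nctr in H1, H2. specialize (H1 i0 Hi0). specialize (H2 i0 Hi0). unfold hctr, hsiz in *. rewrite Nat.eqb_refl in *.
    apply Rabs_def2 in H1, H2. destruct Hs1, Hs1'; subst s s'; auto; nra.
  - fold P. intros x y a Px Py Ha C. replace ((2 * L + Ls * ke) * a) with ((2 * L + Ls * ke) * a + 2 * 0) by ring.
    apply (glue_holes (S k) eta He pt (cl (S n)) (cl_sym (S n))) with (Hs := HsC Hs) (P := P) (F := ng); auto; try lra.
    + intros. eapply cl_mono; eauto.
    + intros x0 y0 z0 a0 b0 _ _. apply cl_trans.
    + intros x0 Q. apply Q.
    + intros c c' x0 [v Hc] [v' Hc'] A1 A2. apply (sy_disj _ _ _ _ _ _ _ _ Sy c v c' v' x0); auto.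
    + intros x0 y0 a0 Q Q' Ha0 C0. rewrite !ng_Q by auto. assert (0 <= L * a0) by (apply Rmult_le_pos; auto). assert (0 <= Ls * ke * a0) by (apply Rmult_le_pos; auto).
      apply (cl_mono _ _ _ (2 * (L * a0))); [|lra]. apply dbl_cl; auto. apply (sy_lip _ _ _ _ _ _ _ _ Sy); auto.
    + intros c x0 y0 a0 [v Hc] Q Q' A1 A2 Ha0 C0. rewrite Rmult_0_r, Rplus_0_r. rewrite (ng_hole c v x0), (ng_hole c v y0) by auto. apply HinL; auto; apply (P_QA c v); auto.
    + intros c x0 y0 a0 [v Hc] Q Q' A1 A2 Ha0 C0. rewrite (ng_hole c v x0), (ng_Q y0) by auto.
      set (w := locc eta c y0). assert (Hw : bdC (S k) w) by exact A2.
      replace ((2 * L + Ls * ke) * a0 + 0) with ((2 * L + Ls * ke) * a0 + 0 + 0) by ring.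
      apply (cl_trans _ _ (dbl (cellb v (gs w)))); [rewrite Rplus_0_r; apply HinL; auto; [apply (P_QA c v); auto|apply bdC_QA; auto]|].
      rewrite <- (locc_inv eta c y0 He). fold w. replace 0 with (2 * 0) by ring. apply dbl_cl; [lra|].
      replace 0 with (0 + 0) by ring. apply (cl_trans _ _ (cellb v (B w))).
      * replace 0 with (/ 2 * 0) by ring. apply cellb_cl; [lra|]. apply S3; auto.
      * apply cl_sym, (sy_hole _ _ _ _ _ _ _ _ Sy); auto.
  - intros x Px. destruct (Qof_or_hole (S k) eta (HsC Hs) x (proj1 Px)) as [Q|(c & [v Hc] & Hx)].
    + rewrite ng_Q by auto. pose proof (sy_wall _ _ _ _ _ _ _ _ Sy x Q) as W. rewrite in_walls_isZ in *. destruct W as (t & Ht & Z). exists t. split; auto.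
      unfold dbl. destruct (Nat.eqb t j0); [apply isZ_double|]; auto.
    + rewrite (ng_hole c v) by auto. destruct (S2 (locc eta c x)) as (s & z & Hs1 & Hz & E); [apply (P_QA c v); auto|].
      apply (isZ_cl0 n _ (dbl (cellb v (TmapA j0 s z)))); [apply dbl_cellb_cl; auto; lra|].
      rewrite in_walls_isZ. apply TmapA_isZ; auto. intros t Ht. apply (sy_int _ _ _ _ _ _ _ _ Sy c v t); auto.
  - intros x Hx. rewrite ng_Q by (eapply bdC_Qof; eauto). pose proof (dbl_cl _ _ 0 ltac:(lra) (sy_bd _ _ _ _ _ _ _ _ Sy x Hx)) as C.
    intros t Ht. specialize (C t Ht). replace (boxS nN (B x) t) with (dbl (boxS N (B x)) t); [lra|]. unfold dbl, boxS, nN. destruct (Nat.eqb t j0); field.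
  - intros c' v' w (c & v & s & Hc & Hs1 & -> & ->) Hw.
    assert (Bw := mx_le_inv (S k) w 1 ltac:(unfold bdC in Hw; lra)).
    set (u := fun t => hctr i0 rho s t + hsiz i0 rho t * w t).
    assert (E : (fun i => nctr c s i + neta i * w i) = (fun i => c i + eta i * u i)) by (apply functional_extensionality; intros t; unfold nctr, neta, u; ring).
    assert (Hu : hn (S k) eta c (fun i => c i + eta i * u i) < 1).
    { rewrite hn_loc by auto. destruct (mx_attained (S k) u) as [t [Ht <-]]; [lia|]. unfold u. pose proof (hsiz_bounds s t Hs1) as HB1. specialize (Bw t Ht).
      apply Rabs_def1; pose proof (Rle_abs (hctr i0 rho s t)); pose proof (Rle_abs (- hctr i0 rho s t)) as R2; rewrite Rabs_Ropp in R2; nra. }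
    rewrite E, (ng_hole c v) by auto.
    rewrite locc_of by auto. pose proof (dbl_cellb_cl v _ _ 0 ltac:(lra) (S4 s w Hs1 Hw)) as C. intros t Ht. specialize (C t Ht). fold u in C.
    replace (cellb (ncor v s) (B w) t) with (dbl (cellb v (TmapA j0 s (B w))) t); [exact C|].
    unfold cellb, ncor, dbl, TmapA. destruct (Nat.eqb_spec t j0); [subst|]; field.
  - intros c' v' t (c & v & s & Hc & Hs1 & -> & ->) Ht. pose proof (sy_int _ _ _ _ _ _ _ _ Sy c v t Hc Ht) as I.
    unfold ncor, dbl. apply isZ_plus.
    + destruct (Nat.eqb t j0); [apply isZ_double|]; auto.
    + destruct (Nat.eqb t j0); [|exists 0%Z; auto]. apply isZ_half_sgn. destruct Hs1; subst s; [apply Rabs_R1|rewrite Rabs_left; lra].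
Qed.
End Systems.

(** * Iterated subdivision *)

Section Iterate.
Variables (n k : nat) (B : pt -> pt) (LB rho : R).
Hypothesis Hk : (1 <= k)%nat.
Hypothesis HLB : 0 <= LB.
Hypothesis HB : forall x, bdC (S k) x -> bdC (S n) (B x).
Hypothesis LipB : cll (S k) (bdC (S k)) (S n) B LB.
Hypothesis Hrho : 0 < rho < 1.
Hypothesis Hsp : forall i j, (i < S k)%nat -> (j < S n)%nat -> exists g L, splits_axes n k i j B rho g L.

(** Only side lengths and hole sizes enter the count that follows, and only in the relevant
    coordinates; positions, map and Lipschitz constant are hidden. *)
Definition reach (N eta : pt) : Prop := exists N' eta' Hs g L, system n k B N' eta' Hs g L /\
  (forall t, (t < S n)%nat -> N' t = N t) /\ (forall t, (t < S k)%nat -> eta' t = eta t).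

Lemma reach_ext N eta N1 eta1 : (forall t, (t < S n)%nat -> N t = N1 t) -> (forall t, (t < S k)%nat -> eta t = eta1 t) -> reach N eta -> reach N1 eta1.
Proof.
  intros E1 E2 (N' & eta' & Hs & g & L & Sy & F1 & F2). exists N', eta', Hs, g, L. split; [auto|split]; intros t Ht; [rewrite F1|rewrite F2]; auto.
Qed.

Lemma reach_step N eta i j : (i < S k)%nat -> (j < S n)%nat -> reach N eta ->
  reach (fun t => if Nat.eqb t j then 2 * N t else N t) (fun t => eta t * hsiz i rho t).
Proof.
  intros Hi Hj (N' & eta' & Hs & g & L & Sy & F1 & F2). destruct (Hsp i j Hi Hj) as (gs & Ls & Sp).
  pose proof (system_step n k B Hk i j rho Ls gs Hi Hj Hrho Sp N' eta' Hs g L Sy) as Sy'.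
  do 5 eexists. split; [exact Sy'|]. split; intros t Ht; [unfold nN; rewrite F1|unfold neta; rewrite F2]; auto.
Qed.

Lemma reach_targets N eta i m : (i < S k)%nat -> (m <= S n)%nat -> reach N eta ->
  reach (fun t => if Nat.ltb t m then 2 * N t else N t) (fun t => eta t * hsiz i rho t ^ m).
Proof.
  intros Hi Hm H. induction m; [apply (reach_ext N eta); auto; intros; simpl; ring|].
  eapply reach_ext; [| |apply (reach_step _ _ i m Hi ltac:(lia) (IHm ltac:(lia)))]; intros t Ht; simpl; [|ring].
  destruct (Nat.eqb_spec t m), (Nat.ltb_spec t m), (Nat.ltb_spec t (S m)); try lia; auto.
Qed.

Definition qN (t : nat) : R := if Nat.eqb t 0 then 4 else 2.

(** One domain axis is split n+2 times: once for each of the n+1 target directions and once more for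
    direction 0, whose length has to grow like the square of the others. *)
Lemma reach_round N eta i : (i < S k)%nat -> reach N eta -> reach (fun t => qN t * N t) (fun t => eta t * hsiz i rho t ^ (n + 2)).
Proof.
  intros Hi H. eapply reach_ext; [| |apply (reach_step _ _ i 0 Hi ltac:(lia) (reach_targets N eta i (S n) Hi (le_n _) H))]; intros t Ht; simpl.
  - unfold qN. rewrite (proj2 (Nat.ltb_lt _ _) Ht). destruct (Nat.eqb t 0); ring.
  - replace (n + 2)%nat with (S (S n)) by lia. simpl. ring.
Qed.

Definition hN (m t : nat) : R := if Nat.ltb t m then / 2 else 1.

Lemma reach_axes N eta m : (m <= S k)%nat -> reach N eta ->
  reach (fun t => qN t ^ m * N t) (fun t => eta t * ((rho * rho) ^ m * hN m t) ^ (n + 2)).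
Proof.
  intros Hm H. induction m.
  - apply (reach_ext N eta); auto; intros t Ht; simpl; [ring|]. rewrite Rmult_1_l, pow1. ring.
  - eapply reach_ext; [| |apply (reach_round _ _ m ltac:(lia) (IHm ltac:(lia)))]; intros t Ht; cbv beta; [simpl; ring|].
    rewrite Rmult_assoc, <- Rpow_mult_distr. f_equal. f_equal. unfold hN, hsiz. simpl pow.
    destruct (Nat.eqb_spec t m), (Nat.ltb_spec t m), (Nat.ltb_spec t (S m)); try lia; field.
Qed.

(** In a block every domain axis gets its round. Each side of a hole is halved in one of the k+1
    rounds and multiplied by [rho * rho] in all of them, n+2 times per round, so that the holes are
    cubes again at the end of a block. *)
Lemma reach_blocks e : reach (fun t => qN t ^ (S k * e)) (fun _ => ((rho * rho) ^ S k / 2) ^ ((n + 2) * e)).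
Proof.
  induction e.
  - rewrite !Nat.mul_0_r. do 5 eexists. split; [apply (system_base n k B LB); auto|]. auto.
  - eapply reach_ext; [| |apply (reach_axes _ _ (S k) (le_n _) IHe)]; intros t Ht; cbv beta.
    + replace (S k * S e)%nat with (S k + S k * e)%nat by lia. rewrite pow_add. reflexivity.
    + replace ((n + 2) * S e)%nat with ((n + 2) * e + (n + 2))%nat by lia. rewrite (pow_add _ ((n + 2) * e) (n + 2)). f_equal. f_equal. unfold hN. rewrite (proj2 (Nat.ltb_lt _ _) Ht). reflexivity.
Qed.
End Iterate.

(** * Iteration *)

Definition cA (n : nat) : R := 256 * (wC n + 4 * wK n).

Lemma cA_pos n : (1 <= n)%nat -> 0 < cA n.
Proof. intros Hn. pose proof (wC_nonneg n Hn). pose proof (wK_pos n Hn). unfold cA. lra. Qed.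

(* Lipschitz up to an additive error, which halves when one of the points is on the
   boundary; with this convention the error of a filling does not grow under glueing. *)
Definition coarse (n k : nat) (r : pt -> hpt) (K eps : R) : Prop :=
  (forall x y a, rmaxabs (S k) x <= 1 -> rmaxabs (S k) y <= 1 -> 0 <= a -> cl (S k) x y a -> hle n (r x) (r y) (K * a + 2 * eps)) /\
  (forall x y a, rmaxabs (S k) x <= 1 -> bdC (S k) y -> 0 <= a -> cl (S k) x y a -> hle n (r x) (r y) (K * a + eps)).

(** * Filling the holes level by level *)

Section Levels.
Variables (n k : nat) (B : pt -> pt) (LB : R).
Hypothesis Hn : (1 <= n)%nat.
Hypothesis Hk : (1 <= k)%nat.
Hypothesis HLB : 0 <= LB.
Hypothesis HB : forall x, bdC (S k) x -> bdC (S n) (B x).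
Hypothesis LipB : cll (S k) (bdC (S k)) (S n) B LB.
Hypothesis Bext : forall x y, (forall i, (i < S k)%nat -> x i = y i) -> B x = B y.

Variables (NN : nat) (N' eta : pt) (Hs : pt -> pt -> Prop) (g : pt -> pt) (Lg h : R).
Hypothesis HN : (12 <= NN)%nat.
Hypothesis Sy : system n k B N' eta Hs g Lg.
Hypothesis HN' : forall y i, (i < S n)%nat -> boxS N' y i = boxN NN y i.
Hypothesis Hh : forall t, (t < S k)%nat -> eta t = h.
Hypothesis Hh1 : 0 < h <= 1.
Hypothesis Hc : cA n <= INR NN * h.

(** Lipschitz constant of the boundary maps of the cells. The 2 comes from [cellb], which maps a
    cube of side 2 to a unit cell; this gain pays for the rescaling by 2 in [outer]. *)
Definition nextL (L : R) : R := cA n * (L / INR NN) / 2.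
Definition cellal (L : R) (al : pt -> hpt) (v y : pt) : hpt := Alev n NN al L (cellb v y).
Definition inner (q : R -> (pt -> hpt) -> pt -> hpt) (L : R) (al : pt -> hpt) (x : pt) : hpt :=
  match excluded_middle_informative (exists cv : pt * pt, Hs (fst cv) (snd cv) /\ hn (S k) eta (fst cv) x < 1) with
  | left E => let cv := proj1_sig (constructive_indefinite_description _ E) in q (nextL L) (cellal L al (snd cv)) (locc eta (fst cv) x)
  | right _ => Alev n NN al L (g x)
  end.
(** The collar is the shell between radius 1/2 and 1. It leads from [al] after [B] on the outside to
    the collapsed values that the walls carry. *)
Definition outer (q : R -> (pt -> hpt) -> pt -> hpt) (L : R) (al : pt -> hpt) (x : pt) : hpt :=
  if Rlt_dec (rmaxabs (S k) x) (/ 2) then inner q L al (fun t => 2 * x t)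
  else al (lam0 (S n) (Gcol n NN (2 * (1 - rmaxabs (S k) x)) (B (lam0 (S k) x)))).
(** The recursion stops with a discontinuous map, constant off the boundary. Its jumps are at most
    the diameter [2 * L] of the image, and [coarse] is made to control such maps. *)
Fixpoint rlev (m : nat) (L : R) (al : pt -> hpt) (x : pt) : hpt :=
  match m with
  | O => if Req_EM_T (rmaxabs (S k) x) 1 then al (B x) else al e0
  | S m' => outer (rlev m') L al x
  end.

Lemma inner_hole q L al c v x : Hs c v -> hn (S k) eta c x < 1 -> inner q L al x = q (nextL L) (cellal L al v) (locc eta c x).
Proof.
  intros H1 Hx. unfold inner. destruct (excluded_middle_informative _) as [E|E]; [|exfalso; apply E; exists (c, v); auto].
  destruct (constructive_indefinite_description _ E) as [[c' v'] [H2 H3]]. simpl in *.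
  destruct (sy_disj _ _ _ _ _ _ _ _ Sy c v c' v' x) as [-> ->]; auto.
Qed.

Lemma inner_Q q L al x : Qof (S k) eta (HsC Hs) x -> inner q L al x = Alev n NN al L (g x).
Proof.
  intros [_ Q]. unfold inner. destruct (excluded_middle_informative _) as [[[c v] [H1 H2]]|E]; [|reflexivity].
  exfalso. simpl in *. specialize (Q c (ex_intro _ v H1)). lra.
Qed.

Lemma NN12 : 12 <= INR NN.
Proof. replace 12 with (INR 12) by (simpl; lra). now apply le_INR. Qed.

(** By [Hc] the loss [/ h] caused by small holes is compensated by the gain [/ INR NN] from the fine
    grid, so the constant rescaled to a hole is at most half of the old one. *)
Lemma nextL_bounds L : 0 < L -> 0 < nextL L <= L / 2 /\ nextL L / h <= L / 2.
Proof.
  intros HL. pose proof NN12. pose proof (cA_pos n Hn). assert (P : 0 < / INR NN) by (apply Rinv_0_lt_compat; lra). assert (Q : 0 < / h) by (apply Rinv_0_lt_compat; lra).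
  assert (K : cA n * / INR NN <= h).
  { apply (Rmult_le_reg_r (INR NN)); [lra|]. rewrite Rmult_assoc, Rinv_l by lra. lra. }
  assert (K0 : 0 < cA n * / INR NN) by (apply Rmult_lt_0_compat; lra).
  replace (nextL L) with (cA n * / INR NN * L / 2) by (unfold nextL; field; lra). set (c := cA n * / INR NN) in *. clearbody c.
  split; [split; nra|]. apply (Rmult_le_reg_r h); [lra|]. unfold Rdiv at 1. rewrite Rmult_assoc, Rinv_l by lra. nra.
Qed.

Section OneLevel.
Variables (L : R) (al : pt -> hpt).
Hypothesis HL : 0 < L.
Hypothesis Hal : hlip n (bdC (S n)) al L.

Lemma Alev_cl w w' a : in_walls n w -> in_walls n w' -> 0 <= a -> cl (S n) w w' a -> hle n (Alev n NN al L w) (Alev n NN al L w') (2 * nextL L * a).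
Proof.
  intros Hw Hw' Ha C. replace (2 * nextL L * a) with (cA n * (L / INR NN) * a) by (unfold nextL; field; pose proof NN12; lra). apply Alev_lip; auto.
Qed.

Lemma cellb_walls c v y : Hs c v -> bdC (S n) y -> in_walls n (cellb v y).
Proof.
  intros H1 Hy. rewrite in_walls_isZ. destruct (mx_attained (S n) y) as [i [Hi E]]; [lia|]. rewrite Hy in E. exists i. split; auto.
  unfold cellb. apply isZ_plus; [apply (sy_int _ _ _ _ _ _ _ _ Sy c v); auto|apply isZ_half_sgn; auto].
Qed.

Lemma cellal_hlip c v : Hs c v -> hlip n (bdC (S n)) (cellal L al v) (nextL L).
Proof.
  intros H1 x y a Hx Hy Ha C. unfold cellal. replace (nextL L * a) with (2 * nextL L * (/ 2 * a)) by field.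
  apply Alev_cl; try (apply (cellb_walls c); auto); [lra|]. apply cellb_cl; auto.
Qed.

Variables (q : R -> (pt -> hpt) -> pt -> hpt) (M ep : R).
Hypothesis HM : 0 <= M.
Hypothesis HMg : 2 * Lg <= M.
Hypothesis HMc : 64 * (32 * LB + 6) <= M.
Hypothesis Hep : 0 <= ep.
Hypothesis Hq : forall al', hlip n (bdC (S n)) al' (nextL L) ->
  coarse n k (q (nextL L) al') (M * nextL L) ep /\ forall x, bdC (S k) x -> hle n (q (nextL L) al' x) (al' (B x)) 0.

Lemma locc_cl_uniform c x y a : 0 <= a -> cl (S k) x y a -> cl (S k) (locc eta c x) (locc eta c y) (/ h * a).
Proof.
  intros Ha C i Hi. specialize (C i Hi). unfold locc. rewrite Hh by auto.
  replace ((x i - c i) / h - (y i - c i) / h) with (/ h * (x i - y i)) by (field; lra). apply Rabs_mult_le; auto.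
  rewrite Rabs_pos_eq; [lra|left; apply Rinv_0_lt_compat; lra].
Qed.

Lemma scaled_le a : 0 <= a -> M * nextL L * (/ h * a) <= M * L / 2 * a.
Proof.
  intros Ha. destruct (nextL_bounds L HL) as [_ K]. replace (M * nextL L * (/ h * a)) with (M * a * (nextL L / h)) by (unfold Rdiv; ring).
  replace (M * L / 2 * a) with (M * a * (L / 2)) by field. apply Rmult_le_compat_l; [apply Rmult_le_pos|]; auto.
Qed.

Lemma inner_hole_lip c v x y a e : Hs c v -> hn (S k) eta c x < 1 -> hle n (q (nextL L) (cellal L al v) (locc eta c x)) y (M * nextL L * (/ h * a) + e) ->
  0 <= a -> 0 <= e -> hle n (inner q L al x) y (M * L / 2 * a + e).
Proof.
  intros H1 Hx H Ha He. rewrite (inner_hole _ _ _ c v) by auto. pose proof (scaled_le a Ha). destruct (nextL_bounds L HL) as [[N0 _] _].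
  assert (0 < / h) by (apply Rinv_0_lt_compat; lra).
  assert (0 <= M * nextL L * (/ h * a)) by (apply Rmult_le_pos; [apply Rmult_le_pos|apply Rmult_le_pos]; lra).
  eapply hle_mono; [|exact H|]; lra.
Qed.

(** Off the holes the walls map has constant at most [L * Lg], which is below [M * L / 2] by the
    choice of [M]. In the holes the recursive filling has the constant [M * nextL L / h], bounded by
    the same number. *)
Lemma inner_glue : (forall x y a, rmaxabs (S k) x <= 1 -> rmaxabs (S k) y <= 1 -> 0 <= a -> cl (S k) x y a -> hle n (inner q L al x) (inner q L al y) (M * L / 2 * a + 2 * ep)) /\
  (forall x y a, rmaxabs (S k) x <= 1 -> Qof (S k) eta (HsC Hs) y -> 0 <= a -> cl (S k) x y a -> hle n (inner q L al x) (inner q L al y) (M * L / 2 * a + ep)).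
Proof.
  destruct (nextL_bounds L HL) as [[N0 N1] N2]. pose proof (sy_eta _ _ _ _ _ _ _ _ Sy) as He. pose proof (sy_L _ _ _ _ _ _ _ _ Sy) as HLg.
  assert (HLam : 0 <= M * L / 2) by (assert (0 <= M * L) by (apply Rmult_le_pos; lra); lra).
  assert (GQ : forall x y a, Qof (S k) eta (HsC Hs) x -> Qof (S k) eta (HsC Hs) y -> 0 <= a -> cl (S k) x y a -> hle n (inner q L al x) (inner q L al y) (M * L / 2 * a)).
  { intros x y a Qx Qy Ha C. rewrite !inner_Q by auto. assert (0 <= Lg * a) by (apply Rmult_le_pos; auto).
    apply (hle_mono _ _ _ (2 * nextL L * (Lg * a))).
    - apply Rmult_le_pos; auto; lra.
    - apply Alev_cl; auto; try (apply (sy_wall _ _ _ _ _ _ _ _ Sy); auto). apply (sy_lip _ _ _ _ _ _ _ _ Sy); auto.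
    - apply Rle_trans with (L * (Lg * a)); [apply Rmult_le_compat_r; lra|]. replace (L * (Lg * a)) with (L * a * Lg) by ring. replace (M * L / 2 * a) with (L * a * (M / 2)) by field.
      apply Rmult_le_compat_l; [apply Rmult_le_pos|]; lra. }
  assert (GI : forall c x y a, HsC Hs c -> rmaxabs (S k) x <= 1 -> rmaxabs (S k) y <= 1 -> hn (S k) eta c x < 1 -> hn (S k) eta c y < 1 -> 0 <= a -> cl (S k) x y a ->
    hle n (inner q L al x) (inner q L al y) (M * L / 2 * a + 2 * ep)).
  { intros c x y a [v H1] _ _ A1 A2 Ha C. apply (inner_hole_lip c v); auto; try lra. rewrite (inner_hole _ _ _ c v y) by auto.
    destruct (Hq _ (cellal_hlip c v H1)) as [[K1 _] _]. apply K1; try (rewrite <- hn_locc; lra); [apply Rmult_le_pos; auto; left; apply Rinv_0_lt_compat; lra|apply locc_cl_uniform; auto]. }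
  assert (GB : forall c x y a, HsC Hs c -> rmaxabs (S k) x <= 1 -> Qof (S k) eta (HsC Hs) y -> hn (S k) eta c x < 1 -> hn (S k) eta c y = 1 -> 0 <= a -> cl (S k) x y a ->
    hle n (inner q L al x) (inner q L al y) (M * L / 2 * a + ep)).
  { intros c x y a [v H1] _ Qy A1 A2 Ha C. set (w := locc eta c y). assert (Hw : bdC (S k) w) by exact A2.
    assert (Hip : 0 < / h) by (apply Rinv_0_lt_compat; lra).
    apply (inner_hole_lip c v); auto. destruct (Hq _ (cellal_hlip c v H1)) as [[_ K2] K3]. rewrite inner_Q by auto.
    assert (0 <= / h * a) by (apply Rmult_le_pos; lra). assert (0 <= M * nextL L * (/ h * a)) by (apply Rmult_le_pos; [apply Rmult_le_pos|]; lra).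
    apply (hle_r0 _ _ (q (nextL L) (cellal L al v) w)); [lra|apply K2; auto; [rewrite <- hn_locc; lra|apply locc_cl_uniform; auto]|].
    apply (hle_l0 _ _ (cellal L al v (B w))); [lra|apply K3; auto|]. apply hle_sym. replace 0 with (2 * nextL L * 0) by ring. unfold cellal.
    apply Alev_cl; [apply (sy_wall _ _ _ _ _ _ _ _ Sy); auto|apply (cellb_walls c); auto|lra|].
    rewrite <- (locc_inv eta c y He). apply (sy_hole _ _ _ _ _ _ _ _ Sy); auto. }
  assert (Dj : forall c c' x, HsC Hs c -> HsC Hs c' -> hn (S k) eta c x < 1 -> hn (S k) eta c' x < 1 -> c = c').
  { intros c c' x [v H1] [v' H1'] A1 A2. apply (sy_disj _ _ _ _ _ _ _ _ Sy c v c' v' x); auto. }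
  split; intros x y a.
  - apply (glue_holes (S k) eta He hpt (hle n) (hle_sym n) (hle_mono n) (fun x y z => hle_trans n x y z)) with (Hs := HsC Hs) (P := fun x => rmaxabs (S k) x <= 1); auto.
  - apply (glue_Q (S k) eta He hpt (hle n) (hle_sym n) (hle_mono n) (fun x y z => hle_trans n x y z)) with (Hs := HsC Hs) (P := fun x => rmaxabs (S k) x <= 1); auto.
Qed.

Lemma al0 x y : bdC (S n) x -> bdC (S n) y -> cl (S n) x y 0 -> hle n (al x) (al y) 0.
Proof. intros. replace 0 with (L * 0) by ring. apply Hal; auto; lra. Qed.

Lemma lam0_Gcol_bd th x : bdC (S n) x -> 0 <= th <= 1 -> bdC (S n) (lam0 (S n) (Gcol n NN th x)).
Proof. intros Hx Hth. apply lam0_bd. pose proof (Gcol_big n NN Hn HN th x Hx Hth). lra. Qed.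

Lemma outer_bd x : bdC (S k) x -> hle n (outer q L al x) (al (B x)) 0.
Proof.
  intros Hx. unfold outer. assert (E : rmaxabs (S k) x = 1) by exact Hx. rewrite E. destruct (Rlt_dec _ _); [lra|].
  rewrite (Bext (lam0 (S k) x) x) by (intros; apply lam0_bd_in; auto).
  replace (Gcol n NN (2 * (1 - 1)) (B x)) with (B x) by (apply functional_extensionality; intros; unfold Gcol; ring).
  apply al0; auto; [apply lam0_bd; rewrite (HB x Hx); lra|]. intros i Hi. rewrite lam0_bd_in, Rminus_diag, Rabs_R0 by auto. lra.
Qed.

Lemma bdC_Q x : bdC (S k) x -> Qof (S k) eta (HsC Hs) x.
Proof. intros Hx. eapply bdC_Qof; eauto. Qed.

(** The collar ends with the collapse, which by [Alev_box] is what the walls carry on the boundary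
    of the box. *)
Lemma outer_mid y : rmaxabs (S k) y = / 2 -> hle n (outer q L al y) (inner q L al (fun t => 2 * y t)) 0.
Proof.
  intros E. set (w := fun t => 2 * y t). assert (Hw : bdC (S k) w) by (unfold bdC, w; rewrite mx_scal, Rabs_pos_eq, E; lra).
  unfold outer. rewrite E. destruct (Rlt_dec _ _); [lra|]. rewrite (Bext (lam0 (S k) y) w) by (intros; rewrite lam0_in by auto; rewrite E; unfold w; field).
  replace (Gcol n NN (2 * (1 - / 2)) (B w)) with (colhat n NN (B w)) by (apply functional_extensionality; intros; unfold Gcol; field).
  rewrite inner_Q by (apply bdC_Q; auto).
  apply (hle_l0 _ _ (Alev n NN al L (boxN NN (B w)))); [lra|apply hle_sym, Alev_box; auto|]. apply hle_sym.
  assert (C : cl (S n) (g w) (boxN NN (B w)) 0) by (intros i Hi; rewrite <- HN' by auto; apply (sy_bd _ _ _ _ _ _ _ _ Sy); auto).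
  assert (W : in_walls n (g w)) by (apply (sy_wall _ _ _ _ _ _ _ _ Sy), bdC_Q; auto).
  replace 0 with (2 * nextL L * 0) by ring. apply Alev_cl; auto; [|lra]. apply (isZ_cl0 n _ (g w)); auto. apply cl_sym; auto.
Qed.

(** The inner cube of radius 1/2 is treated as a single hole. Rescaling by 2 turns the constant
    [M * L / 2] inside into [M * L], so the estimate reproduces itself from one level to the
    next. *)
Lemma outer_coarse : coarse n k (outer q L al) (M * L) ep.
Proof.
  destruct inner_glue as [I1 I2].
  assert (ML : 0 <= M * L) by (apply Rmult_le_pos; lra).
  assert (He : forall i : nat, 0 < (fun _ : nat => / 2) i) by (intros; lra).
  set (c0 := fun c : pt => c = (fun _ => 0)).
  assert (HNc : forall x, hn (S k) (fun _ => / 2) (fun _ => 0) x = 2 * rmaxabs (S k) x).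
  { intros x. rewrite <- (Rabs_pos_eq 2) at 1 by lra. rewrite <- mx_scal. apply mx_ext. intros; f_equal; field. }
  assert (Sc : forall x, rmaxabs (S k) (fun t => 2 * x t) = 2 * rmaxabs (S k) x) by (intros; rewrite mx_scal, Rabs_pos_eq; lra).
  assert (C2 : forall x y a, cl (S k) x y a -> cl (S k) (fun t => 2 * x t) (fun t => 2 * y t) (2 * a)).
  { intros x y a C i Hi. specialize (C i Hi). apply Rabs_le_iff in C. apply Rabs_le_iff. lra. }
  assert (QN : forall x, Qof (S k) (fun _ => / 2) c0 x -> / 2 <= rmaxabs (S k) x <= 1).
  { intros x [X1 X2]. specialize (X2 (fun _ => 0) eq_refl). rewrite HNc in X2. lra. }
  assert (GQ : forall x y a, Qof (S k) (fun _ => / 2) c0 x -> Qof (S k) (fun _ => / 2) c0 y -> 0 <= a -> cl (S k) x y a -> hle n (outer q L al x) (outer q L al y) (M * L * a)).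
  { intros x y a Qx Qy Ha C. apply QN in Qx, Qy. unfold outer. destruct (Rlt_dec _ _); [lra|]. destruct (Rlt_dec _ _); [lra|].
    pose proof (mx_cl _ _ _ _ C Ha) as CM. assert (Bx : bdC (S k) (lam0 (S k) x)) by (apply lam0_bd; lra). assert (By : bdC (S k) (lam0 (S k) y)) by (apply lam0_bd; lra).
    assert (K1 : cl (S n) (B (lam0 (S k) x)) (B (lam0 (S k) y)) (LB * (2 / / 2 * a))).
    { apply LipB; auto; [|apply lam0_lip; auto; lra]. replace (2 / / 2 * a) with (4 * a) by field. lra. }
    replace (2 / / 2 * a) with (4 * a) in K1 by field. assert (0 <= LB * (4 * a)) by (apply Rmult_le_pos; lra).
    assert (K2 := Gcol_cl n NN Hn HN (2 * (1 - rmaxabs (S k) x)) (2 * (1 - rmaxabs (S k) y)) _ _ _ (2 * a) (HB _ Bx) (HB _ By) H K1 ltac:(lra)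
      ltac:(replace (2 * (1 - rmaxabs (S k) x) - 2 * (1 - rmaxabs (S k) y)) with (- 2 * (rmaxabs (S k) x - rmaxabs (S k) y)) by ring; apply Rabs_mult_le; [rewrite Rabs_left; lra|auto])).
    assert (0 <= 8 * (LB * (4 * a)) + 3 * (2 * a)) by lra.
    assert (K3 := lam0_lip (S n) _ _ _ (/ 32) ltac:(lra) (Gcol_big n NN Hn HN (2 * (1 - rmaxabs (S k) x)) _ (HB _ Bx) ltac:(lra)) (Gcol_big n NN Hn HN (2 * (1 - rmaxabs (S k) y)) _ (HB _ By) ltac:(lra)) H0 K2).
    (* Collar constant: 64 from the projection outside the cube of size [/ 32], 8 and 3 from [Gcol]
       in space and time, 4 from the radial projection of the domain and 2 from the speed of the
       collar parameter. *)
    assert (E : 2 / / 32 * (8 * (LB * (4 * a)) + 3 * (2 * a)) = 64 * (32 * LB + 6) * a) by field. rewrite E in K3.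
    assert (0 <= 64 * (32 * LB + 6) * a) by (apply Rmult_le_pos; lra).
    apply (hle_mono _ _ _ (L * (64 * (32 * LB + 6) * a))); [apply Rmult_le_pos; lra| |].
    - apply Hal; auto; apply lam0_Gcol_bd; auto; lra.
    - replace (L * (64 * (32 * LB + 6) * a)) with (L * a * (64 * (32 * LB + 6))) by ring. replace (M * L * a) with (L * a * M) by ring.
      apply Rmult_le_compat_l; auto. apply Rmult_le_pos; lra. }
  assert (Oin : forall x, rmaxabs (S k) x < / 2 -> outer q L al x = inner q L al (fun t => 2 * x t)) by (intros x Hx; unfold outer; destruct (Rlt_dec _ _); [auto|lra]).
  assert (GI : forall c x y a, c0 c -> rmaxabs (S k) x <= 1 -> rmaxabs (S k) y <= 1 -> hn (S k) (fun _ => / 2) c x < 1 -> hn (S k) (fun _ => / 2) c y < 1 -> 0 <= a -> cl (S k) x y a ->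
    hle n (outer q L al x) (outer q L al y) (M * L * a + 2 * ep)).
  { intros c x y a -> _ _ A1 A2 Ha C. rewrite HNc in A1, A2. rewrite !Oin by lra. replace (M * L * a) with (M * L / 2 * (2 * a)) by field. apply I1; try rewrite Sc; try lra. auto. }
  assert (GB : forall c x y a, c0 c -> rmaxabs (S k) x <= 1 -> Qof (S k) (fun _ => / 2) c0 y -> hn (S k) (fun _ => / 2) c x < 1 -> hn (S k) (fun _ => / 2) c y = 1 -> 0 <= a -> cl (S k) x y a ->
    hle n (outer q L al x) (outer q L al y) (M * L * a + ep)).
  { intros c x y a -> _ _ A1 A2 Ha C. rewrite HNc in A1, A2. assert (0 <= M * L * a) by (apply Rmult_le_pos; auto).
    apply (hle_r0 _ _ (inner q L al (fun t => 2 * y t))); [lra| |apply hle_sym, outer_mid; lra].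
    rewrite Oin by lra. replace (M * L * a) with (M * L / 2 * (2 * a)) by field. apply I2; try rewrite Sc; try lra; auto. apply bdC_Q. unfold bdC. rewrite Sc. lra. }
  assert (Dj : forall c c' x, c0 c -> c0 c' -> hn (S k) (fun _ => / 2) c x < 1 -> hn (S k) (fun _ => / 2) c' x < 1 -> c = c') by (intros c c' x -> -> _ _; auto).
  split; intros x y a Hx Hy Ha C.
  - apply (glue_holes (S k) _ He hpt (hle n) (hle_sym n) (hle_mono n) (fun x y z => hle_trans n x y z)) with (Hs := c0) (P := fun x => rmaxabs (S k) x <= 1); auto.
  - apply (glue_Q (S k) _ He hpt (hle n) (hle_sym n) (hle_mono n) (fun x y z => hle_trans n x y z)) with (Hs := c0) (P := fun x => rmaxabs (S k) x <= 1); auto.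
    unfold bdC in Hy. split; [lra|]. intros c ->. rewrite HNc. lra.
Qed.
End OneLevel.

Variable M : R.
Hypothesis HM : 0 <= M.
Hypothesis HMg : 2 * Lg <= M.
Hypothesis HMc : 64 * (32 * LB + 6) <= M.

Lemma hlip_diam L al x y : 0 < L -> hlip n (bdC (S n)) al L -> bdC (S n) x -> bdC (S n) y -> hle n (al x) (al y) (2 * L).
Proof. intros HL Hal Hx Hy. replace (2 * L) with (L * 2) by ring. apply Hal; auto; [lra|apply bdC_cl; auto]. Qed.

Lemma rlev0_value L al x : hlip n (bdC (S n)) al L -> exists z, bdC (S n) z /\ rlev 0 L al x = al z.
Proof. intros Hal. simpl. destruct (Req_EM_T _ _) as [E|E]; [exists (B x); split; auto|exists e0; split; [apply (e0_bd n)|auto]]. Qed.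

(** The constant [M] is the same at every depth. The additive error is proportional to the constant
    of the cell maps, which is at most half of [L], so it halves with each level. *)
Lemma rlev_spec m : forall L al, 0 < L -> hlip n (bdC (S n)) al L ->
  coarse n k (rlev m L al) (M * L) (2 * (/ 2) ^ m * L) /\ forall x, bdC (S k) x -> hle n (rlev m L al x) (al (B x)) 0.
Proof.
  induction m; intros L al HL Hal.
  - assert (K : forall x y, hle n (rlev 0 L al x) (rlev 0 L al y) (2 * L)).
    { intros x y. destruct (rlev0_value L al x Hal) as (z & Hz & ->). destruct (rlev0_value L al y Hal) as (z' & Hz' & ->). apply hlip_diam; auto. }
    assert (ML : 0 <= M * L) by (apply Rmult_le_pos; lra).
    split; [split; intros x y a Hx Hy Ha C; assert (0 <= M * L * a) by (apply Rmult_le_pos; auto); apply (hle_mono _ _ _ (2 * L)); auto; simpl; lra|].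
    intros x Hx. simpl. destruct (Req_EM_T _ _) as [E|E]; [apply hle_refl; lra|contradiction].
  - destruct (nextL_bounds L HL) as [[N0 N1] N2].
    assert (HP : 0 < (/ 2) ^ m) by (apply pow_lt; lra).
    assert (Hq : forall al', hlip n (bdC (S n)) al' (nextL L) -> coarse n k (rlev m (nextL L) al') (M * nextL L) (2 * (/ 2) ^ S m * L) /\
       forall x, bdC (S k) x -> hle n (rlev m (nextL L) al' x) (al' (B x)) 0).
    { intros al' Hal'. destruct (IHm (nextL L) al' N0 Hal') as [[K1 K2] K3]. split; auto.
      assert (E : 2 * (/ 2) ^ m * nextL L <= 2 * (/ 2) ^ S m * L) by (replace (2 * (/ 2) ^ S m * L) with (2 * (/ 2) ^ m * (L / 2)) by (simpl; field); apply Rmult_le_compat_l; lra). assert (E0 : 0 <= 2 * (/ 2) ^ m * nextL L) by (apply Rmult_le_pos; lra).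
      assert (MN : 0 <= M * nextL L) by (apply Rmult_le_pos; lra).
      split; intros x y a Hx Hy Ha C; assert (0 <= M * nextL L * a) by (apply Rmult_le_pos; auto).
      - eapply hle_mono; [|apply (K1 x y a); auto|]; lra.
      - eapply hle_mono; [|apply (K2 x y a); auto|]; lra. }
    assert (Hep : 0 <= 2 * (/ 2) ^ S m * L) by (apply Rmult_le_pos; [simpl; lra|lra]).
    split; [apply (outer_coarse L al HL Hal (rlev m) M _ HM HMg HMc Hep Hq)|]. intros x Hx. apply (outer_bd L al Hal (rlev m)); auto.
Qed.

(** Consecutive depths differ only inside the deepest holes. There the difference is that of depths
    0 and 1, for a cell map whose constant has been halved at least [m] times. *)
Lemma rlev_cauchy m : forall L al x, 0 < L -> hlip n (bdC (S n)) al L -> rmaxabs (S k) x <= 1 ->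
  hle n (rlev (S m) L al x) (rlev m L al x) ((2 * M + 3) * L * (/ 2) ^ m).
Proof.
  induction m; intros L al x HL Hal Hx.
  - destruct (rlev_spec 1 L al HL Hal) as [[_ K2] K3]. assert (W : bdC (S k) e0) by apply (e0_bd k).
    destruct (rlev0_value L al x Hal) as (z & Hz & ->). simpl pow in *.
    assert (C : cl (S k) x e0 2).
    { intros i Hi. pose proof (mx_le_inv _ _ _ Hx i Hi). pose proof (mx_le_inv (S k) e0 1 ltac:(rewrite W; lra) i Hi). apply Rabs_le_iff. lra. }
    specialize (K2 x e0 2 Hx W ltac:(lra) C). assert (0 <= M * L) by (apply Rmult_le_pos; lra).
    replace ((2 * M + 3) * L * 1) with ((M * L * 2 + 2 * (/ 2 * 1) * L) + (0 + 2 * L)) by field.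
    apply (hle_trans _ _ (rlev 1 L al e0)); auto; try lra. apply (hle_trans _ _ (al (B e0))); auto; try lra. apply hlip_diam; auto.
  - destruct (nextL_bounds L HL) as [[N0 N1] N2]. assert (HP : 0 < (/ 2) ^ m) by (apply pow_lt; lra).
    assert (PR : 0 <= (2 * M + 3) * L * (/ 2) ^ S m) by (apply Rmult_le_pos; [apply Rmult_le_pos; lra|left; apply pow_lt; lra]).
    change (hle n (outer (rlev (S m)) L al x) (outer (rlev m) L al x) ((2 * M + 3) * L * (/ 2) ^ S m)).
    unfold outer. destruct (Rlt_dec _ _) as [Hlt|]; [|apply hle_refl; auto].
    unfold inner. destruct (excluded_middle_informative _) as [E|]; [|apply hle_refl; auto].
    destruct (constructive_indefinite_description _ E) as [[c v] [H1 H2]]. simpl fst in *. simpl snd in *. simpl proj1_sig.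
    eapply hle_mono; [|apply IHm; [auto|apply (cellal_hlip L al HL Hal c); auto|rewrite <- hn_locc; lra]|].
    + apply Rmult_le_pos; [apply Rmult_le_pos|]; lra.
    + replace ((2 * M + 3) * nextL L * (/ 2) ^ m) with ((2 * M + 3) * (/ 2) ^ m * nextL L) by ring.
      replace ((2 * M + 3) * L * (/ 2) ^ S m) with ((2 * M + 3) * (/ 2) ^ m * (L / 2)) by (simpl; field).
      apply Rmult_le_compat_l; auto. apply Rmult_le_pos; lra.
Qed.
End Levels.

(** * Limits in the Heisenberg group *)

Definition hcv (n : nat) (p : nat -> hpt) (l : hpt) : Prop :=
  (forall j, (j < n)%nat -> Un_cv (fun m => hx (p m) j) (hx l j) /\ Un_cv (fun m => hy (p m) j) (hy l j)) /\ Un_cv (fun m => hz (p m)) (hz l).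

Lemma Un_cv_const c : Un_cv (fun _ => c) c.
Proof. intros e He. exists O. intros m _. rewrite Rdist_eq. auto. Qed.

Lemma Un_cv_rsum d (u : nat -> nat -> R) l : (forall j, (j < d)%nat -> Un_cv (fun m => u m j) (l j)) -> Un_cv (fun m => rsum d (u m)) (rsum d l).
Proof.
  induction d; intros H; simpl; [apply Un_cv_const|]. apply (CV_plus (fun m => rsum d (u m)) (fun m => u m d)); auto.
Qed.

Lemma Un_cv_le u l v l' : Un_cv u l -> Un_cv v l' -> (forall m, u m <= v m) -> l <= l'.
Proof. intros. eapply Rle_cv_lim; eauto. Qed.

Lemma hle_lim n p q p' q' b b' : hcv n p p' -> hcv n q q' -> Un_cv b b' -> (forall m, hle n (p m) (q m) (b m)) -> hle n p' q' b'.
Proof.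
  intros [P1 P2] [Q1 Q2] Hb H.
  assert (D : forall u v u' v', Un_cv u u' -> Un_cv v v' -> (forall m, Rabs (v m - u m) <= b m) -> Rabs (v' - u') <= b').
  { intros u v u' v' U V K. apply (Un_cv_le (fun m => Rabs (v m - u m)) _ b); auto. apply cv_cvabs, CV_minus; auto. }
  split.
  - intros j Hj. destruct (P1 j Hj), (Q1 j Hj). split; [apply (D (fun m => hx (p m) j) (fun m => hx (q m) j))|apply (D (fun m => hy (p m) j) (fun m => hy (q m) j))]; auto; intros m; apply (H m); auto.
  - apply (Un_cv_le (fun m => Rabs (zeta n (p m) (q m))) _ (fun m => INR n * b m ^ 2)); [| |intros m; apply (H m)].
    + apply cv_cvabs. unfold zeta. apply CV_minus; [apply CV_minus; auto|].
      apply (Un_cv_rsum n (fun m j => (hy (p m) j + hy (q m) j) / 2 * (hx (q m) j - hx (p m) j)) (fun j => (hy p' j + hy q' j) / 2 * (hx q' j - hx p' j))).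
      intros j Hj. destruct (P1 j Hj), (Q1 j Hj). apply CV_mult; [|apply CV_minus; auto].
      apply (CV_mult (fun m => hy (p m) j + hy (q m) j) (fun _ => / 2)); [apply CV_plus; auto|apply Un_cv_const].
    + apply (CV_mult (fun _ => INR n)); [apply Un_cv_const|]. simpl. apply (CV_mult b (fun m => b m * 1)); auto. apply (CV_mult b (fun _ => 1)); auto. apply Un_cv_const.
Qed.

Lemma Un_cv_half_pow : Un_cv (fun m => (/ 2) ^ m) 0.
Proof.
  intros e He. destruct (half_pow_small e He) as [m Hm]. exists m. intros p Hp. unfold R_dist. rewrite Rminus_0_r, Rabs_pos_eq by (left; apply half_pow_pos). auto.
Qed.

Lemma Un_cv_geometric u A : (forall m, Rabs (u (S m) - u m) <= A * (/ 2) ^ m) -> exists l, Un_cv u l.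
Proof.
  intros H. destruct (geometric_cauchy u A H) as [l Hl]. exists l. intros e He.
  assert (HA : 0 <= A) by (specialize (H O); simpl in H; pose proof (Rabs_pos (u 1%nat - u O)); lra).
  destruct (half_pow_small (e / (2 * A + 1))) as [m Hm]; [apply Rdiv_lt_0_compat; lra|]. exists m. intros p Hp. unfold R_dist.
  eapply Rle_lt_trans; [apply Hl|]. specialize (Hm p Hp). pose proof (half_pow_pos p).
  apply (Rmult_lt_compat_r (2 * A + 1)) in Hm; [|lra]. unfold Rdiv in Hm. rewrite Rmult_assoc, Rinv_l in Hm by lra. nra.
Qed.

(** The gauge controls increments of z only relative to [<y, dx>], so y has to be bounded along the
    sequence before z is seen to converge. *)
Lemma hcv_exists n p A : 0 <= A -> (forall m, hle n (p (S m)) (p m) (A * (/ 2) ^ m)) -> exists l, hcv n p l.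
Proof.
  intros HA H.
  assert (X : forall j, exists l, (j < n)%nat -> Un_cv (fun m => hx (p m) j) l).
  { intros j. destruct (Nat.lt_ge_cases j n) as [Hj|Hj]; [|exists 0; lia]. destruct (Un_cv_geometric (fun m => hx (p m) j) A) as [l Hl]; [|exists l; auto].
    intros m. rewrite Rabs_minus_sym. apply (H m); auto. }
  assert (Yd : forall j m, (j < n)%nat -> Rabs (hy (p (S m)) j - hy (p m) j) <= A * (/ 2) ^ m) by (intros j m Hj; rewrite Rabs_minus_sym; apply (H m); auto).
  assert (Y : forall j, exists l, (j < n)%nat -> Un_cv (fun m => hy (p m) j) l).
  { intros j. destruct (Nat.lt_ge_cases j n) as [Hj|Hj]; [|exists 0; lia]. destruct (Un_cv_geometric (fun m => hy (p m) j) A) as [l Hl]; [|exists l; auto]. auto. }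
  set (Yb := rsum n (fun j => Rabs (hy (p O) j)) + 4 * A).
  assert (YB : forall m j, (j < n)%nat -> Rabs (hy (p m) j) <= Yb).
  { intros m j Hj. destruct (geometric_cauchy (fun m => hy (p m) j) A) as [l Hl]; [auto|].
    pose proof (Hl O) as L0. pose proof (Hl m) as Lm. simpl in L0. pose proof (half_pow_pos m). assert ((/ 2) ^ m <= 1) by (rewrite <- (pow1 m); apply pow_incr; lra).
    assert (2 * A * (/ 2) ^ m <= 2 * A) by nra.
    pose proof (rsum_term_le n (fun j => Rabs (hy (p O) j)) j ltac:(intros; apply Rabs_pos) Hj) as T. simpl in T. pose proof (Rabs_triang (hy (p O) j) (hy (p m) j - hy (p O) j)) as T2.
    replace (hy (p O) j + (hy (p m) j - hy (p O) j)) with (hy (p m) j) in T2 by ring.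
    assert (Rabs (hy (p m) j - hy (p O) j) <= 4 * A); [|unfold Yb; lra]. apply Rabs_le_iff in L0, Lm. apply Rabs_le_iff. lra. }
  assert (HYb : 0 <= Yb) by (unfold Yb; pose proof (rsum_nonneg n (fun j => Rabs (hy (p O) j)) ltac:(intros; apply Rabs_pos)); lra).
  destruct (Un_cv_geometric (fun m => hz (p m)) (INR n * A ^ 2 + INR n * (Yb * A))) as [z Hz].
  { intros m. destruct (H m) as [H1 H2]. pose proof (half_pow_pos m). assert ((/ 2) ^ m <= 1) by (rewrite <- (pow1 m); apply pow_incr; lra).
    set (t := (/ 2) ^ m) in *. pose proof (pos_INR n).
    assert (E : hz (p (S m)) - hz (p m) = - (zeta n (p (S m)) (p m) + rsum n (fun j => (hy (p (S m)) j + hy (p m) j) / 2 * (hx (p m) j - hx (p (S m)) j)))) by (unfold zeta; ring).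
    rewrite E, Rabs_Ropp. eapply Rle_trans; [apply Rabs_triang|]. rewrite Rmult_plus_distr_r. apply Rplus_le_compat.
    - eapply Rle_trans; [exact H2|]. replace (INR n * (A * t) ^ 2) with (INR n * A ^ 2 * t * t) by ring. rewrite <- (Rmult_1_r (INR n * A ^ 2 * t)) at 2.
      apply Rmult_le_compat_l; [|auto]. repeat apply Rmult_le_pos; auto; lra.
    - eapply Rle_trans; [apply (rsum_abs_le n _ (Yb * (A * t)))|right; ring]. intros j Hj. apply Rabs_mult_le; [|apply H1; auto].
      pose proof (YB m j Hj) as B1. pose proof (YB (S m) j Hj) as B2. apply Rabs_le_iff in B1, B2. apply Rabs_le_iff. lra. }
  exists (mkH (fun j => proj1_sig (constructive_indefinite_description _ (X j))) (fun j => proj1_sig (constructive_indefinite_description _ (Y j))) z).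
  split; [|exact Hz]. intros j Hj. simpl. split; destruct (constructive_indefinite_description _ _) as [l Hl]; auto.
Qed.

(** * Choice of the scales *)

Lemma one_minus_pow dl q : 0 <= dl <= 1 -> 1 - INR q * dl <= (1 - dl) ^ q.
Proof.
  intros H. induction q; [simpl; lra|]. rewrite S_INR. simpl pow. assert (0 <= (1 - dl) ^ q) by (apply pow_le; lra). pose proof (pos_INR q).
  apply Rle_trans with ((1 - dl) * (1 - INR q * dl)); [|apply Rmult_le_compat_l; lra]. assert (0 <= INR q * dl * dl) by (repeat apply Rmult_le_pos; lra). lra.
Qed.

Lemma shrink_factor q : exists rho, 0 < rho < 1 /\ / 2 <= (rho * rho) ^ q.
Proof.
  set (dl := / (4 * (INR q + 1))). pose proof (pos_INR q). assert (Hd : 0 < dl) by (apply Rinv_0_lt_compat; lra).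
  assert (E : dl * (4 * (INR q + 1)) = 1) by (apply Rinv_l; lra). assert (dl <= / 4) by nra.
  exists (1 - dl). split; [lra|]. replace ((1 - dl) * (1 - dl)) with ((1 - dl) ^ 2) by ring. rewrite <- pow_mult.
  eapply Rle_trans; [|apply one_minus_pow; lra]. rewrite mult_INR. simpl. nra.
Qed.

(** Without the factors [rho] the product would be 2 to the power (k + 1 - (n + 2)) * e, at least
    [2 ^ e]. The factor [rho] is chosen after [e], so close to 1 that all shrinkings together cost
    at most a factor 2. *)
Lemma scale_choice n k X : (n + 2 <= k)%nat -> exists e rho, 0 < rho < 1 /\ (12 <= 2 ^ (S k * e))%nat /\
  0 < ((rho * rho) ^ S k / 2) ^ ((n + 2) * e) <= 1 /\ X <= INR (2 ^ (S k * e)) * ((rho * rho) ^ S k / 2) ^ ((n + 2) * e).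
Proof.
  (* The 2 compensates for the loss due to [rho], and 12 provides the side length that the walls
     construction requires. *)
  intros Hnk. set (Y := 2 * Rabs X + 12). assert (HY : 12 <= Y) by (unfold Y; pose proof (Rabs_pos X); lra).
  destruct (half_pow_small (/ Y)) as [e He]; [apply Rinv_0_lt_compat; lra|]. specialize (He e (le_n e)).
  assert (He2 : Y < 2 ^ e).
  { rewrite pow_inv in He. apply (Rinv_lt_contravar (/ 2 ^ e)) in He; [rewrite !Rinv_inv in He; auto|].
    apply Rmult_lt_0_compat; apply Rinv_0_lt_compat; [apply pow_lt; lra|lra]. }
  destruct (shrink_factor (S k * ((n + 2) * e))) as (rho & Hr & Hq). exists e, rho. split; auto.
  assert (INR2 : forall m, INR (2 ^ m) = 2 ^ m) by (intros m; rewrite pow_INR; reflexivity).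
  assert (Hb : 0 < (rho * rho) ^ S k / 2) by (apply Rdiv_lt_0_compat; [apply pow_lt; nra|lra]).
  assert (Hb1 : (rho * rho) ^ S k <= 1) by (rewrite <- (pow1 (S k)); apply pow_incr; nra).
  split; [|split; [split|]].
  - apply INR_le. rewrite INR2. replace (INR 12) with 12 by (simpl; lra). apply Rle_trans with (2 ^ e); [lra|]. apply Rle_pow; [lra|]. simpl. lia.
  - apply pow_lt; auto.
  - rewrite <- (pow1 ((n + 2) * e)). apply pow_incr. lra.
  - rewrite INR2. replace ((rho * rho) ^ S k / 2) with ((rho * rho) ^ S k * / 2) by reflexivity. rewrite Rpow_mult_distr, <- pow_mult.
    replace (S k * e)%nat with ((n + 2) * e + (S k - (n + 2)) * e)%nat by (rewrite <- Nat.mul_add_distr_r; f_equal; lia). rewrite pow_add.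
    assert (E2 : 2 ^ ((n + 2) * e) * (/ 2) ^ ((n + 2) * e) = 1) by (rewrite <- Rpow_mult_distr, Rinv_r, pow1 by lra; auto).
    replace (2 ^ ((n + 2) * e) * 2 ^ ((S k - (n + 2)) * e) * ((rho * rho) ^ (S k * ((n + 2) * e)) * (/ 2) ^ ((n + 2) * e))) with
      (2 ^ ((n + 2) * e) * (/ 2) ^ ((n + 2) * e) * (2 ^ ((S k - (n + 2)) * e) * (rho * rho) ^ (S k * ((n + 2) * e)))) by ring.
    rewrite E2, Rmult_1_l. pose proof (Rle_abs X). assert (2 ^ e <= 2 ^ ((S k - (n + 2)) * e)) by (apply Rle_pow; [lra|nia]). unfold Y in *. nra.
Qed.

Lemma Bmap_ext n k beta x y : (forall i, (i < S k)%nat -> x i = y i) -> Bmap n k beta x = Bmap n k beta y.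
Proof. intros H. unfold Bmap. rewrite (std_ext (S k) x y); auto. Qed.

Theorem cube_extension n k beta al L : (2 <= n)%nat -> (n + 2 <= k)%nat -> maps_to (sphere k) (sphere n) beta ->
  lipschitz_on (S k) (S n) (sphere k) beta -> satisfies_star n k beta -> 0 < L -> hlip n (bdC (S n)) al L ->
  exists r K, 0 <= K /\ (forall x y a, rmaxabs (S k) x <= 1 -> rmaxabs (S k) y <= 1 -> 0 <= a -> cl (S k) x y a -> hle n (r x) (r y) (K * a)) /\
    forall x, bdC (S k) x -> hle n (r x) (al (Bmap n k beta x)) 0.
Proof.
  intros Hn Hk M HLip Hstar HL Hal. assert (Hn1 : (1 <= n)%nat) by lia. assert (Hk1 : (1 <= k)%nat) by lia.
  destruct (cll_of_lipschitz_on _ _ _ _ HLip) as (L1 & HL1 & Lip). destruct (Bmap_cll n k beta L1 HL1 M Lip) as (LB & HLB & LipB).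
  set (B := Bmap n k beta) in *. assert (HB : forall x, bdC (S k) x -> bdC (S n) (B x)) by (intros; apply Bmap_bd; auto).
  destruct (scale_choice n k (cA n) Hk) as (e & rho & Hr & N12 & Hh & Hc). set (NN := (2 ^ (S k * e))%nat) in *. set (h := ((rho * rho) ^ S k / 2) ^ ((n + 2) * e)) in *.
  destruct (reach_blocks n k B LB rho Hk1 HLB HB LipB Hr (fun i j Hi Hj => splits_axes_exist n k beta i j rho Hn1 Hk1 Hi Hj Hr M HLip Hstar) e)
    as (N' & eta & Hs & g & Lg & Sy & EN & Eeta). fold h in Eeta.
  assert (ENN : INR NN = 2 ^ (S k * e)) by (unfold NN; rewrite pow_INR; reflexivity).
  assert (HN' : forall y i, (i < S n)%nat -> boxS N' y i = boxN NN y i).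
  { intros y i Hi. unfold boxS. rewrite EN by auto. unfold qN. destruct i as [|i]; simpl Nat.eqb; unfold boxN; rewrite ENN; [|reflexivity].
    rewrite <- Rpow_mult_distr. replace (2 * 2) with 4 by ring. reflexivity. }
  assert (HLg := sy_L _ _ _ _ _ _ _ _ Sy).
  set (K := 2 * Lg + 64 * (32 * LB + 6)). assert (HK : 0 <= K) by (unfold K; lra).
  assert (Spec := fun m => rlev_spec n k B LB Hn1 Hk1 HLB HB LipB (Bmap_ext n k beta) NN N' eta Hs g Lg h N12 Sy HN' Eeta Hh Hc K HK ltac:(unfold K; lra) ltac:(unfold K; lra) m L al HL Hal).
  assert (Cau := fun m x => rlev_cauchy n k B LB Hn1 Hk1 HLB HB LipB (Bmap_ext n k beta) NN N' eta Hs g Lg h N12 Sy HN' Eeta Hh Hc K HK ltac:(unfold K; lra) ltac:(unfold K; lra) m L al x HL Hal).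
  set (R := rlev n k B NN eta Hs g) in *.
  assert (Ex : forall x, exists l, rmaxabs (S k) x <= 1 -> hcv n (fun m => R m L al x) l).
  { intros x. destruct (Rle_dec (rmaxabs (S k) x) 1) as [Hx|Hx]; [|exists hzero; intros; contradiction].
    destruct (hcv_exists n (fun m => R m L al x) ((2 * K + 3) * L)) as [l Hl]; [apply Rmult_le_pos; lra|intros m; apply Cau; auto|]. exists l; auto. }
  set (r := fun x => proj1_sig (constructive_indefinite_description _ (Ex x))).
  assert (Hrl : forall x, rmaxabs (S k) x <= 1 -> hcv n (fun m => R m L al x) (r x)).
  { intros x Hx. unfold r. destruct (constructive_indefinite_description _ (Ex x)) as [l Hl]. simpl; auto. }
  exists r, (K * L). split; [apply Rmult_le_pos; lra|]. split.
  - intros x y a Hx Hy Ha C. apply (hle_lim n (fun m => R m L al x) (fun m => R m L al y) _ _ (fun m => K * L * a + 2 * (2 * (/ 2) ^ m * L))); auto.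
    + cut (Un_cv (fun m => K * L * a + 2 * (2 * (/ 2) ^ m * L)) (K * L * a + 2 * (2 * 0 * L))).
      { replace (K * L * a + 2 * (2 * 0 * L)) with (K * L * a) by ring. auto. }
      apply (CV_plus (fun _ => K * L * a) (fun m => 2 * (2 * (/ 2) ^ m * L))); [apply Un_cv_const|]. apply (CV_mult (fun _ => 2) (fun m => 2 * (/ 2) ^ m * L)); [apply Un_cv_const|].
      apply (CV_mult (fun m => 2 * (/ 2) ^ m) (fun _ => L)); [|apply Un_cv_const]. apply (CV_mult (fun _ => 2) (fun m => (/ 2) ^ m)); [apply Un_cv_const|apply Un_cv_half_pow].
    + intros m. apply (Spec m); auto.
  - intros x Hx. apply (hle_lim n (fun m => R m L al x) (fun _ => al (B x)) _ _ (fun _ => 0)).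
    + apply Hrl. unfold bdC in Hx. lra.
    + split; [intros; split|]; apply Un_cv_const.
    + apply Un_cv_const.
    + intros m. apply (Spec m); auto.
Qed.

(** * From the cube to the ball *)

Definition ballcube (d : nat) (x : pt) : pt := fun i => x i * (norm d x / rmaxabs d x).

Lemma norm_le_mx d x : norm d x <= INR d * rmaxabs d x.
Proof.
  unfold norm. pose proof (cl_dist d x (fun _ => 0) (rmaxabs d x) (mx_nonneg d x)) as C. unfold dist in C.
  rewrite (rsum_ext d _ (fun i => x i ^ 2)) in C by (intros; rewrite Rminus_0_r; auto). apply C. intros i Hi. rewrite Rminus_0_r. apply mx_ge; auto.
Qed.

Lemma ballcube_ratio d x i : (i < d)%nat -> Rabs (x i) * (norm d x / rmaxabs d x) <= norm d x.
Proof.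
  intros Hi. pose proof (mx_ge d x i Hi). pose proof (norm_ge0 d x). pose proof (Rabs_pos (x i)).
  destruct (Req_dec (rmaxabs d x) 0) as [E|E].
  - assert (Rabs (x i) = 0) as -> by lra. lra.
  - pose proof (mx_nonneg d x). apply (Rmult_le_reg_r (rmaxabs d x)); [lra|]. unfold Rdiv. rewrite !Rmult_assoc, Rinv_l by auto. rewrite Rmult_1_r. nra.
Qed.

Lemma ballcube_cl d x y a : 0 <= a -> cl d x y a -> cl d (ballcube d x) (ballcube d y) (3 * INR d * a).
Proof.
  (* By symmetry [y] may be assumed to have the smaller sup norm; its coordinates divided by the sup
     norm of [x] are then at most 1. *)
  assert (W : forall x y a, 0 <= a -> cl d x y a -> rmaxabs d y <= rmaxabs d x -> cl d (ballcube d x) (ballcube d y) (3 * INR d * a)).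
  { clear. intros x y a Ha C Hle i Hi. unfold ballcube. pose proof (mx_nonneg d x) as X0. pose proof (mx_nonneg d y) as Y0.
    pose proof (norm_ge0 d x). pose proof (norm_ge0 d y). pose proof (norm_le_mx d x) as NX. pose proof (norm_le_mx d y) as NY. pose proof (mx_ge d y i Hi) as Yi. pose proof (mx_ge d x i Hi) as Xi.
    assert (HN : Rabs (norm d x - norm d y) <= INR d * a) by (apply norm_cl; auto). pose proof (mx_cl d x y a C Ha) as HM. specialize (C i Hi). pose proof (pos_INR d) as Pd.
    assert (Da : 0 <= INR d * a) by (apply Rmult_le_pos; auto).
    set (mX := rmaxabs d x) in *. set (mY := rmaxabs d y) in *. set (nX := norm d x) in *. set (nY := norm d y) in *.
    destruct (Req_dec mX 0) as [E|E].
    { rewrite E in *. assert (x i = 0) by (apply Rabs_le_iff in Xi; lra). assert (y i = 0) by (assert (mY = 0) as E2 by lra; rewrite E2 in Yi; apply Rabs_le_iff in Yi; lra).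
      rewrite H1, H2, !Rmult_0_l, Rminus_0_r, Rabs_R0. nra. }
    assert (F : nX / mX <= INR d) by (apply (Rmult_le_reg_r mX); [lra|]; unfold Rdiv; rewrite Rmult_assoc, Rinv_l by auto; lra).
    assert (F0 : 0 <= nX / mX) by (apply Rmult_le_pos; [auto|left; apply Rinv_0_lt_compat; lra]).
    assert (T1 : Rabs ((x i - y i) * (nX / mX)) <= a * INR d) by (apply Rabs_mult_le; auto; rewrite Rabs_pos_eq; auto).
    destruct (Req_dec mY 0) as [E'|E'].
    { rewrite E' in Yi. assert (Ey : y i = 0) by (apply Rabs_le_iff in Yi; lra). rewrite Ey in *. rewrite Rmult_0_l, Rminus_0_r. rewrite Rminus_0_r in T1. lra. }
    assert (Q : Rabs (y i / mX) <= 1).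
    { unfold Rdiv. rewrite Rabs_mult, (Rabs_pos_eq (/ mX)) by (left; apply Rinv_0_lt_compat; lra). apply (Rmult_le_reg_r mX); [lra|]. rewrite Rmult_assoc, Rinv_l by auto. lra. }
    assert (Q2 : Rabs (nY / mY) <= INR d).
    { rewrite Rabs_pos_eq by (apply Rmult_le_pos; [auto|left; apply Rinv_0_lt_compat; lra]). apply (Rmult_le_reg_r mY); [lra|]. unfold Rdiv. rewrite Rmult_assoc, Rinv_l by auto. lra. }
    replace (x i * (nX / mX) - y i * (nY / mY)) with ((x i - y i) * (nX / mX) + (y i / mX * (nX - nY) + y i / mX * (nY / mY * - (mX - mY)))) by (field; auto).
    assert (T2 : Rabs (y i / mX * (nX - nY)) <= 1 * (INR d * a)) by (apply Rabs_mult_le; auto).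
    assert (T3 : Rabs (y i / mX * (nY / mY * - (mX - mY))) <= 1 * (INR d * a)) by (apply Rabs_mult_le; auto; apply Rabs_mult_le; auto; rewrite Rabs_Ropp; auto).
    pose proof (Rabs_triang ((x i - y i) * (nX / mX)) (y i / mX * (nX - nY) + y i / mX * (nY / mY * - (mX - mY)))). pose proof (Rabs_triang (y i / mX * (nX - nY)) (y i / mX * (nY / mY * - (mX - mY)))). lra. }
  intros Ha C. destruct (Rle_dec (rmaxabs d y) (rmaxabs d x)); [apply W; auto|]. apply cl_sym, W; auto; [apply cl_sym; auto|lra].
Qed.

Lemma std_ballcube n x : sphere n x -> std (S n) (ballcube (S n) x) = x /\ bdC (S n) (ballcube (S n) x) /\ std (S n) (lam0 (S n) x) = x.
Proof.
  intros Hx. destruct (sphere_mx n x Hx) as [M0 _].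
  assert (N1 : norm (S n) x = 1) by (unfold norm; destruct Hx as [-> _]; apply sqrt_1).
  assert (E : forall i, (i < S n)%nat -> ballcube (S n) x i = lam0 (S n) x i) by (intros; unfold ballcube; rewrite lam0_in, N1 by auto; field; lra).
  assert (Es : std (S n) (lam0 (S n) x) = x).
  { apply functional_extensionality. intros i. unfold std. destruct (Nat.ltb_spec i (S n)) as [Hi|Hi]; [|symmetry; apply Hx; auto].
    assert (Nl : norm (S n) (lam0 (S n) x) = / rmaxabs (S n) x).
    { unfold norm. rewrite (rsum_ext (S n) _ (fun i => (/ rmaxabs (S n) x) ^ 2 * x i ^ 2)) by (intros; rewrite lam0_in by auto; unfold Rdiv; ring).
      rewrite rsum_scal. destruct Hx as [-> _]. rewrite Rmult_1_r, sqrt_pow2; auto. left; apply Rinv_0_lt_compat; auto. }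
    rewrite Nl, lam0_in by auto. field. lra. }
  split; [|split; auto].
  - rewrite (std_ext (S n) _ (lam0 (S n) x)); auto.
  - unfold bdC. rewrite (mx_ext (S n) _ (lam0 (S n) x)) by (intros; rewrite E; auto). apply lam0_bd; auto.
Qed.

Theorem theorem3 (n k : nat) (alpha : pt -> hpt) (beta : pt -> pt) :
  (2 <= n)%nat -> (n + 2 <= k)%nat ->
  hlipschitz_on (S n) n (sphere n) alpha ->
  maps_to (sphere k) (sphere n) beta ->
  lipschitz_on (S k) (S n) (sphere k) beta ->
  satisfies_star n k beta ->
  exists r : pt -> hpt,
    hlipschitz_on (S k) n (ball (S k)) r /\
    (forall x, sphere k x -> hpt_eq n (r x) (alpha (beta x))).
Proof.
  intros Hn Hk (La & HLa & Ha) M HLip Hstar. pose proof (pos_INR (S n)) as Pn. pose proof (pos_INR (S k)) as Pk.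
  set (al := fun x => alpha (std (S n) x)).
  (* The 2 is the loss in passing from the metric to the gauge. The [+ 1] keeps the constant
     positive, as the dilation by [/ lam] requires, even when [La] is 0. *)
  set (L := 2 * (La * (INR (S n) * (1 + INR (S n)))) + 1).
  assert (HP : 0 <= La * (INR (S n) * (1 + INR (S n)))) by (repeat apply Rmult_le_pos; lra).
  assert (Hal : hlip n (bdC (S n)) al L).
  { intros x y a Hx Hy Ha0 C. unfold al. pose proof (std_cll (S n) x y a Hx Hy Ha0 C) as C2.
    assert (P1 : 0 <= (1 + INR (S n)) * a) by (apply Rmult_le_pos; lra). pose proof (cl_dist _ _ _ _ P1 C2) as D.
    pose proof (Ha _ _ (std_bd_sphere n x Hx) (std_bd_sphere n y Hy)) as CC. pose proof (dist_nonneg (S n) (std (S n) x) (std (S n) y)).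
    apply hle_of_cc_le in CC; [|apply Rmult_le_pos; auto]. assert (0 <= La * dist (S n) (std (S n) x) (std (S n) y)) by (apply Rmult_le_pos; auto).
    eapply hle_mono; [|exact CC|]; [lra|]. apply (Rmult_le_compat_l La) in D; auto. unfold L. nra. }
  destruct (cube_extension n k beta al L Hn Hk M HLip Hstar ltac:(unfold L; lra) Hal) as (r & K & HK & Lr & Er).
  exists (fun x => r (ballcube (S k) x)). split.
  (* [100 * INR n * INR n] is the cost of returning from the gauge to the metric, [3 * INR (S k)]
     that of [ballcube]. *)
  - exists (100 * INR n * INR n * (K * (3 * INR (S k)))). pose proof (pos_INR n). split; [repeat apply Rmult_le_pos; lra|].
    assert (Bb : forall x, ball (S k) x -> rmaxabs (S k) (ballcube (S k) x) <= 1).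
    { intros x [Hx _]. assert (norm (S k) x <= 1) by (unfold norm; rewrite <- sqrt_1; apply sqrt_le_1_alt; auto).
      apply mx_le; [lra|]. intros i Hi. unfold ballcube. rewrite Rabs_mult, (Rabs_pos_eq (norm (S k) x / rmaxabs (S k) x)).
      - eapply Rle_trans; [apply ballcube_ratio; auto|auto].
      - apply Rmult_le_pos; [apply norm_ge0|]. pose proof (mx_nonneg (S k) x). destruct (Req_dec (rmaxabs (S k) x) 0) as [E|E]; [rewrite E, Rinv_0; lra|left; apply Rinv_0_lt_compat; lra]. }
    intros x y Hx Hy. pose proof (dist_nonneg (S k) x y) as D0. set (a := dist (S k) x y) in *.
    assert (0 <= 3 * INR (S k) * a) by (repeat apply Rmult_le_pos; lra).
    apply (cc_le_of_hle_le n _ _ _ (K * (3 * INR (S k) * a))); [lia| |apply Rmult_le_pos; auto|right; ring].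
    apply Lr; auto. apply ballcube_cl; auto. apply dist_cl. unfold a; lra.
  - intros x Hx. destruct (std_ballcube k x Hx) as (E1 & E2 & _). destruct (hle0_inv _ _ _ (Er _ E2)) as [F1 F2].
    unfold al, Bmap in F1, F2. rewrite E1 in F1, F2. destruct (std_ballcube n (beta x) (M x Hx)) as (_ & _ & E3). rewrite E3 in F1, F2. split; auto.
Qed.
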